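(* For every integer $k\ge 1$, the function $q^{-1}R_{k+1}(q^{24})$ (viewed as a function of $z\in\mathbb{H}$, with $q=e^{2\pi i z}$) is a quasimock theta function.
   Context: Throughout, $\mathbb{H}$ is the upper half plane, $z=x+iy\in\mathbb{H}$ and $q:=e^{2\pi i z}$. The rank of a partition is its largest part minus its number of parts; $N(m,n)$ denotes the number of partitions of $n$ with rank $m$. For $k\ge1$ define the symmetrized rank moment $\eta_{2k}(n):=\sum_{m\in\mathbb{Z}}\binom{m+\lfloor (2k-1)/2\rfloor}{2k}N(m,n)$ and $R_{k+1}(q):=\sum_{n\ge0}\eta_{2k}(n)q^n$. A quasimodular form is a meromorphic function $f:\mathbb{H}\to\mathbb{C}$ that can be written as a linear combination of derivatives of modular forms. For $\kappa\in\frac12\mathbb{Z}\setminus\mathbb{Z}$ the weight $\kappa$ hyperbolic Laplacian is $\Delta_\kappa:=-y^2\left(\frac{\partial^2}{\partial x^2}+\frac{\partial^2}{\partial y^2}\right)+i\kappa y\left(\frac{\partial}{\partial x}+i\frac{\partial}{\partial y}\right)$. For odd $v$ let $\epsilon_v=1$ if $v\equiv1\pmod 4$ and $\epsilon_v=i$ if $v\equiv 3\pmod 4$. A (harmonic) weak Maass form of weight $\kappa$ with Nebentypus $\chi$ (a Dirichlet character) on a subgroup $\Gamma\subset\Gamma_0(4)$ is a smooth $g:\mathbb{H}\to\mathbb{C}$ with (i) $g(Az)=\left(\frac{c}{d}\right)^{2\kappa}\epsilon_d^{-2\kappa}\chi(d)(cz+d)^{\kappa}g(z)$ for all $A=\begin{pmatrix}a&b\\c&d\end{pmatrix}\in\Gamma$;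 (ii) $\Delta_\kappa g=0$; (iii) $g$ has at most linear exponential growth at all cusps of $\Gamma$. Such a form decomposes as a holomorphic part (a $q$-series $\sum c^+(n)q^n$) plus a non-holomorphic part. A function $f:\mathbb{H}\to\mathbb{C}$ is called a quasimock theta function if there exists a quasimodular form $h$ such that $f+h$ is a linear combination of derivatives of holomorphic parts of weak Maass forms. *)

(* Defs.v *)
From Stdlib Require Import Reals ZArith List Lia Sorting.Sorted.
From Coquelicot Require Import Coquelicot.
Import ListNotations.


Fixpoint parts_aux (fuel n b : nat) : list (list nat) :=
  match fuel with
  | O => if Nat.eqb n 0 then [[]] else []
  | S f =>
      if Nat.eqb n 0 then [[]]
      else flat_map (fun p => map (cons p) (parts_aux f (n - p) p))
                    (seq 1 (Nat.min b n))
  end.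

Definition partitions (n : nat) : list (list nat) := parts_aux n n n.

Definition is_partition (n : nat) (l : list nat) : Prop :=
  List.Forall (fun p : nat => (0 < p)%nat) l /\ Sorted.Sorted ge l /\ fold_right Nat.add 0%nat l = n.

(* rank = largest part minus number of parts (the largest part of a
   non-increasing list is its head; the empty partition has rank 0). *)
Definition rank (l : list nat) : Z :=
  (Z.of_nat (hd 0%nat l) - Z.of_nat (length l))%Z.

Definition Nrank (m : Z) (n : nat) : nat :=
  length (filter (fun l => Z.eqb (rank l) m) (partitions n)).

Definition gbinom (x : Z) (j : nat) : R :=
  fold_right Rmult 1 (map (fun i => IZR x - INR i) (seq 0 j)) / INR (fact j).

Open Scope R_scope.
(* eta_{2k}(n) = sum_{m in Z} binom(m + floor((2k-1)/2), 2k) N(m,n).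
   Since N(m,n) = 0 for |m| > n, the sum is taken over -n <= m <= n. *)
Definition eta2k (k n : nat) : R :=
  fold_right Rplus 0
    (map (fun i : nat =>
            let m := (Z.of_nat i - Z.of_nat n)%Z in
            gbinom (m + Z.div (2 * Z.of_nat k - 1) 2) (2 * k) * INR (Nrank m n))
         (seq 0 (2 * n + 1))).

Definition cexp (z : C) : C :=
  (exp (Re z) * cos (Im z), exp (Re z) * sin (Im z)).

Definition qq (z : C) : C := cexp (Cmult (RtoC (2 * PI)) (Cmult Ci z)).

Definition inH (z : C) : Prop := 0 < Im z.

Definition Cpowz (w : C) (n : Z) : C :=
  match n with
  | Z0 => RtoC 1
  | Zpos p => Cpow w (Pos.to_nat p)
  | Zneg p => Cinv (Cpow w (Pos.to_nat p))
  end.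

(* principal square root, argument in (-pi/2, pi/2] (so sqrt(-1) = i) *)
Definition csqrt (w : C) : C :=
  (sqrt ((Cmod w + Re w) / 2),
   (if Rlt_dec (Im w) 0 then -1 else 1) * sqrt ((Cmod w - Re w) / 2)).

Definition Chalfpow (w : C) (m : Z) : C := Cpowz (csqrt w) m.

Definition mob (a b c d : Z) (z : C) : C :=
  Cmult (Cplus (Cmult (RtoC (IZR a)) z) (RtoC (IZR b)))
        (Cinv (Cplus (Cmult (RtoC (IZR c)) z) (RtoC (IZR d)))).

Definition jfac (c d : Z) (z : C) : C :=
  Cplus (Cmult (RtoC (IZR c)) z) (RtoC (IZR d)).

Definition holo_H (f : C -> C) : Prop :=
  forall z, inH z -> @ex_derive C_AbsRing C_NormedModule f z.

Fixpoint is_nderiv (n : nat) (f g : C -> C) : Prop :=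
  match n with
  | O => forall z, inH z -> g z = f z
  | S n' => exists f' : C -> C,
      (forall z, inH z -> @is_derive C_AbsRing C_NormedModule f z (f' z))
      /\ is_nderiv n' f' g
  end.

Definition dX (f : C -> C) (z : C) : C :=
  (Derive (fun t => Re (f (t, Im z))) (Re z),
   Derive (fun t => Im (f (t, Im z))) (Re z)).
Definition dY (f : C -> C) (z : C) : C :=
  (Derive (fun t => Re (f (Re z, t))) (Im z),
   Derive (fun t => Im (f (Re z, t))) (Im z)).

Fixpoint iterD (w : list bool) (f : C -> C) : C -> C :=
  match w with
  | [] => f
  | true :: w' => dX (iterD w' f)
  | false :: w' => dY (iterD w' f)
  end.

Definition smooth_H (f : C -> C) : Prop :=
  forall (w : list bool) (z : C), inH z ->
    continuous (iterD w f) z /\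
    ex_derive (fun t => Re (iterD w f (t, Im z))) (Re z) /\
    ex_derive (fun t => Im (iterD w f (t, Im z))) (Re z) /\
    ex_derive (fun t => Re (iterD w f (Re z, t))) (Im z) /\
    ex_derive (fun t => Im (iterD w f (Re z, t))) (Im z).

(* weight kappa = m/2 hyperbolic Laplacian:
   -y^2 (g_xx + g_yy) + i kappa y (g_x + i g_y) *)
Definition laplacian (m : Z) (g : C -> C) (z : C) : C :=
  Cplus (Cmult (RtoC (- (Im z) ^ 2)) (Cplus (dX (dX g) z) (dY (dY g) z)))
        (Cmult (Cmult Ci (RtoC (IZR m / 2 * Im z)))
               (Cplus (dX g z) (Cmult Ci (dY g z)))).

Fixpoint spf_aux (fuel : nat) (d n : Z) : Z :=
  match fuel with
  | O => n
  | S f => if Z.eqb (Z.modulo n d) 0 then d else spf_aux f (d + 1) n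
  end.
Definition spf (n : Z) : Z := spf_aux (Z.to_nat n) 2 n.

Definition legendre (a p : Z) : Z :=
  if Z.eqb (Z.modulo a p) 0 then 0
  else if existsb (fun x : nat => Z.eqb (Z.modulo (Z.of_nat x * Z.of_nat x - a) p) 0)
                  (seq 0 (Z.to_nat p))
       then 1 else -1.

Fixpoint jacobi_aux (fuel : nat) (a n : Z) : Z :=
  match fuel with
  | O => 1
  | S f => if Z.leb n 1 then 1
           else let p := spf n in (legendre a p * jacobi_aux f a (Z.div n p))%Z
  end.
Definition jacobi (a n : Z) : Z := jacobi_aux (Z.to_nat n) a n.

(* Shimura's extension of (c/d) to odd d of either sign *)
Definition kron (c d : Z) : Z :=
  if Z.ltb 0 d then jacobi c d
  else (jacobi c (- d) * (if Z.ltb c 0 then -1 else 1))%Z.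

Definition epsd (d : Z) : C :=
  if Z.eqb (Z.modulo d 4) 1 then RtoC 1 else Ci.

Definition dirichlet_char (M : Z) (chi : Z -> C) : Prop :=
  (1 <= M)%Z /\
  (forall n, chi (n + M)%Z = chi n) /\
  (forall a b, chi (a * b)%Z = Cmult (chi a) (chi b)) /\
  (forall n, chi n = RtoC 0 <-> Z.gcd n M <> 1%Z).

(* subgroups Gamma with Gamma(N) <= Gamma <= Gamma_0(4)  (congruence
   subgroups of Gamma_0(4)); matrices are written (a b; c d) *)
Definition SL2Z (a b c d : Z) : Prop := (a * d - b * c = 1)%Z.

Definition cong_subgroup_G04 (N : Z) (G : Z -> Z -> Z -> Z -> Prop) : Prop :=
  (1 <= N)%Z /\
  (forall a b c d, G a b c d -> SL2Z a b c d /\ Z.modulo c 4 = 0%Z) /\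
  G 1%Z 0%Z 0%Z 1%Z /\
  (forall a b c d a' b' c' d', G a b c d -> G a' b' c' d' ->
      G (a*a' + b*c')%Z (a*b' + b*d')%Z (c*a' + d*c')%Z (c*b' + d*d')%Z) /\
  (forall a b c d, G a b c d -> G d (- b)%Z (- c)%Z a) /\
  (forall a b c d, SL2Z a b c d ->
      Z.modulo (a - 1) N = 0%Z -> Z.modulo b N = 0%Z ->
      Z.modulo c N = 0%Z -> Z.modulo (d - 1) N = 0%Z -> G a b c d).

Definition transforms (m : Z) (G : Z -> Z -> Z -> Z -> Prop) (chi : Z -> C)
  (g : C -> C) : Prop :=
  forall a b c d z, G a b c d -> inH z ->
    g (mob a b c d z) =
    Cmult (Cmult (Cmult (Cpowz (RtoC (IZR (kron c d))) m) (Cpowz (epsd d) (- m)))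
                 (chi d))
          (Cmult (Chalfpow (jfac c d z) m) (g z)).

Definition linexp_growth (m : Z) (g : C -> C) : Prop :=
  forall a b c d, SL2Z a b c d ->
    exists K y0 : R, 0 < K /\ forall z, y0 < Im z ->
      Cmod (g (mob a b c d z)) * Rpower (Cmod (jfac c d z)) (- IZR m / 2)
        <= K * exp (K * Im z).

Definition modular_form (g : C -> C) : Prop :=
  exists (m N M : Z) (G : Z -> Z -> Z -> Z -> Prop) (chi : Z -> C),
    cong_subgroup_G04 N G /\ dirichlet_char M chi /\
    holo_H g /\ transforms m G chi g /\ linexp_growth m g.

Fixpoint lincomb (l : list (C * (C -> C))) (z : C) : C :=
  match l with
  | [] => RtoC 0
  | (a, F) :: l' => Cplus (Cmult a (F z)) (lincomb l' z)
  end.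

Definition quasimodular (h : C -> C) : Prop :=
  exists l : list (C * (C -> C)),
    (forall a F, In (a, F) l ->
       exists (n : nat) (g : C -> C), modular_form g /\ is_nderiv n g F) /\
    forall z, inH z -> h z = lincomb l z.

Definition weak_maass (m N M : Z) (G : Z -> Z -> Z -> Z -> Prop) (chi : Z -> C)
  (g : C -> C) : Prop :=
  Z.odd m = true /\ cong_subgroup_G04 N G /\ dirichlet_char M chi /\
  smooth_H g /\ transforms m G chi g /\
  (forall z, inH z -> laplacian m g z = RtoC 0) /\ linexp_growth m g.

Definition fcoef (N : Z) (f : C -> C) (n : Z) (y : R) : C :=
  Cmult (RtoC (/ IZR N))
    (@RInt C_R_CompleteNormedModule
       (fun x : R => Cmult (f (x, y))
                    (cexp (Cmult (RtoC (- 2 * PI * IZR n * x / IZR N)) Ci)))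
       0 (IZR N)).

(* gp is the holomorphic part of g : gp is holomorphic and N-periodic and
   the non-holomorphic part g - gp has Fourier modes (in e^{2 pi i n x/N})
   of the form  c y^{1-kappa} (n = 0) and decaying ones (n < 0, the
   Gamma(1-kappa, 4 pi |n| y) q^n terms), and no modes with n > 0. *)
Definition holomorphic_part (g gp : C -> C) : Prop :=
  exists (m N M : Z) (G : Z -> Z -> Z -> Z -> Prop) (chi : Z -> C),
    weak_maass m N M G chi g /\
    holo_H gp /\
    (forall z, inH z -> gp (Cplus z (RtoC (IZR N))) = gp z) /\
    let gm := fun z => Cminus (g z) (gp z) in
    (forall n : Z, (n < 0)%Z ->
       filterlim (fun y => fcoef N gm n y) (Rbar_locally p_infty)
                 (locally (RtoC 0))) /\
    (exists c : C, forall y, 0 < y ->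
       fcoef N gm 0 y = Cmult c (RtoC (Rpower y (1 - IZR m / 2)))) /\
    (forall n : Z, (0 < n)%Z -> forall y, 0 < y -> fcoef N gm n y = RtoC 0).

Definition quasimock (f : C -> C) : Prop :=
  exists h : C -> C, quasimodular h /\
  exists l : list (C * (C -> C)),
    (forall a F, In (a, F) l ->
       exists (n : nat) (g gp : C -> C),
         holomorphic_part g gp /\ is_nderiv n gp F) /\
    forall z, inH z -> Cplus (f z) (h z) = lincomb l z.

(* R_{k+1}(q) = sum_n eta_{2k}(n) q^n *)

(* Main.v *)
(** Conjugation and Dyson's adjoint map determine the generating function of the rank, and [q^(-1) R_(k+1)(q^24)] becomes a
linear combination of the functions [S_j / eta], where [eta] is [eta(24 z)] and [S_j] is the sum of
[(-1)^n (l+1/2)^(2j+1) q^(36 n^2 + 24 n (l+1/2))] over [n >= 1] and [l >= 0]. The Lipschitz formula turns [S_j] into a sum [B_(j+1)]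
over the lattice [24 Z z + Z]. Damping the lattice sum by a Gaussian gives a sum that is modular, and by Poisson summation over one
lattice direction the two differ by a nonholomorphic integral [T_j] of [conj eta]. Consequently [E_0 = - 1 / eta], [E_(j+1) = B_(j+1) / eta - T_j]
transforms under the congruence group [Gam] like the sequence of derivatives of a modular form of weight [-1/2]. After the
derivatives of [- 1 / eta] are subtracted, the entry [E_1] is a harmonic Maass form of weight [3/2] whose shadow is [eta]; after its
derivatives are subtracted too, a holomorphic sequence is left, and its entries are quasimodular. *)
Require Import Defs.
From Stdlib Require Import Reals Lra Lia Psatz ZArith List Permutation Sorting.Sorted Classical ClassicalEpsilon FunctionalExtensionality Znumtheory.
From Coquelicot Require Import Coquelicot.
Import ListNotations.
Open Scope R_scope.

#[local] Hint Resolve Cmod_ge_0 exp_pos PI_RGT_0 pow2_ge_0 pos_INR Rabs_pos sqrt_pos INR_fact_lt_0 INR_fact_neq_0 Rlt_le Rle_refl Cpow_nz : core.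
#[local] Hint Unfold inH : core.
Ltac cring := apply injective_projections; simpl; ring.
Ltac pos :=
  match goal with
  | _ => assumption
  | |- 0 <= Rabs _ => apply Rabs_pos
  | |- 0 <= Cmod _ => apply Cmod_ge_0
  | |- 0 <= _ ^ 2 => apply pow2_ge_0
  | |- 0 <= INR _ => apply pos_INR
  | |- 0 <= sqrt _ => apply sqrt_pos
  | |- 0 < PI => exact PI_RGT_0
  | |- 0 < exp _ => apply exp_pos
  | |- 0 < INR (fact _) => apply INR_fact_lt_0
  | |- 0 < _ * _ => apply Rmult_lt_0_compat; pos
  | |- 0 < _ / _ => apply Rdiv_lt_0_compat; pos
  | |- 0 < / _ => apply Rinv_0_lt_compat; pos
  | |- 0 < _ ^ _ => apply pow_lt; pos
  | |- 0 < sqrt _ => apply sqrt_lt_R0; pos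
  | |- 0 < _ + _ => first [apply Rplus_lt_le_0_compat; pos | apply Rplus_le_lt_0_compat; pos]
  | |- 0 <= _ * _ => apply Rmult_le_pos; pos
  | |- 0 <= _ ^ _ => apply pow_le; pos
  | |- 0 <= _ + _ => apply Rplus_le_le_0_compat; pos
  | |- 0 <= _ => left; pos
  | _ => lra
  end.
Ltac cnz := let E := fresh in intros E; apply RtoC_inj in E; lra.
Ltac auto0 := try solve [reflexivity | auto with nocore].
Tactic Notation "have" lconstr(p) := pose proof p.
Tactic Notation "have" lconstr(p) "as" simple_intropattern(i) := pose proof p as i.
Tactic Notation "le_via" uconstr(x) := eapply Rle_trans; [apply x|].
Tactic Notation "lt_via" uconstr(x) := eapply Rle_lt_trans; [apply x|].
Ltac fext := apply functional_extensionality.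
Ltac inv_le := apply Rinv_le_contravar.
Ltac mul_l := apply Rmult_le_compat_l.
Ltac mul_r := apply Rmult_le_compat_r.
Ltac mul_le := apply Rmult_le_compat.
Ltac int_cont := apply (@ex_RInt_continuous R_CompleteNormedModule).
Notation zn := Z.of_nat (only parsing).

(** The definition of a weak Maass form prescribes the theta multiplier with the Kronecker symbol,
    while lattice sums only see products such as [eta * conj eta]. So the law of [eta] is found in
    two stages: up to a constant of modulus 1 by comparing moduli, then exactly by comparison with
    [theta], whose behaviour near rational points is governed by quadratic Gauss sums. The damping
    rate X = PI / (16 Im z) is forced: X |w|^2 is invariant under the group acting on z and on the
    lattice, and exp (X (w^2 - |w|^2)) is, up to sign, q^(36 n^2) on the row w = 24 n z + m. A
    factor r in front of w^2 joins the modular sum (r = 0) to the holomorphic one (r = 1). For r < 1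
    Poisson summation turns the lattice Gaussian into [eta z] times the conjugate of [eta] at
    another point of the same vertical line; this is where the shadow comes from. Every T_j is up to
    a constant an iterated z-derivative of T_0, so one harmonic form accounts for the nonholomorphic
    parts of all entries. As all weights are half-integral, no constant in these chains of
    derivatives vanishes. *)

Lemma ex_derive_cpt (f : R -> R) x : ex_derive f x -> continuity_pt f x.
 intros. now apply continuity_pt_filterlim, (ex_derive_continuous f). Qed.

(** * Unconditional sums over arbitrary index types *)

Lemma eq_dec_cl (I : Type) (x y : I) : {x = y} + {x <> y}.
 apply excluded_middle_informative. Qed.
Definition Csum {I : Type} (f : I -> C) (l : list I) : C :=
 fold_right (fun i s => Cplus (f i) s) (RtoC 0) l.
Definition Rsum {I : Type} (g : I -> R) (l : list I) : R :=
 fold_right (fun i s => g i + s) 0 l.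
(** Convergence along the net of finite duplicate-free lists ordered by inclusion. In C this amounts
    to absolute convergence, so sums can be reindexed and regrouped freely; [bnd] is the matching
    condition of domination. *)
Definition Sums {I : Type} (f : I -> C) (s : C) : Prop :=
 forall eps, 0 < eps -> exists l0 : list I, forall l, NoDup l -> incl l0 l -> Cmod (Cminus (Csum f l) s) < eps.
Definition bnd {I : Type} (g : I -> R) (B : R) : Prop :=
 forall l, NoDup l -> Rsum g l <= B.
Lemma Csum_app {I} (f : I -> C) l m : Csum f (l ++ m) = Cplus (Csum f l) (Csum f m).
 induction l; simpl; [ring | rewrite IHl; ring]. Qed.
Lemma Rsum_app {I} (g : I -> R) l m : Rsum g (l ++ m) = Rsum g l + Rsum g m.
 induction l; simpl; [ring |lra]. Qed.
Lemma Csum_perm {I} (f : I -> C) l m : Permutation l m -> Csum f l = Csum f m.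
 induction 1; simpl; auto; [now rewrite IHPermutation|ring|congruence]. Qed.
Lemma Rsum_perm {I} (g : I -> R) l m : Permutation l m -> Rsum g l = Rsum g m.
 induction 1; simpl; auto; [lra|ring|lra]. Qed.
Lemma Csum_plus {I} (f g : I -> C) l :
 Csum (fun i => Cplus (f i) (g i)) l = Cplus (Csum f l) (Csum g l).
 induction l; simpl; [ring | rewrite IHl; ring]. Qed.
Lemma Csum_scal {I} (c : C) (f : I -> C) l :
 Csum (fun i => Cmult c (f i)) l = Cmult c (Csum f l).
 induction l; simpl; [ring | rewrite IHl; ring]. Qed.
Lemma Csum_ext_in {I} (f g : I -> C) l :
 (forall i, In i l -> f i = g i) -> Csum f l = Csum g l.
 induction l; simpl; intros H; auto. rewrite IHl, H by auto. auto. Qed.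
Lemma Rsum_le_in {I} (f g : I -> R) l :
 (forall i, In i l -> f i <= g i) -> Rsum f l <= Rsum g l.
 induction l; simpl; intros H; [lra|]. apply Rplus_le_compat; auto. Qed.
Lemma Rsum_nonneg {I} (g : I -> R) l : (forall i, 0 <= g i) -> 0 <= Rsum g l.
 intros H; induction l; simpl; [lra | specialize (H a); lra]. Qed.
Lemma Rsum_scal {I} (c : R) (f : I -> R) l : Rsum (fun i => c * f i) l = c * Rsum f l.
 induction l; simpl; [ring |lra]. Qed.
Lemma Rsum_plus {I} (f g : I -> R) l : Rsum (fun i => f i + g i) l = Rsum f l + Rsum g l.
 induction l; simpl; [ring |lra]. Qed.
Lemma Csum_map {I J} (phi : J -> I) (f : I -> C) l :
 Csum f (map phi l) = Csum (fun j => f (phi j)) l.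
 induction l; simpl; auto. now rewrite IHl. Qed.
Lemma Rsum_map {I J} (phi : J -> I) (f : I -> R) l :
 Rsum f (map phi l) = Rsum (fun j => f (phi j)) l.
 induction l; simpl; auto. lra. Qed.
Lemma Cmod_Csum {I} (f : I -> C) l : Cmod (Csum f l) <= Rsum (fun i => Cmod (f i)) l.
 induction l; simpl; [rewrite Cmod_0; lra|le_via Cmod_triangle; lra]. Qed.
Lemma Csum_RtoC {I} (g : I -> R) l : Csum (fun i => RtoC (g i)) l = RtoC (Rsum g l).
 induction l; simpl; auto. now rewrite IHl, RtoC_plus. Qed.
Lemma split_incl {I} (l0 l : list I) : NoDup l0 -> NoDup l -> incl l0 l ->
 exists l', Permutation l (l0 ++ l') /\ NoDup l' /\ (forall i, In i l' -> ~ In i l0).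
 intros H0 H Hi. exists (filter (fun i => if in_dec (eq_dec_cl I) i l0 then false else true) l). assert (Hf : forall i, In i (filter (fun i => if in_dec (eq_dec_cl I) i l0 then false else true) l)
   <-> In i l /\ ~ In i l0) by (intros i; rewrite filter_In; destruct in_dec; intuition congruence). split; [|split].
 - apply NoDup_Permutation; auto; [|intros x; rewrite in_app_iff, Hf; specialize (Hi x); tauto]. apply NoDup_app; auto. apply NoDup_filter; auto. intros a Ha Hb. apply Hf in Hb. tauto.
 - apply NoDup_filter; auto.
 - intros i Hin. apply Hf in Hin. tauto.
Qed.
Lemma nodup_super {I} (l0 : list I) : exists l, NoDup l /\ incl l0 l.
 exists (nodup (eq_dec_cl I) l0). split; [apply NoDup_nodup|]. intros x Hx. now apply nodup_In. Qed.
Lemma bnd_nonneg {I} (g : I -> R) B : bnd g B -> 0 <= B.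
 intros H. specialize (H [] (NoDup_nil _)). auto. Qed.
Lemma Sums_nonneg_ex {I} (g : I -> R) B : (forall i, 0 <= g i) -> bnd g B ->
 exists s, Sums (fun i => RtoC (g i)) (RtoC s).
 intros Hg HB. destruct (completeness (fun s => exists l, NoDup l /\ s = Rsum g l)) as [s [Hs1 Hs2]].
 - exists B. intros x [l [Hl ->]]. auto.
 - exists 0, []. split; [constructor |auto].
 - exists s. intros eps Heps. destruct (classic (exists l0, NoDup l0 /\ s - eps < Rsum g l0)) as [[l0 [Hl0 Hs]]|].
  + exists l0. intros l Hl Hi. destruct (split_incl l0 l Hl0 Hl Hi) as [l' [Hp _]]. rewrite Csum_RtoC, <- RtoC_minus, Cmod_R. assert (Rsum g l <= s) by eauto.
   assert (Rsum g l0 <= Rsum g l) by (rewrite (Rsum_perm _ _ _ Hp), Rsum_app; have Rsum_nonneg g l' Hg; lra). apply Rabs_def1; lra.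
  + assert (s <= s - eps); [|lra]. apply Hs2. intros x [l [Hl ->]]. apply Rnot_lt_le. eauto.
Qed.
Lemma Sums_plus {I} (f g : I -> C) s t :
 Sums f s -> Sums g t -> Sums (fun i => Cplus (f i) (g i)) (Cplus s t).
 intros Hf Hg eps He. destruct (Hf (eps/2)) as [l1 H1]; [lra|]. destruct (Hg (eps/2)) as [l2 H2]; [lra|]. exists (l1 ++ l2). intros l Hl Hi. rewrite Csum_plus. replace (Cminus (Cplus (Csum f l) (Csum g l)) (Cplus s t)) with
  (Cplus (Cminus (Csum f l) s) (Cminus (Csum g l) t)) by ring. lt_via Cmod_triangle. specialize (H1 l Hl (fun x Hx => Hi x (in_or_app _ _ _ (or_introl Hx)))). specialize (H2 l Hl (fun x Hx => Hi x (in_or_app _ _ _ (or_intror Hx)))). lra.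
Qed.
Lemma Sums_scal {I} (c : C) (f : I -> C) s :
 Sums f s -> Sums (fun i => Cmult c (f i)) (Cmult c s).
 intros Hf eps He. destruct (Hf (eps / (Cmod c + 1))) as [l1 H1]; [pos|]. exists l1. intros l Hl Hi. rewrite Csum_scal.
 replace (Cminus (Cmult c (Csum f l)) (Cmult c s)) with (Cmult c (Cminus (Csum f l) s)) by ring. rewrite Cmod_mult. specialize (H1 l Hl Hi).
 have Cmod_ge_0 c. apply Rle_lt_trans with (Cmod c * eps / (Cmod c + 1)); [nra|apply Rmult_lt_reg_r with (Cmod c + 1); field_simplify; nra].
Qed.
Lemma Sums_ext {I} (f g : I -> C) s : (forall i, f i = g i) -> Sums f s -> Sums g s.
 intros H Hf. replace g with f; auto. now fext. Qed.
Tactic Notation "sum_ext" uconstr(x) := eapply Sums_ext; [|apply x].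
Lemma Sums_eq {I} (f : I -> C) s t : Sums f s -> s = t -> Sums f t.
 intros H <-; auto. Qed.
Lemma Sums_opp {I} (f : I -> C) s : Sums f s -> Sums (fun i => Copp (f i)) (Copp s).
 intros H. apply (Sums_scal (-1)) in H. eapply Sums_eq; [eapply Sums_ext; [|eauto]|]; intros; simpl; ring. Qed.
Lemma Sums_minus {I} (f g : I -> C) s t :
 Sums f s -> Sums g t -> Sums (fun i => Cminus (f i) (g i)) (Cminus s t).
 intros Hf Hg. apply Sums_plus; auto. now apply Sums_opp. Qed.
Lemma Sums_0 {I} : Sums (fun _ : I => RtoC 0) (RtoC 0).
 intros eps He. exists []. intros l _. assert (H : Csum (fun _ : I => 0) l = 0) by (induction l; simpl; [auto | rewrite IHl; ring]). rewrite H. replace (Cminus 0 0) with (RtoC 0) by ring. now rewrite Cmod_0.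
Qed.
#[local] Hint Resolve Sums_0 : core.
Lemma Sums_unique {I} (f : I -> C) s t : Sums f s -> Sums f t -> s = t.
 intros Hs Ht. apply NNPP. intros Hne. assert (Hd : 0 < Cmod (Cminus s t)) by (apply Cmod_gt_0; intros H; apply Hne; now apply Ceq_minus).
 destruct (Hs (Cmod (Cminus s t) / 2)) as [l1 H1]; [lra|]. destruct (Ht (Cmod (Cminus s t) / 2)) as [l2 H2]; [lra|]. destruct (nodup_super (l1 ++ l2)) as [l [Hl Hi]]. specialize (H1 l Hl (fun x Hx => Hi x (in_or_app _ _ _ (or_introl Hx)))).
 specialize (H2 l Hl (fun x Hx => Hi x (in_or_app _ _ _ (or_intror Hx)))). assert (Cmod (Cminus s t) <= Cmod (Cminus (Csum f l) s) + Cmod (Cminus (Csum f l) t)); [|lra]. rewrite <- (Cmod_opp (Cminus (Csum f l) s)).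
 replace (Cminus s t) with (Cplus (Copp (Cminus (Csum f l) s)) (Cminus (Csum f l) t)) by ring. apply Cmod_triangle.
Qed.
Lemma bnd_le {I} (g h : I -> R) B : (forall i, g i <= h i) -> bnd h B -> bnd g B.
 intros H Hh l Hl. eapply Rle_trans; [|apply Hh, Hl]. apply Rsum_le_in; auto. Qed.
Lemma bnd_scal {I} c (g : I -> R) B : 0 <= c -> bnd g B -> bnd (fun i => c * g i) (c * B).
 intros Hc H l Hl. rewrite Rsum_scal. mul_l; auto. Qed.
Lemma bnd_plus {I} (g h : I -> R) A B : bnd g A -> bnd h B -> bnd (fun i => g i + h i) (A + B).
 intros Hg Hh l Hl. rewrite Rsum_plus. apply Rplus_le_compat; auto. Qed.
Lemma bnd_inj {I J} (phi : J -> I) (g : I -> R) B :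
 (forall x y, phi x = phi y -> x = y) -> bnd g B -> bnd (fun j => g (phi j)) B.
 intros Hphi Hg l Hl. rewrite <- Rsum_map. apply Hg. apply FinFun.Injective_map_NoDup; auto. Qed.
Lemma bnd_weaken {I} (g : I -> R) A B : A <= B -> bnd g A -> bnd g B.
 intros H Hg l Hl. specialize (Hg l Hl). lra. Qed.
(** Reduction to nonnegative families: a real family u with |u| <= |f| is the difference of (|f| +
    u) / 2 and (|f| - u) / 2, and f is split into real and imaginary parts. *)
Lemma Sums_ex {I} (f : I -> C) B : bnd (fun i => Cmod (f i)) B -> exists s, Sums f s.
 intros H. assert (Hp : forall u : I -> R, (forall i, Rabs (u i) <= Cmod (f i)) -> exists s, Sums (fun i => u i) s).
 { intros u Hu. destruct (Sums_nonneg_ex (fun i => (Cmod (f i) + u i) / 2) B) as [s1 H1].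
  { intros i. specialize (Hu i). apply Rabs_le_between in Hu. lra. }
  { eapply bnd_le; [|eauto]. intros i. specialize (Hu i). apply Rabs_le_between in Hu. lra. } destruct (Sums_nonneg_ex (fun i => (Cmod (f i) - u i) / 2) B) as [s2 H2].
  { intros i. specialize (Hu i). apply Rabs_le_between in Hu. lra. }
  { eapply bnd_le; [|eauto]. intros i. specialize (Hu i). apply Rabs_le_between in Hu. lra. } exists (Cminus s1 s2). eapply Sums_ext; [|apply Sums_minus; [eauto|eauto]]. intros i; simpl. rewrite <- RtoC_minus. f_equal. lra. }
 destruct (Hp (fun i => Re (f i))) as [s1 H1].
 { intros i. apply re_le_Cmod. } destruct (Hp (fun i => Im (f i))) as [s2 H2].
 { intros i. le_via Rmax_r. apply Rmax_Cmod. } exists (Cplus s1 (Cmult Ci s2)). eapply Sums_ext; [|apply Sums_plus; [eauto| apply Sums_scal, H2]]. intros i. apply injective_projections; simpl; unfold Re, Im; ring.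
Qed.
Lemma Sums_bound {I} (f : I -> C) s B : Sums f s -> bnd (fun i => Cmod (f i)) B -> Cmod s <= B.
 intros Hs HB. apply Rnot_lt_le. intros Hlt. destruct (Hs (Cmod s - B)) as [l0 H0]; [lra|]. destruct (nodup_super l0) as [l [Hl Hi]]. specialize (H0 l Hl Hi).
 have HB l Hl. have Cmod_Csum f l. assert (Cmod s <= Cmod (Csum f l) + Cmod (Cminus (Csum f l) s)).
 { rewrite <- (Cmod_opp (Cminus (Csum f l) s)). replace s with (Cplus (Csum f l) (Copp (Cminus (Csum f l) s))) at 1 by ring. apply Cmod_triangle. } lra.
Qed.
Lemma Sums_reindex {I J} (phi : J -> I) (psi : I -> J) (f : I -> C) s :
 (forall j, psi (phi j) = j) -> (forall i, phi (psi i) = i) -> Sums f s -> Sums (fun j => f (phi j)) s.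
 intros H1 H2 Hf eps He. destruct (Hf eps He) as [l0 H0]. exists (map psi l0). intros l Hl Hi. rewrite <- Csum_map.
 apply H0; [apply FinFun.Injective_map_NoDup; auto; intros x y Hxy; rewrite <- (H1 x), <- H1; now f_equal|intros x Hx; rewrite <- (H2 x); apply in_map, Hi, in_map, Hx].
Qed.
Lemma Sums_reindex_back {I J} (phi : J -> I) (psi : I -> J) (f : I -> C) s :
 (forall j, psi (phi j) = j) -> (forall i, phi (psi i) = i) -> Sums (fun j => f (phi j)) s -> Sums f s.
 intros H1 H2 Hf. apply (Sums_reindex psi phi) in Hf; auto. eapply Sums_ext; [|eauto]. intros i; simpl. now rewrite H2. Qed.
Definition lefts {I J} (l : list (I + J)) : list I :=
 flat_map (fun x => match x with inl i => [i] | inr _ => [] end) l.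
Definition rights {I J} (l : list (I + J)) : list J :=
 flat_map (fun x => match x with inl _ => [] | inr j => [j] end) l.
Lemma in_lefts {I J} (l : list (I + J)) i : In i (lefts l) <-> In (inl i) l.
 unfold lefts. rewrite in_flat_map. split; [intros [[|] [H1 H2]]; simpl in H2; [destruct H2 as [->|[]]; auto |lra]|exists (inl i); simpl; auto]. Qed.
Lemma in_rights {I J} (l : list (I + J)) i : In i (rights l) <-> In (inr i) l.
 unfold rights. rewrite in_flat_map. split; [intros [[|] [H1 H2]]; simpl in H2; [lra| destruct H2 as [->|[]]; auto]|exists (inr i); simpl; auto]. Qed.
Lemma NoDup_lr {I J} (l : list (I + J)) : NoDup l -> NoDup (lefts l) /\ NoDup (rights l).
 induction 1 as [|[|] l Hn Hl []]; simpl; split; try constructor; auto; [now rewrite in_lefts|now rewrite in_rights]. Qed.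
Lemma Csum_lr {I J} (f : I + J -> C) l :
 Csum f l = Cplus (Csum (fun i => f (inl i)) (lefts l)) (Csum (fun j => f (inr j)) (rights l)).
 induction l as [|[|] l IH]; simpl; [ring| |]; rewrite IH; ring. Qed.
Lemma Rsum_lr {I J} (f : I + J -> R) l :
 Rsum f l = Rsum (fun i => f (inl i)) (lefts l) + Rsum (fun j => f (inr j)) (rights l).
 induction l as [|[|] l IH]; simpl; [ring| |]; rewrite IH; ring. Qed.
Lemma Sums_sum {I J} (f : I + J -> C) s t :
 Sums (fun i => f (inl i)) s -> Sums (fun j => f (inr j)) t -> Sums f (Cplus s t).
 intros Hs Ht eps He. destruct (Hs (eps/2)) as [l1 H1]; [lra|]. destruct (Ht (eps/2)) as [l2 H2]; [lra|]. exists (map inl l1 ++ map inr l2). intros l Hl Hi.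
 destruct (NoDup_lr l Hl) as [N1 N2]. rewrite Csum_lr. specialize (H1 (lefts l) N1). specialize (H2 (rights l) N2). replace (Cminus _ (Cplus s t)) with
  (Cplus (Cminus (Csum (fun i => f (inl i)) (lefts l)) s) (Cminus (Csum (fun j => f (inr j)) (rights l)) t)) by ring. lt_via Cmod_triangle. assert (incl l1 (lefts l)) by (intros x Hx; apply in_lefts, Hi, in_or_app; left; now apply in_map).
 assert (incl l2 (rights l)) by (intros x Hx; apply in_rights, Hi, in_or_app; right; now apply in_map). intuition lra.
Qed.
Lemma bnd_sum {I J} (f : I + J -> R) A B :
 bnd (fun i => f (inl i)) A -> bnd (fun j => f (inr j)) B -> bnd f (A + B).
 intros HA HB l Hl. destruct (NoDup_lr l Hl). rewrite Rsum_lr. apply Rplus_le_compat; auto. Qed.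
(** For a finite list of rows, each row sum is approximated by a finite set of cells that also
    contains the cells of [l0] in that row. The union of the chosen cells then contains [l0], so its
    sum is close to S. *)
Lemma Sums_fubini {I J} (f : I * J -> C) (g : I -> C) S :
 Sums f S -> (forall i, Sums (fun j => f (i, j)) (g i)) -> Sums g S.
 intros HS Hg eps He. destruct (HS (eps/2)) as [l0 H0]; [lra|]. exists (map fst l0). intros L HL Hi. assert (Hd : 0 < eps / 2 / (INR (length L) + 1)) by pos.
 assert (HP : forall M, NoDup M -> exists P, NoDup P /\ (forall p, In p P -> In (fst p) M) /\ (forall p, In p l0 -> In (fst p) M -> In p P) /\ Cmod (Cminus (Csum f P) (Csum g M)) <= INR (length M) * (eps / 2 / (INR (length L) + 1))).
 { induction M as [|i M IH]; intros HM.
  - exists []. simpl. split; [constructor|]. replace (Cminus 0 0) with (RtoC 0) by ring. rewrite Cmod_0, Rmult_0_l. auto.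
  - inversion HM as [|? ? HiM HM']. destruct (IH HM') as [P [P1 [P2 []]]]. destruct (Hg i _ Hd) as [j0 Hj0]. destruct (nodup_super (j0 ++ map snd (filter (fun p => if eq_dec_cl I (fst p) i then true else false) l0))) as [js [Hjs Hjsi]].
   exists (map (fun j => (i, j)) js ++ P). repeat split.
   + apply NoDup_app; auto; [apply FinFun.Injective_map_NoDup; congruence|intros [a b] Ha Hb; apply in_map_iff in Ha; destruct Ha as [j [Ha _]]; inversion Ha; subst; apply HiM, (P2 _ Hb)].
   + intros p Hp. apply in_app_or in Hp. destruct Hp as [Hp|]; [apply in_map_iff in Hp; destruct Hp as [j [<- _]]; simpl; auto|right; auto].
   + intros p Hp [|]; [|apply in_or_app; auto]. apply in_or_app. left. destruct p as [a b]; subst. apply in_map_iff. exists b. split; auto.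
    apply Hjsi, in_or_app. right. apply in_map_iff. exists (a, b). split; auto. apply filter_In. split; auto. destruct eq_dec_cl; congruence.
   + rewrite Csum_app, Csum_map. simpl Csum. specialize (Hj0 js Hjs (fun x Hx => Hjsi x (in_or_app _ _ _ (or_introl Hx)))). replace (Cminus _ _) with (Cplus (Cminus (Csum (fun j => f (i, j)) js) (g i)) (Cminus (Csum f P) (Csum g M))) by ring.
    le_via Cmod_triangle. replace (length (i :: M)) with (Datatypes.S (length M)) by reflexivity. rewrite S_INR. lra. }
 destruct (HP L HL) as [P [P1 [P2 [P3 P4]]]]. assert (Hincl : incl l0 P) by (intros p Hp; apply P3; auto; apply Hi, in_map, Hp). specialize (H0 P P1 Hincl).
 replace (Cminus (Csum g L) S) with (Cplus (Copp (Cminus (Csum f P) (Csum g L))) (Cminus (Csum f P) S)) by ring. lt_via Cmod_triangle. rewrite Cmod_opp. assert (INR (length L) * eps / 2 / (INR (length L) + 1) < eps / 2).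
 { have pos_INR (length L). apply Rmult_lt_reg_r with (INR (length L) + 1); [lra|]. field_simplify; nra. } lra.
Qed.
Lemma bnd_fubini {I J} (f : I * J -> R) (A : I -> R) B :
 (forall p, 0 <= f p) -> (forall i, bnd (fun j => f (i, j)) (A i)) -> bnd A B -> bnd f B.
 intros Hf HA HB l Hl. assert (Hmain : forall L, NoDup L -> forall l, NoDup l -> (forall p, In p l -> In (fst p) L) -> Rsum f l <= Rsum A L).
 { induction L as [|i L IH]; intros HL m Hm Hfst.
  - destruct m as [|]; simpl; [lra|]. exfalso. apply (Hfst p). now left.
  - inversion HL. set (t := fun p : I * J => if eq_dec_cl I (fst p) i then true else false).
   assert (Hp : Permutation m (filter t m ++ filter (fun p => negb (t p)) m)) by (clear; induction m as [|]; simpl; auto; destruct t; simpl; [auto|rewrite IHm at 1; apply Permutation_middle]).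
   rewrite (Rsum_perm _ _ _ Hp), Rsum_app. apply Rplus_le_compat.
   + assert (Hmap : filter t m = map (fun j => (i, j)) (map snd (filter t m))) by (rewrite map_map, <- map_id at 1; apply map_ext_in; intros [] Hab; apply filter_In in Hab; unfold t in Hab; destruct eq_dec_cl; [subst; auto |lra]).
    rewrite Hmap, Rsum_map. apply HA. assert (Hn : NoDup (filter t m)) by now apply NoDup_filter. rewrite Hmap in Hn. apply NoDup_map_inv in Hn. auto.
   + apply IH; auto; [now apply NoDup_filter|intros p Hp'; apply filter_In in Hp'; destruct Hp' as [Hp1 Hp2]; destruct (Hfst p Hp1) as [|]; auto; unfold t in Hp2; destruct eq_dec_cl; [lra| congruence]]. }
 destruct (nodup_super (map fst l)) as [L [HL1 HL2]]. eapply Rle_trans; [apply (Hmain L HL1 l Hl)|auto]. intros p Hp. apply HL2, in_map, Hp.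
Qed.
Lemma bnd_prod {I J} (f : I -> R) (g : J -> R) A B :
 (forall i, 0 <= f i) -> (forall j, 0 <= g j) -> bnd f A -> bnd g B -> bnd (fun p : I * J => f (fst p) * g (snd p)) (A * B).
 intros Hf Hg HA HB. apply bnd_fubini with (A := fun i => f i * B).
 - intros p. apply Rmult_le_pos; auto.
 - intros i. simpl. apply bnd_scal; auto.
 - intros l Hl. replace (Rsum (fun i => f i * B) l) with (B * Rsum f l); [rewrite Rmult_comm; mul_r; [eapply bnd_nonneg; eauto | auto]|rewrite <- Rsum_scal; clear Hl; induction l; simpl; lra].
Qed.
Lemma Sums_prod {I J} (f : I -> C) (g : J -> C) s t A B :
 bnd (fun i => Cmod (f i)) A -> bnd (fun j => Cmod (g j)) B -> Sums f s -> Sums g t -> Sums (fun p : I * J => Cmult (f (fst p)) (g (snd p))) (Cmult s t).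
 intros HA HB Hs Ht. destruct (Sums_ex (fun p : I * J => Cmult (f (fst p)) (g (snd p))) (A * B)) as [S HS].
 { eapply bnd_le; [|apply (bnd_prod _ _ _ _ (fun i => Cmod_ge_0 (f i)) (fun j => Cmod_ge_0 (g j)) HA HB)]. intros p. rewrite Cmod_mult. lra. }
 assert (H : Sums (fun i => Cmult (f i) t) S) by (apply Sums_fubini with (1 := HS); intros i; simpl; now apply Sums_scal). eapply Sums_eq; [eauto|].
 eapply Sums_unique; [eauto|]. eapply Sums_eq; [eapply Sums_ext; [|apply (Sums_scal t), Hs]|]; intros; simpl; ring.
Qed.
Lemma bnd_tail {I} (g : I -> R) B : (forall i, 0 <= g i) -> bnd g B ->
 forall eps, 0 < eps -> exists l0, NoDup l0 /\ forall l, NoDup l -> (forall i, In i l -> ~ In i l0) -> Rsum g l < eps.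
 intros Hg HB eps He. destruct (Sums_nonneg_ex g B Hg HB) as [s Hs]. destruct (Hs (eps/2)) as [l1 H1]; [lra|]. destruct (nodup_super l1) as [l0 [N0 I0]]. exists l0. split; auto. intros l Hl Hd. have H1 l0 N0 I0 as E0.
 assert (N1 : NoDup (l0 ++ l)) by (apply NoDup_app; auto; intros a Ha Hb; exact (Hd _ Hb Ha)). assert (E1 := H1 (l0 ++ l) N1 (fun x Hx => in_or_app _ _ _ (or_introl (I0 x Hx)))). rewrite Csum_RtoC, <- RtoC_minus, Cmod_R in E0, E1.
 rewrite Rsum_app in E1. apply Rabs_def2 in E0, E1. lra.
Qed.
(* [sz x -> 0] inside [dom] encodes the filter along which the limit is taken. *)
Lemma tannery {I X : Type} (dom : X -> Prop) (sz : X -> R) (F : X -> I -> C) (f : I -> C)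
  (M : I -> R) (B : R) (S : X -> C) (s : C) : bnd M B -> (forall x i, dom x -> Cmod (F x i) <= M i) -> (forall i, Cmod (f i) <= M i) -> (forall i eps, 0 < eps -> exists d, 0 < d /\ forall x, dom x -> sz x < d -> Cmod (Cminus (F x i) (f i)) < eps) ->
 (forall x, dom x -> Sums (F x) (S x)) -> Sums f s -> forall eps, 0 < eps -> exists d, 0 < d /\ forall x, dom x -> sz x < d -> Cmod (Cminus (S x) s) < eps.
 intros HB HF Hf Hlim HS Hs eps He. assert (HM : forall i, 0 <= M i) by (intros i; eapply Rle_trans; [apply Cmod_ge_0|auto]). destruct (bnd_tail M B HM HB (eps/8)) as [l0 [N0 T0]]; [lra|].
 (* Finite sums converge term by term; the remaining differences are dominated by 2 M, whose tail
    outside [l0] is below eps / 4. *)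
 assert (Hfin : forall l, forall e, 0 < e -> exists d, 0 < d /\ forall x, dom x -> sz x < d -> Cmod (Csum (fun i => Cminus (F x i) (f i)) l) < e).
 { induction l as [|i l IH]; intros e Hpe; simpl; [exists 1; split; [lra|]; now rewrite Cmod_0|]. destruct (Hlim i (e/2)) as [d1 [D1 E1]]; [lra|].
  destruct (IH (e/2)) as [d2 [D2 E2]]; [lra|]. exists (Rmin d1 d2). split; [now apply Rmin_pos|]. intros x Hx Hsz. lt_via Cmod_triangle. specialize (E1 x Hx (Rlt_le_trans _ _ _ Hsz (Rmin_l _ _))).
  specialize (E2 x Hx (Rlt_le_trans _ _ _ Hsz (Rmin_r _ _))). lra. } destruct (Hfin l0 (eps/4)) as [d [Hd E]]; [lra|]. exists d. split; auto. intros x Hx Hsz. specialize (E x Hx Hsz).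
 have Sums_minus _ _ _ _ (HS x Hx) Hs as Hm. destruct (Hm (eps/4)) as [l1 H1]; [lra|]. destruct (nodup_super (l0 ++ l1)) as [l [Nl Il]]. specialize (H1 l Nl (fun y Hy => Il y (in_or_app _ _ _ (or_intror Hy)))).
 destruct (split_incl l0 l N0 Nl (fun y Hy => Il y (in_or_app _ _ _ (or_introl Hy)))) as [l' [P' [N' D']]]. rewrite (Csum_perm _ _ _ P'), Csum_app in H1. assert (Ht : Cmod (Csum (fun i => Cminus (F x i) (f i)) l') <= eps / 4).
 { le_via Cmod_Csum. apply Rle_trans with (Rsum (fun i => 2 * M i) l'); [|rewrite Rsum_scal; specialize (T0 l' N' D'); lra]. apply Rsum_le_in. intros i _. le_via Cmod_triangle. rewrite Cmod_opp. specialize (HF x i Hx). specialize (Hf i). lra. }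
 set (a := Csum (fun i => Cminus (F x i) (f i)) l0) in *. set (b := Csum (fun i => Cminus (F x i) (f i)) l') in *. replace (Cminus (S x) s) with (Cplus (Cplus a b) (Copp (Cminus (Cplus a b) (Cminus (S x) s)))) by ring. lt_via Cmod_triangle.
 rewrite Cmod_opp. have Cmod_triangle a b. lra.
Qed.
Lemma bnd_nat {g : nat -> R} B : (forall n, 0 <= g n) -> (forall N, Rsum g (seq 0 N) <= B) -> bnd g B.
 intros Hg HB l Hl. assert (exists N, incl l (seq 0 N)) as [N HN].
 { clear Hl. induction l as [|a l [N IH]]; [exists O; easy|exists (Nat.max N (S a)); intros x [|Hx]; apply in_seq; [lia|]; apply IH, in_seq in Hx; lia]. }
 destruct (split_incl l (seq 0 N) Hl (seq_NoDup _ _) HN) as [l' [P _]]. specialize (HB N). rewrite (Rsum_perm _ _ _ P), Rsum_app in HB. have Rsum_nonneg g l' Hg. lra.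
Qed.
Lemma bnd_geom r : 0 <= r < 1 -> bnd (fun n : nat => r ^ n) (/ (1 - r)).
 intros Hr. apply bnd_nat.
 { intros n. pos. } intros N. assert (Rsum (fun n : nat => r ^ n) (seq 0 N) = (1 - r ^ N) / (1 - r)) by (induction N; [simpl; lra|]; rewrite seq_S, Rsum_app, IHN; simpl; field; lra).
 rewrite H. unfold Rdiv. rewrite <- (Rmult_1_l (/ (1 - r))) at 2. mul_r; [pos|have pow_le r N; lra].
Qed.
Definition Z_of_sum (x : nat + nat) : Z :=
 match x with inl n => zn n | inr n => (- zn n - 1)%Z end.
Definition sum_of_Z (z : Z) : nat + nat :=
 if (0 <=? z)%Z then inl (Z.to_nat z) else inr (Z.to_nat (- z - 1)).
Lemma Z_of_sum_K x : sum_of_Z (Z_of_sum x) = x.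
 destruct x as [|]; unfold sum_of_Z, Z_of_sum; [destruct (Z.leb_spec 0 (zn n)); [|lia]; now rewrite Nat2Z.id|destruct (Z.leb_spec 0 (- zn n - 1)); f_equal; lia].
Qed.
Lemma sum_of_Z_K z : Z_of_sum (sum_of_Z z) = z.
 unfold sum_of_Z. destruct (Z.leb_spec 0 z); simpl; lia. Qed.
Lemma bnd_Z (g : Z -> R) A B : bnd (fun n : nat => g (zn n)) A ->
 bnd (fun n : nat => g (- zn n - 1)%Z) B -> bnd g (A + B).
 intros HA HB. assert (H : bnd (fun x => g (Z_of_sum x)) (A + B)) by now apply bnd_sum.
 apply (bnd_inj sum_of_Z) in H; [eapply bnd_le; [|eauto]; intros z; simpl; rewrite sum_of_Z_K; lra|intros x y E; rewrite <- (sum_of_Z_K x), <- sum_of_Z_K; now f_equal].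
Qed.
Lemma Sums_Z (f : Z -> C) s t : Sums (fun n : nat => f (zn n)) s ->
 Sums (fun n : nat => f (- zn n - 1)%Z) t -> Sums f (Cplus s t).
 intros Hs Ht. apply (Sums_reindex_back Z_of_sum sum_of_Z); [apply Z_of_sum_K | apply sum_of_Z_K|]. now apply Sums_sum. Qed.
Lemma Sums_is_series (f : nat -> C) s : Sums f s ->
 @is_series C_AbsRing C_NormedModule f s.
 intros Hf. apply filterlim_locally. intros eps. assert (Hsum : forall N, @sum_n C_AbelianMonoid f N = Csum f (seq 0 (S N))).
 { induction N; [auto|rewrite sum_Sn, IHN, (seq_S (S N) 0), Csum_app; cring]. } destruct (Hf eps (cond_pos eps)) as [l0 H0]. assert (exists N, incl l0 (seq 0 N)) as [N HN].
 { clear H0. induction l0 as [|a l [N IH]]; [exists O; easy|exists (Nat.max N (S a)); intros x [|Hx]; apply in_seq; [lia|]; apply IH, in_seq in Hx; lia]. }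
 exists N. intros n Hn. apply C_NormedModule_mixin_compat1. rewrite Hsum. apply H0; [apply seq_NoDup|]. intros x Hx. apply HN, in_seq in Hx. apply in_seq. lia.
Qed.
(** Chosen by epsilon and meaningful only for summable families. The series below are named through
    it, and each gets a [_spec] lemma once a bound is available. *)
Definition tsum {I : Type} (f : I -> C) : C :=
 epsilon (inhabits (RtoC 0)) (fun s => Sums f s).
Lemma tsum_ex {I} (f : I -> C) s : Sums f s -> Sums f (tsum f).
 intros H. unfold tsum. apply epsilon_spec. eauto. Qed.
Lemma tsum_HasSum {I} (f : I -> C) B : bnd (fun i => Cmod (f i)) B -> Sums f (tsum f).
 intros H. destruct (Sums_ex f B H) as []. eapply tsum_ex; eauto. Qed.
Lemma tsum_eq {I} (f : I -> C) s : Sums f s -> tsum f = s.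
 intros H. eapply Sums_unique; [eapply tsum_ex; eauto | auto]. Qed.
Lemma tsum_ext {I} (f g : I -> C) : (forall i, f i = g i) -> tsum f = tsum g.
 intros H. f_equal. now fext. Qed.
Lemma Sums_single {I} (i0 : I) (f : I -> C) : (forall i, i <> i0 -> f i = 0) -> Sums f (f i0).
 exists [i0]. intros l Hl Hi. assert (Hin : In i0 l) by (apply Hi; now left). assert (E : Csum f l = f i0).
 { clear Hi. induction l as [|a l IH]; [easy|]. inversion Hl. simpl. destruct Hin as [->|].
  - replace (Csum f l) with (RtoC 0); [ring|]. symmetry. rewrite (Csum_ext_in f (fun _ => 0)); [clear; induction l; simpl; auto; rewrite IHl; ring|intros i Hil; apply H; intros ->; auto].
  - rewrite H by (intros ->; contradiction). rewrite IH; auto. ring. } rewrite E. replace (f i0 - f i0)%C with (RtoC 0) by ring. now rewrite Cmod_0.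
Qed.

(** * Wirtinger calculus and termwise differentiation *)

(* Wirtinger derivatives: [A] and [B] are the coefficients of [dz] and [d(conj z)]. *)
Definition wder (F : C -> C) (z A B : C) : Prop :=
 forall eps, 0 < eps -> exists d, 0 < d /\ forall h, Cmod h < d -> Cmod (F (z + h) - F z - (A * h + B * Cconj h))%C <= eps * Cmod h.
Definition rder (f : R -> C) (t : R) (l : C) : Prop :=
 forall eps, 0 < eps -> exists d, 0 < d /\ forall s, Rabs s < d -> Cmod (f (t + s)%R - f t - l * s)%C <= eps * Rabs s.
Lemma wder_eq F z A B A' B' : wder F z A B -> A = A' -> B = B' -> wder F z A' B'.
 intros H <- <-; auto. Qed.
Tactic Notation "wder_by" uconstr(x) := eapply wder_eq; [apply x|].
Lemma wder_loc F G z A B r : 0 < r -> (forall h, Cmod h < r -> F (z + h)%C = G (z + h)%C) ->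
 wder F z A B -> wder G z A B.
 intros Hr He HF eps Hp. destruct (HF eps Hp) as [d ]. exists (Rmin d r). split; [now apply Rmin_pos|]. intros h Hh. rewrite <- He by (eapply Rlt_le_trans; [eauto|apply Rmin_r]).
 replace (G z) with (F z); [apply H; eapply Rlt_le_trans; [eauto|apply Rmin_l]|specialize (He 0); rewrite Cplus_0_r in He; apply He; now rewrite Cmod_0].
Qed.
Lemma Im_plus (a b : C) : Im (a + b)%C = Im a + Im b.
 auto. Qed.
Lemma Re_plus (a b : C) : Re (a + b)%C = Re a + Re b.
 auto. Qed.
Lemma im_le_Cmod (c : C) : Rabs (Im c) <= Cmod c.
 le_via Rmax_r. apply Rmax_Cmod. Qed.
Lemma inH_ball z h : inH z -> Cmod h < Im z -> inH (z + h)%C.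
 unfold inH. rewrite Im_plus. have im_le_Cmod h. apply Rabs_le_between in H. lra. Qed.
Lemma wder_extH F G z A B : inH z -> (forall z, inH z -> F z = G z) -> wder F z A B -> wder G z A B.
 intros Hz He. apply wder_loc with (r := Im z); [auto|]. intros h Hh. apply He. now apply inH_ball. Qed.
Lemma wder_const c z : wder (fun _ => c) z 0 0.
 exists 1. split; [lra|]. intros h _. replace (c - c - (0 * h + 0 * Cconj h))%C with (RtoC 0) by ring. rewrite Cmod_0. pos. Qed.
#[local] Hint Resolve wder_const : core.
Lemma wder_id z : wder (fun z => z) z 1 0.
 exists 1. split; [lra|]. intros h _. replace (z + h - z - (1 * h + 0 * Cconj h))%C with (RtoC 0) by ring. rewrite Cmod_0. pos. Qed.
#[local] Hint Resolve wder_id : core.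
Lemma wder_Cconj z : wder Cconj z 0 1.
 exists 1. split; [lra|]. intros h _. rewrite Cplus_conj. replace (Cconj z + Cconj h - Cconj z - (0 * h + 1 * Cconj h))%C with (RtoC 0) by ring. rewrite Cmod_0. pos.
Qed.
Lemma wder_plus F G z A B A' B' : wder F z A B -> wder G z A' B' ->
 wder (fun z => F z + G z)%C z (A + A')%C (B + B')%C.
 intros HF HG eps He. destruct (HF (eps/2)) as [d1 [D1 E1]]; [lra|]. destruct (HG (eps/2)) as [d2 [D2 E2]]; [lra|]. exists (Rmin d1 d2).
 split; [now apply Rmin_pos|]. intros h Hh. specialize (E1 h (Rlt_le_trans _ _ _ Hh (Rmin_l _ _))). specialize (E2 h (Rlt_le_trans _ _ _ Hh (Rmin_r _ _))). replace (F (z + h) + G (z + h) - (F z + G z) - ((A + A') * h + (B + B') * Cconj h))%C with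
  (F (z + h) - F z - (A * h + B * Cconj h) + (G (z + h) - G z - (A' * h + B' * Cconj h)))%C by ring. le_via Cmod_triangle. lra.
Qed.
Lemma Cmod_lin A B h : Cmod (A * h + B * Cconj h)%C <= (Cmod A + Cmod B) * Cmod h.
 le_via Cmod_triangle. rewrite !Cmod_mult, Cmod_conj. lra. Qed.
Lemma wder_lip F z A B : wder F z A B -> exists d, 0 < d /\ forall h, Cmod h < d ->
 Cmod (F (z + h) - F z)%C <= (Cmod A + Cmod B + 1) * Cmod h.
 intros H. destruct (H 1) as [d [Hd E]]; [lra|]. exists d. split; auto. intros h Hh. specialize (E h Hh). replace (F (z + h) - F z)%C with (F (z + h) - F z - (A * h + B * Cconj h) + (A * h + B * Cconj h))%C by ring. le_via Cmod_triangle.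
 have Cmod_lin A B h. lra.
Qed.
Lemma small_eps K eps : 0 <= K -> 0 < eps -> exists e, 0 < e /\ K * e <= eps.
 exists (eps / (K + 1)). split; [pos|]. apply Rmult_le_reg_r with (K + 1); [lra|]. field_simplify; nra. Qed.
Lemma wder_scal c F z A B : wder F z A B -> wder (fun z => c * F z)%C z (c * A)%C (c * B)%C.
 intros H eps He. destruct (small_eps (Cmod c) eps) as [e [P Q]]; [auto|auto|]. destruct (H e P) as [d [Hd E]]. exists d. split; auto. intros h Hh. specialize (E h Hh).
 replace (c * F (z + h) - c * F z - (c * A * h + c * B * Cconj h))%C with (c * (F (z + h) - F z - (A * h + B * Cconj h)))%C by ring.
 rewrite Cmod_mult. have Cmod_ge_0 h. have Cmod_ge_0 c. apply Rle_trans with (Cmod c * (e * Cmod h)); [mul_l; auto|nra].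
Qed.
Lemma wder_opp F z A B : wder F z A B -> wder (fun z => - F z)%C z (- A)%C (- B)%C.
 intros H. apply (wder_scal (-1)) in H. eapply wder_eq; [eapply wder_loc with (r := 1); [lra| |exact H]|ring|ring]. intros; simpl; ring. Qed.
Lemma wder_minus F G z A B A' B' : wder F z A B -> wder G z A' B' ->
 wder (fun z => F z - G z)%C z (A - A')%C (B - B')%C.
 intros HF HG. apply wder_plus; auto. now apply wder_opp. Qed.
Lemma wder_comp F g z A B a b : wder F (g z) A B -> wder g z a b ->
 wder (fun z => F (g z)) z (A * a + B * Cconj b)%C (A * b + B * Cconj a)%C.
 intros HF Hg eps He. destruct (wder_lip _ _ _ _ Hg) as [d1 [D1 L1]]. have Cmod_ge_0 A. have Cmod_ge_0 B. have Cmod_ge_0 a. have Cmod_ge_0 b. set (K := Cmod a + Cmod b + 1) in *. destruct (small_eps K (eps/2)) as [e1 [P1 Q1]]; [unfold K; lra|lra|].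
 destruct (small_eps (Cmod A + Cmod B) (eps/2)) as [e2 [P2 Q2]]; [lra|lra|]. destruct (HF e1 P1) as [d2 [D2 E2]]. destruct (Hg e2 P2) as [d3 [D3 E3]]. assert (HK : 0 < K) by (unfold K; lra). exists (Rmin (d2 / K) (Rmin d1 d3)). split.
 { repeat apply Rmin_pos; auto. pos. } intros h Hh. assert (Hm : Cmod h < d2 / K /\ Cmod h < d1 /\ Cmod h < d3) by (revert Hh; unfold Rmin; repeat destruct Rle_dec; lra).
 destruct Hm as [M1 [M2 M3]]. specialize (L1 h M2). specialize (E3 h M3). set (k := (g (z + h) - g z)%C) in *. have Cmod_ge_0 h.
 assert (Hk : Cmod k < d2) by (lt_via L1; apply Rmult_lt_reg_r with (/ K); [pos|]; replace (K * Cmod h * / K) with (Cmod h) by (field; lra); exact M1).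
 specialize (E2 k Hk). replace (g z + k)%C with (g (z + h)%C) in E2 by cring. set (e := (k - (a * h + b * Cconj h))%C) in *. replace (F (g (z + h)) - F (g z) - ((A * a + B * Cconj b) * h + (A * b + B * Cconj a) * Cconj h))%C with
  (F (g (z + h)) - F (g z) - (A * k + B * Cconj k) + (A * e + B * Cconj e))%C. 2:{ cring. } le_via Cmod_triangle. have Cmod_lin A B e. nra.
Qed.
Lemma wder_comp_hol F g z A a b : wder F (g z) A 0 -> wder g z a b ->
 wder (fun z => F (g z)) z (A * a)%C (A * b)%C.
 intros H1 H2. eapply wder_eq; [apply (wder_comp _ _ _ _ _ _ _ H1 H2)| |]; ring. Qed.
Lemma wder_sq z : wder (fun z => z * z)%C z (2 * z)%C 0.
 intros eps He. exists eps. split; auto. intros h Hh. replace ((z + h) * (z + h) - z * z - (2 * z * h + 0 * Cconj h))%C with (h * h)%C by ring. rewrite Cmod_mult. mul_r; [auto|lra].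
Qed.
(** Polarization, 4 F G = (F + G)^2 - (F - G)^2, reduces the product rule to the chain rule for the
    square. *)
Lemma wder_mult F G z A B A' B' : wder F z A B -> wder G z A' B' ->
 wder (fun z => F z * G z)%C z (A * G z + F z * A')%C (B * G z + F z * B')%C.
 intros HF HG. assert (E : (fun z => F z * G z)%C = (fun z => / 4 * ((F z + G z) * (F z + G z) - (F z - G z) * (F z - G z)))%C) by (fext; intros; field).
 rewrite E. eapply wder_eq; [apply wder_scal, wder_minus; [apply (wder_comp_hol (fun z => z * z)%C (fun z => F z + G z)%C); [apply wder_sq|apply wder_plus; eauto]|apply (wder_comp_hol (fun z => z * z)%C (fun z => F z - G z)%C); [apply wder_sq|apply wder_minus; eauto]]| |]; field.
Qed.
(** Two candidates give (A - A') u + (B - B') conj u = 0 in every unit direction u, and u = 1 and u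
    = i separate the coefficients. Transformation laws are later obtained by differentiating one
    identity in two ways and invoking this. *)
Lemma wder_unique F z A B A' B' : wder F z A B -> wder F z A' B' -> A = A' /\ B = B'.
 intros H1 H2. assert (H : forall u : C, Cmod u = 1 -> ((A - A') * u + (B - B') * Cconj u)%C = 0).
 { intros u Hu. apply Cmod_eq_0. apply Rle_antisym; [|auto]. apply Rnot_lt_le. intros Hlt. set (v := ((A - A') * u + (B - B') * Cconj u)%C) in *.
  destruct (H1 (Cmod v / 4)) as [d1 [D1 E1]]; [lra|]. destruct (H2 (Cmod v / 4)) as [d2 [D2 E2]]; [lra|]. set (t := Rmin d1 d2 / 2). assert (Ht : 0 < t) by (have Rmin_pos d1 d2 D1 D2; unfold t; lra).
  assert (Htm : Cmod (t * u) = t) by (rewrite Cmod_mult, Cmod_R, Hu, Rabs_pos_eq; lra). assert (t < d1 /\ t < d2) by (unfold t; have Rmin_l d1 d2; have Rmin_r d1 d2; lra). specialize (E1 (t * u)%C). specialize (E2 (t * u)%C). rewrite Htm in *.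
  assert (Hv : (t * v = F (z + t * u) - F z - (A' * (t * u) + B' * Cconj (t * u)) - (F (z + t * u) - F z - (A * (t * u) + B * Cconj (t * u))))%C) by cring.
  assert (Cmod (t * v) <= Cmod v / 4 * t + Cmod v / 4 * t) by (rewrite Hv; le_via Cmod_triangle; rewrite Cmod_opp; lra). rewrite Cmod_mult, Cmod_R, Rabs_pos_eq in H0 by lra. nra. }
 have H 1%C Cmod_1 as Ha. have H Ci Cmod_Ci as Hb. assert (C1 : Cconj 1 = 1) by cring. assert (C2 : Cconj Ci = Copp Ci) by cring. rewrite C1 in Ha. rewrite C2 in Hb. assert (Hb' : (A - A' - (B - B'))%C = 0).
 { replace (A - A' - (B - B'))%C with (((A - A') * Ci + (B - B') * - Ci) * / Ci)%C; [rewrite Hb; ring|]. field. apply Ci_nz. } assert (Hs : forall u v : C, (u * 1 + v * 1)%C = 0 -> (u - v)%C = 0 -> u = 0 /\ v = 0).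
 { intros u v E1 E2. assert (u = v) as -> by now apply Ceq_minus. assert (H2v : (2 * v)%C = 0) by (rewrite <- E1; ring). assert (v = 0) as ->; [|auto]. replace v with (/ 2 * (2 * v))%C; [rewrite H2v; ring|]. field. }
 destruct (Hs _ _ Ha Hb') as []. split; now apply Ceq_minus.
Qed.
Lemma is_derive_wder (F : C -> C) (z A : C) : wder F z A 0 -> @is_derive C_AbsRing C_NormedModule F z A.
 split; [apply is_linear_scal_l|]. intros x Hx. assert (x = z) as -> by (apply (@is_filter_lim_locally_unique C_AbsRing (AbsRing_NormedModule C_AbsRing)) in Hx; auto). intros eps.
 destruct (H eps (cond_pos eps)) as [d [Hd E]]. exists (mkposreal d Hd). intros y0 Hy. revert Hy. set (y := y0 : C). intros Hy. specialize (E (y - z)%C Hy).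
 replace (z + (y - z))%C with y in E by ring. change (Cmod (F y - F z - (y - z) * A) <= eps * Cmod (y - z)). replace (F y - F z - (y - z) * A)%C with (F y - F z - (A * (y - z) + 0 * Cconj (y - z)))%C by ring. auto.
Qed.
Lemma wder_line_re (F : C -> C) z A B (h c : C) : wder F z A B ->
 is_derive (fun t : R => Re (c * F (z + t * h)%C)%C) 0 (Re (c * (A * h + B * Cconj h))%C).
 intros H. apply is_derive_Reals. intros eps He. have Cmod_ge_0 c as Hc. have Cmod_ge_0 h as Hh. destruct (small_eps (Cmod c * Cmod h) (eps/2)) as [e [P Q]]; [nra|lra|]. destruct (H e P) as [d [Hd E]]. assert (Hdp : 0 < d / (Cmod h + 1)) by pos.
 exists (mkposreal _ Hdp). intros t Ht0 Htd. assert (Hth : Cmod (t * h) = Rabs t * Cmod h) by now rewrite Cmod_mult, Cmod_R. assert (Hta : 0 < Rabs t) by now apply Rabs_pos_lt. assert (Cmod (t * h) < d).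
 { apply Rle_lt_trans with (Rabs t * (Cmod h + 1)); [nra|]. apply Rmult_lt_reg_r with (/ (Cmod h + 1)); [pos|]. rewrite Rmult_assoc, Rinv_r, Rmult_1_r by lra. auto. }
 specialize (E _ H0). rewrite Hth in E. replace (0 + t) with t by ring. replace (z + 0 * h)%C with z by ring.
 assert (Hc2 : Cconj (t * h) = (t * Cconj h)%C) by cring. rewrite Hc2 in E. set (w := (F (z + t * h) - F z - (A * (t * h) + B * (t * Cconj h)))%C) in *. replace ((Re (c * F (z + t * h))%C - Re (c * F z)) / t - Re (c * (A * h + B * Cconj h)))
  with (Re (c * w) / t). 2:{ simpl. field; lra. } rewrite Rabs_div by auto. apply Rle_lt_trans with (Cmod (c * w) / Rabs t).
 { mul_r; [pos|]. apply re_le_Cmod. } rewrite Cmod_mult. apply Rle_lt_trans with (Cmod c * (e * (Rabs t * Cmod h)) / Rabs t).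
 { mul_r; [pos|]. nra. } replace (Cmod c * (e * (Rabs t * Cmod h)) / Rabs t) with (Cmod c * Cmod h * e) by (field; lra). lra.
Qed.
Lemma wder_line_re_at (F : C -> C) z A B (h c : C) (t0 : R) : wder F (z + t0 * h)%C A B ->
 is_derive (fun t : R => Re (c * F (z + t * h)%C)%C) t0 (Re (c * (A * h + B * Cconj h))%C).
 intros H. apply (wder_line_re _ _ _ _ h c) in H. set (l := Re (c * (A * h + B * Cconj h))). assert (H2 := is_derive_comp (fun t : R => Re (c * F (z + t0 * h + t * h)%C)) (fun t => t - t0) t0 l 1). cbv beta in H2.
 replace (t0 - t0) with 0 in H2 by ring. specialize (H2 H). assert (H3 : is_derive (fun t => t - t0) t0 1) by (auto_derive; auto). specialize (H2 H3).
 match type of H2 with is_derive _ _ ?v => replace v with l in H2 by (symmetry; apply Rmult_1_l) end. eapply is_derive_ext; [|eauto]. intros t. cbn beta. do 3 f_equal. cring.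
Qed.
(** Pairing with the conjugate of the total increment gives a real function on [0, 1] whose
    increment is the squared modulus, so the real mean value theorem applies. *)
Lemma wder_mvt F z h M :
 (forall t : R, 0 <= t <= 1 -> exists A B, wder F (z + t * h)%C A B /\ Cmod A + Cmod B <= M) -> Cmod (F (z + h) - F z)%C <= M * Cmod h.
 intros H. set (D := (F (z + h) - F z)%C). set (phi := fun t : R => Re (Cconj D * F (z + t * h)%C)). assert (Hd : forall t, 0 <= t <= 1 -> exists l : R, is_derive phi t l /\ Rabs l <= Cmod D * (M * Cmod h)).
 { intros t Ht. destruct (H t Ht) as [A [B []]]. exists (Re (Cconj D * (A * h + B * Cconj h))). split; [now apply wder_line_re_at|le_via re_le_Cmod; rewrite Cmod_mult, Cmod_conj; mul_l; [auto|]; le_via Cmod_lin; mul_r; [auto|auto]]. }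
 destruct (MVT_gen phi 0 1 (Derive phi)) as [c [Hc1 Hc2]].
 - intros x Hx. rewrite Rmin_left, Rmax_right in Hx by lra. destruct (Hd x) as [l ]; [lra|]. apply Derive_correct. now exists l.
 - intros x Hx. rewrite Rmin_left, Rmax_right in Hx by lra. destruct (Hd x) as [l ]; [lra|]. apply ex_derive_cpt. now exists l.
 - rewrite Rmin_left, Rmax_right in Hc1 by lra. destruct (Hd c Hc1) as [l [Hl1 Hl2]]. rewrite (is_derive_unique _ _ _ Hl1) in Hc2. assert (E : phi 1 - phi 0 = Cmod D * Cmod D).
  { unfold phi. replace (z + 1 * h)%C with (z + h)%C by ring. replace (z + 0 * h)%C with z by ring. replace (Cmod D * Cmod D) with (Re (Cconj D * D)); [simpl; lra|replace (Cmod D * Cmod D) with (Cmod D ^ 2) by ring; rewrite Cmod2_alt; simpl; lra]. }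
  have Cmod_ge_0 D. have Rle_abs l. destruct (Req_dec (Cmod D) 0) as [E0|]; [rewrite E0; destruct (H 0) as [A [B ]]; [lra|]; have Cmod_ge_0 A; have Cmod_ge_0 B; pos|nra].
Qed.
Lemma wder_const_seg F z h : (forall t : R, 0 <= t <= 1 -> wder F (z + t * h)%C 0 0) -> F (z + h)%C = F z.
 intros H. apply Ceq_minus, Cmod_eq_0. apply Rle_antisym; [|auto]. replace 0 with (0 * Cmod h) by ring. apply wder_mvt. exists 0, 0. split; auto. rewrite Cmod_0. lra.
Qed.
(** Dominated convergence for the difference quotients: the mean value inequality bounds each of
    them by the bound on the derivatives, uniformly in the increment. *)
Lemma wder_sum {I : Type} (f A B : I -> C -> C) (M : I -> R) (K rho : R) (F : C -> C) (z a b : C) :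
 0 < rho -> bnd M K -> (forall i h, Cmod h < rho -> wder (f i) (z + h)%C (A i (z + h)%C) (B i (z + h)%C)) -> (forall i h, Cmod h < rho -> Cmod (A i (z + h)%C) + Cmod (B i (z + h)%C) <= M i) ->
 (forall h, Cmod h < rho -> Sums (fun i => f i (z + h)%C) (F (z + h)%C)) -> Sums (fun i => A i z) a -> Sums (fun i => B i z) b -> wder F z a b.
 intros Hr HM Hf HAB HF Ha Hb eps He. assert (Z0 : (z + 0)%C = z) by ring. assert (H0r : Cmod 0 < rho) by (rewrite Cmod_0; lra). set (G := fun h i => ((f i (z + h) - f i z - (A i z * h + B i z * Cconj h)) / h)%C).
 set (S := fun h : C => ((F (z + h) - F z - (a * h + b * Cconj h)) / h)%C). assert (HM0 : forall i, 0 <= M i) by (intros i; eapply Rle_trans; [|apply (HAB i 0 H0r)]; pos).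
 destruct (tannery (fun h : C => h <> 0 /\ Cmod h < rho) Cmod G (fun _ => 0) (fun i => 2 * M i) (2 * K) S 0) with eps as [d [Hd E]]; auto.
 - apply bnd_scal; [lra|auto].
 - intros h i [Hh0 Hh]. unfold G. rewrite Cmod_div by auto. apply Rmult_le_reg_r with (Cmod h); [now apply Cmod_gt_0|]. unfold Rdiv.
  rewrite Rmult_assoc, Rinv_l, Rmult_1_r by (apply Rgt_not_eq; now apply Cmod_gt_0). le_via Cmod_triangle. rewrite Cmod_opp.
  assert (Cmod (f i (z + h) - f i z)%C <= M i * Cmod h) by (apply wder_mvt; intros t Ht; assert (Cmod (t * h) < rho) by (rewrite Cmod_mult, Cmod_R, Rabs_pos_eq; have Cmod_ge_0 h; nra); exists (A i (z + t * h)%C), (B i (z + t * h)%C); auto).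
  have Cmod_lin (A i z) (B i z) h. have HAB i 0 H0r. rewrite Z0 in H1. have Cmod_ge_0 h. nra.
 - intros i. rewrite Cmod_0. specialize (HM0 i). lra.
 - intros i e Hpe. have Hf i 0 H0r as Hi. rewrite Z0 in Hi. destruct (Hi (e/2)) as [d [Hd E]]; [lra|]. exists d. split; auto. intros h [] Hs.
  specialize (E h Hs). unfold G. replace _%C with ((f i (z + h) - f i z - (A i z * h + B i z * Cconj h)) / h)%C by ring. rewrite Cmod_div by auto.
  apply Rle_lt_trans with (e / 2); [|lra]. apply Rmult_le_reg_r with (Cmod h); [now apply Cmod_gt_0|]. unfold Rdiv. rewrite Rmult_assoc, Rinv_l by (apply Rgt_not_eq; now apply Cmod_gt_0). lra.
 - intros h [Hh0 Hh]. have HF h Hh as S1. have HF 0 H0r as S0. rewrite Z0 in S0. have Sums_minus _ _ _ _ (Sums_minus _ _ _ _ S1 S0) (Sums_plus _ _ _ _ (Sums_scal h _ _ Ha) (Sums_scal (Cconj h) _ _ Hb)) as Q.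
  apply (Sums_scal (/ h)) in Q. eapply Sums_eq; [eapply Sums_ext; [|exact Q]|]; unfold G, S; intros; field; auto.
 -
 - exists (Rmin d rho). split; [now apply Rmin_pos|]. intros h Hh. destruct (classic (h = 0)) as [->|].
  + rewrite Z0. replace (F z - F z - (a * 0 + b * Cconj 0))%C with (RtoC 0); [rewrite Cmod_0; lra|cring].
  + assert (H1 : h <> 0 /\ Cmod h < rho) by (split; auto; eapply Rlt_le_trans; [eauto|apply Rmin_r]).
   specialize (E h H1 (Rlt_le_trans _ _ _ Hh (Rmin_l _ _))). unfold S in E. replace _%C with ((F (z + h) - F z - (a * h + b * Cconj h)) / h)%C in E by ring.
   rewrite Cmod_div in E by auto. left. apply Rmult_lt_reg_r with (/ Cmod h); [apply Rinv_0_lt_compat; now apply Cmod_gt_0|]. rewrite Rmult_assoc, Rinv_r, Rmult_1_r by (apply Rgt_not_eq; now apply Cmod_gt_0). auto.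
Qed.
Lemma rder_real (f : R -> R) t l : is_derive f t l -> rder (fun t => RtoC (f t)) t (RtoC l).
 intros H. apply is_derive_Reals in H. intros eps He. destruct (H eps He) as [d E]. exists d. split; [apply cond_pos|]. intros s Hs. rewrite <- RtoC_minus, <- RtoC_mult, <- RtoC_minus, Cmod_R. destruct (Req_dec s 0) as [->|].
 - rewrite Rplus_0_r. replace (f t - f t - l * 0) with 0 by ring. rewrite Rabs_R0. lra.
 - left. replace (f (t + s) - f t - l * s) with (((f (t + s) - f t) / s - l) * s) by (field; lra). rewrite Rabs_mult. apply Rmult_lt_compat_r; auto. now apply Rabs_pos_lt.
Qed.
(* [u] is a real-linear functional, applied below to [Re] and [Im] *)
Lemma wder_rder (f : R -> C) (u : C -> R) (p q : C) z l :
 (forall a b, u (a + b)%C = u a + u b) -> (forall a, RtoC (u a) = (p * a + q * Cconj a)%C) -> (forall a, Rabs (u a) <= Cmod a) -> rder f (u z) l -> wder (fun z => f (u z)) z (l * p)%C (l * q)%C.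
 intros Hu Hl Hm H eps He. destruct (H eps He) as [d [Hd E]]. exists d. split; auto. intros h Hh. rewrite Hu. specialize (E (u h) (Rle_lt_trans _ _ _ (Hm h) Hh)).
 replace (l * p * h + l * q * Cconj h)%C with (l * u h)%C; [le_via E; mul_l; [lra|auto]|rewrite Hl; ring].
Qed.
Lemma wder_Im_fun f z l : rder f (Im z) l -> wder (fun z => f (Im z)) z (l * (- Ci / 2))%C (l * (Ci / 2))%C.
 apply wder_rder; [auto| |apply im_le_Cmod]. intros []. apply injective_projections; simpl; field. Qed.
Lemma wder_Re_fun f z l : rder f (Re z) l -> wder (fun z => f (Re z)) z (l * (1 / 2))%C (l * (1 / 2))%C.
 apply wder_rder; [auto| |apply re_le_Cmod]. intros []. apply injective_projections; simpl; field. Qed.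
Lemma wder_Cinv (z : C) : z <> 0 -> wder Cinv z (- / (z * z))%C 0.
 intros Hz eps He. assert (Hm : 0 < Cmod z) by now apply Cmod_gt_0. destruct (small_eps (2 / Cmod z ^ 3) eps) as [e ]; [|lra|].
 { pos. } exists (Rmin e (Cmod z / 2)). split; [apply Rmin_pos; lra|]. intros h Hh. assert (H1 : Cmod h < e) by (eapply Rlt_le_trans; [eauto|apply Rmin_l]).
 assert (H2 : Cmod h < Cmod z / 2) by (eapply Rlt_le_trans; [apply Hh|apply Rmin_r]). assert (H3 : Cmod z / 2 <= Cmod (z + h)).
 { assert (Cmod z <= Cmod (z + h) + Cmod h); [|lra]. replace z with (z + h + - h)%C at 1 by ring. rewrite <- (Cmod_opp h). apply Cmod_triangle. } assert (Hzh : (z + h)%C <> 0) by (apply Cmod_gt_0; lra).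
 replace (/ (z + h) - / z - (- / (z * z) * h + 0 * Cconj h))%C with (h * h * / (z * z * (z + h)))%C by (field; auto). assert (Hne : (z * z * (z + h))%C <> 0) by (repeat apply Cmult_neq_0; auto). rewrite Cmod_mult, Cmod_inv, !Cmod_mult by auto.
 assert (Hi : / (Cmod z * Cmod z * Cmod (z + h)) <= 2 / Cmod z ^ 3) by (replace (2 / Cmod z ^ 3) with (/ (Cmod z * Cmod z * Cmod z / 2)) by (field; lra); inv_le; [pos|nra]). assert (0 < / (Cmod z * Cmod z * Cmod (z + h))) by pos.
 replace (Cmod h * Cmod h * / (Cmod z * Cmod z * Cmod (z + h))) with (/ (Cmod z * Cmod z * Cmod (z + h)) * Cmod h * Cmod h) by ring. mul_r; auto. nra.
Qed.

(** * The complex exponential and additive characters *)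

Lemma cexp_plus a b : cexp (a + b)%C = (cexp a * cexp b)%C.
 destruct a, b. unfold cexp; simpl. rewrite exp_plus, cos_plus, sin_plus. cring. Qed.
Lemma Cmod_cexp a : Cmod (cexp a) = exp (Re a).
 unfold Cmod; simpl. replace (_ + _) with (exp (Re a) * exp (Re a) * (Rsqr (sin (Im a)) + Rsqr (cos (Im a)))) by (unfold Rsqr; ring). rewrite sin2_cos2, Rmult_1_r. apply sqrt_square. auto.
Qed.
Lemma cexp_0 : cexp 0 = 1.
 unfold cexp; simpl. rewrite exp_0, cos_0, sin_0. cring. Qed.
Lemma cexp_neq_0 a : cexp a <> 0.
 apply Cmod_gt_0. rewrite Cmod_cexp. auto. Qed.
Lemma cexp_conj a : Cconj (cexp a) = cexp (Cconj a).
 destruct a. unfold cexp; simpl. rewrite cos_neg, sin_neg. cring. Qed.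
Lemma cexp_real (x : R) : cexp x = RtoC (exp x).
 unfold cexp; simpl. rewrite cos_0, sin_0. cring. Qed.
Lemma cexp_opp a : cexp (- a)%C = (/ cexp a)%C.
 assert (H : (cexp (- a) * cexp a)%C = 1) by (rewrite <- cexp_plus, <- cexp_0; f_equal; ring). replace (/ cexp a)%C with (cexp (- a) * cexp a * / cexp a)%C by (rewrite H; ring). field. apply cexp_neq_0.
Qed.
Lemma wder_cexp z : wder cexp z (cexp z) 0.
 assert (He : wder (fun z => exp (Re z)) z (exp (Re z) * (1/2)) (exp (Re z) * (1/2))) by apply (wder_Re_fun (fun t => exp t)), rder_real, is_derive_exp.
 assert (Hc : wder (fun z => cos (Im z)) z (RtoC (- sin (Im z)) * (- Ci / 2)) (RtoC (- sin (Im z)) * (Ci/2))) by (apply (wder_Im_fun (fun t => cos t)), rder_real; auto_derive; auto; ring).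
 assert (Hs : wder (fun z => sin (Im z)) z (cos (Im z) * (- Ci / 2)) (cos (Im z) * (Ci/2))) by (apply (wder_Im_fun (fun t => sin t)), rder_real; auto_derive; auto; ring).
 have wder_mult _ _ _ _ _ _ _ He (wder_plus _ _ _ _ _ _ _ Hc (wder_scal Ci _ _ _ _ Hs)). eapply wder_eq; [eapply wder_loc with (r := 1); [lra| |exact H]| |]; [intros h _; cring|apply injective_projections; simpl; field|cring].
Qed.
Lemma wder_dX F z A B : wder F z A B ->
 dX F z = (A + B)%C /\ ex_derive (fun t => Re (F (t, Im z))) (Re z) /\ ex_derive (fun t => Im (F (t, Im z))) (Re z).
 intros H. assert (H1 : forall c, is_derive (fun t : R => Re (c * F (t, Im z))) (Re z) (Re (c * (A + B)))).
 { intros c. have wder_line_re_at F (0, Im z) A B 1 c (Re z) as Q. replace ((0, Im z) + Re z * 1)%C with z in Q by (apply injective_projections; simpl; unfold Re, Im; ring).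
  replace (A * 1 + B * Cconj 1)%C with (A + B)%C in Q; [eapply is_derive_ext; [|eauto]; intros t; cbn beta; do 3 f_equal; cring|cring]. }
 assert (HR : is_derive (fun t => Re (F (t, Im z))) (Re z) (Re (A + B))) by (specialize (H1 1%C); replace (1 * (A + B))%C with (A + B)%C in H1 by ring; eapply is_derive_ext; [|eauto]; intros t; cbn beta; now rewrite Cmult_1_l).
 assert (HI : is_derive (fun t => Im (F (t, Im z))) (Re z) (Im (A + B))) by (replace (Im (A + B)) with (Re (- Ci * (A + B))) by (simpl; ring); eapply is_derive_ext; [|eauto]; intros t; simpl; unfold Im; ring).
 repeat split; [apply injective_projections; [apply (is_derive_unique _ _ _ HR)|apply (is_derive_unique _ _ _ HI)]|eexists; exact HR|eexists; exact HI].
Qed.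
Lemma wder_dY F z A B : wder F z A B ->
 dY F z = (Ci * (A - B))%C /\ ex_derive (fun t => Re (F (Re z, t))) (Im z) /\ ex_derive (fun t => Im (F (Re z, t))) (Im z).
 intros H. assert (H1 : forall c, is_derive (fun t : R => Re (c * F (Re z, t))) (Im z) (Re (c * (Ci * (A - B))))).
 { intros c. have wder_line_re_at F (Re z, 0) A B Ci c (Im z) as Q. replace ((Re z, 0) + Im z * Ci)%C with z in Q by (apply injective_projections; simpl; unfold Re, Im; ring).
  replace (A * Ci + B * Cconj Ci)%C with (Ci * (A - B))%C in Q; [eapply is_derive_ext; [|eauto]; intros t; cbn beta; do 3 f_equal; cring|cring]. }
 assert (HR : is_derive (fun t => Re (F (Re z, t))) (Im z) (Re (Ci * (A - B)))) by (specialize (H1 1%C); replace (1 * (Ci * (A - B)))%C with (Ci * (A - B))%C in H1 by ring; eapply is_derive_ext; [|eauto]; intros t; cbn beta; now rewrite Cmult_1_l).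
 assert (HI : is_derive (fun t => Im (F (Re z, t))) (Im z) (Im (Ci * (A - B)))) by (replace (Im (Ci * (A - B))) with (Re (- Ci * (Ci * (A - B)))) by (simpl; ring); eapply is_derive_ext; [|eauto]; intros t; simpl; unfold Im; ring).
 repeat split; [apply injective_projections; [apply (is_derive_unique _ _ _ HR)|apply (is_derive_unique _ _ _ HI)]|eexists; exact HR|eexists; exact HI].
Qed.
Lemma wder_continuous F z A B : wder F z A B -> continuous F z.
 intros H. destruct (wder_lip _ _ _ _ H) as [d [Hd E]]. apply filterlim_locally. intros eps. set (K := Cmod A + Cmod B + 1).
 assert (HK : 0 < K) by (have Cmod_ge_0 A; have Cmod_ge_0 B; unfold K; lra). assert (Hs : 0 < sqrt 2) by pos. set (r := Rmin d (eps / K) / sqrt 2).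
 assert (Hr : 0 < r) by (apply Rdiv_lt_0_compat; auto; apply Rmin_pos; auto; apply Rdiv_lt_0_compat; auto; apply cond_pos). exists (mkposreal r Hr).
 intros y0 Hy. revert Hy. set (y := y0 : C). intros Hy. apply C_NormedModule_mixin_compat2 in Hy. simpl in Hy. replace (sqrt 2 * r) with (Rmin d (eps / K)) in Hy by (unfold r; field; lra). apply C_NormedModule_mixin_compat1.
 specialize (E (y - z)%C (Rlt_le_trans _ _ _ Hy (Rmin_l _ _))). replace (z + (y - z))%C with y in E by ring. lt_via E.
 apply Rlt_le_trans with (K * (eps / K)); [apply Rmult_lt_compat_l; auto; eapply Rlt_le_trans; [eauto|apply Rmin_r]|right; field; lra].
Qed.
Definition ee (s : C) : C := cexp (RtoC (2 * PI) * (Ci * s))%C.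
Lemma qq_ee z : qq z = ee z.
 auto. Qed.
Lemma ee_plus a b : ee (a + b)%C = (ee a * ee b)%C.
 unfold ee. rewrite <- cexp_plus. f_equal. ring. Qed.
Lemma ee_0 : ee 0 = 1.
 unfold ee. rewrite <- cexp_0. f_equal. ring. Qed.
Lemma ee_opp a : ee (- a)%C = (/ ee a)%C.
 unfold ee. rewrite <- cexp_opp. f_equal. ring. Qed.
Lemma ee_neq_0 a : ee a <> 0.
 apply cexp_neq_0. Qed.
#[local] Hint Resolve ee_neq_0 : core.
Lemma Cmod_ee s : Cmod (ee s) = exp (- 2 * PI * Im s).
 unfold ee. rewrite Cmod_cexp. f_equal. destruct s; simpl. lra. Qed.
Lemma Cmod_ee_R (x : R) : Cmod (ee x) = 1.
 rewrite Cmod_ee, Rmult_0_r. apply exp_0. Qed.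
Lemma ee_conj a : Cconj (ee a) = ee (- Cconj a)%C.
 unfold ee. rewrite cexp_conj. f_equal. cring. Qed.
Lemma ee_R (x : R) : ee x = (cos (2 * PI * x), sin (2 * PI * x)).
 unfold ee, cexp; simpl. replace (2 * PI * (0 * x - 1 * 0) - 0 * (0 * 0 + 1 * x)) with 0 by ring. rewrite exp_0. replace (2 * PI * (0 * 0 + 1 * x) + 0 * (0 * x - 1 * 0)) with (2 * PI * x) by ring. cring.
Qed.
Lemma ee_nat (n : nat) : ee (INR n) = RtoC 1.
 induction n; [apply ee_0|rewrite S_INR, RtoC_plus, ee_plus, IHn, ee_R; replace (2 * PI * 1) with (2 * PI) by ring; rewrite cos_2PI, sin_2PI; cring].
Qed.
Lemma ee_Z (n : Z) : ee (IZR n) = RtoC 1.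
 destruct (Z_le_gt_dec 0 n); [rewrite <- (Z2Nat.id n), <- INR_IZR_INZ by lia; apply ee_nat|replace n with (- zn (Z.to_nat (- n)))%Z by lia; rewrite opp_IZR, RtoC_opp, ee_opp, <- INR_IZR_INZ, ee_nat; field].
Qed.
Lemma ee_shift s (n : Z) : ee (s + IZR n)%C = ee s.
 rewrite ee_plus, ee_Z. ring. Qed.
Lemma ee_pow s n : (ee s ^ n)%C = ee (INR n * s)%C.
 induction n; [simpl; rewrite <- ee_0; f_equal; ring|simpl Cpow; rewrite IHn, S_INR, RtoC_plus, <- ee_plus; f_equal; ring]. Qed.
Lemma ee_imag (x : R) : ee (Ci * x)%C = RtoC (exp (- 2 * PI * x)).
 unfold ee. replace (RtoC (2 * PI) * (Ci * (Ci * x)))%C with (RtoC (- 2 * PI * x)); [apply cexp_real|cring]. Qed.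
Lemma ee_half (n : Z) : ee (IZR n / 2)%C = if Z.even n then RtoC 1 else RtoC (-1).
 assert (H1 : ee (1 / 2) = -1) by (replace (1 / 2)%C with (RtoC (1 / 2)) by (rewrite RtoC_div; [auto|lra]); rewrite ee_R; replace (2 * PI * (1 / 2)) with PI by field; now rewrite cos_PI, sin_PI). destruct (Z.even n) eqn:E.
 - apply Z.even_spec in E. destruct E as [k ->]. rewrite mult_IZR, RtoC_mult. replace (2 * IZR k / 2)%C with (RtoC (IZR k)) by field. apply ee_Z.
 - assert (Ho : Z.odd n = true) by (rewrite <- Z.negb_even, E; auto). apply Z.odd_spec in Ho. destruct Ho as [k ->].
  rewrite plus_IZR, mult_IZR, RtoC_plus, RtoC_mult. replace ((2 * IZR k + 1) / 2)%C with (1 / 2 + IZR k)%C by field. now rewrite ee_shift.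
Qed.
Lemma wder_ee_lin (c : C) z : wder (fun z => ee (c * z)%C) z (2 * PI * Ci * c * ee (c * z)%C)%C 0.
 have wder_comp_hol cexp (fun z => RtoC (2 * PI) * (Ci * (c * z)))%C z _ _ _ (wder_cexp _) (wder_scal (RtoC (2 * PI)) _ _ _ _ (wder_scal Ci _ _ _ _ (wder_scal c _ _ _ _ (wder_id z)))). eapply wder_eq; [eauto| |]; unfold ee; rewrite ?RtoC_mult; ring.
Qed.

(** * Exponential and Gaussian bounds *)

Lemma exp_ge_1x x : 1 + x <= exp x.
 destruct (Req_dec x 0) as [->|]; [rewrite exp_0; lra|]. left. now apply exp_ineq1. Qed.
Lemma exp_le x y : x <= y -> exp x <= exp y.
 intros [|]; [left; now apply exp_increasing | subst; lra]. Qed.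
Lemma pow_le_fact_exp p x : 0 <= x -> x ^ p <= INR (fact p) * exp x.
 revert x. induction p; intros x Hx; [simpl; have exp_ge_1x x; lra|]. assert (H : forall u, 0 <= u -> u ^ S p <= INR (fact (S p)) * (exp u - 1) + 0 * u).
 { intros u Hu. set (f := fun u => INR (fact (S p)) * exp u - 1 - u ^ S p). assert (Hf : forall v, is_derive f v (INR (fact (S p)) * exp v - INR (S p) * v ^ p)) by (intros v; unfold f; auto_derive; auto; simpl; ring).
  destruct (MVT_gen f 0 u (fun v => INR (fact (S p)) * exp v - INR (S p) * v ^ p)) as [c [Hc E]].
  - auto.
  - intros v _. apply ex_derive_cpt. eexists; apply Hf.
  - rewrite Rmin_left in Hc by lra. assert (0 <= INR (fact (S p)) * exp c - INR (S p) * c ^ p).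
   { rewrite fact_simpl, mult_INR. specialize (IHp c (proj1 Hc)). assert (0 < INR (S p)) by (apply lt_0_INR; lia). nra. }
   assert (f u = f 0 + (INR (fact (S p)) * exp c - INR (S p) * c ^ p) * u) by lra. unfold f in H0. rewrite exp_0, pow_i in H0 by lia. nra. } specialize (H x Hx). have INR_fact_lt_0 (S p). nra.
Qed.
Lemma bnd_inv_sq_nat : bnd (fun n : nat => / (1 + INR n ^ 2)) 3.
 apply bnd_nat; [intros n; pos|]. assert (H : forall N, Rsum (fun n : nat => / (1 + INR n ^ 2)) (seq 0 (S N)) <= 3 - 2 / INR (S N)).
 { induction N; [simpl; lra|]. rewrite seq_S, Rsum_app. set (x := INR (S N)) in *. replace (Rsum _ [(0 + S N)%nat]) with (/ (1 + x ^ 2)) by (unfold Rsum, x; cbn [fold_right]; rewrite Nat.add_0_l; ring). rewrite S_INR. fold x.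
  assert (Hx : 0 < x) by (apply lt_0_INR; lia). assert (/ (1 + x ^ 2) <= 2 / x - 2 / (x + 1)).
  { replace (2 / x - 2 / (x + 1)) with (/ (x * (x + 1) / 2)) by (field; lra). inv_le; [nra|]. nra. } lra. }
 intros [|N]; [simpl; lra|]. eapply Rle_trans; [auto|]. assert (0 < 2 / INR (S N)); [|lra]. apply Rdiv_lt_0_compat; [lra|]. apply lt_0_INR; lia.
Qed.
Lemma bnd_inv_sq_Z : bnd (fun n : Z => / (1 + IZR n ^ 2)) 6.
 replace 6 with (3 + 3) by ring. apply bnd_Z.
 - eapply bnd_le; [|apply bnd_inv_sq_nat]. intros n. rewrite <- INR_IZR_INZ. lra.
 - eapply bnd_le; [|apply bnd_inv_sq_nat]. intros n. rewrite minus_IZR, opp_IZR, <- INR_IZR_INZ. have pos_INR n. inv_le; nra.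
Qed.
(** The bound does not depend on a: the integer part of a is a reindexing, and the fractional part
    costs a factor 3, whence 18 = 3 * 6. *)
Lemma bnd_inv_sq (a : R) : bnd (fun n : Z => / (1 + (IZR n + a) ^ 2)) 18.
 set (k := Int_part a). set (b := frac_part a). assert (Hb : 0 <= b < 1) by (destruct (base_fp a); unfold b; lra). assert (Ha : a = IZR k + b) by (unfold k, b, frac_part; ring). assert (H := bnd_scal 3 _ _ ltac:(lra) bnd_inv_sq_Z).
 apply (bnd_inj (fun n => (n + k)%Z)) in H; [|lia]. replace 18 with (3 * 6) by ring. eapply bnd_le; [|eauto]. intros n. cbn beta. rewrite plus_IZR, Ha.
 set (M := IZR n + IZR k). replace (IZR n + (IZR k + b)) with (M + b) by (unfold M; ring). assert (0 < 1 + M ^ 2) by pos. replace (3 * / (1 + M ^ 2)) with (/ ((1 + M ^ 2) / 3)) by (field; lra). inv_le; [lra|]. have pow2_ge_0 (M + 3 / 2 * b). nra.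
Qed.
Lemma exp_gauss_le c s : 0 < c -> exp (- c * s ^ 2) <= (1 + / c) * / (1 + s ^ 2).
 intros Hc. replace (- c * s ^ 2) with (- (c * s ^ 2)) by ring. rewrite exp_Ropp. have pow2_ge_0 s. have exp_ge_1x (c * s ^ 2).
 assert (0 < / c) by now apply Rinv_0_lt_compat. assert (0 < 1 + c * s ^ 2) by nra. apply Rle_trans with (/ (1 + c * s ^ 2)); [inv_le; lra|]. apply Rmult_le_reg_r with ((1 + c * s ^ 2) * (1 + s ^ 2)); [nra|].
 replace (/ (1 + c * s ^ 2) * ((1 + c * s ^ 2) * (1 + s ^ 2))) with (1 + s ^ 2) by (field; lra). replace ((1 + / c) * / (1 + s ^ 2) * ((1 + c * s ^ 2) * (1 + s ^ 2))) with (1 + s ^ 2 + / c + c * s ^ 2) by (field; lra). nra.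
Qed.
Lemma bnd_gauss c a : 0 < c -> bnd (fun n : Z => exp (- c * (IZR n + a) ^ 2)) ((1 + / c) * 18).
 intros Hc. eapply bnd_le; [|apply bnd_scal; [|apply bnd_inv_sq]]; [intros n; apply exp_gauss_le, Hc|pos]. Qed.
Lemma Sums_unif {I X : Type} (dom : X -> Prop) (f : X -> I -> C) (F : X -> C) (M : I -> R) B :
 bnd M B -> (forall i, 0 <= M i) -> (forall x i, dom x -> Cmod (f x i) <= M i) -> (forall x, dom x -> Sums (f x) (F x)) -> forall eps, 0 < eps -> exists l0, forall l, NoDup l -> incl l0 l -> forall x, dom x -> Cmod (Csum (f x) l - F x)%C <= eps.
 intros HB HM Hf HF eps He. destruct (bnd_tail M B HM HB (eps/2)) as [l0 [N0 T0]]; [lra|]. exists l0. intros l Hl Hi x Hx. destruct (HF x Hx (eps/2)) as [l1 H1]; [lra|]. destruct (nodup_super (l ++ l1)) as [L [NL IL]].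
 specialize (H1 L NL (fun y Hy => IL y (in_or_app _ _ _ (or_intror Hy)))). destruct (split_incl l L Hl NL (fun y Hy => IL y (in_or_app _ _ _ (or_introl Hy)))) as [l' [P [N' D]]]. rewrite (Csum_perm _ _ _ P), Csum_app in H1.
 assert (Hc : Cmod (Csum (f x) l') <= eps / 2) by (le_via Cmod_Csum; left; eapply Rle_lt_trans; [|apply (T0 l' N')]; [apply Rsum_le_in; auto|intros i Hi' Hi0; apply (D i Hi'); auto]).
 replace (Csum (f x) l - F x)%C with (Csum (f x) l + Csum (f x) l' - F x + - Csum (f x) l')%C by ring. le_via Cmod_triangle. rewrite Cmod_opp. lra.
Qed.

(** * Uniqueness of Fourier coefficients *)

Ltac Req := match goal with |- @eq _ ?a ?b => change (@eq R a b) end.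
Definition fourier_null (v : R -> R) : Prop := forall k : Z,
 is_RInt (fun x => v x * cos (2 * PI * (IZR k * x))) 0 1 0 /\ is_RInt (fun x => v x * sin (2 * PI * (IZR k * x))) 0 1 0.
Lemma is_RInt_lin3 (f g h : R -> R) a b c0 c1 c2 : is_RInt f a b 0 -> is_RInt g a b 0 -> is_RInt h a b 0 ->
 is_RInt (fun x => c0 * f x + c1 * g x + c2 * h x) a b 0.
 intros Hf Hg Hh. apply (is_RInt_scal _ _ _ c0) in Hf. apply (is_RInt_scal _ _ _ c1) in Hg. apply (is_RInt_scal _ _ _ c2) in Hh.
 have is_RInt_plus _ _ _ _ _ _ (is_RInt_plus _ _ _ _ _ _ Hf Hg) Hh. match type of H with is_RInt _ _ _ ?v => replace v with 0 in H end; [auto|]. unfold plus, scal; simpl. unfold mult; simpl. ring.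
Qed.
Lemma fourier_null_kernel v x0 : fourier_null v ->
 fourier_null (fun x => v x * ((1 + cos (2 * PI * (x - x0))) / 2)).
 intros H k. assert (Hc : forall x, cos (2 * PI * (x - x0)) = cos (2 * PI * x) * cos (2 * PI * x0) + sin (2 * PI * x) * sin (2 * PI * x0)) by (intros x; rewrite <- cos_minus; f_equal; ring).
 destruct (H k) as [C0 S0]. destruct (H (k + 1)%Z) as [C1 S1]. destruct (H (k - 1)%Z) as [C2 S2]. set (c0 := cos (2 * PI * x0)) in *. set (s0 := sin (2 * PI * x0)) in *.
 assert (Ep : forall x, 2 * PI * (IZR (k + 1) * x) = 2 * PI * (IZR k * x) + 2 * PI * x) by (intros; rewrite plus_IZR; ring).
 assert (Em : forall x, 2 * PI * (IZR (k - 1) * x) = 2 * PI * (IZR k * x) - 2 * PI * x) by (intros; rewrite minus_IZR; ring). split.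
 - have is_RInt_lin3 _ _ _ _ _ (1/2) 1 1 C0 (is_RInt_lin3 _ _ _ _ _ (c0/4) (c0/4) 0 C1 C2 C0) (is_RInt_lin3 _ _ _ _ _ (s0/4) (-s0/4) 0 S1 S2 C0) as Q.
  eapply is_RInt_ext; [|eauto]. intros x _. Req. rewrite Hc, Ep, Em, sin_plus, sin_minus, cos_plus, cos_minus. field.
 - have is_RInt_lin3 _ _ _ _ _ (1/2) 1 1 S0 (is_RInt_lin3 _ _ _ _ _ (c0/4) (c0/4) 0 S1 S2 C0) (is_RInt_lin3 _ _ _ _ _ (-s0/4) (s0/4) 0 C1 C2 C0) as Q.
  eapply is_RInt_ext; [|eauto]. intros x _. Req. rewrite Hc, Ep, Em, sin_plus, sin_minus, cos_plus, cos_minus. field.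
Qed.
(** Multiplying by the kernel K = (1 + cos (2 PI (x - x0))) / 2 keeps all Fourier coefficients zero,
    so u is orthogonal to every power of K. If u x0 > 0, then near x0 the kernel is at least c1 and
    away from x0 at most c2 < c1, and the positive contribution of order c1^n wins for large n. *)
Lemma fourier_unique_pos (u : R -> R) x0 : (forall x, 0 <= x <= 1 -> continuous u x) -> fourier_null u ->
 0 < x0 < 1 -> u x0 <= 0.
 intros Hu HF Hx0. apply Rnot_lt_le. intros Hpos. set (K := fun x => (1 + cos (2 * PI * (x - x0))) / 2). assert (Hn : forall n, fourier_null (fun x => u x * K x ^ n)).
 { induction n.
  - intros k. destruct (HF k) as [A B]. split; [eapply is_RInt_ext; [|exact A] | eapply is_RInt_ext; [|eauto]]; intros; simpl; ring.
  - apply (fourier_null_kernel _ x0) in IHn. intros k. destruct (IHn k) as [A B]. split; [eapply is_RInt_ext; [|exact A] | eapply is_RInt_ext; [|eauto]]; intros; simpl; unfold K; ring. }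
 assert (Hint : forall n, is_RInt (fun x => u x * K x ^ n) 0 1 0) by (intros n; destruct (Hn n 0%Z) as [A _]; eapply is_RInt_ext; [|eauto]; intros x _; cbn beta; Req; replace (2 * PI * (0 * x)) with 0 by ring; rewrite cos_0; ring).
 set (del := u x0 / 2). assert (Hc0 : continuous u x0) by (apply Hu; lra). assert (Hr1 : exists r1, 0 < r1 /\ forall x, Rabs (x - x0) < r1 -> del < u x).
 { assert (Hd : 0 < del) by (unfold del; lra). apply filterlim_locally with (eps := mkposreal del Hd) in Hc0. destruct Hc0 as [r Hr]. exists r.
  split; [apply cond_pos|]. intros x Hx. specialize (Hr x Hx). change (Rabs (u x - u x0) < del) in Hr. apply Rabs_def2 in Hr. unfold del in *. lra. }
 destruct Hr1 as [r1 [Hr1 Hu1]]. set (r := Rmin r1 (Rmin x0 (1 - x0)) / 2). assert (Hr : 0 < r /\ r < r1 /\ r < x0 /\ r < 1 - x0).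
 { assert (0 < Rmin r1 (Rmin x0 (1 - x0))) by (repeat apply Rmin_pos; lra). unfold r. have Rmin_l r1 (Rmin x0 (1 - x0)). have Rmin_r r1 (Rmin x0 (1 - x0)). have Rmin_l x0 (1 - x0). have Rmin_r x0 (1 - x0). lra. }
 assert (HM : exists M, 0 <= M /\ forall x, 0 <= x <= 1 -> - M <= u x).
 { destruct (continuity_ab_min u 0 1) as [m Hm]; [lra| |]; [intros c Hc; apply continuity_pt_filterlim, Hu, Hc|]. exists (Rabs (u m)). split; [auto|]. intros x Hx. have proj1 Hm x Hx. have Rle_abs (- u m). rewrite Rabs_Ropp in *. lra. }
 destruct HM as [M [HM0 HM]]. set (c1 := (1 + cos (PI * r)) / 2). set (c2 := (1 + cos (2 * PI * r)) / 2). have PI_RGT_0 as HPI. assert (Hc21 : c2 < c1).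
 { unfold c1, c2. assert (cos (2 * PI * r) < cos (PI * r)); [|lra]. apply cos_decreasing_1; nra. } assert (Hc2 : 0 <= c2) by (unfold c2; have COS_bound (2 * PI * r); lra).
 assert (HK0 : forall x, 0 <= K x) by (intros x; unfold K; have COS_bound (2 * PI * (x - x0)); lra).
 assert (HKabs : forall x, K x = (1 + cos (2 * PI * Rabs (x - x0))) / 2) by (intros x; unfold K; f_equal; f_equal; unfold Rabs; destruct Rcase_abs; auto; rewrite <- cos_neg; f_equal; ring).
 assert (HK2 : forall x, 0 <= x <= 1 -> r <= Rabs (x - x0) -> K x <= c2).
 { intros x Hx Hxr. rewrite HKabs. unfold c2. set (s := Rabs (x - x0)) in *. assert (Hs1 : s <= 1 - r) by (unfold s, Rabs; destruct Rcase_abs; lra).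
  assert (cos (2 * PI * s) <= cos (2 * PI * r)); [|lra]. destruct (Rle_dec s (1/2)); [apply cos_decr_1; nra|].
  replace (cos (2 * PI * s)) with (cos (2 * PI * (1 - s))); [apply cos_decr_1; nra|replace (2 * PI * (1 - s)) with (- (2 * PI * s) + 2 * INR 1 * PI) by (simpl; lra); rewrite cos_period; apply cos_neg]. }
 assert (HK1 : forall x, Rabs (x - x0) <= r / 2 -> c1 <= K x) by (intros x Hx; rewrite HKabs; unfold c1; assert (cos (PI * r) <= cos (2 * PI * Rabs (x - x0))); [|lra]; have Rabs_pos (x - x0); apply cos_decr_1; nra).
 assert (Hlow : forall n x, 0 <= x <= 1 -> - M * c2 ^ n <= u x * K x ^ n).
 { intros n x Hx. assert (0 <= c2 ^ n) by now apply pow_le. assert (0 <= K x ^ n) by now apply pow_le.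
  destruct (Rle_dec r (Rabs (x - x0))) as [|]; [specialize (HM x Hx); assert (K x ^ n <= c2 ^ n) by (apply pow_incr; auto); nra|assert (del < u x) by (apply Hu1; lra); unfold del in *; nra]. }
 assert (Hhigh : forall n x, Rabs (x - x0) <= r / 2 -> del * c1 ^ n <= u x * K x ^ n) by (intros n x Hx; assert (del < u x) by (apply Hu1; lra); assert (c1 ^ n <= K x ^ n) by (apply pow_incr; split; [lra|auto]); assert (0 <= c1 ^ n) by pos; unfold del in *; nra).
 (* The interval of radius r / 2 around x0 contributes at least del * r * c1^n, and on the rest of
    [0, 1] the integrand is at least - M * c2^n. *)
 assert (Hkey : forall n, del * r * c1 ^ n <= M * c2 ^ n).
 { intros n. set (f := fun x => u x * K x ^ n). assert (Hex : forall a b, 0 <= a -> a <= b -> b <= 1 -> ex_RInt f a b).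
  { intros a b Ha Hab Hb. int_cont. intros x Hx. rewrite Rmin_left, Rmax_right in Hx by lra. apply (continuous_mult u (fun x => K x ^ n)); [apply Hu; lra|]. apply (ex_derive_continuous (fun x => K x ^ n) x). unfold K. auto_derive. auto. }
  assert (E : RInt f 0 1 = 0) by apply is_RInt_unique, Hint. rewrite <- (RInt_Chasles f 0 (x0 - r/2) 1) in E by (apply Hex; lra).
  rewrite <- (RInt_Chasles f (x0 - r/2) (x0 + r/2) 1) in E by (apply Hex; lra). assert (I1 : (x0 - r/2 - 0) * (- M * c2 ^ n) <= RInt f 0 (x0 - r/2)).
  { rewrite <- (RInt_const (V := R_CompleteNormedModule)). apply RInt_le; try lra; [apply ex_RInt_const|apply Hex; lra|intros; apply Hlow; lra]. }
  assert (I3 : (1 - (x0 + r/2)) * (- M * c2 ^ n) <= RInt f (x0 + r/2) 1) by (rewrite <- (RInt_const (V := R_CompleteNormedModule)); apply RInt_le; try lra; [apply ex_RInt_const|apply Hex; lra|intros; apply Hlow; lra]).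
  assert (I2 : (x0 + r/2 - (x0 - r/2)) * (del * c1 ^ n) <= RInt f (x0 - r/2) (x0 + r/2)) by (rewrite <- (RInt_const (V := R_CompleteNormedModule)); apply RInt_le; try lra; [apply ex_RInt_const|apply Hex; lra|intros x Hx; apply Hhigh, Rabs_le; lra]).
  unfold plus in E; simpl in E. assert (0 <= M * c2 ^ n) by pos. nra. } assert (Hc1p : 0 < c1) by lra. assert (Hdr : 0 < del * r) by (unfold del; nra). destruct (pow_lt_1_zero (c2 / c1)) with (y := del * r / (M + 1)) as [N HN].
 - rewrite Rabs_pos_eq by (apply Rdiv_le_0_compat; lra). apply Rmult_lt_reg_r with c1; auto. field_simplify; lra.
 - pos.
 - specialize (HN N (le_n _)). specialize (Hkey N). rewrite Rabs_pos_eq in HN by (apply pow_le, Rdiv_le_0_compat; lra). unfold Rdiv in HN.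
  rewrite Rpow_mult_distr, pow_inv in HN. assert (Hp : 0 < c1 ^ N) by now apply pow_lt. assert (c2 ^ N * (M + 1) < del * r * c1 ^ N).
  { apply Rmult_lt_reg_r with (/ (c1 ^ N * (M + 1))); [pos|]. replace (c2 ^ N * (M + 1) * / (c1 ^ N * (M + 1))) with (c2 ^ N * / c1 ^ N) by (field; lra).
   replace (del * r * c1 ^ N * / (c1 ^ N * (M + 1))) with (del * r / (M + 1)) by (field; lra). auto. } nra.
Qed.
Lemma fourier_unique (u : R -> R) x0 : (forall x, 0 <= x <= 1 -> continuous u x) -> fourier_null u ->
 0 < x0 < 1 -> u x0 = 0.
 intros Hu HF Hx. apply Rle_antisym; [now apply fourier_unique_pos|]. assert (- u x0 <= 0); [|lra]. apply (fourier_unique_pos (fun x => - u x)); auto; [intros x Hxx; apply (continuous_opp u), Hu, Hxx|]. intros k. destruct (HF k) as [A B].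
 split; [have is_RInt_lin3 _ _ _ _ _ (-1) 0 0 A A A as Q | have is_RInt_lin3 _ _ _ _ _ (-1) 0 0 B B B as Q]; eapply is_RInt_ext; try exact Q; intros; simpl; ring.
Qed.

(** * Integrals of complex-valued functions on an interval *)

Definition Ccont (f : R -> C) (x : R) : Prop :=
 continuous (fun x => Re (f x)) x /\ continuous (fun x => Im (f x)) x.
Definition Cint (f : R -> C) (a b : R) : C :=
 (RInt (fun x => Re (f x)) a b, RInt (fun x => Im (f x)) a b).
Lemma Ccont_eps f x : (forall eps, 0 < eps -> exists d, 0 < d /\ forall y, Rabs (y - x) < d ->
 Cmod (f y - f x)%C < eps) -> Ccont f x.
 split; apply filterlim_locally; intros eps; destruct (H eps (cond_pos eps)) as [d [Hd E]]; exists (mkposreal d Hd); intros y Hy; specialize (E y Hy); eapply Rle_lt_trans; try exact E;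
  [apply (re_le_Cmod (f y - f x)) | apply (im_le_Cmod (f y - f x))].
Qed.
Lemma Ccont_wder (G : C -> C) (x : R) A B : wder G x A B -> Ccont (fun x => G x) x.
 intros H. destruct (wder_lip _ _ _ _ H) as [d [Hd E]]. apply Ccont_eps. intros eps He. set (K := Cmod A + Cmod B + 1). assert (HK : 0 < K) by (have Cmod_ge_0 A; have Cmod_ge_0 B; unfold K; lra). exists (Rmin d (eps / K)).
 split; [apply Rmin_pos; auto; now apply Rdiv_lt_0_compat|]. intros y Hy. specialize (E (y - x)). rewrite Cmod_R in E. specialize (E (Rlt_le_trans _ _ _ Hy (Rmin_l _ _))). replace (x + RtoC (y - x))%C with (RtoC y) in E by cring. lt_via E.
 apply Rlt_le_trans with (K * (eps / K)); [|right; field; lra]. apply Rmult_lt_compat_l; auto. eapply Rlt_le_trans; [eauto|apply Rmin_r].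
Qed.
Lemma Ccont_ex f a b : (forall x, Rmin a b <= x <= Rmax a b -> Ccont f x) ->
 ex_RInt (fun x => Re (f x)) a b /\ ex_RInt (fun x => Im (f x)) a b.
 split; int_cont; intros x Hx; apply (H x Hx). Qed.
Lemma continuous_Rmult (f g : R -> R) x : continuous f x -> continuous g x -> continuous (fun x => f x * g x) x.
 apply (continuous_mult f g x). Qed.
Lemma Ccont_plus f g x : Ccont f x -> Ccont g x -> Ccont (fun x => f x + g x)%C x.
 intros [] []. split; [apply (continuous_plus (fun x => Re (f x)) (fun x => Re (g x))); auto|apply (continuous_plus (fun x => Im (f x)) (fun x => Im (g x))); auto].
Qed.
Lemma Ccont_scal c f x : Ccont f x -> Ccont (fun x => c * f x)%C x.
 intros []. split.
 - apply (continuous_minus (fun x => Re c * Re (f x)) (fun x => Im c * Im (f x))); apply continuous_Rmult; auto using continuous_const.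
 - apply (continuous_plus (fun x => Re c * Im (f x)) (fun x => Im c * Re (f x))); apply continuous_Rmult; auto using continuous_const.
Qed.
Lemma Ccont_mult f g x : Ccont f x -> Ccont g x -> Ccont (fun x => f x * g x)%C x.
 intros [] []. split.
 - apply (continuous_minus (fun x => Re (f x) * Re (g x)) (fun x => Im (f x) * Im (g x))); apply continuous_Rmult; auto.
 - apply (continuous_plus (fun x => Re (f x) * Im (g x)) (fun x => Im (f x) * Re (g x))); apply continuous_Rmult; auto.
Qed.
Lemma Ccont_const c x : Ccont (fun _ => c) x.
 split; apply continuous_const. Qed.
#[local] Hint Resolve Ccont_const : core.
Lemma Ccont_Csum {I} (f : I -> R -> C) l x : (forall i, Ccont (f i) x) -> Ccont (fun x => Csum (fun i => f i x) l) x.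
 intros H. induction l; simpl; [auto| apply Ccont_plus; auto]. Qed.
Lemma Ccont_HasSum {I} (f : I -> R -> C) (F : R -> C) (M : I -> R) B a b x :
 bnd M B -> (forall i, 0 <= M i) -> (forall i x, a < x < b -> Cmod (f i x) <= M i) -> (forall i x, a < x < b -> Ccont (f i) x) -> (forall x, a < x < b -> Sums (fun i => f i x) (F x)) -> a < x < b -> Ccont F x.
 intros HB HM Hf Hc HF Hx. apply Ccont_eps. intros eps He. destruct (Sums_unif (fun x => a < x < b) (fun x i => f i x) F M B HB HM) with (eps := eps / 4) as [l0 H0]; auto; [lra|]. destruct (nodup_super l0) as [l [Hl Hi]]. specialize (H0 l Hl Hi).
 assert (Cl : Ccont (fun x => Csum (fun i => f i x) l) x) by (clear H0 Hi Hl; induction l; simpl; [auto| apply Ccont_plus; auto]). destruct Cl as [C1 C2].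
 assert (He4 : 0 < eps / 4) by lra. apply filterlim_locally with (eps := mkposreal _ He4) in C1. apply filterlim_locally with (eps := mkposreal _ He4) in C2.
 destruct C1 as [d1 D1]. destruct C2 as [d2 D2]. exists (Rmin (Rmin d1 d2) (Rmin (x - a) (b - x))). split.
 { repeat apply Rmin_pos; try apply cond_pos; lra. } intros y Hy. assert (Hm : Rabs (y - x) < d1 /\ Rabs (y - x) < d2 /\ Rabs (y - x) < x - a /\ Rabs (y - x) < b - x) by (revert Hy; unfold Rmin; repeat destruct Rle_dec; lra).
 destruct Hm as [M1 [M2 [M3 M4]]]. assert (Hyab : a < y < b) by (apply Rabs_def2 in M3; apply Rabs_def2 in M4; lra). specialize (D1 y M1).
 specialize (D2 y M2). have H0 x Hx. have H0 y Hyab. set (Sx := Csum (fun i => f i x) l) in *. set (Sy := Csum (fun i => f i y) l) in *. assert (Hs : Cmod (Sy - Sx) < eps / 2).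
 { change (Rabs (Re Sy - Re Sx) < eps / 4) in D1. change (Rabs (Im Sy - Im Sx) < eps / 4) in D2. replace (Sy - Sx)%C with (RtoC (Re Sy - Re Sx) + Ci * RtoC (Im Sy - Im Sx))%C by (apply injective_projections; simpl; unfold Re, Im; ring).
  lt_via Cmod_triangle. rewrite Cmod_mult, Cmod_Ci, !Cmod_R. lra. } replace (F y - F x)%C with (Sx - F x + (Sy - Sx + - (Sy - F y)))%C by ring. lt_via Cmod_triangle. have Cmod_triangle (Sy - Sx) (- (Sy - F y)) as T. rewrite Cmod_opp in T. lra.
Qed.
Lemma Cint_ext f g a b : (forall x, f x = g x) -> Cint f a b = Cint g a b.
 intros H. replace g with f; auto. now fext. Qed.
Lemma Cint_plus f g a b : (forall x, Rmin a b <= x <= Rmax a b -> Ccont f x) ->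
 (forall x, Rmin a b <= x <= Rmax a b -> Ccont g x) -> Cint (fun x => f x + g x)%C a b = (Cint f a b + Cint g a b)%C.
 intros Hf Hg. destruct (Ccont_ex f a b Hf) as []. destruct (Ccont_ex g a b Hg) as [].
 apply injective_projections; simpl; [rewrite <- (RInt_plus (fun x => Re (f x)) (fun x => Re (g x))); auto|rewrite <- (RInt_plus (fun x => Im (f x)) (fun x => Im (g x))); auto].
Qed.
Lemma Cint_scal c f a b : (forall x, Rmin a b <= x <= Rmax a b -> Ccont f x) ->
 Cint (fun x => c * f x)%C a b = (c * Cint f a b)%C.
 intros Hf. destruct (Ccont_ex f a b Hf) as []. assert (Hs : forall k u, ex_RInt u a b -> RInt (fun x => k * u x) a b = k * RInt u a b) by (intros k u Hu; apply (RInt_scal u a b k Hu)).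
 assert (He : forall k u, ex_RInt u a b -> ex_RInt (fun x => k * u x) a b) by (intros k u Hu; apply (ex_RInt_scal u a b k Hu)).
 apply injective_projections; simpl; rewrite <- !Hs; auto; [apply (RInt_minus (fun x => fst c * Re (f x)) (fun x => snd c * Im (f x))); auto|apply (RInt_plus (fun x => fst c * Im (f x)) (fun x => snd c * Re (f x))); auto].
Qed.
(** The factor 2 comes from estimating real and imaginary parts separately. *)
Lemma Cint_bound f a b M : a <= b -> (forall x, a <= x <= b -> Ccont f x) ->
 (forall x, a <= x <= b -> Cmod (f x) <= M) -> Cmod (Cint f a b) <= 2 * (M * (b - a)).
 intros Hab Hc HM. destruct (Ccont_ex f a b) as [].
 { intros x Hx. rewrite Rmin_left, Rmax_right in Hx by auto. auto. } assert (B1 : Rabs (RInt (fun x => Re (f x)) a b) <= M * (b - a)) by (rewrite Rmult_comm; apply abs_RInt_le_const; auto; intros t Ht; eapply Rle_trans; [apply re_le_Cmod|auto]).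
 assert (B2 : Rabs (RInt (fun x => Im (f x)) a b) <= M * (b - a)) by (rewrite Rmult_comm; apply abs_RInt_le_const; auto; intros t Ht; eapply Rle_trans; [apply im_le_Cmod|auto]).
 replace (Cint f a b) with (RInt (fun x => Re (f x)) a b + Ci * RInt (fun x => Im (f x)) a b)%C by cring. le_via Cmod_triangle. rewrite Cmod_mult, Cmod_Ci, !Cmod_R. lra.
Qed.
Lemma Cint_Csum {I} (f : I -> R -> C) l a b :
 (forall i x, Rmin a b <= x <= Rmax a b -> Ccont (f i) x) -> Cint (fun x => Csum (fun i => f i x) l) a b = Csum (fun i => Cint (f i) a b) l.
 intros H. induction l; simpl; [unfold Cint; rewrite !RInt_const; apply injective_projections; unfold scal; simpl; unfold mult; simpl; ring|rewrite Cint_plus, IHl; auto; intros x Hx; apply Ccont_Csum; auto].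
Qed.
Lemma Cint_HasSum {I} (f : I -> R -> C) (F : R -> C) (M : I -> R) B a b : a < b ->
 bnd M B -> (forall i, 0 <= M i) -> (forall i x, a <= x <= b -> Cmod (f i x) <= M i) -> (forall i x, a <= x <= b -> Ccont (f i) x) -> (forall x, a <= x <= b -> Ccont F x) -> (forall x, a <= x <= b -> Sums (fun i => f i x) (F x)) ->
 Sums (fun i => Cint (f i) a b) (Cint F a b).
 intros Hab HB HM Hf Hc HcF HF eps He. destruct (Sums_unif (fun x => a <= x <= b) (fun x i => f i x) F M B HB HM) with (eps := eps / (4 * (b - a))) as [l0 H0]; auto.
 { pos. } exists l0. intros l Hl Hi. assert (Hmm : forall x, Rmin a b <= x <= Rmax a b -> a <= x <= b) by (intros x; rewrite Rmin_left, Rmax_right; auto). rewrite <- Cint_Csum by auto.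
 replace (Cint (fun x => Csum (fun i => f i x) l) a b - Cint F a b)%C with (Cint (fun x => Csum (fun i => f i x) l + -1 * F x)%C a b).
 - eapply Rle_lt_trans; [apply Cint_bound; [lra| |]|].
  + intros x Hx. apply Ccont_plus; [apply Ccont_Csum; auto | apply Ccont_scal; auto].
  + intros x Hx. replace _%C with (Csum (fun i => f i x) l - F x)%C by ring. auto.
  + replace (2 * (eps / (4 * (b - a)) * (b - a))) with (eps / 2) by (field; lra). lra.
 - rewrite Cint_plus, Cint_scal; auto; [ring|intros x Hx; apply Ccont_Csum; auto|intros x Hx; apply Ccont_scal; auto].
Qed.

(** * Poisson summation for Gaussians *)

Lemma inv_sq_shift M b : Rabs b <= 2 -> / (1 + (M + b) ^ 2) <= 9 * / (1 + M ^ 2).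
 intros Hb. assert (0 < 1 + M ^ 2) by pos. replace (9 * / (1 + M ^ 2)) with (/ ((1 + M ^ 2) / 9)) by (field; lra). inv_le; [lra|]. apply Rabs_le_between in Hb. assert (b ^ 2 <= 4) by nra. have pow2_ge_0 (M + 9 / 8 * b). lra.
Qed.
(** The window is half-open, from -N to N - 1, so that the unit intervals [m, m + 1] tile [-N, N]
    exactly. *)
Definition zrange (N : nat) : list Z := map (fun i => (zn i - zn N)%Z) (seq 0 (2 * N)).
Lemma Sums_zrange (f : Z -> C) s : Sums f s -> forall eps, 0 < eps -> exists N, forall n, (N <= n)%nat ->
 Cmod (Csum f (zrange n) - s)%C < eps.
 intros H eps He. destruct (H eps He) as [l0 H0]. assert (exists N, forall n z, (N <= n)%nat -> In z l0 -> In z (zrange n)) as [N HN].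
 { clear H0. induction l0 as [|a l [N IH]]; [exists O; easy|exists (Nat.max N (S (Z.to_nat (Z.abs a)))); intros n z Hn [|]; [|apply IH; [lia|auto]]; apply in_map_iff; exists (Z.to_nat (a + zn n)); split; [lia|]; apply in_seq; lia]. }
 exists N. intros n Hn. apply H0; [apply FinFun.Injective_map_NoDup; [intros x y; lia | apply seq_NoDup]|intros z Hz; auto].
Qed.
Definition gauss (t b s : R) : C := (RtoC (exp (- (PI * t) * s ^ 2)) * ee (RtoC (s * b)))%C.
Notation gcos t b s := (exp (- (PI * t) * s ^ 2) * cos (2 * PI * (s * b))) (only parsing).
Notation gsin t b s := (exp (- (PI * t) * s ^ 2) * sin (2 * PI * (s * b))) (only parsing).
Lemma gauss_Re t b s : Re (gauss t b s) = gcos t b s.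
 unfold gauss. rewrite ee_R. simpl; lra. Qed.
Lemma gauss_Im t b s : Im (gauss t b s) = gsin t b s.
 unfold gauss. rewrite ee_R. simpl; lra. Qed.
Lemma Cmod_gauss t b s : Cmod (gauss t b s) = exp (- (PI * t) * s ^ 2).
 unfold gauss. rewrite Cmod_mult, Cmod_ee_R, Cmod_R, Rabs_pos_eq; [ring|auto]. Qed.
Lemma gauss_cont_Re t b s : continuous (fun s => gcos t b s) s.
 apply (ex_derive_continuous (fun s => gcos t b s) s). auto_derive. auto. Qed.
Lemma gauss_cont_Im t b s : continuous (fun s => gsin t b s) s.
 apply (ex_derive_continuous (fun s => gsin t b s) s). auto_derive. auto. Qed.
Lemma RInt_lin2 (f g : R -> R) a b c d : ex_RInt f a b -> ex_RInt g a b ->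
 RInt (fun x => c * f x + d * g x) a b = c * RInt f a b + d * RInt g a b.
 intros [lf Hf] [lg Hg]. rewrite (is_RInt_unique _ _ _ _ Hf), (is_RInt_unique _ _ _ _ Hg). apply is_RInt_unique, (is_RInt_plus (fun x => c * f x) (fun x => d * g x)); [apply (is_RInt_scal f a b c lf Hf)|apply (is_RInt_scal g a b d lg Hg)].
Qed.
Definition gaussH (t b M : R) : R := RInt (fun s => gcos t b s) (- M) M.
Lemma RInt_eq (f g : R -> R) a b : (forall x, f x = g x) -> RInt f a b = RInt g a b.
 intros H. replace g with f; auto. now fext. Qed.
Lemma is_derive_val (f : R -> R) x l l' : is_derive f x l -> l = l' -> is_derive f x l'.
 intros H <-; auto. Qed.
(** Differentiation under the integral followed by integration by parts. The first term is the
    boundary term of the truncation; without it this is the differential equation solved by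
    multiples of exp (- PI b^2 / t). *)
Lemma gaussH_derive t b M : 0 < t ->
 is_derive (fun b => gaussH t b M) b (2 / t * exp (- (PI * t) * M ^ 2) * sin (2 * PI * (M * b)) - 2 * PI * b / t * gaussH t b M).
 intros Ht. set (f := fun b s => gcos t b s). assert (Hd : forall b s, is_derive (fun b => f b s) b (- (2 * PI * s) * (gsin t b s))) by (intros b' s; unfold f; generalize (exp (- (PI * t) * s ^ 2)); intros e; auto_derive; auto; ring).
 assert (HD : forall b s, Derive (fun b => f b s) b = - (2 * PI * s) * (gsin t b s)) by (intros b' s; apply is_derive_unique, Hd). assert (HP : is_derive (fun x => RInt (fun s => f x s) (- M) M) b (RInt (fun s => Derive (fun u => f u s) b) (- M) M)).
 { apply is_derive_RInt_param.
  - apply filter_forall. eexists. auto.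
  - intros s _. eapply continuity_2d_pt_ext; [intros u v; symmetry; apply HD|]. assert (Hid1 : continuity_2d_pt (fun u v => u) b s) by apply continuity_2d_pt_id1.
   assert (Hid2 : continuity_2d_pt (fun u v => v) b s) by apply continuity_2d_pt_id2. apply continuity_2d_pt_mult.
   + apply (continuity_1d_2d_pt_comp (fun v => - (2 * PI * v)) (fun u v => v)); auto. apply ex_derive_cpt. auto_derive. auto.
   + apply continuity_2d_pt_mult.
    * apply (continuity_1d_2d_pt_comp (fun v => exp (- (PI * t) * v ^ 2)) (fun u v => v)); auto. apply ex_derive_cpt. auto_derive. auto.
    * apply (continuity_1d_2d_pt_comp (fun v => sin (2 * PI * v)) (fun u v => v * u)); [apply ex_derive_cpt; auto_derive; auto|apply continuity_2d_pt_mult; auto].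
  - apply filter_forall. intros x. int_cont. intros s _. apply gauss_cont_Re. } eapply is_derive_val; [eauto|]. rewrite (RInt_eq _ _ _ _ (fun s => HD b s)). set (g := fun s => gsin t b s).
 assert (Hg : is_RInt (fun s => 2 * PI * b * f b s + t * (- (2 * PI * s) * g s)) (- M) M (g M - g (- M))).
 { apply (is_RInt_derive g); [intros s _; unfold g, f; auto_derive; auto; simpl; lra|intros s _; unfold g, f; match goal with |- continuous ?h s => apply (ex_derive_continuous h s) end; auto_derive; auto]. }
 apply (is_RInt_unique (V := R_CompleteNormedModule)) in Hg. assert (E1 : ex_RInt (f b) (- M) M) by (int_cont; intros s _; apply gauss_cont_Re).
 assert (E2 : ex_RInt (fun s => - (2 * PI * s) * g s) (- M) M) by (int_cont; intros s _; unfold g; match goal with |- continuous ?h s => apply (ex_derive_continuous h s) end; auto_derive; auto).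
 rewrite RInt_lin2 in Hg by auto. assert (Hgg : g M - g (- M) = 2 * exp (- (PI * t) * M ^ 2) * sin (2 * PI * (M * b))).
 { unfold g. replace ((- M) ^ 2) with (M ^ 2) by ring. replace (2 * PI * (- M * b)) with (- (2 * PI * (M * b))) by ring. rewrite sin_neg. ring. } change (RInt (fun s => - (2 * PI * s) * g s) (- M) M =
  2 / t * exp (- (PI * t) * M ^ 2) * sin (2 * PI * (M * b)) - 2 * PI * b / t * RInt (f b) (- M) M). apply Rmult_eq_reg_l with t; [|lra]. field_simplify; [|lra]. lra.
Qed.
Lemma gaussH_bound t b M : 0 < t ->
 Rabs (exp (PI * b ^ 2 / t) * gaussH t b M - gaussH t 0 M) <= exp (PI * b ^ 2 / t) * (2 / t) * exp (- (PI * t) * M ^ 2) * Rabs b.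
 intros Ht. set (psi := fun b => exp (PI * b ^ 2 / t) * gaussH t b M). set (dpsi := fun b => exp (PI * b ^ 2 / t) * (2 / t * exp (- (PI * t) * M ^ 2) * sin (2 * PI * (M * b)))). assert (Hd : forall b, is_derive psi b (dpsi b)).
 { intros b'. assert (He : is_derive (fun b => exp (PI * b ^ 2 / t)) b' (2 * PI * b' / t * exp (PI * b' ^ 2 / t))) by (auto_derive; simpl; lra).
  eapply is_derive_val; [apply (is_derive_mult (fun b => exp (PI * b ^ 2 / t)) (fun b => gaussH t b M) b' _ _ He (gaussH_derive t b' M Ht))|]; [intros; apply Rmult_comm|].
  change (2 * PI * b' / t * exp (PI * b' ^ 2 / t) * gaussH t b' M + exp (PI * b' ^ 2 / t) * (2 / t * exp (- (PI * t) * M ^ 2) * sin (2 * PI * (M * b')) - 2 * PI * b' / t * gaussH t b' M) = dpsi b'). unfold dpsi. lra. }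
 destruct (MVT_gen psi 0 b dpsi) as [c [Hc E]].
 - auto.
 - intros x _. apply ex_derive_cpt. eexists; apply Hd.
 - assert (E0 : psi 0 = gaussH t 0 M) by (unfold psi; replace (PI * 0 ^ 2 / t) with 0 by lra; rewrite exp_0; ring). fold (psi b). rewrite <- E0, E, Rminus_0_r, Rabs_mult. mul_r; [auto|]. unfold dpsi.
  rewrite !Rabs_mult, Rabs_pos_eq, Rabs_pos_eq, Rabs_pos_eq; try (left; apply exp_pos); try (apply Rdiv_le_0_compat; lra). assert (Hs : Rabs (sin (2 * PI * (M * c))) <= 1) by (apply Rabs_le; apply SIN_bound).
  assert (Hcb : c ^ 2 <= b ^ 2) by (unfold Rmin, Rmax in Hc; destruct Rle_dec; nra). assert (exp (PI * c ^ 2 / t) <= exp (PI * b ^ 2 / t)) by (apply exp_le; mul_r; [pos|]; mul_l; [pos|auto]).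
  have exp_pos (PI * c ^ 2 / t). assert (Hq : 0 < 2 / t * exp (- (PI * t) * M ^ 2)) by pos. rewrite (Rmult_assoc (exp (PI * b ^ 2 / t))). mul_le; try lra; [pos|nra].
Qed.
Lemma gauss_tail_lim t K : 0 < t -> is_lim_seq (fun n => K * exp (- (PI * t) * INR n ^ 2)) 0.
 intros Ht. replace (Finite 0) with (Rbar_mult K 0) by (simpl; f_equal; ring). apply is_lim_seq_scal_l, is_lim_seq_le_le with (u := fun _ => 0) (w := fun n => exp (- (PI * t)) ^ n).
 - split; [auto|]. assert (Hp : exp (- (PI * t)) ^ n = exp (- PI * t * INR n)).
  { induction n; [simpl; rewrite Rmult_0_r, exp_0; auto|]. rewrite S_INR. simpl pow. rewrite IHn, <- exp_plus. f_equal. ring. } rewrite Hp. apply exp_le. assert (0 < PI * t) by pos. assert (INR n <= INR n ^ 2); [|nra]. destruct n; [auto|].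
  assert (1 <= INR (S n)) by (rewrite S_INR; have pos_INR n; lra). nra.
 - apply is_lim_seq_const.
 - apply is_lim_seq_geom. rewrite Rabs_pos_eq, <- exp_0 by auto. apply exp_increasing. have PI_RGT_0. nra.
Qed.
Lemma Csum_cons {I} (f : I -> C) i l : Csum f (i :: l) = (f i + Csum f l)%C.
 auto. Qed.
Lemma Rsum_cons {I} (f : I -> R) i l : Rsum f (i :: l) = f i + Rsum f l.
 auto. Qed.
Lemma gauss_cont t b s : Ccont (gauss t b) s.
 split; [eapply continuous_ext; [intros x; symmetry; apply gauss_Re|]; apply gauss_cont_Re|eapply continuous_ext; [intros x; symmetry; apply gauss_Im|]; apply gauss_cont_Im].
Qed.
Lemma Ccont_shift f v x : Ccont f (v + x) -> Ccont (fun x => f (v + x)) x.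
 intros [A B]. assert (H : continuous (fun x => v + x) x) by (apply (continuous_plus (fun _ => v) (fun x => x)); [apply continuous_const |easy]).
 split; [apply (continuous_comp (fun x => v + x) (fun x => Re (f x))); auto|apply (continuous_comp (fun x => v + x) (fun x => Im (f x))); auto].
Qed.
Definition gaussF (t b x : R) : C := tsum (fun m : Z => gauss t b (IZR m + x)).
Lemma gaussF_spec t b x : 0 < t -> Sums (fun m : Z => gauss t b (IZR m + x)) (gaussF t b x).
 intros Ht. eapply tsum_HasSum. eapply bnd_le; [|apply bnd_gauss]; [intros m; rewrite Cmod_gauss; auto|pos]. Qed.
Definition gaussM (t : R) (m : Z) : R := (1 + / (PI * t)) * 9 * / (1 + IZR m ^ 2).
Lemma gaussM_pos t m : 0 < t -> 0 <= gaussM t m.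
 intros Ht. unfold gaussM. pos. Qed.
Lemma gaussM_bnd t : 0 < t -> bnd (gaussM t) ((1 + / (PI * t)) * 9 * 6).
 intros Ht. assert (0 < / (PI * t)) by pos. apply bnd_scal; [lra|apply bnd_inv_sq_Z]. Qed.
Lemma gaussM_le t b m x : 0 < t -> Rabs x <= 2 -> Cmod (gauss t b (IZR m + x)) <= gaussM t m.
 intros Ht Hx. rewrite Cmod_gauss. assert (Hp : 0 < PI * t) by pos. eapply Rle_trans; [apply exp_gauss_le, Hp|]. unfold gaussM. rewrite Rmult_assoc. mul_l; [|now apply inv_sq_shift]. pos.
Qed.
Lemma gaussF_cont t b x : 0 < t -> -2 < x < 2 -> Ccont (gaussF t b) x.
 intros Ht Hx. apply (Ccont_HasSum (fun m x => gauss t b (IZR m + x)) _ (gaussM t) _ (-2) 2 x (gaussM_bnd t Ht)); auto.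
 - intros; now apply gaussM_pos.
 - intros m y Hy. apply gaussM_le; auto. apply Rabs_le; lra.
 - intros m y _. apply Ccont_shift, gauss_cont.
 - intros y _. now apply gaussF_spec.
Qed.
Lemma RInt_shift (f : R -> R) v a b : (forall x, continuous f x) -> RInt (fun x => f (v + x)) a b = RInt f (v + a) (v + b).
 intros Hf. replace (v + a) with (1 * a + v) by ring. replace (v + b) with (1 * b + v) by ring. rewrite <- RInt_comp_lin; [apply RInt_eq; intros x; rewrite Rmult_1_l; f_equal; ring|int_cont; auto].
Qed.
Lemma sum_zrange_RInt (f : R -> R) N n : (forall x, continuous f x) ->
 Rsum (fun i : nat => RInt f (INR i - INR N) (INR i - INR N + 1)) (seq 0 n) = RInt f (- INR N) (INR n - INR N).
 intros Hf. assert (Hex : forall a b, ex_RInt f a b) by (intros; int_cont; intros; apply Hf). induction n.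
 - rewrite Rminus_0_l. symmetry. apply (RInt_point (V := R_CompleteNormedModule)).
 - rewrite seq_S, Rsum_app, IHn. simpl Rsum. rewrite Rplus_0_r, S_INR. replace (INR n + 1 - INR N) with (INR n - INR N + 1) by ring. apply (RInt_Chasles f); auto.
Qed.
Lemma Cint_gauss_zrange t b N :
 Csum (fun m : Z => Cint (fun x => gauss t b (IZR m + x)) 0 1) (zrange N) = RtoC (gaussH t b (INR N)).
 set (g := fun s => gcos t b s). set (h := fun s => gsin t b s). assert (Hg : forall x, continuous g x) by (intros; apply gauss_cont_Re). assert (Hh : forall x, continuous h x) by (intros; apply gauss_cont_Im).
 assert (E : forall m : Z, Cint (fun x => gauss t b (IZR m + x)) 0 1 = (RInt g (IZR m) (IZR m + 1), RInt h (IZR m) (IZR m + 1))).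
 { intros m. unfold Cint. f_equal.
  - rewrite (RInt_eq _ (fun x => g (IZR m + x))) by (intros; apply gauss_Re). rewrite RInt_shift, Rplus_0_r; auto.
  - rewrite (RInt_eq _ (fun x => h (IZR m + x))) by (intros; apply gauss_Im). rewrite RInt_shift, Rplus_0_r; auto. } unfold zrange. rewrite Csum_map.
 assert (E2 : forall l : list nat, Csum (fun j : nat => Cint (fun x => gauss t b (IZR (zn j - zn N) + x)) 0 1) l =
   (Rsum (fun i : nat => RInt g (INR i - INR N) (INR i - INR N + 1)) l, Rsum (fun i : nat => RInt h (INR i - INR N) (INR i - INR N + 1)) l)) by (induction l as [|i l IH]; [auto|]; rewrite Csum_cons, IH, E, minus_IZR, <- !INR_IZR_INZ; auto).
 rewrite E2, !sum_zrange_RInt by auto. replace (INR (2 * N) - INR N) with (INR N) by (rewrite mult_INR; simpl; ring). apply injective_projections; [auto|]. simpl. assert (Hex : forall a b, ex_RInt h a b) by (intros; int_cont; auto).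
 (* The imaginary part of the integrand is odd. *)
 assert (Ho : RInt h (- INR N) (INR N) = RInt h (INR N) (- INR N)).
 { have RInt_comp_lin h (-1) 0 (INR N) (- INR N) (Hex _ _) as Q. replace (-1 * INR N + 0) with (- INR N) in Q by ring.
  replace (-1 * - INR N + 0) with (INR N) in Q by ring. rewrite <- Q. apply RInt_eq. intros x. change (-1 * h (-1 * x + 0) = h x). unfold h.
  replace ((-1 * x + 0) ^ 2) with (x ^ 2) by ring. replace (2 * PI * ((-1 * x + 0) * b)) with (- (2 * PI * (x * b))) by ring. rewrite sin_neg. ring. }
 have opp_RInt_swap h (- INR N) (INR N) (Hex _ _) as Hs. change (- RInt h (- INR N) (INR N) = RInt h (INR N) (- INR N)) in Hs. lra.
Qed.
(** The Gaussian integral over the whole line, expressed through the periodized Gaussian so that no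
    improper integral occurs. Its value 1 / sqrt t is a consequence of the summation formula
    itself. *)
Definition gaussL (t : R) : R := Re (Cint (gaussF t 0) 0 1).
Lemma Cint_gaussF_lim t b : 0 < t -> exists L, Cint (gaussF t b) 0 1 = RtoC L /\ is_lim_seq (fun n => gaussH t b (INR n)) L.
 intros Ht. assert (HS : Sums (fun m : Z => Cint (fun x => gauss t b (IZR m + x)) 0 1) (Cint (gaussF t b) 0 1)).
 { apply (Cint_HasSum _ _ (gaussM t) _ 0 1 ltac:(lra) (gaussM_bnd t Ht)).
  - intros; now apply gaussM_pos.
  - intros m y Hy. apply gaussM_le; auto. apply Rabs_le; lra.
  - intros m y _. apply Ccont_shift, gauss_cont.
  - intros y Hy. apply gaussF_cont; lra.
  - intros y _. now apply gaussF_spec. } assert (HL : is_lim_seq (fun n => gaussH t b (INR n)) (Re (Cint (gaussF t b) 0 1)) /\ Im (Cint (gaussF t b) 0 1) = 0).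
 { have Sums_zrange _ _ HS as HZ. split.
  - apply is_lim_seq_spec. intros eps. destruct (HZ eps (cond_pos eps)) as [N HN]. exists N. intros n Hn. specialize (HN n Hn). rewrite Cint_gauss_zrange in HN. eapply Rle_lt_trans; [|eauto]. eapply Rle_trans; [|apply re_le_Cmod]. auto.
  - destruct (Req_dec (Im (Cint (gaussF t b) 0 1)) 0); auto. destruct (HZ (Rabs (Im (Cint (gaussF t b) 0 1)))) as [N HN]; [now apply Rabs_pos_lt|].
   specialize (HN N (le_n _)). rewrite Cint_gauss_zrange in HN. have im_le_Cmod (gaussH t b (INR N) - Cint (gaussF t b) 0 1) as Hi. replace (Im (gaussH t b (INR N) - Cint (gaussF t b) 0 1)) with (- Im (Cint (gaussF t b) 0 1)) in Hi
    by (simpl; ring). rewrite Rabs_Ropp in Hi. lra. } exists (Re (Cint (gaussF t b) 0 1)). destruct HL as [H1 H2]. split; auto. apply injective_projections; [auto|auto].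
Qed.
(** The differential equation in b makes exp (PI b^2 / t) times the truncated integral constant in b
    up to the truncation error, which vanishes in the limit. *)
Lemma Cint_gaussF t b : 0 < t -> Cint (gaussF t b) 0 1 = RtoC (exp (- (PI * b ^ 2 / t)) * gaussL t).
 intros Ht. destruct (Cint_gaussF_lim t b Ht) as [L [E HL]]. destruct (Cint_gaussF_lim t 0 Ht) as [L0 [E0 HL0]]. rewrite E. f_equal. unfold gaussL. rewrite E0, re_RtoC.
 assert (Hd : is_lim_seq (fun n => exp (PI * b ^ 2 / t) * gaussH t b (INR n) - gaussH t 0 (INR n)) (exp (PI * b ^ 2 / t) * L - L0)) by (apply is_lim_seq_minus'; auto; apply (is_lim_seq_scal_l _ (exp (PI * b ^ 2 / t)) L HL)).
 assert (Hz : is_lim_seq (fun n => exp (PI * b ^ 2 / t) * gaussH t b (INR n) - gaussH t 0 (INR n)) 0).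
 { apply is_lim_seq_abs_0, is_lim_seq_le_le with (u := fun _ => 0) (w := fun n => exp (PI * b ^ 2 / t) * 2 / t * Rabs b * exp (- (PI * t) * INR n ^ 2)).
  - split; [auto|]. eapply Rle_trans; [apply gaussH_bound, Ht|]. lra.
  - apply is_lim_seq_const.
  - now apply gauss_tail_lim. } apply is_lim_seq_unique in Hd. apply is_lim_seq_unique in Hz. rewrite Hd in Hz. apply Rbar_finite_eq in Hz. rewrite exp_Ropp.
 apply Rmult_eq_reg_l with (exp (PI * b ^ 2 / t)); [|apply Rgt_not_eq, exp_pos]. rewrite <- Rmult_assoc, Rinv_r by apply Rgt_not_eq, exp_pos. lra.
Qed.
Lemma ee_m (k : Z) (x : R) (m : Z) : ee (RtoC ((IZR m + x) * IZR k)) = ee (RtoC (x * IZR k)).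
 replace (RtoC ((IZR m + x) * IZR k)) with (RtoC (x * IZR k) + IZR (m * k))%C; [apply ee_shift|rewrite mult_IZR; cring]. Qed.
Lemma gaussF_twist t b k x : 0 < t -> (gaussF t b x * ee (RtoC (- (x * IZR k))))%C = gaussF t (b - IZR k) x.
 intros Ht. symmetry. apply tsum_eq. eapply Sums_eq; [eapply Sums_ext; [|apply (Sums_scal (ee (RtoC (- (x * IZR k)))) _ _ (gaussF_spec t b x Ht))]|ring].
 intros m. unfold gauss. replace ((IZR m + x) * (b - IZR k)) with ((IZR m + x) * b + - ((IZR m + x) * IZR k)) by ring. rewrite RtoC_plus, ee_plus, (RtoC_opp ((IZR m + x) * IZR k)), ee_opp, ee_m, <- ee_opp, <- RtoC_opp. ring.
Qed.
Lemma Cint_ee_period (k L : R) : k <> 0 -> ee (RtoC (L * k)) = 1 -> Cint (fun x => ee (RtoC (x * k))) 0 L = 0.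
 intros Hk He. have PI_RGT_0. rewrite ee_R in He. injection He as He1 He2. assert (R1 : is_RInt (fun x => cos (2 * PI * (x * k))) 0 L (/ (2 * PI * k) * sin (2 * PI * (L * k)) - / (2 * PI * k) * sin (2 * PI * (0 * k)))).
 { apply (is_RInt_derive (fun x => / (2 * PI * k) * sin (2 * PI * (x * k)))); [intros x _; auto_derive; auto; field; lra|intros x _; apply (ex_derive_continuous (fun x => cos (2 * PI * (x * k))) x); auto_derive; auto]. }
 assert (R2 : is_RInt (fun x => sin (2 * PI * (x * k))) 0 L (- / (2 * PI * k) * cos (2 * PI * (L * k)) - - / (2 * PI * k) * cos (2 * PI * (0 * k)))).
 { apply (is_RInt_derive (fun x => - / (2 * PI * k) * cos (2 * PI * (x * k)))); [intros x _; auto_derive; auto; field; lra|intros x _; apply (ex_derive_continuous (fun x => sin (2 * PI * (x * k))) x); auto_derive; auto]. }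
 apply injective_projections.
 - etransitivity; [apply RInt_eq; intros x; now rewrite ee_R|]. etransitivity; [apply (is_RInt_unique _ _ _ _ R1)|]. rewrite Rmult_0_l, Rmult_0_r, sin_0, He2. simpl; lra.
 - etransitivity; [apply RInt_eq; intros x; now rewrite ee_R|]. etransitivity; [apply (is_RInt_unique _ _ _ _ R2)|]. rewrite Rmult_0_l, Rmult_0_r, cos_0, He1. simpl; lra.
Qed.
Lemma Cint_ee (j : Z) : Cint (fun x => ee (RtoC (x * IZR j))) 0 1 = if Z.eq_dec j 0 then RtoC 1 else RtoC 0.
 destruct (Z.eq_dec j 0) as [->|Hj].
 - unfold Cint. rewrite (RInt_eq _ (fun _ => 1)), (RInt_eq (fun x => Im _) (fun _ => 0)).
  + rewrite !(RInt_const (V := R_CompleteNormedModule)). apply injective_projections; simpl; unfold scal; simpl; unfold mult; simpl; ring.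
  + intros x. rewrite ee_R. simpl. rewrite !Rmult_0_r. apply sin_0.
  + intros x. rewrite ee_R. simpl. rewrite !Rmult_0_r. apply cos_0.
 - apply Cint_ee_period; [now apply not_0_IZR|]. rewrite Rmult_1_l. apply ee_Z.
Qed.
Lemma is_RInt_of (f : R -> R) a b v : ex_RInt f a b -> RInt f a b = v -> is_RInt f a b v.
 intros H <-. now apply (RInt_correct (V := R_CompleteNormedModule)). Qed.
Lemma zero_limit (u : R -> R) : continuous u 0 -> (forall x, 0 < x < 1 -> u x = 0) -> u 0 = 0.
 intros Hc H. destruct (Req_dec (u 0) 0) as [|]; auto. assert (Hp : 0 < Rabs (u 0)) by now apply Rabs_pos_lt. apply filterlim_locally with (eps := mkposreal _ Hp) in Hc. destruct Hc as [d Hd]. have cond_pos d as Hdp. set (x := Rmin d 1 / 2).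
 assert (Hx : 0 < x < 1 /\ x < d) by (unfold x; have Rmin_l d 1; have Rmin_r d 1; have Rmin_pos d 1 Hdp ltac:(lra); lra).
 assert (Hb : ball 0 d x) by (change (Rabs (x - 0) < d); rewrite Rabs_pos_eq; lra). specialize (Hd x Hb). change (Rabs (u x - u 0) < Rabs (u 0)) in Hd. rewrite H in Hd by lra. rewrite Rminus_0_l, Rabs_Ropp in Hd. lra.
Qed.
Lemma Ccont_ee_lin (k : R) x : Ccont (fun x => ee (RtoC (x * k))) x.
 assert (E : (fun x : R => ee (RtoC (x * k))) = fun x : R => ee (k * x)) by (fext; intros t; rewrite RtoC_mult, Cmult_comm; reflexivity). rewrite E. apply (Ccont_wder (fun z => ee (k * z)) x _ _ (wder_ee_lin k x)).
Qed.
Lemma Ccont_ee_opp (k : R) x : Ccont (fun x => ee (RtoC (- (x * k)))) x.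
 replace (fun x => ee (RtoC (- (x * k)))) with (fun x => ee (RtoC (x * - k))); [apply Ccont_ee_lin|]. fext. intros t. do 2 f_equal. ring.
Qed.
Lemma fourier_null_Re (D : R -> C) : (forall x, 0 <= x <= 1 -> Ccont D x) ->
 (forall k : Z, Cint (fun x => D x * ee (RtoC (- (x * IZR k))))%C 0 1 = 0) -> fourier_null (fun x => Re (D x)).
 intros Hc H. assert (HI : forall k : Z, is_RInt (fun x => Re (D x * ee (RtoC (- (x * IZR k))))) 0 1 0 /\ is_RInt (fun x => Im (D x * ee (RtoC (- (x * IZR k))))) 0 1 0).
 { intros k. destruct (Ccont_ex (fun x => D x * ee (RtoC (- (x * IZR k))))%C 0 1) as [].
  { intros x Hx. rewrite Rmin_left, Rmax_right in Hx by lra. apply Ccont_mult; [auto|apply Ccont_ee_opp]. } split; apply is_RInt_of; auto; [exact (f_equal (@fst R R) (H k))|exact (f_equal (@snd R R) (H k))]. }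
 intros k. destruct (HI k) as [A1 A2]. destruct (HI (- k)%Z) as [B1 B2]. split; [have is_RInt_lin3 _ _ _ _ _ (/ 2) (/ 2) 0 A1 B1 B1 as Q|have is_RInt_lin3 _ _ _ _ _ (- / 2) (/ 2) 0 A2 B2 B2 as Q];
  (eapply is_RInt_ext; [|exact Q]); intros x _; Req; cbv beta; rewrite !ee_R, opp_IZR; replace (2 * PI * - (x * - IZR k)) with (2 * PI * (IZR k * x)) by ring;
  replace (2 * PI * - (x * IZR k)) with (- (2 * PI * (IZR k * x))) by ring; rewrite cos_neg, sin_neg; simpl; unfold Re, Im; field.
Qed.
Lemma fourier_zero (D : R -> C) y : (forall x, -2 < x < 2 -> Ccont D x) ->
 (forall k : Z, Cint (fun x => D x * ee (RtoC (- (x * IZR k))))%C 0 1 = 0) -> 0 <= y < 1 -> Re (D y) = 0.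
 intros Hc H Hy. assert (H0 : forall y, 0 < y < 1 -> Re (D y) = 0).
 { intros u Hu. apply (fourier_unique (fun x => Re (D x))); [intros x Hx; apply Hc; lra|apply fourier_null_Re; auto; intros x Hx; apply Hc; lra|auto]. }
 destruct (Req_dec y 0) as [->|]; [|apply H0; lra]. apply (zero_limit (fun x => Re (D x))); [apply Hc; lra|auto].
Qed.
Definition dualF (t b x : R) : C := tsum (fun k : Z => (RtoC (exp (- (PI / t) * (IZR k - b) ^ 2)) * ee (RtoC (x * IZR k)))%C).
Lemma Cmod_dual t b x k : Cmod (RtoC (exp (- (PI / t) * (IZR k - b) ^ 2)) * ee (RtoC (x * IZR k)))%C = exp (- (PI / t) * (IZR k + - b) ^ 2).
 rewrite Cmod_mult, Cmod_ee_R, Cmod_R, Rabs_pos_eq by auto. unfold Rminus. ring. Qed.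
Lemma dualF_spec t b x : 0 < t ->
 Sums (fun k : Z => (RtoC (exp (- (PI / t) * (IZR k - b) ^ 2)) * ee (RtoC (x * IZR k)))%C) (dualF t b x).
 intros Ht. eapply tsum_HasSum. eapply bnd_le; [|apply bnd_gauss]; [intros m; rewrite Cmod_dual; auto|pos]. Qed.
Lemma dualF_cont t b x : 0 < t -> Ccont (dualF t b) x.
 intros Ht. assert (Hp : 0 < PI / t) by pos. apply (Ccont_HasSum (fun k x => exp (- (PI / t) * (IZR k - b) ^ 2) * ee (RtoC (x * IZR k)))%C _ (fun k => exp (- (PI / t) * (IZR k + - b) ^ 2)) _ (x - 1) (x + 1) x (bnd_gauss (PI / t) (- b) Hp)).
 - auto.
 - intros k y _. rewrite Cmod_dual. auto.
 - split; [cbn; match goal with |- continuous ?h ?p => apply (ex_derive_continuous h p) end; auto_derive; auto|cbn; match goal with |- continuous ?h ?p => apply (ex_derive_continuous h p) end; auto_derive; auto].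
 - intros y _. now apply dualF_spec.
 - lra.
Qed.
Lemma dualF_coef t b k : 0 < t ->
 Cint (fun x => dualF t b x * ee (RtoC (- (x * IZR k))))%C 0 1 = RtoC (exp (- (PI / t) * (IZR k - b) ^ 2)).
 intros Ht. assert (Hp : 0 < PI / t) by pos. assert (Ek : forall x, ee (RtoC (- (x * IZR k))) = ee (RtoC (x * IZR (- k)))) by (intros x; do 2 f_equal; rewrite opp_IZR; ring).
 assert (H : Sums (fun j : Z => Cint (fun x => exp (- (PI / t) * (IZR j - b) ^ 2) * ee (RtoC (x * IZR (j - k))))%C 0 1) (Cint (fun x => dualF t b x * ee (RtoC (- (x * IZR k))))%C 0 1)).
 { apply (Cint_HasSum (fun j x => exp (- (PI / t) * (IZR j - b) ^ 2) * ee (RtoC (x * IZR (j - k))))%C _ (fun k => exp (- (PI / t) * (IZR k + - b) ^ 2)) _ 0 1 ltac:(lra) (bnd_gauss (PI / t) (- b) Hp)).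
  - auto.
  - intros j y _. rewrite Cmod_mult, Cmod_ee_R, Cmod_R, Rabs_pos_eq, Rmult_1_r by auto. auto.
  - intros j y _. apply Ccont_scal, Ccont_ee_lin.
  - intros y _. apply Ccont_mult; [now apply dualF_cont|]. apply Ccont_ee_opp.
  - intros y _. eapply Sums_eq; [eapply Sums_ext; [|apply (Sums_scal (ee (RtoC (- (y * IZR k)))) _ _ (dualF_spec t b y Ht))]|ring]. intros j. rewrite Ek.
   replace (RtoC (y * IZR (j - k))) with (RtoC (y * IZR j) + RtoC (y * IZR (- k)))%C; [rewrite ee_plus; ring|rewrite <- RtoC_plus; f_equal; rewrite minus_IZR, opp_IZR; ring]. } eapply Sums_unique; [eauto|].
 assert (E : forall j, Cint (fun x => exp (- (PI / t) * (IZR j - b) ^ 2) * ee (RtoC (x * IZR (j - k))))%C 0 1 =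
   (exp (- (PI / t) * (IZR j - b) ^ 2) * if Z.eq_dec (j - k) 0 then 1 else 0)%C) by (intros j; rewrite Cint_scal by (intros; apply Ccont_ee_lin); now rewrite Cint_ee).
 eapply Sums_eq; [apply (Sums_single k)|]; [intros j Hj; rewrite E; destruct (Z.eq_dec (j - k) 0); [lia|]; ring|rewrite E; destruct (Z.eq_dec (k - k) 0); [|lia]; ring].
Qed.
(** Both sides are continuous, 1-periodic and have the same Fourier coefficients. The constant
    [gaussL t] is still undetermined here. *)
Lemma poisson_pre t b x : 0 < t -> gaussF t b x = (gaussL t * dualF t b x)%C.
 intros Ht. set (D := fun x => (gaussF t b x + RtoC (- gaussL t) * dualF t b x)%C). assert (HcD : forall x, -2 < x < 2 -> Ccont D x).
 { intros y Hy. apply Ccont_plus; [now apply gaussF_cont | apply Ccont_scal; now apply dualF_cont]. } assert (Hcoef : forall k : Z, Cint (fun x => D x * ee (RtoC (- (x * IZR k))))%C 0 1 = 0).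
 { intros k. assert (Hek : forall x, Ccont (fun x => ee (RtoC (- (x * IZR k)))) x) by (intros; apply Ccont_ee_opp).
  rewrite (Cint_ext _ (fun x => gaussF t (b - IZR k) x + RtoC (- gaussL t) * (dualF t b x * ee (RtoC (- (x * IZR k)))))%C); [|intros y; rewrite <- gaussF_twist by auto; cring]. rewrite Cint_plus.
  + rewrite Cint_scal; [|intros y _; apply Ccont_mult; [now apply dualF_cont|auto]]. rewrite dualF_coef, Cint_gaussF, <- RtoC_mult, <- RtoC_plus by auto.
   f_equal. replace (- (PI * (b - IZR k) ^ 2 / t)) with (- (PI / t) * (IZR k - b) ^ 2) by lra. ring.
  + intros y Hy. rewrite Rmin_left, Rmax_right in Hy by lra. apply gaussF_cont; lra.
  + intros y _. apply Ccont_scal, Ccont_mult; [now apply dualF_cont|auto]. } assert (H0 : forall y, 0 <= y < 1 -> D y = 0).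
 { intros y Hy. apply injective_projections; [now apply fourier_zero|]. transitivity (Re (- Ci * D y)%C); [simpl; unfold Re; ring|]. apply (fourier_zero (fun x => - Ci * D x)%C); auto; [intros; now apply Ccont_scal, HcD|].
  intros k. rewrite (Cint_ext _ (fun x => - Ci * (D x * ee (RtoC (- (x * IZR k)))))%C) by (intros; ring). rewrite Cint_scal, Hcoef; [ring|].
  intros u Hu. rewrite Rmin_left, Rmax_right in Hu by lra. apply Ccont_mult; [apply HcD; lra|apply Ccont_ee_opp]. } assert (Hper : forall k y, D (IZR k + y) = D y).
 { intros k y. unfold D. f_equal.
  - apply tsum_eq. have Sums_reindex (fun m => (m + k)%Z) (fun m => (m - k)%Z) (fun m : Z => gauss t b (IZR m + y)) (gaussF t b y) as Q.
   eapply Sums_ext; [|apply Q; [lia|lia|now apply gaussF_spec]]. intros m. cbv beta. f_equal. rewrite plus_IZR. ring.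
  - f_equal. apply tsum_ext. intros j. rewrite !(Rmult_comm _ (IZR j)), Rmult_plus_distr_l, RtoC_plus, ee_plus, <- mult_IZR, ee_Z. ring. } set (k := Int_part x). set (y := frac_part x). assert (Hx : x = IZR k + y) by (unfold k, y, frac_part; ring).
 assert (Hy : 0 <= y < 1) by (destruct (base_fp x); unfold y; lra). assert (HD : D x = 0) by (rewrite Hx, Hper; auto). unfold D in HD. apply Ceq_minus. rewrite <- HD, RtoC_opp. ring.
Qed.
Lemma Sums_dom {I} (f : I -> C) s (g : I -> R) t : Sums f s -> Sums (fun i => RtoC (g i)) t -> (forall i, Cmod (f i) <= g i) -> Cmod s <= Cmod t.
 intros Hf Hg Hfg. apply Rnot_lt_le. intros L. set (e := (Cmod s - Cmod t) / 2). assert (He : 0 < e) by (unfold e; lra). destruct (Hf e He) as [l1 H1].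
 destruct (Hg e He) as [l2 H2]. destruct (nodup_super (l1 ++ l2)) as [l [Hl Hi]]. specialize (H1 l Hl ltac:(intros x Hx; apply Hi, in_app_iff; auto)).
 specialize (H2 l Hl ltac:(intros x Hx; apply Hi, in_app_iff; auto)). rewrite Csum_RtoC in H2. have Cmod_Csum f l. have Rsum_le_in (fun i => Cmod (f i)) g l (fun i _ => Hfg i). have Cmod_triangle (Csum f l) (s - Csum f l) as T1.
 replace (Csum f l + (s - Csum f l))%C with s in T1 by ring. replace (s - Csum f l)%C with (- (Csum f l - s))%C in T1 by ring. rewrite Cmod_opp in T1.
 have Cmod_triangle t (Rsum g l - t) as T2. replace (t + (Rsum g l - t))%C with (RtoC (Rsum g l)) in T2 by ring. rewrite Cmod_R in T2. have Rle_abs (Rsum g l). unfold e in *. lra.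
Qed.
Lemma gaussL_lim t : 0 < t -> is_lim_seq (fun n => gaussH t 0 (INR n)) (gaussL t).
 intros Ht. destruct (Cint_gaussF_lim t 0 Ht) as [L [E HL]]. unfold gaussL. now rewrite E. Qed.
Lemma gaussH0_mono M M' : 0 <= M <= M' -> gaussH 1 0 M <= gaussH 1 0 M'.
 intros HM. unfold gaussH. set (g := fun s => exp (- (PI * 1) * s ^ 2) * cos (2 * PI * (s * 0))). assert (Hg : forall x, continuous g x) by (intros; apply gauss_cont_Re).
 assert (Hex : forall a b, ex_RInt g a b) by (intros; int_cont; intros; apply Hg). assert (Hpos : forall x, 0 <= g x) by (intros x; unfold g; rewrite !Rmult_0_r, cos_0, Rmult_1_r; auto).
 assert (H1 : RInt g (- M') M' = RInt g (- M') (- M) + (RInt g (- M) M + RInt g M M')) by (rewrite <- (RInt_Chasles g (- M') (- M) M'), <- (RInt_Chasles g (- M) M M'); auto).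
 assert (0 <= RInt g (- M') (- M)) by (apply RInt_ge_0; auto; lra). assert (0 <= RInt g M M') by (apply RInt_ge_0; auto; lra). lra.
Qed.
Lemma gaussH_scale t M : 0 < t -> gaussH 1 0 (sqrt t * M) = sqrt t * gaussH t 0 M.
 unfold gaussH. set (g := fun s => exp (- (PI * 1) * s ^ 2) * cos (2 * PI * (s * 0))). assert (Hex : forall a b, ex_RInt g a b) by (intros; int_cont; intros; apply gauss_cont_Re).
 have RInt_comp_lin g (sqrt t) 0 (- M) M (Hex _ _) as Q. rewrite !Rplus_0_r in Q. replace (sqrt t * - M) with (- (sqrt t * M)) in Q by ring. rewrite <- Q. set (h := fun s => exp (- (PI * t) * s ^ 2) * cos (2 * PI * (s * 0))).
 assert (Eh : ex_RInt h (- M) M) by (int_cont; intros; apply gauss_cont_Re). etransitivity; [|apply (RInt_scal h (- M) M (sqrt t) Eh)]. apply RInt_eq. intros x. f_equal. unfold g, h. rewrite !Rmult_0_r. f_equal. f_equal.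
 rewrite Rplus_0_r, Rpow_mult_distr, pow2_sqrt by lra. ring.
Qed.
(** The substitution s -> sqrt t * s produces the cut-offs sqrt t * n, which are not integers;
    monotonicity of the truncated integral in its cut-off covers them. *)
Lemma gaussL_scale t : 0 < t -> gaussL t = / sqrt t * gaussL 1.
 intros Ht. assert (Hs : 0 < sqrt t) by now apply sqrt_lt_R0. have gaussL_lim 1 ltac:(lra) as L1. have gaussL_lim t Ht as Lt. assert (Hup : forall M, 0 <= M -> gaussH 1 0 M <= gaussL 1).
 { intros M HM. destruct (nfloor_ex M HM) as [n Hn]. apply Rle_trans with (gaussH 1 0 (INR (S n))); [apply gaussH0_mono; rewrite S_INR; lra|].
  apply (is_lim_seq_incr_compare (fun n => gaussH 1 0 (INR n))); auto. intros m. apply gaussH0_mono. rewrite S_INR. have pos_INR m. lra. } assert (Lt2 : is_lim_seq (fun n => gaussH 1 0 (sqrt t * INR n)) (gaussL 1)).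
 { apply is_lim_seq_spec. intros eps. apply is_lim_seq_spec in L1. destruct (L1 eps) as [N HN]. specialize (HN N (le_n _)). destruct (nfloor_ex (INR N / sqrt t)) as [m Hm].
  { apply Rdiv_le_0_compat; [auto|auto]. } exists (S m). intros n Hn. assert (Hge : INR N <= sqrt t * INR n).
  { apply le_INR in Hn. rewrite S_INR in Hn. apply Rle_trans with (sqrt t * INR N / sqrt t); [right; field; lra|]. nra. } have gaussH0_mono (INR N) (sqrt t * INR n) (conj (pos_INR N) Hge). have Hup (sqrt t * INR n) ltac:(pos). apply Rabs_def2 in HN.
  apply Rabs_def1; lra. } assert (Lt3 : is_lim_seq (fun n => gaussH 1 0 (sqrt t * INR n)) (sqrt t * gaussL t)) by (eapply is_lim_seq_ext; [intros n; symmetry; apply gaussH_scale, Ht|]; apply (is_lim_seq_scal_l _ (sqrt t) _ Lt)).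
 apply is_lim_seq_unique in Lt2. apply is_lim_seq_unique in Lt3. rewrite Lt2 in Lt3. apply Rbar_finite_eq in Lt3. rewrite Lt3. field. lra.
Qed.
(* The self-dual case [t = 1] of the summation formula fixes the Gaussian integral. *)
Lemma gaussL_1 : gaussL 1 = 1.
 have poisson_pre 1 0 0 ltac:(lra). assert (E : gaussF 1 0 0 = dualF 1 0 0).
 { apply tsum_ext. intros m. unfold gauss. rewrite Rmult_0_r, Rmult_0_l. do 3 f_equal. field. } rewrite <- E in H. assert (HF : Cmod 1 <= Cmod (gaussF 1 0 0)).
 { apply (Sums_dom (fun m : Z => if Z.eq_dec m 0 then RtoC 1 else RtoC 0) 1 (fun m => exp (- (PI * 1) * (IZR m + 0) ^ 2))).
  - apply (Sums_single 0%Z (fun m : Z => if Z.eq_dec m 0 then RtoC 1 else RtoC 0)). intros m Hm. now destruct (Z.eq_dec m 0).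
  - eapply Sums_ext; [|apply gaussF_spec; lra]. intros m. unfold gauss. rewrite Rmult_0_r, ee_0. ring.
  - intros m. destruct (Z.eq_dec m 0) as [->|]; [rewrite Cmod_1, Rplus_0_r, pow_i, Rmult_0_r, exp_0 by lia; lra|rewrite Cmod_0; auto]. }
 rewrite Cmod_1 in HF. apply RtoC_inj. transitivity (gaussL 1 * gaussF 1 0 0 / gaussF 1 0 0)%C; [|rewrite <- H]; field; intros E0; rewrite E0, Cmod_0 in HF; lra.
Qed.
Theorem poisson_gauss t b x : 0 < t -> gaussF t b x = (RtoC (/ sqrt t) * dualF t b x)%C.
 intros Ht. rewrite poisson_pre, gaussL_scale, gaussL_1, Rmult_1_r by auto. auto. Qed.

(** * Theta series and Gaussian sums over the lattice *)

Definition polar (rho theta : R) : C := (RtoC (exp rho) * ee (RtoC theta))%C.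
Lemma polar_mult r1 t1 r2 t2 : (polar r1 t1 * polar r2 t2)%C = polar (r1 + r2) (t1 + t2).
 unfold polar. rewrite exp_plus, RtoC_mult, RtoC_plus, ee_plus. ring. Qed.
Lemma polar_eq r1 t1 r2 t2 : r1 = r2 -> t1 = t2 -> polar r1 t1 = polar r2 t2.
 now intros -> ->. Qed.
(** Identities between theta terms thus split into one real identity for the size and one for the
    phase modulo integers. *)
Lemma polar_eqZ r1 t1 r2 t2 (k : Z) : r1 = r2 -> t1 = t2 + IZR k -> polar r1 t1 = polar r2 t2.
 intros -> ->. unfold polar. now rewrite RtoC_plus, ee_shift. Qed.
Lemma Cmod_polar r t : Cmod (polar r t) = exp r.
 unfold polar. rewrite Cmod_mult, Cmod_ee_R, Cmod_R, Rabs_pos_eq; [ring|auto]. Qed.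
Lemma Cconj_RtoC (x : R) : Cconj (RtoC x) = RtoC x.
 cring. Qed.
Lemma polar_conj r t : Cconj (polar r t) = polar r (- t).
 unfold polar. rewrite Cmult_conj, ee_conj, !Cconj_RtoC, RtoC_opp. auto. Qed.
Lemma ee_polar (c : R) z : ee (c * z)%C = polar (- 2 * PI * c * Im z) (c * Re z).
 unfold polar. replace (c * z)%C with (Ci * RtoC (c * Im z) + RtoC (c * Re z))%C; [rewrite ee_plus, ee_imag; do 3 f_equal; ring|destruct z as []; cring].
Qed.
(** The sign (-1)^i for every integer i, in polar form so that it merges with the other phases. *)
Definition sg (i : Z) : C := polar 0 (IZR i / 2).
Lemma sg_plus i j : sg (i + j) = (sg i * sg j)%C.
 unfold sg. rewrite polar_mult. apply polar_eq; [ring|]. rewrite plus_IZR. field. Qed.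
Lemma sg_par i j k : (i = j + 2 * k)%Z -> sg i = sg j.
 intros ->. apply polar_eqZ with k; [auto|]. rewrite plus_IZR, mult_IZR. field. Qed.
Lemma Cmod_sg i : Cmod (sg i) = 1.
 unfold sg. rewrite Cmod_polar. apply exp_0. Qed.
Lemma sg_0 : sg 0 = 1.
 unfold sg, polar. rewrite exp_0. replace (IZR 0 / 2) with 0 by field. rewrite ee_0. ring. Qed.
Lemma sg_1 : sg 1 = (-1).
 unfold sg, polar. rewrite exp_0, ee_R. replace (2 * PI * (1 / 2)) with PI by field. rewrite cos_PI, sin_PI. cring. Qed.
Lemma sg_conj i : Cconj (sg i) = sg i.
 unfold sg. rewrite polar_conj. apply polar_eqZ with (k := (- i)%Z); [auto|]. rewrite opp_IZR. field. Qed.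
Definition etat (i : Z) (z : C) : C := (sg i * ee (RtoC (IZR (6 * i + 1) ^ 2) * z))%C.
Definition eta (z : C) : C := tsum (fun i => etat i z).
Definition theta (z : C) : C := tsum (fun a : Z => ee (RtoC (IZR a ^ 2) * z)%C).
Lemma Cmod_ee_c (c : R) z : Cmod (ee (c * z)%C) = exp (- 2 * PI * c * Im z).
 now rewrite ee_polar, Cmod_polar. Qed.
Lemma Cmod_etat i z : Cmod (etat i z) = exp (- 2 * PI * (IZR (6 * i + 1) ^ 2) * Im z).
 unfold etat. rewrite Cmod_mult, Cmod_sg, Cmod_ee_c. ring. Qed.
Lemma two_pi_pos y : 0 < y -> 0 < 2 * PI * y.
 intros Hy. pos. Qed.
#[local] Hint Resolve two_pi_pos : core.
Lemma bnd_theta y : 0 < y -> bnd (fun a : Z => exp (- 2 * PI * IZR a ^ 2 * y)) ((1 + / (2 * PI * y)) * 18).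
 intros Hy. have bnd_gauss (2 * PI * y) 0 (two_pi_pos y Hy). eapply bnd_le; [|eauto]. right. f_equal. ring. Qed.
Lemma bnd_theta_aff (p q : Z) y : 0 < y -> (p <> 0)%Z ->
 bnd (fun i : Z => exp (- 2 * PI * IZR (p * i + q) ^ 2 * y)) ((1 + / (2 * PI * y)) * 18).
 intros Hy Hp. apply (bnd_inj (fun i => (p * i + q)%Z) (fun a : Z => exp (- 2 * PI * IZR a ^ 2 * y))); [nia|now apply bnd_theta]. Qed.
Lemma bnd_etat z : inH z -> bnd (fun i => Cmod (etat i z)) ((1 + / (2 * PI * Im z)) * 18).
 intros Hz. eapply bnd_le; [|apply (bnd_theta_aff 6 1 (Im z) Hz); lia]. intros i. rewrite Cmod_etat. auto. Qed.
Lemma eta_spec z : inH z -> Sums (fun i => etat i z) (eta z).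
 intros Hz. eapply tsum_HasSum, bnd_etat, Hz. Qed.
Lemma bnd_thetat z : inH z -> bnd (fun a : Z => Cmod (ee (RtoC (IZR a ^ 2) * z)%C)) ((1 + / (2 * PI * Im z)) * 18).
 intros Hz. eapply bnd_le; [|apply (bnd_theta (Im z) Hz)]. intros a. rewrite Cmod_ee_c. auto. Qed.
Lemma theta_spec z : inH z -> Sums (fun a : Z => ee (RtoC (IZR a ^ 2) * z)%C) (theta z).
 intros Hz. eapply tsum_HasSum, bnd_thetat, Hz. Qed.
Lemma bnd2_gauss c1 c2 (sh : Z -> R) : 0 < c1 -> 0 < c2 ->
 bnd (fun p : Z * Z => exp (- c1 * (IZR (snd p) + sh (fst p)) ^ 2 - c2 * IZR (fst p) ^ 2)) (((1 + / c1) * 18) * ((1 + / c2) * 18)).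
 intros H1 H2. apply (bnd_fubini _ (fun n : Z => (1 + / c1) * 18 * exp (- c2 * (IZR n + 0) ^ 2))).
 - auto.
 - intros n. cbn [fst snd]. intros l Hl. assert (E : Rsum (fun j : Z => exp (- c1 * (IZR j + sh n) ^ 2 - c2 * IZR n ^ 2)) l =
   exp (- c2 * (IZR n + 0) ^ 2) * Rsum (fun j : Z => exp (- c1 * (IZR j + sh n) ^ 2)) l) by (rewrite <- Rsum_scal; f_equal; fext; intros j; rewrite <- exp_plus; f_equal; ring). rewrite E, Rmult_comm. mul_r; [auto|]. now apply bnd_gauss.
 - apply bnd_scal; [|now apply bnd_gauss]. pos.
Qed.
Definition Xy (z : C) : R := PI / (16 * Im z).
Definition lw (z : C) (p : Z * Z) : C := (RtoC (24 * IZR (fst p)) * z + RtoC (IZR (snd p)))%C.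
(** This is 1 when both coordinates are even and -1 otherwise. It depends only on residues modulo 2
    and is symmetric in the coordinates, which serves both the congruence group and the
    inversion. *)
Definition leps (p : Z * Z) : C := sg (fst p + snd p + fst p * snd p).
Definition thT (r : R) (z : C) (p : Z * Z) : C :=
 (leps p * cexp (RtoC (Xy z) * (r * (lw z p * lw z p) - lw z p * Cconj (lw z p))))%C.
Lemma lw_Re z p : Re (lw z p) = 24 * IZR (fst p) * Re z + IZR (snd p).
 unfold Re; simpl. ring. Qed.
Lemma lw_Im z p : Im (lw z p) = 24 * IZR (fst p) * Im z.
 unfold Im; simpl. ring. Qed.
Lemma Xy_pos z : inH z -> 0 < Xy z.
 intros Hz. unfold Xy. pos. Qed.
Lemma cexp_polar a : cexp a = polar (Re a) (Im a / (2 * PI)).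
 unfold polar. rewrite ee_R. replace (2 * PI * (Im a / (2 * PI))) with (Im a) by (field; apply PI_neq0). cring. Qed.
Lemma thT_polar r z n m : inH z -> thT r z (n, m) =
 polar (- Xy z * ((1 - r) * (24 * IZR n * Re z + IZR m) ^ 2 + (1 + r) * (24 * IZR n * Im z) ^ 2)) (IZR (n + m + n * m) / 2 + 3 * r * IZR n / 2 * (24 * IZR n * Re z + IZR m)).
 intros Hz. unfold thT, leps, sg. rewrite cexp_polar, polar_mult. assert (HR : forall w : C, Re (Xy z * (r * (w * w) - w * Cconj w)) = - Xy z * ((1 - r) * Re w ^ 2 + (1 + r) * Im w ^ 2)) by (intros []; simpl; ring).
 assert (HI : forall w : C, Im (Xy z * (r * (w * w) - w * Cconj w)) = 2 * Xy z * r * Re w * Im w) by (intros []; simpl; ring). rewrite HR, HI, lw_Re, lw_Im. cbn. apply polar_eq; [ring|]. unfold Xy. field. split; [unfold inH in *; lra| apply PI_neq0].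
Qed.
Lemma Cmod_thT r z p : inH z -> Cmod (thT r z p) =
 exp (- (Xy z * (1 - r)) * (IZR (snd p) + 24 * Re z * IZR (fst p)) ^ 2 - Xy z * (1 + r) * (24 * Im z) ^ 2 * IZR (fst p) ^ 2).
 intros Hz. destruct p as []. rewrite thT_polar, Cmod_polar by auto. cbn. f_equal. ring. Qed.
Lemma bnd_thT r z : inH z -> 0 <= r < 1 -> exists K, bnd (fun p => Cmod (thT r z p)) K.
 intros Hz Hr. have Xy_pos z Hz. assert (H1 : 0 < Xy z * (1 - r)) by pos. assert (H2 : 0 < Xy z * (1 + r) * (24 * Im z) ^ 2) by pos. eexists.
 eapply bnd_le; [|apply (bnd2_gauss _ _ (fun n => 24 * Re z * IZR n) H1 H2)]. intros p. rewrite Cmod_thT by auto. auto.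
Qed.
Lemma thT_row r z n : inH z -> 0 <= r < 1 ->
 let t := (1 - r) / (16 * Im z) in let b := 3 * r * IZR n / 2 + (IZR n + 1) / 2 in Sums (fun m => thT r z (n, m)) (polar (- Xy z * (1 + r) * (24 * IZR n * Im z) ^ 2) (IZR n / 2 - 12 * IZR n * (IZR n + 1) * Re z) * gaussF t b (24 * IZR n * Re z))%C.
 intros Hz Hr t b. assert (Ht : 0 < t) by (unfold inH in *; apply Rdiv_lt_0_compat; lra). eapply Sums_ext; [|apply Sums_scal, (gaussF_spec t b _ Ht)]. intros m. cbv beta. change (gauss t b (IZR m + 24 * IZR n * Re z)) with
  (polar (- (PI * t) * (IZR m + 24 * IZR n * Re z) ^ 2) ((IZR m + 24 * IZR n * Re z) * b)). rewrite thT_polar, polar_mult by auto. apply polar_eq; [unfold Xy, t; lra|unfold b; rewrite !plus_IZR, mult_IZR; field].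
Qed.
(* [E a b = q^(a^2) conj(q'^(b^2))], where [q, q'] belong to [z, z']. *)
Definition EE (z z' : C) (a b : Z) : C := (ee (RtoC (IZR a ^ 2) * z) * Cconj (ee (RtoC (IZR b ^ 2) * z')))%C.
Definition zr (r : R) (z : C) : C := (Re z, Im z * (1 + r) / (1 - r)).
Lemma EE_polar z z' a b : EE z z' a b =
 polar (- 2 * PI * (IZR a ^ 2 * Im z + IZR b ^ 2 * Im z')) (IZR a ^ 2 * Re z - IZR b ^ 2 * Re z').
 unfold EE. rewrite !ee_polar, polar_conj, polar_mult. apply polar_eq; ring. Qed.
(** After Poisson summation in m the exponent decouples into a holomorphic square at z and an
    antiholomorphic square at z_r, with the linear forms a = 2n + 2k - 1 and b = 4n - 2k + 1. *)
Lemma thT_row_dual r z n : inH z -> 0 <= r < 1 ->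
 let t := (1 - r) / (16 * Im z) in let b := 3 * r * IZR n / 2 + (IZR n + 1) / 2 in Sums (fun k : Z => (RtoC (4 * sqrt (Im z / (1 - r))) * (sg n * EE z (zr r z) (2 * n + 2 * k - 1) (4 * n - 2 * k + 1)))%C)
  (polar (- Xy z * (1 + r) * (24 * IZR n * Im z) ^ 2) (IZR n / 2 - 12 * IZR n * (IZR n + 1) * Re z) * gaussF t b (24 * IZR n * Re z))%C.
 intros Hz Hr t b. assert (Ht : 0 < t) by (unfold inH in *; apply Rdiv_lt_0_compat; lra). rewrite poisson_gauss by auto.
 assert (Es : / sqrt t = 4 * sqrt (Im z / (1 - r))) by (unfold inH in Hz; rewrite <- sqrt_inv; replace (/ t) with (4 ^ 2 * (Im z / (1 - r))) by (unfold t; field; lra); rewrite sqrt_mult; [|lra|pos]; f_equal; apply sqrt_pow2; lra).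
 rewrite Es. match goal with |- Sums _ (?A * (?B * ?D)) => replace (A * (B * D))%C with (B * A * D)%C by ring end. eapply Sums_ext; [|apply Sums_scal, (dualF_spec t b _ Ht)]. intros k. cbv beta.
 change (exp (- (PI / t) * (IZR k - b) ^ 2) * ee (RtoC (24 * IZR n * Re z * IZR k)))%C with (polar (- (PI / t) * (IZR k - b) ^ 2) (24 * IZR n * Re z * IZR k)). rewrite <- Cmult_assoc. f_equal. unfold sg. rewrite EE_polar, !polar_mult.
 assert (H1 : IZR (2 * n + 2 * k - 1) = 2 * IZR n + 2 * IZR k - 1) by (rewrite minus_IZR, plus_IZR, !mult_IZR; ring).
 assert (H2 : IZR (4 * n - 2 * k + 1) = 4 * IZR n - 2 * IZR k + 1) by (rewrite plus_IZR, minus_IZR, !mult_IZR; ring). rewrite H1, H2. unfold inH in Hz. apply polar_eq; [unfold Xy, t, b; cbn; field; lra|simpl; lra].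
Qed.
Lemma zr_inH r z : inH z -> 0 <= r < 1 -> inH (zr r z).
 unfold inH. cbn. intros Hz Hr. pos. Qed.
Lemma Z_mod3 (A : Z) : {i | A = 3 * i + 1}%Z + {i | A = 3 * i}%Z + {i | A = 3 * i + 2}%Z.
 have Z_div_mod_eq_full A 3. have Z.mod_pos_bound A 3 ltac:(lia). destruct (Z.eq_dec (A mod 3) 0) as [|]; [left; right; exists (A / 3)%Z; lia|].
 destruct (Z.eq_dec (A mod 3) 1) as [|]; [left; left; exists (A / 3)%Z; lia|]. right; exists (A / 3)%Z; lia.
Qed.
(** Sorts the pairs (n, k) by n + k modulo 3. Up to signs, (2n + 2k - 1, 4n - 2k + 1) is (6i + 1, 6j
    + 1) in the first two classes and (6i + 3, 6j + 3) in the third. *)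
Definition unfold3 (x : (Z * Z + Z * Z) + Z * Z) : Z * Z :=
 match x with
 | inl (inl (i, j)) => (i - j, 2 * i + j + 1)%Z
 | inl (inr (i, j)) => (j - i, - 2 * i - j)%Z
 | inr (i, j) => (i + j + 1, 2 * i - j + 1)%Z end.
Definition fold3 (p : Z * Z) : (Z * Z + Z * Z) + Z * Z :=
 let (n, k) := p in match Z_mod3 (n + k) with
 | inl (inl (exist i _)) => inl (inl (i, i - n)%Z)
 | inl (inr (exist i _)) => inl (inr (- i, n - i)%Z)
 | inr (exist i _) => inr (i, n - i - 1)%Z end.
Lemma unfold3_K x : fold3 (unfold3 x) = x.
 destruct x as [[[]|[]]|[]]; unfold fold3, unfold3; destruct Z_mod3 as [[[]|[]]|[]]; repeat f_equal; lia.
Qed.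
Lemma fold3_K p : unfold3 (fold3 p) = p.
 destruct p as []; unfold fold3, unfold3; destruct Z_mod3 as [[[]|[]]|[]]; f_equal; lia. Qed.
Lemma EE_par z z' a b a' b' : (a = a' \/ a = - a')%Z -> (b = b' \/ b = - b')%Z -> EE z z' a b = EE z z' a' b'.
 intros Ha Hb. rewrite !EE_polar. assert (Ea : IZR a ^ 2 = IZR a' ^ 2) by (destruct Ha as [->| ->]; rewrite ?opp_IZR; ring). assert (Eb : IZR b ^ 2 = IZR b' ^ 2) by (destruct Hb as [->| ->]; rewrite ?opp_IZR; ring). now rewrite Ea, Eb.
Qed.
Lemma Sums_conj {I} (f : I -> C) s : Sums f s -> Sums (fun i => Cconj (f i)) (Cconj s).
 intros H eps He. destruct (H eps He) as [l0 H0]. exists l0. intros l Hl Hi. assert (E : Csum (fun i => Cconj (f i)) l = Cconj (Csum f l)) by (clear; induction l; simpl; [cring|]; now rewrite IHl, Cplus_conj).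
 rewrite E, <- Cminus_conj, Cmod_conj. auto.
Qed.
Lemma Sums_eta2 z z' : inH z -> inH z' ->
 Sums (fun p : Z * Z => (sg (fst p) * sg (snd p) * EE z z' (6 * fst p + 1) (6 * snd p + 1))%C) (eta z * Cconj (eta z'))%C.
 intros Hz Hz'. eapply Sums_ext; [|apply (Sums_prod (fun i => etat i z) (fun j => Cconj (etat j z')) (eta z) (Cconj (eta z')) ((1 + / (2 * PI * Im z)) * 18) ((1 + / (2 * PI * Im z')) * 18) (bnd_etat z Hz))].
 2:{ eapply bnd_le; [|apply (bnd_etat z' Hz')]. intros i. rewrite Cmod_conj. auto. } 2: apply (eta_spec z Hz). 2: apply Sums_conj, (eta_spec z' Hz'). intros . unfold etat, EE. rewrite Cmult_conj, sg_conj. ring.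
Qed.
(** The reflection i -> -1 - i preserves (6i + 3)^2 and reverses the sign (-1)^i, so the terms
    cancel in pairs. *)
Lemma Sums_odd3 z z' : inH z -> inH z' ->
 Sums (fun p : Z * Z => (sg (fst p) * sg (snd p) * EE z z' (6 * fst p + 3) (6 * snd p + 3))%C) 0.
 intros Hz Hz'. set (u := fun z i => (sg i * ee (RtoC (IZR (6 * i + 3) ^ 2) * z))%C).
 assert (Hu : forall z, inH z -> bnd (fun i => Cmod (u z i)) ((1 + / (2 * PI * Im z)) * 18)) by (intros w Hw; eapply bnd_le; [|apply (bnd_theta_aff 6 3 (Im w) Hw); lia]; intros i; unfold u; rewrite Cmod_mult, Cmod_sg, Cmod_ee_c; lra).
 assert (H0 : Sums (u z) 0).
 { destruct (Sums_ex _ _ (Hu z Hz)) as [s Hs]. assert (Hs' : Sums (u z) (- s)).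
  { apply Sums_opp in Hs. apply (Sums_reindex (fun i => (- 1 - i)%Z) (fun i => (- 1 - i)%Z)) in Hs; [|lia|lia]. eapply Sums_ext; [|eauto]. intros i. unfold u.
   replace (IZR (6 * (-1 - i) + 3) ^ 2) with (IZR (6 * i + 3) ^ 2); [rewrite (sg_par (-1 - i) (i + 1) (- 1 - i)), sg_plus, sg_1; ring|rewrite !plus_IZR, !mult_IZR, minus_IZR; ring]. }
  have Sums_unique _ _ _ Hs Hs' as E. assert (s = 0) as ->; [|auto]. replace s with (/ 2 * (s - - s))%C by field. rewrite <- E. ring. } eapply Sums_eq.
 - eapply Sums_ext; [|apply (Sums_prod (u z) (fun j => Cconj (u z' j)) 0 (Cconj (tsum (u z'))) ((1 + / (2 * PI * Im z)) * 18) ((1 + / (2 * PI * Im z')) * 18) (Hu z Hz))].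
  + intros . unfold u, EE. rewrite Cmult_conj, sg_conj. ring.
  + eapply bnd_le; [|auto]. intros i. rewrite Cmod_conj. auto.
  + auto.
  + apply Sums_conj. eapply tsum_HasSum, Hu, Hz'.
 - ring.
Qed.
(** Poisson summation row by row. Of the three residue classes two contribute
    [eta z * conj (eta (zr r z))] each and the third cancels, which turns the factor 4 of the dual
    rows into 8. *)
Theorem Theta_identity r z : inH z -> 0 <= r < 1 ->
 Sums (thT r z) (RtoC (8 * sqrt (Im z / (1 - r))) * (eta z * Cconj (eta (zr r z))))%C.
 intros Hz Hr. have zr_inH r z Hz Hr as Hzr. set (z' := zr r z). set (h := fun p : Z * Z => (RtoC (4 * sqrt (Im z / (1 - r))) * (sg (fst p) * EE z z' (2 * fst p + 2 * snd p - 1) (4 * fst p - 2 * snd p + 1)))%C).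
 assert (Hh : Sums h (RtoC (8 * sqrt (Im z / (1 - r))) * (eta z * Cconj (eta z')))).
 { replace (RtoC (8 * sqrt (Im z / (1 - r))) * (eta z * Cconj (eta z')))%C with (RtoC (4 * sqrt (Im z / (1 - r))) * (eta z * Cconj (eta z') + eta z * Cconj (eta z') + - 0))%C by cring.
  apply Sums_scal, (Sums_reindex_back unfold3 fold3 _ _ unfold3_K fold3_K). apply Sums_sum; [apply Sums_sum|].
  - sum_ext (Sums_eta2 z z' Hz Hzr). intros [i j]. cbn [unfold3 fst snd]. rewrite <- sg_plus, (sg_par (i - j) (i + j) (- j)) by lia. f_equal. apply EE_par; lia.
  - sum_ext (Sums_eta2 z z' Hz Hzr). intros [i j]. cbn [unfold3 fst snd]. rewrite <- sg_plus, (sg_par (j - i) (i + j) (- i)) by lia. f_equal. apply EE_par; lia.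
  - eapply Sums_ext; [|apply Sums_opp, (Sums_odd3 z z' Hz Hzr)]. intros [i j]. cbn [unfold3 fst snd].
   rewrite <- sg_plus, (sg_plus (i + j) 1), sg_1, (EE_par z z' (2 * (i + j + 1) + 2 * (2 * i - j + 1) - 1) (4 * (i + j + 1) - 2 * (2 * i - j + 1) + 1) (6 * i + 3) (6 * j + 3)) by lia. ring. }
 destruct (bnd_thT r z Hz Hr) as [K HK]. destruct (Sums_ex _ _ HK) as [S HS]. eapply Sums_eq; [eauto|]. have Sums_fubini _ _ _ HS (fun n => thT_row r z n Hz Hr). have Sums_fubini _ _ _ Hh (fun n => thT_row_dual r z n Hz Hr).
 eapply Sums_unique; [eauto|auto].
Qed.
(** A Gaussian at the points 24 n z + (2k - 1) of the lattice, with 24th roots of unity as phases.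
    It is the Poisson dual of the double series [theta * conj eta]. *)
Definition thE (z : C) (p : Z * Z) : C :=
 polar (- (PI / (576 * Im z)) * ((24 * IZR (fst p) * Re z + IZR (2 * snd p - 1)) ^ 2 + (24 * IZR (fst p) * Im z) ^ 2)) (IZR ((2 * snd p - 1) * (2 - fst p)) / 24).
(** With n = a + 6j + 1 in place of the index a of [theta], the terms at fixed n form a Gaussian in
    j with parameter t = 144 Im z, to which Poisson summation applies. *)
Lemma thE_spec z : inH z -> Sums (thE z) (RtoC (12 * sqrt (Im z)) * (theta z * Cconj (eta z)))%C.
 intros Hz. assert (Hy : 0 < Im z) by exact Hz. set (t := 144 * Im z). assert (Ht : 0 < t) by (unfold t; lra). assert (Hs : 12 * sqrt (Im z) = sqrt t).
 { unfold t. replace 144 with (12 ^ 2) by ring. rewrite sqrt_mult by lra. f_equal. symmetry. apply sqrt_pow2. lra. } assert (Hst : 0 < sqrt t) by now apply sqrt_lt_R0.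
 assert (Hprod : Sums (fun p : Z * Z => (sg (snd p) * EE z z (fst p - 6 * snd p - 1) (6 * snd p + 1))%C) (theta z * Cconj (eta z))).
 { assert (H : Sums (fun p : Z * Z => (ee (RtoC (IZR (fst p) ^ 2) * z) * Cconj (etat (snd p) z))%C) (theta z * Cconj (eta z))).
  { apply (Sums_prod (fun a : Z => ee (RtoC (IZR a ^ 2) * z)) (fun j => Cconj (etat j z)) _ _ ((1 + / (2 * PI * Im z)) * 18) ((1 + / (2 * PI * Im z)) * 18) (bnd_thetat z Hz)).
   - eapply bnd_le; [|apply (bnd_etat z Hz)]. intros i. rewrite Cmod_conj. auto.
   - apply theta_spec, Hz.
   - apply Sums_conj, eta_spec, Hz. } apply (Sums_reindex (fun p : Z * Z => (fst p - 6 * snd p - 1, snd p)%Z) (fun p : Z * Z => (fst p + 6 * snd p + 1, snd p)%Z)) in H.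
  - eapply Sums_ext; [|eauto]. intros . cbn [fst snd]. unfold EE, etat. rewrite Cmult_conj, sg_conj. ring.
  - intros. cring.
  - intros. cring. } set (xi := fun n : Z => (2 - IZR n) / 12). set (b := fun n : Z => 1 / 2 - 12 * IZR n * Re z). set (row := fun n : Z => (polar (- PI * IZR n ^ 2 * Im z) (- xi n / 2) * gaussF t (b n) (xi n))%C).
 assert (R1 : forall n : Z, Sums (fun j : Z => (sg j * EE z z (n - 6 * j - 1) (6 * j + 1))%C) (row n)).
 { intros n. eapply Sums_ext; [|apply Sums_scal, (gaussF_spec t (b n) (xi n) Ht)]. intros j. cbv beta. change (gauss t (b n) (IZR j + xi n)) with (polar (- (PI * t) * (IZR j + xi n) ^ 2) ((IZR j + xi n) * b n)). unfold sg.
  rewrite EE_polar, !polar_mult, !minus_IZR, plus_IZR, mult_IZR. apply polar_eq; unfold t, b, xi; field. } assert (R2 : forall n : Z, Sums (fun k : Z => (RtoC (/ sqrt t) * thE z (n, k))%C) (row n)).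
 { intros n. unfold row. rewrite poisson_gauss by auto. match goal with |- Sums _ (?A * (?B * ?D)) => replace (A * (B * D))%C with (B * (A * D))%C by ring end. apply Sums_scal.
  eapply Sums_ext; [|apply Sums_scal, (dualF_spec t (b n) (xi n) Ht)]. intros k. cbv beta. change (exp (- (PI / t) * (IZR k - b n) ^ 2) * ee (RtoC (xi n * IZR k)))%C with (polar (- (PI / t) * (IZR k - b n) ^ 2) (xi n * IZR k)). unfold thE.
  rewrite polar_mult. cbn [fst snd]. rewrite mult_IZR, !minus_IZR, mult_IZR. apply polar_eq; unfold t, b, xi; field. lra. } assert (Hbnd : exists K, bnd (fun p => Cmod (thE z p)) K).
 { assert (H1 : 0 < PI / t) by pos. assert (H2 : 0 < PI * Im z) by pos. eexists. eapply bnd_le; [|apply (bnd2_gauss _ _ (fun n => 12 * Re z * IZR n - 1 / 2) H1 H2)]. intros. unfold thE. rewrite Cmod_polar. right. f_equal.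
  rewrite minus_IZR, mult_IZR. unfold t. field. lra. } destruct Hbnd as [K HK]. destruct (Sums_ex _ _ HK) as [S HS]. have Sums_fubini _ _ _ Hprod R1 as F1.
 have Sums_fubini _ _ _ (Sums_scal (RtoC (/ sqrt t)) _ _ HS) R2 as F2. have Sums_unique _ _ _ F1 F2 as E. rewrite E, Hs, Cmult_assoc, <- RtoC_mult, Rinv_r, Cmult_1_l by lra. auto.
Qed.

(** * The principal congruence group of level 576 and the laws of moduli *)

Definition Gam (a b c d : Z) : Prop :=
 (a * d - b * c = 1 /\ exists a' b' c' d', a = 1 + 576 * a' /\ b = 576 * b' /\ c = 576 * c' /\ d = 1 + 576 * d')%Z.
Lemma jfac_neq_0 a b c d z : (a * d - b * c = 1)%Z -> inH z -> jfac c d z <> 0.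
 unfold inH. destruct z as []. cbn. intros Hd Hy E. injection E as E1 E2. assert (Hc : IZR c = 0) by nra. rewrite Hc in E1. assert (Hdd : IZR d = 0) by lra. apply eq_IZR in Hc. apply eq_IZR in Hdd. lia.
Qed.
Lemma mob_jfac a b c d z : (a * d - b * c = 1)%Z -> inH z ->
 (mob a b c d z * jfac c d z)%C = (RtoC (IZR a) * z + RtoC (IZR b))%C.
 intros Hd Hz. unfold mob. fold (jfac c d z). field. now apply (jfac_neq_0 a b). Qed.
Lemma Im_div (u v : C) : v <> 0 -> Im (u * / v)%C = Im (u * Cconj v)%C / Cmod v ^ 2.
 rewrite Cmod2_alt. destruct u as [], v as []. simpl; lra. Qed.
Lemma mob_Im a b c d z : (a * d - b * c = 1)%Z -> inH z -> Im (mob a b c d z) = Im z / Cmod (jfac c d z) ^ 2.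
 intros Hd Hz. have jfac_neq_0 a b c d z Hd Hz. apply (f_equal IZR) in Hd. rewrite minus_IZR, !mult_IZR in Hd. unfold mob. rewrite Im_div by auto.
 f_equal. destruct z as [x y]. unfold Im; simpl. transitivity ((IZR a * IZR d - IZR b * IZR c) * y); [ring|rewrite Hd; ring].
Qed.
Lemma mob_inH a b c d z : (a * d - b * c = 1)%Z -> inH z -> inH (mob a b c d z).
 intros Hd Hz. unfold inH. rewrite mob_Im by auto. apply Rdiv_lt_0_compat; [auto|]. apply pow_lt, Cmod_gt_0. now apply (jfac_neq_0 a b). Qed.
Lemma Xy_mob a b c d z : (a * d - b * c = 1)%Z -> inH z -> Xy (mob a b c d z) = Xy z * Cmod (jfac c d z) ^ 2.
 intros Hd Hz. unfold Xy. rewrite mob_Im by auto. have jfac_neq_0 a b c d z Hd Hz as HJ. apply Cmod_gt_0 in HJ. unfold inH in Hz. field. lra. Qed.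
(* Action of [(a b; c d)] with [c = 24 c'] on the coordinates [(n, m)] of the lattice point [24 n z + m]. *)
Definition latmap (a b c' d : Z) (p : Z * Z) : Z * Z :=
 (a * fst p + c' * snd p, 24 * b * fst p + d * snd p)%Z.
Lemma latmap_inv a b c' d p : (a * d - b * (24 * c') = 1)%Z -> latmap d (- b) (- c') a (latmap a b c' d p) = p.
 intros H. destruct p as [n m]. unfold latmap. cbn [fst snd]. f_equal.
 - replace (d * (a * n + c' * m) + - c' * (24 * b * n + d * m))%Z with ((a * d - b * (24 * c')) * n)%Z by ring. rewrite H; ring.
 - replace (24 * - b * (a * n + c' * m) + a * (24 * b * n + d * m))%Z with ((a * d - b * (24 * c')) * m)%Z by ring. rewrite H; ring.
Qed.
Lemma lw_mob a b c' d z p : (a * d - b * (24 * c') = 1)%Z -> inH z ->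
 lw (mob a b (24 * c') d z) p = (lw z (latmap a b c' d p) / jfac (24 * c') d z)%C.
 intros Hd Hz. have jfac_neq_0 a b (24 * c') d z Hd Hz. assert (E : (mob a b (24 * c') d z * jfac (24 * c') d z = IZR a * z + IZR b)%C) by now apply mob_jfac. destruct p as [n m]. unfold lw, latmap. cbn [fst snd].
 replace (RtoC (24 * IZR n) * mob a b (24 * c') d z + IZR m)%C with ((RtoC (24 * IZR n) * (mob a b (24 * c') d z * jfac (24 * c') d z) + IZR m * jfac (24 * c') d z) / jfac (24 * c') d z)%C by (field; auto).
 rewrite E. f_equal. unfold jfac. rewrite !plus_IZR, !mult_IZR, !RtoC_mult, !RtoC_plus, !RtoC_mult. ring.
Qed.
Lemma Cmod2_conj' (w : C) : RtoC (Cmod w ^ 2) = (w * Cconj w)%C.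
 apply Cmod2_conj. Qed.
Lemma leps_par n m n' m' A B : (n' = n + 2 * A)%Z -> (m' = m + 2 * B)%Z -> leps (n', m') = leps (n, m).
 intros -> ->. unfold leps. cbn [fst snd]. apply sg_par with (k := (A + B + n * B + m * A + 2 * A * B)%Z). ring. Qed.
(** The level 576 is 24^2: one factor 24 is used up by the passage from c to c / 24, and the
    quotient is still even, so that the action on coordinates is trivial modulo 2. *)
Lemma leps_latmap a b c d p : Gam a b c d -> leps (latmap a b (c / 24) d p) = leps p.
 intros [_ [a' [b' [c' [d' [-> [-> [-> ->]]]]]]]]. destruct p as [n m]. unfold latmap. cbn [fst snd]. replace (576 * c' / 24)%Z with (24 * c')%Z by (replace (576 * c')%Z with (24 * c' * 24)%Z by ring; now rewrite Z.div_mul).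
 apply (leps_par _ _ _ _ (288 * a' * n + 12 * c' * m) (12 * 576 * b' * n + 288 * d' * m)); ring.
Qed.
Lemma Gam_c a b c d : Gam a b c d -> c = (24 * (c / 24))%Z /\ (a * d - b * (24 * (c / 24)) = 1)%Z /\ (a * d - b * c = 1)%Z.
 intros [H [a' [b' [c' [d' [Ha [Hb [Hc Hd]]]]]]]]. assert (E : c = (24 * (c / 24))%Z) by (rewrite Hc; replace (576 * c')%Z with (24 * c' * 24)%Z by ring; rewrite Z.div_mul; lia). lia.
Qed.
Lemma Sums_latmap a b c d (f : Z * Z -> C) s : Gam a b c d -> Sums f s -> Sums (fun p => f (latmap a b (c / 24) d p)) s.
 intros HG. destruct (Gam_c a b c d HG) as []. apply (Sums_reindex _ (latmap d (- b) (- (c / 24)) a)); [intros p; now apply latmap_inv|intros p; have latmap_inv d (- b) (- (c / 24)) a p as Q; rewrite !Z.opp_involutive in Q; apply Q; lia].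
Qed.
Lemma Theta0_spec z : inH z -> Sums (thT 0 z) (RtoC (8 * sqrt (Im z)) * (eta z * Cconj (eta z)))%C.
 intros Hz. eapply Sums_eq; [apply (Theta_identity 0 z Hz); lra|]. replace (zr 0 z) with z by (unfold zr; destruct z; simpl; f_equal; field). do 3 f_equal. f_equal. field.
Qed.
Lemma thT0_eq z p : thT 0 z p = (leps p * RtoC (exp (- (Xy z * Cmod (lw z p) ^ 2))))%C.
 unfold thT. f_equal. rewrite <- cexp_real. f_equal. rewrite RtoC_opp, RtoC_mult, Cmod2_conj'. ring. Qed.
Lemma Xw_mob a b c d z p : Gam a b c d -> inH z ->
 Xy (mob a b c d z) * Cmod (lw (mob a b c d z) p) ^ 2 = Xy z * Cmod (lw z (latmap a b (c / 24) d p)) ^ 2.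
 intros HG Hz. destruct (Gam_c a b c d HG) as [Ec [Hd Hd']]. have jfac_neq_0 a b c d z Hd' Hz as HJ. rewrite Xy_mob, Ec, lw_mob, <- Ec, Cmod_div by auto. apply Cmod_gt_0 in HJ. field. lra.
Qed.
Lemma sqrt_mob a b c d z : (a * d - b * c = 1)%Z -> inH z ->
 sqrt (Im (mob a b c d z)) * Cmod (jfac c d z) = sqrt (Im z).
 intros Hd Hz. rewrite mob_Im by auto. have jfac_neq_0 a b c d z Hd Hz as HJ. apply Cmod_gt_0 in HJ. rewrite sqrt_div by pos. rewrite sqrt_pow2 by lra. field. lra.
Qed.
(** At r = 0 the summand depends only on X |w|^2 and a parity sign, and the group permutes the
    lattice points. Comparing the factors sqrt (Im z) leaves |J|. Only the modulus of [eta] is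
    controlled at this point. *)
Lemma eta_mob_mod a b c d z : Gam a b c d -> inH z ->
 (eta (mob a b c d z) * Cconj (eta (mob a b c d z)))%C = (RtoC (Cmod (jfac c d z)) * (eta z * Cconj (eta z)))%C.
 intros HG Hz. destruct (Gam_c a b c d HG) as [Ec [Hd Hd']]. have mob_inH a b c d z Hd' Hz as Hmz. have Theta0_spec _ Hmz as H1. have Sums_latmap a b c d _ _ HG (Theta0_spec z Hz).
 assert (E : (RtoC (8 * sqrt (Im (mob a b c d z))) * (eta (mob a b c d z) * Cconj (eta (mob a b c d z))))%C =
   (RtoC (8 * sqrt (Im z)) * (eta z * Cconj (eta z)))%C) by (eapply Sums_unique; [exact H1|]; eapply Sums_ext; [|eauto]; intros p; rewrite !thT0_eq, leps_latmap, Xw_mob; auto).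
 rewrite <- (sqrt_mob a b c d z Hd' Hz) in E. assert (Hs : 0 < sqrt (Im (mob a b c d z))) by pos. assert (Hn : RtoC (8 * sqrt (Im (mob a b c d z))) <> 0) by cnz.
 replace (8 * (sqrt (Im (mob a b c d z)) * Cmod (jfac c d z))) with (8 * sqrt (Im (mob a b c d z)) * Cmod (jfac c d z)) in E by ring.
 set (s := 8 * sqrt (Im (mob a b c d z))) in *. rewrite RtoC_mult in E. set (e := (eta (mob a b c d z) * Cconj (eta (mob a b c d z)))%C) in *. replace e with (/ s * (s * e))%C by (field; auto). rewrite E. field. auto.
Qed.
Definition thmap (a b c' d' : Z) (p : Z * Z) : Z * Z :=
 (a * fst p + c' * (2 * snd p - 1), 12 * b * fst p + (1 + 576 * d') * snd p - 288 * d')%Z.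
(** The numerator of the phase changes by a multiple of 24; this is where the second factor 24 of
    the level is used. *)
Lemma thE_mob a b c' d' z p : (a * (1 + 576 * d') - b * (576 * c') = 1)%Z -> (exists a' b', a = 1 + 576 * a' /\ b = 576 * b')%Z ->
 inH z -> thE (mob a b (576 * c') (1 + 576 * d') z) p = thE z (thmap a b (24 * c') d' p).
 intros Hd [a' [b' ]] Hz. set (d := (1 + 576 * d')%Z). replace (576 * c')%Z with (24 * (24 * c'))%Z in * by ring. have jfac_neq_0 a b _ d z Hd Hz as HJ. have lw_mob as Hl.
 assert (HE : forall z p, thE z p = polar (- (PI / (576 * Im z)) * Cmod (lw z (fst p, 2 * snd p - 1)%Z) ^ 2) (IZR ((2 * snd p - 1) * (2 - fst p)) / 24)) by (intros w q; rewrite Cmod2_alt, lw_Re, lw_Im; auto).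
 rewrite !HE, Hl, Cmod_div, mob_Im by auto. set (k := ((2 * snd p - 1) * (2 - fst p) - (2 * snd (thmap a b (24 * c') d' p) - 1) * (2 - fst (thmap a b (24 * c') d' p)))%Z). assert (Hk : exists k', k = (24 * k')%Z).
 { unfold k, thmap. destruct p as [n M]. cbn [fst snd]. set (A := (24 * a' * n + c' * (2 * M - 1))%Z). set (B := (576 * b' * n + 24 * d' * (2 * M - 1))%Z). exists ((2 * M - 1) * A - B * (2 - n) + 24 * B * A)%Z. lia. }
 destruct Hk as [k' Hk]. apply polar_eqZ with (k := k').
 - have HJ as HJ'. apply Cmod_gt_0 in HJ'. unfold inH in Hz. replace (latmap a b (24 * c') d (fst p, (2 * snd p - 1)%Z)) with
   (fst (thmap a b (24 * c') d' p), (2 * snd (thmap a b (24 * c') d' p) - 1)%Z); [field; lra|unfold latmap, thmap, d; cbn [fst snd]; f_equal; ring].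
 - assert (E : IZR ((2 * snd p - 1) * (2 - fst p)) = IZR k + IZR ((2 * snd (thmap a b (24 * c') d' p) - 1) * (2 - fst (thmap a b (24 * c') d' p)))) by (rewrite <- plus_IZR; f_equal; lia). rewrite E, Hk, mult_IZR. field.
Qed.
(** Together with the law of [eta * conj eta], this shows that [theta] and [eta] have the same
    multiplier on the group, so the multiplier can be computed on [theta]. *)
Lemma theta_eta_mob a b c d z : Gam a b c d -> inH z ->
 (theta (mob a b c d z) * Cconj (eta (mob a b c d z)))%C = (RtoC (Cmod (jfac c d z)) * (theta z * Cconj (eta z)))%C.
 intros HG Hz. destruct (Gam_c a b c d HG) as [Ec [Hd Hd']]. have mob_inH a b c d z Hd' Hz as Hmz. have thE_spec _ Hmz as H1. have thE_spec z Hz as H2.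
 assert (E : (RtoC (12 * sqrt (Im (mob a b c d z))) * (theta (mob a b c d z) * Cconj (eta (mob a b c d z))))%C = (RtoC (12 * sqrt (Im z)) * (theta z * Cconj (eta z)))%C).
 { eapply Sums_unique; [exact H1|]. destruct HG as [_ [a' [b' [c' [d' [Ha [Hb [Hc Hdd]]]]]]]]. apply (Sums_reindex (thmap a b (24 * c') d') (fun p => ((1 + 576 * d') * fst p - 24 * c' * (2 * snd p - 1),
   - 12 * b * fst p + a * snd p - 288 * a')%Z)) in H2.
  - eapply Sums_ext; [|eauto]. rewrite Hc, Hdd. symmetry. apply thE_mob; [lia|eauto| auto].
  - intros [n M]. unfold thmap. cbn [fst snd]. rewrite Hc, Hdd in Hd'. subst a b. f_equal.
   + transitivity (((1 + 576 * a') * (1 + 576 * d') - 576 * b' * (576 * c')) * n)%Z; [ring|rewrite Hd'; ring].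
   + apply Z.mul_reg_l with 2%Z; [lia|]. transitivity (((1 + 576 * a') * (1 + 576 * d') - 576 * b' * (576 * c')) * (2 * M - 1) + 1)%Z; [ring|rewrite Hd'; ring].
  - intros [n M]. unfold thmap. cbn [fst snd]. rewrite Hc, Hdd in Hd'. subst a b. f_equal.
   + transitivity (((1 + 576 * a') * (1 + 576 * d') - 576 * b' * (576 * c')) * n)%Z; [ring|rewrite Hd'; ring].
   + apply Z.mul_reg_l with 2%Z; [lia|]. transitivity (((1 + 576 * a') * (1 + 576 * d') - 576 * b' * (576 * c')) * (2 * M - 1) + 1)%Z; [ring|rewrite Hd'; ring]. }
 rewrite <- (sqrt_mob a b c d z Hd' Hz) in E. assert (Hs : 0 < sqrt (Im (mob a b c d z))) by pos. assert (Hn : RtoC (12 * sqrt (Im (mob a b c d z))) <> 0) by cnz.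
 replace (12 * (sqrt (Im (mob a b c d z)) * Cmod (jfac c d z))) with (12 * sqrt (Im (mob a b c d z)) * Cmod (jfac c d z)) in E by ring.
 set (s := 12 * sqrt (Im (mob a b c d z))) in *. rewrite RtoC_mult in E. set (e := (theta (mob a b c d z) * Cconj (eta (mob a b c d z)))%C) in *. replace e with (/ s * (s * e))%C by (field; auto). rewrite E. field. auto.
Qed.

(** * Partitions and Dyson's bijection *)

Open Scope nat_scope.
Definition lsum (l : list nat) : nat := fold_right Nat.add 0 l.
Definition pos_sorted (l : list nat) : Prop := List.Forall (fun p : nat => 0 < p) l /\ Sorted ge l.
Lemma pos_sorted_cons x t : pos_sorted (x :: t) <-> 0 < x /\ hd 0 t <= x /\ pos_sorted t.
 split.
 - intros [H1 H2]. inversion H1; inversion H2. repeat split; auto. destruct t; simpl; [lia|]. match goal with H : HdRel _ _ _ |- _ => inversion H; lia end.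
 - intros [H1 [H2 []]]. split; constructor; auto. destruct t; constructor. auto.
Qed.
Lemma pos_sorted_nil : pos_sorted [].
 easy. Qed.
Lemma parts_aux_spec f : forall n b l, n <= f ->
 (In l (parts_aux f n b) <-> pos_sorted l /\ lsum l = n /\ hd 0 l <= b).
 assert (Hnil : forall n b l, n = 0 -> In l [[]] <-> pos_sorted l /\ lsum l = n /\ hd 0 l <= b) by (split; [intros [<-|[]]; split; [easy|simpl; lia]|intros [H1 [H2 _]]; destruct l as [|]; [now left|]; apply pos_sorted_cons in H1; simpl in H2; lia]).
 induction f; intros n b l Hn; [assert (n = 0) by lia; subst; auto|]. simpl. destruct (Nat.eqb_spec n 0) as [|]; [auto|]. rewrite in_flat_map. split.
 + intros [p [Hp Hl]]. apply in_seq in Hp. apply in_map_iff in Hl. destruct Hl as [t [<- Ht]]. apply IHf in Ht; [|lia]. rewrite pos_sorted_cons. simpl. intuition lia.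
 + intros [H1 [H2 H3]]. destruct l as [|x t]; [simpl in H2; lia|]. apply pos_sorted_cons in H1. simpl in H2, H3. exists x. split; [apply in_seq; lia|apply in_map; apply IHf; intuition lia].
Qed.
Lemma parts_aux_NoDup f : forall n b, NoDup (parts_aux f n b).
 induction f; intros n b; simpl; destruct (Nat.eqb n 0); try (repeat constructor; tauto). assert (H : forall L, NoDup L -> NoDup (flat_map (fun p => map (cons p) (parts_aux f (n - p) p)) L)).
 { induction L as [|]; intros HL; [constructor|]. inversion HL; subst. apply NoDup_app.
  - apply FinFun.Injective_map_NoDup; auto. congruence.
  - auto.
  - intros l H1' H2'. apply in_map_iff in H1'. destruct H1' as [t [<- _]]. apply in_flat_map in H2'. destruct H2' as [p [Hp Hl]]. apply in_map_iff in Hl. destruct Hl as [t' [E _]]. injection E as -> _. auto. } apply H, seq_NoDup.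
Qed.
Lemma partitions_spec n l : In l (partitions n) <-> pos_sorted l /\ lsum l = n.
 unfold partitions. rewrite parts_aux_spec by lia. split; [tauto|]. intros []. split; [auto|]. destruct l; simpl in *; lia. Qed.
Lemma partitions_NoDup n : NoDup (partitions n).
 apply parts_aux_NoDup. Qed.
Lemma length_bij {A B} (l1 : list A) (l2 : list B) (f : A -> B) (g : B -> A) : NoDup l1 -> NoDup l2 ->
 (forall x, In x l1 -> In (f x) l2 /\ g (f x) = x) -> (forall y, In y l2 -> In (g y) l1 /\ f (g y) = y) -> length l1 = length l2.
 intros N1 N2 H1 H2. rewrite <- (length_map f l1). apply Permutation_length, NoDup_Permutation; auto.
 - apply NoDup_map_NoDup_ForallPairs; auto. intros x y Hx Hy E. rewrite <- (proj2 (H1 x Hx)), <- (proj2 (H1 y Hy)). now f_equal.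
 - intros y. rewrite in_map_iff. split; [intros [x [<- Hx]]; now apply H1|intros Hy; exists (g y); destruct (H2 y Hy); auto].
Qed.
Definition npart (n : nat) : nat := length (partitions n).
Definition nrank_ge (m : Z) (n : nat) : nat := length (filter (fun l => Z.leb m (rank l)) (partitions n)).
Definition nrank_le (m : Z) (n : nat) : nat := length (filter (fun l => Z.leb (rank l) m) (partitions n)).
Lemma nrank_ge_le m n : nrank_ge m n + nrank_le (m - 1) n = npart n.
 unfold nrank_le, npart. rewrite <- (filter_length (fun l => Z.leb m (rank l)) (partitions n)). f_equal. f_equal. apply filter_ext. lia. Qed.
Lemma nrank_ge_npart m n : nrank_ge m n <= npart n.
 have nrank_ge_le m n. lia. Qed.
Lemma nrank_le_npart m n : nrank_le m n <= npart n.
 have nrank_ge_le (m + 1) n. replace (m + 1 - 1)%Z with m in H by ring. lia. Qed.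
(** A column of height h placed in front of the Ferrers diagram of r, meaningful for length r <= h;
    [dropcol] removes the first column again. *)
Definition addcol (h : nat) (r : list nat) : list nat := map S r ++ repeat 1 (h - length r).
Definition dropcol (l : list nat) : list nat := filter (fun x => Nat.ltb 0 x) (map pred l).
Lemma lsum_cons x l : lsum (x :: l) = x + lsum l.
 auto. Qed.
Lemma lsum_app l m : lsum (l ++ m) = lsum l + lsum m.
 induction l; [auto|]. cbn [app]. rewrite !lsum_cons. lia. Qed.
Lemma lsum_repeat1 k : lsum (repeat 1 k) = k.
 induction k; [auto|]. cbn [repeat]. rewrite lsum_cons. lia. Qed.
Lemma lsum_mapS r : lsum (map S r) = lsum r + length r.
 induction r; [auto|]. cbn [map length]. rewrite !lsum_cons. lia. Qed.
Lemma addcol_sum h r : length r <= h -> lsum (addcol h r) = lsum r + h.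
 unfold addcol. rewrite lsum_app, lsum_repeat1, lsum_mapS. lia. Qed.
Lemma addcol_length h r : length r <= h -> length (addcol h r) = h.
 unfold addcol. rewrite length_app, length_map, repeat_length. lia. Qed.
Lemma addcol_hd h r : hd 0 (addcol h r) <= S (hd 0 r).
 destruct r; simpl; [|lia]. destruct h; simpl; lia. Qed.
Lemma pos_sorted_ones k : pos_sorted (repeat 1 k).
 induction k; [easy|]. apply pos_sorted_cons. split; [lia|]. split; [|auto]. destruct k; simpl; lia. Qed.
Lemma addcol_pos_sorted h r : pos_sorted r -> pos_sorted (addcol h r).
 unfold addcol. generalize (h - length r). intros k. induction r as [|]; intros H; [apply pos_sorted_ones|]. apply pos_sorted_cons in H.
 destruct H as [H1 [H2 H3]]. apply pos_sorted_cons. split; [lia|]. split; [|auto]. destruct r; simpl; [destruct k; simpl; lia|simpl in H2; lia].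
Qed.
Lemma dropcol_addcol h r : pos_sorted r -> dropcol (addcol h r) = r.
 intros H. unfold addcol, dropcol. rewrite map_app, filter_app. assert (E2 : filter (fun x => Nat.ltb 0 x) (map pred (repeat 1 (h - length r))) = []) by (generalize (h - length r); induction n; auto). rewrite E2.
 destruct H as [H _]. clear E2. induction r as [|x r IH]; [auto|]. inversion H as [|]. destruct x; [lia|]. cbn. f_equal. auto.
Qed.
Lemma dropcol_len l : length (dropcol l) <= length l.
 unfold dropcol. rewrite filter_length_le, length_map. lia. Qed.
Lemma dropcol_ones l : pos_sorted l -> hd 0 l <= 1 -> dropcol l = [] /\ l = repeat 1 (length l).
 induction l as [|x l IH]; intros H Hh; simpl; auto. apply pos_sorted_cons in H. destruct H as [H1 []]. simpl in Hh. assert (x = 1) by lia. subst. destruct IH as [E1 E2]; auto. now rewrite <- E2.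
Qed.
Lemma addcol_dropcol l : pos_sorted l -> addcol (length l) (dropcol l) = l.
 induction l as [|x l IH]; intros H; [auto|]. have H as H'. apply pos_sorted_cons in H. destruct H as [H1 []]. destruct (Nat.eq_dec x 1) as [->|].
 - destruct (dropcol_ones (1 :: l) H' (le_n 1)) as [E1 E2]. rewrite E1. auto.
 - assert (E : dropcol (x :: l) = pred x :: dropcol l) by (unfold dropcol; simpl; destruct (Nat.ltb_spec 0 (pred x)); [auto|lia]). rewrite E. unfold addcol. simpl. f_equal; [lia|]. auto.
Qed.
Lemma dropcol_hd l : pos_sorted l -> hd 0 (dropcol l) = pred (hd 0 l).
 destruct l as [|x l]; intros H; [auto|]. have H as H'. apply pos_sorted_cons in H.
 destruct (Nat.eq_dec x 1) as [->|]; [destruct (dropcol_ones (1 :: l) H' (le_n 1)) as [E1 E2]; now rewrite E1|unfold dropcol; simpl; destruct (Nat.ltb_spec 0 (pred x)); [auto|lia]].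
Qed.
Lemma dropcol_pos_sorted l : pos_sorted l -> pos_sorted (dropcol l).
 induction l as [|x l IH]; intros H; [auto|]. apply pos_sorted_cons in H. destruct H as [H1 []]. destruct (Nat.eq_dec x 1) as [->|]; [auto|].
 assert (E : dropcol (x :: l) = pred x :: dropcol l) by (unfold dropcol; simpl; destruct (Nat.ltb_spec 0 (pred x)); [auto|lia]). rewrite E. apply pos_sorted_cons. split; [lia|]. split; [|auto]. rewrite dropcol_hd by auto. lia.
Qed.
Lemma dropcol_sum l : pos_sorted l -> lsum (dropcol l) + length l = lsum l.
 intros H. rewrite <- (addcol_dropcol l H) at 3. rewrite addcol_sum; [lia|apply dropcol_len]. Qed.
(* Dyson's adjoint: remove the largest part of a partition of rank at least [m] and add a first column
  that is shorter by [m + 1]; what results has rank at most [m + 2]. *)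
Definition dyson (m : Z) (l : list nat) : list nat := addcol (Z.to_nat (zn (hd 0 l) - m - 1)) (tl l).
Definition undyson (m : Z) (l : list nat) : list nat :=
 match Z.to_nat (zn (length l) + m + 1) with 0 => [] | S x => S x :: dropcol l end.
(** With largest part x, the condition rank >= m says exactly that a column of height x - m - 1 is
    long enough for the remaining parts, and the size changes by - m - 1. The empty partition is
    given largest part 0: for m <= -1 it corresponds to - m - 1 parts equal to 1, which is the first
    branch of [undyson]. *)
Lemma dyson_count (m : Z) (n N : nat) : (zn N = zn n - m - 1)%Z -> (m <> -2)%Z ->
 (m <= -1 \/ 1 <= m \/ 0 < zn n)%Z -> nrank_ge m n = nrank_le (m + 2) N.
 intros HN Hm2 Hm. apply (length_bij _ _ (dyson m) (undyson m)); try apply NoDup_filter, partitions_NoDup.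
 - intros l Hl. apply filter_In in Hl. destruct Hl as [Hp Hr]. apply Z.leb_le in Hr. apply partitions_spec in Hp. destruct Hp as [Hp Hs]. unfold rank in Hr. destruct l as [|x t].
  + simpl in Hr, Hs. unfold dyson. simpl hd. simpl tl. set (h := Z.to_nat (zn 0 - m - 1)). split.
   * apply filter_In. split; [apply partitions_spec; split; [apply addcol_pos_sorted, pos_sorted_nil|]; rewrite addcol_sum by (simpl; lia); simpl; lia|unfold rank; rewrite addcol_length by (simpl; lia); have addcol_hd h []; simpl in H; lia].
   * unfold undyson. rewrite addcol_length by (simpl; lia). replace (Z.to_nat (zn h + m + 1)) with 0 by lia. auto.
  + simpl in Hr, Hs. apply pos_sorted_cons in Hp. destruct Hp as [H1 []]. unfold dyson. simpl hd. simpl tl. set (h := Z.to_nat (zn x - m - 1)). assert (Hlen : length t <= h) by lia. split.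
   * apply filter_In. split; [apply partitions_spec; split; [now apply addcol_pos_sorted|]; rewrite addcol_sum; lia|unfold rank; rewrite addcol_length; have addcol_hd h t; lia].
   * unfold undyson. rewrite addcol_length, dropcol_addcol by auto. replace (Z.to_nat (zn h + m + 1)) with x by lia. destruct x; [lia|auto].
 - intros l Hl. apply filter_In in Hl. destruct Hl as [Hp Hr]. apply partitions_spec in Hp. destruct Hp as [Hp Hs]. unfold rank in Hr. have dropcol_sum l Hp as Hds. have dropcol_len l. have dropcol_hd l Hp. unfold undyson.
  destruct (Z.to_nat (zn (length l) + m + 1)) as [|x] eqn:Ex.
  + assert (Hh1 : hd 0 l <= 1) by lia. destruct (dropcol_ones l Hp Hh1) as [E1 E2]. rewrite E1 in Hds. simpl in Hds.
   split; [apply filter_In; split; [apply partitions_spec; split; [easy|]|]; unfold rank; simpl; lia|unfold dyson; simpl; replace (Z.to_nat (- m - 1)) with (length l) by lia; unfold addcol; rewrite Nat.sub_0_r; auto].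
  + split.
   * apply filter_In. split; [apply partitions_spec; split; [apply pos_sorted_cons; split; [lia|]; split; [lia|]; now apply dropcol_pos_sorted|simpl; lia]|apply Z.leb_le; unfold rank; cbn [hd length]; lia].
   * unfold dyson. cbn [hd tl]. replace (Z.to_nat (zn (S x) - m - 1)) with (length l) by lia. now apply addcol_dropcol.
Qed.
Lemma nrank_ge_rec m n : 1 <= m -> nrank_ge (zn m) (S m + n) = nrank_le (zn m + 2) n.
 intros Hm. apply dyson_count; lia. Qed.
Lemma nrank_ge_small m n : 1 <= m -> n < S m -> nrank_ge (zn m) n = 0.
 intros Hm Hn. apply length_zero_iff_nil. destruct filter as [|] eqn:E; auto. assert (Hl : In l (filter (fun l => (zn m <=? rank l)%Z) (partitions n))) by (rewrite E; now left). apply filter_In in Hl. destruct Hl as [Hp Hr].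
 apply Z.leb_le in Hr. apply partitions_spec in Hp. unfold rank in Hr. destruct l as [|]; simpl in *; [lia|]. lia.
Qed.
Lemma nrank_le_rec s n : 1 <= s -> nrank_le (- zn s) (S s + n) = nrank_ge (- zn s - 2) n.
 symmetry. replace (- zn s)%Z with (- zn s - 2 + 2)%Z at 2 by ring. apply dyson_count; lia. Qed.
Lemma nrank_le_small s n : 1 <= s -> n < S s -> nrank_le (- zn s) n = 0.
 intros Hm Hn. apply length_zero_iff_nil. destruct filter as [|] eqn:E; auto. assert (Hl : In l (filter (fun l => (rank l <=? - zn s)%Z) (partitions n))) by (rewrite E; now left). apply filter_In in Hl. destruct Hl as [Hp Hr].
 apply Z.leb_le in Hr. apply partitions_spec in Hp. destruct Hp as [Hp Hsum]. unfold rank in Hr. have dropcol_sum l Hp. destruct l as [|]; [simpl in *; lia|]. apply pos_sorted_cons in Hp. simpl in Hr, Hsum, H. lia.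
Qed.
Lemma nrank_ge0_rec n : nrank_ge 0 (S n) = nrank_le 2 n.
 apply dyson_count; lia. Qed.
Close Scope nat_scope.

(** * Generating functions of ranks and the pentagonal number theorem *)

Lemma Sums_inj {I J} (phi : J -> I) (g : I -> C) s : (forall x y, phi x = phi y -> x = y) ->
 (forall i, (forall j, phi j <> i) -> g i = 0) -> Sums (fun j => g (phi j)) s -> Sums g s.
 intros Hinj H0 Hs eps He. destruct (Hs eps He) as [l0 Hl0]. exists (map phi l0). intros l Hl Hi. assert (HL : exists l', NoDup l' /\ (forall j, In j l' <-> In (phi j) l) /\ Csum g l = Csum (fun j => g (phi j)) l').
 { clear Hi Hl0. induction l as [|i l IH]; [exists []; split; [constructor|]; easy|]. inversion Hl as [|? ? Hn Hl']. destruct (IH Hl') as [l' [N' [I' S']]]. destruct (classic (exists j, phi j = i)) as [[j <-]|].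
  + exists (j :: l'). split; [constructor; auto; now rewrite I'|]. split; [intros k; simpl; rewrite I'; split; [intros [->|]; auto|]; intros [|]; auto|rewrite Csum_cons, S'; auto].
  + exists l'. split; auto. split; [intros k; rewrite I'; simpl; split; auto; intros [|]; auto; exfalso; eauto|rewrite Csum_cons, H0, S'; [ring|]; eauto]. }
 destruct HL as [l' [N' [I' S']]]. rewrite S'. apply Hl0; auto. intros j Hj. apply I', Hi, in_map, Hj.
Qed.
Lemma Sums_shift k (f g : nat -> C) s : (forall n, g (k + n)%nat = f n) -> (forall n, (n < k)%nat -> g n = 0) ->
 Sums f s -> Sums g s.
 intros H1 H2 Hf. apply (Sums_inj (fun n => (k + n)%nat)); [lia|intros i Hi; destruct (Nat.lt_ge_cases i k); auto; exfalso; apply (Hi (i - k)%nat); lia|eapply Sums_ext; auto].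
Qed.
Definition pcount (b n : nat) : nat := length (parts_aux n n b).
Lemma pcount_fuel f n b : (n <= f)%nat -> length (parts_aux f n b) = pcount b n.
 intros H. apply Permutation_length, NoDup_Permutation; try apply parts_aux_NoDup. intros l. rewrite !parts_aux_spec by lia. tauto. Qed.
Lemma pcount_S b n : pcount (S b) n = (pcount b n + if Nat.leb (S b) n then pcount (S b) (n - S b) else 0)%nat.
 unfold pcount. destruct n as [|f]; [auto|]. cbn [parts_aux Nat.eqb].
 destruct (Nat.leb_spec (S b) (S f)) as [|]; [rewrite (Nat.min_l (S b)), (Nat.min_l b), seq_S, flat_map_app, length_app by lia; f_equal; cbn; rewrite app_nil_r, length_map; apply pcount_fuel; lia|rewrite !Nat.min_r; lia].
Qed.
Lemma npart_pcount n N : (n <= N)%nat -> npart n = pcount N n.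
 intros H. apply Permutation_length, NoDup_Permutation; try apply parts_aux_NoDup. intros l. unfold partitions. rewrite !parts_aux_spec by lia.
 assert (Hh : (hd 0%nat l <= lsum l)%nat) by (destruct l; [auto|rewrite lsum_cons; simpl; lia]). intuition lia.
Qed.
Lemma Rsum_shift_le k (h : nat -> R) N : (forall n, 0 <= h n) ->
 Rsum (fun n => if Nat.leb k n then h (n - k)%nat else 0) (seq 0 N) <= Rsum h (seq 0 N).
 intros Hh. assert (E : Rsum (fun n => if Nat.leb k n then h (n - k)%nat else 0) (seq 0 N) = Rsum h (seq 0 (N - k))).
 { induction N; [auto|]. rewrite seq_S, Rsum_app, IHN. cbn [Rsum fold_right]. rewrite Nat.add_0_l.
  destruct (Nat.leb_spec k N); [replace (S N - k)%nat with (S (N - k)) by lia; rewrite seq_S, Rsum_app; auto|replace (S N - k)%nat with (N - k)%nat by lia; ring]. } rewrite E.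
 replace (seq 0 N) with (seq 0 (N - k) ++ seq (N - k) (N - (N - k))); [rewrite Rsum_app; have Rsum_nonneg h (seq (N - k) (N - (N - k))) Hh; lra|rewrite <- seq_app; f_equal; lia].
Qed.
(** Induction on the largest allowed part. Allowing the part b + 1 multiplies the series by 1 / (1 -
    r^(b+1)), which is at most exp (r^(b+1) / (1 - r)), and the exponents add up to a geometric
    sum. *)
Lemma pcount_sum_le r b N : 0 <= r < 1 ->
 Rsum (fun n => INR (pcount b n) * r ^ n) (seq 0 N) <= exp (r * (1 - r ^ b) / (1 - r) ^ 2).
 intros Hr. induction b as [|].
 - replace (r * (1 - r ^ 0) / (1 - r) ^ 2) with 0 by lra. rewrite exp_0. destruct N; [simpl; lra|]. rewrite <- cons_seq, Rsum_cons. simpl INR. assert (E2 : Rsum (fun n => INR (pcount 0 n) * r ^ n) (seq 1 N) = 0).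
  { assert (H : forall l, (forall n, In n l -> (1 <= n)%nat) -> Rsum (fun n => INR (pcount 0 n) * r ^ n) l = 0) by (induction l as [|x l IHl]; intros Hl; [auto|]; rewrite Rsum_cons, IHl by (intros; apply Hl; now right); specialize (Hl x (or_introl eq_refl)); destruct x; [lia|]; simpl; lra).
   apply H. intros n Hn. apply in_seq in Hn. lia. } lra.
 - set (T := fun b => Rsum (fun n => INR (pcount b n) * r ^ n) (seq 0 N)). assert (Hpos : forall b n, 0 <= INR (pcount b n) * r ^ n) by (intros; apply Rmult_le_pos; [auto|pos]). assert (Hstep : T (S b) <= T b + r ^ S b * T (S b)).
  { unfold T at 1. rewrite (functional_extensionality (fun n => INR (pcount (S b) n) * r ^ n) (fun n => INR (pcount b n) * r ^ n + r ^ S b * if Nat.leb (S b) n then INR (pcount (S b) (n - S b)) * r ^ (n - S b) else 0)).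
   - rewrite Rsum_plus, Rsum_scal. apply Rplus_le_compat_l. mul_l; [pos|]. apply (Rsum_shift_le (S b) (fun n => INR (pcount (S b) n) * r ^ n)). auto.
   - intros n. rewrite pcount_S, plus_INR. destruct (Nat.leb_spec (S b) n); [replace (r ^ n) with (r ^ S b * r ^ (n - S b)) by (rewrite <- pow_add; f_equal; lia); lra|simpl; lra]. }
  assert (HrS : 0 <= r ^ S b <= r) by (simpl; assert (0 <= r ^ b <= 1) by (split; [pos|rewrite <- (pow1 b); apply pow_incr; lra]); nra).
  set (s := r ^ S b) in *. assert (HT : T (S b) <= T b * / (1 - s)) by (apply Rmult_le_reg_r with (1 - s); [lra|]; rewrite Rmult_assoc, Rinv_l; nra).
  assert (Hinv : / (1 - s) <= exp (s / (1 - r))) by (replace (/ (1 - s)) with (1 + s / (1 - s)) by (field; lra); le_via exp_ge_1x; apply exp_le; mul_l; [lra|]; inv_le; lra). eapply Rle_trans; [exact HT|].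
  apply Rle_trans with (exp (r * (1 - r ^ b) / (1 - r) ^ 2) * exp (s / (1 - r))); [mul_le; auto; [apply Rsum_nonneg; auto|pos]|rewrite <- exp_plus; right; f_equal; unfold s; simpl; field; lra].
Qed.
Lemma bnd_npart r : 0 <= r < 1 -> bnd (fun n => INR (npart n) * r ^ n) (exp (/ (1 - r) ^ 2)).
 intros Hr. apply bnd_nat; [intros n; pos|]. intros N. eapply Rle_trans; [|le_via (pcount_sum_le r N N Hr)].
 + apply Rsum_le_in. intros n Hn. apply in_seq in Hn. rewrite (npart_pcount n N) by lia. auto.
 + apply exp_le. unfold Rdiv. rewrite <- (Rmult_1_l (/ (1 - r) ^ 2)) at 2. mul_r; [pos|assert (0 <= r ^ N <= 1) by (split; [pos|rewrite <- (pow1 N); apply pow_incr; lra]); nra].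
Qed.
Definition gen (c : nat -> nat) (q : C) : C := tsum (fun n => RtoC (INR (c n)) * q ^ n)%C.
Lemma Cmod_gen_term (c : nat -> nat) q n : Cmod (RtoC (INR (c n)) * q ^ n)%C = INR (c n) * Cmod q ^ n.
 rewrite Cmod_mult, Cmod_pow, Cmod_R, Rabs_pos_eq; [auto|auto]. Qed.
Lemma bnd_gen c q : (forall n, (c n <= npart n)%nat) -> Cmod q < 1 ->
 bnd (fun n => Cmod (RtoC (INR (c n)) * q ^ n)%C) (exp (/ (1 - Cmod q) ^ 2)).
 intros Hc Hq. eapply bnd_le; [|apply bnd_npart; split; [auto|auto]]. intros n. rewrite Cmod_gen_term. mul_r; [pos|]. now apply le_INR.
Qed.
Lemma gen_spec c q : (forall n, (c n <= npart n)%nat) -> Cmod q < 1 -> Sums (fun n => RtoC (INR (c n)) * q ^ n)%C (gen c q).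
 intros Hc Hq. eapply tsum_HasSum, bnd_gen; auto. Qed.
Lemma gen_bound c q : (forall n, (c n <= npart n)%nat) -> Cmod q < 1 -> Cmod (gen c q) <= exp (/ (1 - Cmod q) ^ 2).
 intros Hc Hq. eapply Sums_bound; [now apply gen_spec|now apply bnd_gen]. Qed.
Lemma gen_compl c d q : (forall n, c n + d n = npart n)%nat -> Cmod q < 1 -> gen c q = (gen npart q - gen d q)%C.
 intros H Hq. apply tsum_eq. eapply Sums_ext; [|apply Sums_minus; [apply gen_spec; auto|apply gen_spec; auto]]; [intros n; cbv beta; rewrite <- H, plus_INR, RtoC_plus; ring|intros n; specialize (H n); lia].
Qed.
Lemma Cpow_add (q : C) a b : (q ^ (a + b))%C = (q ^ a * q ^ b)%C.
 induction a; simpl; [ring|]. rewrite IHa. ring. Qed.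
Lemma gen_shift k c d q : (forall n, c (k + n) = d n)%nat -> (forall n, n < k -> c n = 0)%nat ->
 (forall n, (d n <= npart n)%nat) -> Cmod q < 1 -> gen c q = (q ^ k * gen d q)%C.
 intros H1 H2 Hd Hq. apply tsum_eq. eapply Sums_shift; [| |apply Sums_scal, (gen_spec d q Hd Hq)]; [intros n; rewrite H1, Cpow_add; ring|intros n Hn; rewrite H2 by auto; cring].
Qed.
Definition genA (m : nat) (q : C) : C := gen (nrank_ge (zn m)) q.
Definition genC (s : nat) (q : C) : C := gen (nrank_le (- zn s)) q.
(** Dyson's map turns rank >= m into rank <= m + 2, the complement of rank >= m + 3. The ranks <= -s
    satisfy the same recursion. *)
Lemma genA_rec m q : (1 <= m)%nat -> Cmod q < 1 -> genA m q = (q ^ S m * (gen npart q - genA (m + 3) q))%C.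
 intros Hm Hq. unfold genA. rewrite (gen_shift (S m) _ (nrank_le (zn m + 2)) q); auto.
 - f_equal. apply gen_compl; auto. intros n. have nrank_ge_le (zn (m + 3)) n. replace (zn (m + 3) - 1)%Z with (zn m + 2)%Z in H by lia. lia.
 - intros n. now apply nrank_ge_rec.
 - intros n Hn. now apply nrank_ge_small.
 - apply nrank_le_npart.
Qed.
Lemma genC_rec s q : (1 <= s)%nat -> Cmod q < 1 -> genC s q = (q ^ S s * (gen npart q - genC (s + 3) q))%C.
 intros Hs Hq. unfold genC. rewrite (gen_shift (S s) _ (nrank_ge (- zn s - 2)) q); auto.
 - f_equal. apply gen_compl; auto. intros n. have nrank_ge_le (- zn s - 2) n. replace (- zn s - 2 - 1)%Z with (- zn (s + 3))%Z in H by lia. auto.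
 - intros n. now apply nrank_le_rec.
 - intros n Hn. now apply nrank_le_small.
 - apply nrank_ge_npart.
Qed.
(** The exponent reached after j + 1 steps of the recursion: the sum of m + 3i + 1 over 0 <= i <=
    j. *)
Fixpoint pexp (j m : nat) : nat := match j with O => S m | S j' => (S m + pexp j' (m + 3))%nat end.
Lemma pexp_closed j m : (2 * pexp j m = (j + 1) * (3 * j + 2) + 2 * m * (j + 1))%nat.
 revert m. induction j; intros m; cbn; [lia|]. specialize (IHj (m + 3)%nat). nia. Qed.
Definition genE (m : nat) (q : C) : C := tsum (fun j => RtoC ((-1) ^ j) * q ^ pexp j m)%C.
Lemma Cmod_m1pow j : Cmod (RtoC ((-1) ^ j)) = 1.
 rewrite Cmod_R. apply pow_1_abs. Qed.
Lemma bnd_genE m q : Cmod q < 1 -> bnd (fun j => Cmod (RtoC ((-1) ^ j) * q ^ pexp j m)%C) (/ (1 - Cmod q)).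
 intros Hq. eapply bnd_le; [|apply bnd_geom; split; [auto|auto]]. intros j. rewrite Cmod_mult, Cmod_m1pow, Cmod_pow, Rmult_1_l.
 assert (Hj : (j <= pexp j m)%nat) by (have pexp_closed j m; nia). replace (pexp j m) with (j + (pexp j m - j))%nat by lia. rewrite pow_add.
 rewrite <- (Rmult_1_r (Cmod q ^ j)) at 2. mul_l; [pos|]. rewrite <- (pow1 (pexp j m - j)). apply pow_incr. auto.
Qed.
Lemma genE_spec m q : Cmod q < 1 -> Sums (fun j => RtoC ((-1) ^ j) * q ^ pexp j m)%C (genE m q).
 intros Hq. eapply tsum_HasSum, bnd_genE, Hq. Qed.
Lemma Sums_nat_S (f : nat -> C) s : Sums (fun n => f (S n)) s -> Sums f (f O + s)%C.
 intros H. assert (H1 : Sums (fun n => match n with O => f O | S _ => 0 end) (f O)).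
 { apply (Sums_single O (fun n => match n with O => f O | S _ => 0 end)). intros [|]; [lia|auto]. } assert (H2 : Sums (fun n => match n with O => 0 | S _ => f n end) s) by (apply (Sums_shift 1 (fun n => f (S n))); auto; intros [|]; [auto|lia]).
 eapply Sums_ext; [|apply Sums_plus; [eauto|eauto]]. intros [|]; ring.
Qed.
Lemma genE_rec m q : Cmod q < 1 -> genE m q = (q ^ S m * (1 - genE (m + 3) q))%C.
 intros Hq. apply tsum_eq. eapply Sums_eq; [apply Sums_nat_S; eapply Sums_ext; [|apply (Sums_scal (- q ^ S m)), (genE_spec (m + 3) q Hq)]; intros j; change (pexp (S j) m) with (S m + pexp j (m + 3))%nat; rewrite Cpow_add; cring|cring].
Qed.
(* The recursion [d m = - q^(m+1) d (m + 3)] has no bounded solution but zero. *)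
Lemma rec_zero (d : nat -> C) q K : Cmod q < 1 -> (forall m, Cmod (d m) <= K) ->
 (forall m, (1 <= m)%nat -> d m = (- q ^ S m * d (m + 3)%nat)%C) -> forall m, (1 <= m)%nat -> d m = 0.
 intros Hq HK Hrec m Hm. have Cmod_ge_0 q. assert (HJ : forall J m, (1 <= m)%nat -> Cmod (d m) <= Cmod q ^ J * K).
 { induction J; intros k Hk; [simpl; rewrite Rmult_1_l; auto|]. rewrite Hrec, Cmod_mult, Cmod_opp, Cmod_pow by auto. specialize (IHJ (k + 3)%nat ltac:(lia)).
  replace (Cmod q ^ S J * K) with (Cmod q * (Cmod q ^ J * K)) by (simpl; lra). mul_le; auto using Cmod_ge_0; [pos|]. assert (Cmod q ^ k <= 1) by (rewrite <- (pow1 k); apply pow_incr; lra). simpl. nra. }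
 apply Cmod_eq_0. apply Rle_antisym; [|auto]. apply Rnot_lt_le. intros Hlt. assert (HK0 : 0 <= K) by (eapply Rle_trans; [apply Cmod_ge_0|apply (HK O)]). destruct (pow_lt_1_zero (Cmod q)) with (y := Cmod (d m) / (K + 1)) as [N HN].
 - now rewrite Rabs_pos_eq.
 - pos.
 - specialize (HN N (le_n _)). rewrite Rabs_pos_eq in HN by now apply pow_le. specialize (HJ N m Hm). apply (Rmult_lt_compat_r (K + 1)) in HN; [|lra]. unfold Rdiv in HN. rewrite Rmult_assoc, Rinv_l in HN by lra. nra.
Qed.
Lemma genE_bound m q : Cmod q < 1 -> Cmod (genE m q) <= / (1 - Cmod q).
 intros Hq. eapply Sums_bound; [now apply genE_spec|now apply bnd_genE]. Qed.
Lemma gen_solve (a : nat -> C) q K : Cmod q < 1 -> (forall m, Cmod (a m) <= K) ->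
 (forall m, (1 <= m)%nat -> a m = (q ^ S m * (gen npart q - a (m + 3)%nat))%C) -> forall m, (1 <= m)%nat -> a m = (gen npart q * genE m q)%C.
 intros Hq HK Hrec m Hm. apply Ceq_minus. apply (rec_zero (fun m => a m - gen npart q * genE m q)%C q (K + Cmod (gen npart q) * / (1 - Cmod q))); auto; [|intros k Hk; rewrite Hrec, genE_rec by auto; ring].
 intros k. le_via Cmod_triangle. rewrite Cmod_opp, Cmod_mult. apply Rplus_le_compat; auto. mul_l; [auto|]. now apply genE_bound.
Qed.
Lemma genA_formula m q : (1 <= m)%nat -> Cmod q < 1 -> genA m q = (gen npart q * genE m q)%C.
 intros Hm Hq. apply (gen_solve (fun m => genA m q) q (exp (/ (1 - Cmod q) ^ 2))); auto; [intros k; apply gen_bound; auto; apply nrank_ge_npart|intros k Hk; now apply genA_rec].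
Qed.
Lemma genC_formula m q : (1 <= m)%nat -> Cmod q < 1 -> genC m q = (gen npart q * genE m q)%C.
 intros Hm Hq. apply (gen_solve (fun m => genC m q) q (exp (/ (1 - Cmod q) ^ 2))); auto; [intros k; apply gen_bound; auto; apply nrank_le_npart|intros k Hk; now apply genC_rec].
Qed.
(** At m = 0 the recursion acquires the term 1 of the empty partition. Inserting the formulas for
    rank <= -1 and rank >= 3 leaves an equation for the partition series alone. *)
Lemma euler_pentagonal q : Cmod q < 1 -> (gen npart q * (1 - genE 1 q - genE 0 q))%C = 1.
 intros Hq. assert (H0 : gen (nrank_ge 0) q = (1 + q * gen (nrank_le 2) q)%C).
 { apply tsum_eq. eapply Sums_eq; [apply Sums_nat_S; eapply Sums_ext; [|apply (Sums_scal q), (gen_spec (nrank_le 2) q); auto]; [intros n; rewrite nrank_ge0_rec; cring|intros; apply nrank_le_npart]|cring]. }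
 rewrite (gen_compl (nrank_ge 0) (nrank_le (- zn 1)) q) in H0; auto. 2:{ apply nrank_ge_le. } rewrite (gen_compl (nrank_le 2) (nrank_ge (zn 3)) q) in H0; auto. 2:{ intros n. have nrank_ge_le 3 n. simpl in *. lia. }
 change (gen (nrank_le (- zn 1)) q) with (genC 1 q) in H0. change (gen (nrank_ge (zn 3)) q) with (genA 3 q) in H0. rewrite genC_formula, genA_formula in H0 by auto. rewrite (genE_rec 0) by auto. simpl Nat.add. simpl Cpow. set (P := gen npart q) in *.
 replace (P * (1 - genE 1 q - q * 1 * (1 - genE 3 q)))%C with (P - P * genE 1 q - q * (P - P * genE 3 q))%C by ring. rewrite H0. ring.
Qed.
Lemma m1pow_sg j : RtoC ((-1) ^ j) = sg (zn j).
 induction j; [symmetry; apply sg_0|]. rewrite Nat2Z.inj_succ, <- Z.add_1_r, sg_plus, <- IHj, sg_1. cring. Qed.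
Lemma Cmod_ee24 z : inH z -> Cmod (ee (24 * z)%C) < 1.
 intros Hz. rewrite Cmod_ee_c, <- exp_0. apply exp_increasing. unfold inH in Hz. have PI_RGT_0. nra. Qed.
(** In the pentagonal series, [genE 1] collects the indices i >= 1 and [genE 0] the indices i <=
    -1. *)
Lemma eta_eq_E z : inH z -> eta z = (ee z * (1 - genE 1 (ee (24 * z)) - genE 0 (ee (24 * z))))%C.
 intros Hz. have Cmod_ee24 z Hz as Hq. set (q := ee (24 * z)). assert (Hpow : forall k : nat, (ee z * q ^ k)%C = ee (RtoC (24 * INR k + 1) * z)) by (intros k; unfold q; rewrite ee_pow, <- ee_plus; f_equal; cring).
 apply tsum_eq. replace (ee z * (1 - genE 1 q - genE 0 q))%C with (ee z + - ee z * genE 1 q + - ee z * genE 0 q)%C by ring. apply Sums_Z.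
 - replace (ee z) with (etat (zn 0) z) at 1.
  + apply Sums_nat_S. eapply Sums_ext; [|apply Sums_scal, (genE_spec 1 q Hq)]. intros j. unfold etat. rewrite Nat2Z.inj_succ, <- Z.add_1_r, sg_plus, sg_1, m1pow_sg.
   replace (ee (RtoC (IZR (6 * (zn j + 1) + 1) ^ 2) * z)) with (ee z * q ^ pexp j 1)%C; [ring|]. rewrite Hpow. do 3 f_equal. have pexp_closed j 1 as Hc. apply (f_equal INR) in Hc. repeat rewrite ?mult_INR, ?plus_INR in Hc. simpl INR in Hc.
   rewrite plus_IZR, mult_IZR, plus_IZR, <- INR_IZR_INZ. nra.
  + unfold etat. change (zn 0) with 0%Z. rewrite sg_0, Cmult_1_l. f_equal. cring.
 - eapply Sums_ext; [|apply Sums_scal, (genE_spec 0 q Hq)]. intros j. unfold etat. rewrite m1pow_sg, (sg_par (- zn j - 1) (zn j + 1) (- zn j - 1)), sg_plus, sg_1 by lia.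
  replace (ee (RtoC (IZR (6 * (- zn j - 1) + 1) ^ 2) * z)) with (ee z * q ^ pexp j 0)%C; [ring|]. rewrite Hpow. do 3 f_equal. have pexp_closed j 0 as Hc. apply (f_equal INR) in Hc. repeat rewrite ?mult_INR, ?plus_INR in Hc. simpl INR in Hc.
  rewrite plus_IZR, mult_IZR, minus_IZR, opp_IZR, <- INR_IZR_INZ. nra.
Qed.
Lemma eta_partitions z : inH z -> (eta z * gen npart (ee (24 * z)))%C = ee z.
 intros Hz. rewrite eta_eq_E by auto. have euler_pentagonal _ (Cmod_ee24 z Hz). replace _%C with (ee z * (gen npart (ee (24 * z)) * (1 - genE 1 (ee (24 * z)) - genE 0 (ee (24 * z)))))%C by ring. rewrite H. ring.
Qed.
Lemma eta_neq_0 z : inH z -> eta z <> 0.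
 intros Hz E. have eta_partitions z Hz. rewrite E, Cmult_0_l in H. now apply (ee_neq_0 z). Qed.
#[local] Hint Resolve eta_neq_0 : core.

(** * Exponential series with moderate growth at the real axis *)

Lemma Sums_fin {I} (f : I -> C) l : NoDup l -> (forall i, ~ In i l -> f i = 0) -> Sums f (Csum f l).
 intros Hl H0 eps He. exists l. intros l' Hl' Hi. destruct (split_incl l l' Hl Hl' Hi) as [m [P [_ Hm]]]. rewrite (Csum_perm f _ _ P), Csum_app.
 assert (E : Csum f m = 0) by (clear P; induction m as [|x m IH]; [auto|]; rewrite Csum_cons, H0, IH; [ring| |]; [intros i Hin; apply Hm; now right|apply Hm; now left]). rewrite E. replace _%C with (RtoC 0) by ring. now rewrite Cmod_0.
Qed.
Lemma pow_exp_le p t x : 0 < t -> 0 <= x -> x ^ p * exp (- t * x) <= INR (fact p) * (2 / t) ^ p * exp (- (t / 2) * x).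
 intros Ht Hx. have pow_le_fact_exp. assert (H0 : 0 <= t / 2 * x) by pos. replace (x ^ p) with ((2 / t) ^ p * (t / 2 * x) ^ p) by (rewrite <- Rpow_mult_distr; f_equal; field; lra).
 replace (exp (- (t / 2) * x)) with (exp (t / 2 * x) * exp (- t * x)) by (rewrite <- exp_plus; f_equal; field). replace (INR (fact p) * (2 / t) ^ p * (exp (t / 2 * x) * exp (- t * x)))
  with ((2 / t) ^ p * exp (- t * x) * (INR (fact p) * exp (t / 2 * x))) by ring. replace ((2 / t) ^ p * (t / 2 * x) ^ p * exp (- t * x)) with ((2 / t) ^ p * exp (- t * x) * (t / 2 * x) ^ p) by ring. mul_l; auto. pos.
Qed.
Lemma exp_INR t m : exp (- t * INR m) = exp (- t) ^ m.
 induction m; [rewrite Rmult_0_r; apply exp_0|]. rewrite S_INR. simpl. rewrite <- IHm, <- exp_plus. f_equal. ring. Qed.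
Lemma exp_neg_lt1 t : 0 < t -> 0 <= exp (- t) < 1.
 split; [auto|]. rewrite <- exp_0. apply exp_increasing. lra. Qed.
(** One constant K serves all t; the factor exp (4 / t) swallows the powers of 1 / t that appear as
    t -> 0. *)
Lemma bnd_pow_exp p : exists K, 0 <= K /\ forall t, 0 < t -> bnd (fun m : nat => (INR m + 1) ^ p * exp (- t * (INR m + 1))) (K * exp (4 * / t)).
 have INR_fact_lt_0 p. exists (INR (fact p) * INR (fact p)). split; [pos|]. intros t Ht. have Rinv_0_lt_compat _ Ht. assert (H2t : 0 <= 2 / t) by lra. have exp_ge_1x (t / 2) as He.
 eapply bnd_weaken; [|eapply bnd_le; [|apply (bnd_scal (INR (fact p) * (2 / t) ^ p)); [pos|apply (bnd_geom (exp (- (t / 2)))), exp_neg_lt1; lra]]].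
 - assert (H1 : / (1 - exp (- (t / 2))) <= exp (2 / t)).
  { apply Rle_trans with (1 + 2 / t); [|apply exp_ge_1x]. have exp_neg_lt1 (t / 2) ltac:(lra). apply Rmult_le_reg_r with (1 - exp (- (t / 2))); [lra|].
   rewrite Rinv_l, exp_Ropp by lra. apply Rmult_le_reg_r with (exp (t / 2)); [auto|]. rewrite Rmult_assoc, Rmult_minus_distr_r, Rinv_l by lra. assert (2 / t * t / 2 = 1) by (field; lra). nra. }
  have pow_le_fact_exp p (2 / t) H2t. replace (4 * / t) with (2 / t + 2 / t) by lra. rewrite exp_plus. have exp_neg_lt1 (t / 2) ltac:(lra).
  apply Rle_trans with (INR (fact p) * (INR (fact p) * exp (2 / t)) * exp (2 / t)); [|lra]. mul_le; auto; [pos|pos|nra].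
 - intros m. have pos_INR m. eapply Rle_trans; [apply pow_exp_le; lra|]. mul_l; [pos|]. rewrite <- exp_INR. apply exp_le. nra.
Qed.
(** Growth of the form K exp (K / y) as y -> 0 is stable under termwise differentiation, and it is
    strong enough to yield linear exponential growth at every cusp. *)
Definition qs {I} (c : I -> C) (lam : I -> R) : Prop := (forall i, 0 <= lam i) /\
 exists K, 0 <= K /\ forall y, 0 < y -> bnd (fun i => Cmod (c i) * exp (- (2 * PI * y) * lam i)) (K * exp (K * / y)).
Definition qF {I} (c : I -> C) (lam : I -> R) (z : C) : C := tsum (fun i => c i * ee (lam i * z))%C.
Lemma qs_term {I} (c : I -> C) lam z i y : 0 <= lam i -> 0 < y -> y <= Im z -> Cmod (c i * ee (lam i * z))%C <= Cmod (c i) * exp (- (2 * PI * y) * lam i).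
 intros Hl Hy Hz. rewrite Cmod_mult, Cmod_ee_c. mul_l; [auto|]. apply exp_le. have Rmult_le_pos (2 * PI * lam i) (Im z - y) ltac:(pos) ltac:(lra). lra.
Qed.
Lemma qF_spec {I} (c : I -> C) lam z : qs c lam -> inH z -> Sums (fun i => c i * ee (lam i * z))%C (qF c lam z).
 intros [Hl []] Hz. eapply tsum_HasSum, bnd_le; [intros i; apply (qs_term c lam z i (Im z)); auto|apply H, Hz]. Qed.
Lemma qs_deriv {I} (c : I -> C) lam : qs c lam -> qs (fun i => 2 * PI * Ci * lam i * c i)%C lam.
 intros [Hl [K [HK H]]]. split; auto. exists (2 * K + 2). split; [lra|]. intros y Hy. have Rinv_0_lt_compat _ Hy. have PI_RGT_0. eapply bnd_weaken; [|eapply bnd_le; [|apply (bnd_scal (2 * / y)); [lra|apply (H (y / 2)); lra]]].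
 - replace (/ (y / 2)) with (2 * / y) by (field; lra). apply Rle_trans with (2 * exp (/ y) * (K * exp (K * (2 * / y)))).
  + mul_r; [pos|]. have exp_ge_1x (/ y). lra.
  + replace (2 * exp (/ y) * (K * exp (K * (2 * / y)))) with (2 * K * (exp (/ y) * exp (K * (2 * / y)))) by ring. rewrite <- exp_plus. mul_le; [lra|auto|lra|apply exp_le; nra].
 - intros i. rewrite !Cmod_mult, Cmod_Ci, !Cmod_R, !Rabs_pos_eq by (auto; lra). have pow_le_fact_exp 1 (PI * y * lam i) as HP. simpl in HP. assert (Hpy : 0 <= PI * y * lam i) by (apply Rmult_le_pos; [pos|auto]). rewrite Rmult_1_r, Rmult_1_l in HP.
  replace (exp (- (2 * PI * (y / 2)) * lam i)) with (exp (PI * y * lam i) * exp (- (2 * PI * y) * lam i)) by (rewrite <- exp_plus; f_equal; field).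
  replace (2 * PI * 1 * lam i * Cmod (c i) * exp (- (2 * PI * y) * lam i)) with (2 * / y * (Cmod (c i) * exp (- (2 * PI * y) * lam i)) * (PI * y * lam i)) by (field; lra).
  replace (2 * / y * (Cmod (c i) * (exp (PI * y * lam i) * exp (- (2 * PI * y) * lam i)))) with (2 * / y * (Cmod (c i) * exp (- (2 * PI * y) * lam i)) * exp (PI * y * lam i)) by ring. mul_l; auto. pos.
Qed.
Lemma half_ball z h : inH z -> Cmod h < Im z / 2 -> Im z / 2 <= Im (z + h)%C /\ inH (z + h)%C.
 intros Hz Hh. unfold inH in *. rewrite Im_plus. have im_le_Cmod h. assert (H1 : Rabs (Im h) <= Im z / 2) by lra. apply Rabs_le_between in H1. lra.
Qed.
Lemma qF_wder {I} (c : I -> C) lam z : qs c lam -> inH z -> wder (qF c lam) z (qF (fun i => 2 * PI * Ci * lam i * c i)%C lam z) 0.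
 intros Hq Hz. have qs_deriv c lam Hq as Hd. assert (Hy : 0 < Im z / 2) by pos. have Hd as [Hl [K [HK H]]]. specialize (H _ Hy).
 apply (wder_sum (fun i z => c i * ee (lam i * z))%C (fun i z => 2 * PI * Ci * lam i * c i * ee (lam i * z))%C (fun _ _ => 0) _ _ (Im z / 2)) with (1 := Hy) (2 := H).
 - intros i h Hh. eapply wder_eq; [apply wder_scal, wder_ee_lin|ring|ring].
 - intros i h Hh. rewrite Cmod_0, Rplus_0_r. destruct (half_ball z h Hz Hh). now apply (qs_term (fun i => 2 * PI * Ci * lam i * c i)%C).
 - intros h Hh. apply qF_spec; auto. now apply half_ball.
 - apply qF_spec; auto.
 - auto.
Qed.

(** * Rank moments in terms of the series [Sj] *)

Lemma is_series_unique_C (a : nat -> C) (l l' : C) :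
 @is_series C_AbsRing C_NormedModule a l -> @is_series C_AbsRing C_NormedModule a l' -> l = l'.
 apply (@filterlim_locally_unique _ C_AbsRing C_NormedModule eventually). exact _. Qed.
Fixpoint Pk (k : nat) (s : R) : R := match k with O => 1 | S k' => Pk k' s * (s ^ 2 - (INR k' + / 2) ^ 2) end.
Definition oddp (f : R -> R) : Prop :=
 exists l : list (R * nat), forall s, f s = Rsum (fun p => fst p * s ^ (2 * snd p + 1)) l.
Lemma oddp_plus f g : oddp f -> oddp g -> oddp (fun s => f s + g s).
 intros [l Hl] [m Hm]. exists (l ++ m). intros s. now rewrite Rsum_app, Hl, Hm. Qed.
Lemma oddp_scal c f : oddp f -> oddp (fun s => c * f s).
 intros [l Hl]. exists (map (fun p => (c * fst p, snd p)) l). intros s. rewrite Rsum_map, Hl, <- Rsum_scal. cbn. f_equal. fext. intuition lra.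
Qed.
Lemma oddp_sq f : oddp f -> oddp (fun s => s ^ 2 * f s).
 intros [l Hl]. exists (map (fun p => (fst p, S (snd p))) l). intros s. rewrite Rsum_map, Hl, <- Rsum_scal. cbn [fst snd]. f_equal. fext. intros p. replace (2 * S (snd p) + 1)%nat with (2 + 2 * snd p + 1)%nat by lia. simpl; lra.
Qed.
Lemma oddp_ext f g : (forall s, f s = g s) -> oddp f -> oddp g.
 intros E [l Hl]. exists l. intros s. now rewrite <- E. Qed.
(** The second statement closes the induction: multiplying [Pk k] by s^2 - c mixes the difference
    and the sum of its values at s + 1 and s - 1. *)
Lemma oddp_Pk k : oddp (fun s => Pk k (s + 1) - Pk k (s - 1)) /\ oddp (fun s => s * (Pk k (s + 1) + Pk k (s - 1))).
 induction k as [|k [HD HV]]; [split; [exists []|exists [(2, O)]]; intros s; simpl; ring|]. set (c := (INR k + / 2) ^ 2). split.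
 + eapply oddp_ext; [|apply oddp_plus; [apply oddp_plus; [apply oddp_sq, HD|apply (oddp_scal (1 - c)), HD]|apply (oddp_scal 2), HV]]. intros s. cbn. lra.
 + eapply oddp_ext; [|apply oddp_plus; [apply oddp_plus; [apply oddp_sq, HV|apply (oddp_scal (1 - c)), HV]|apply (oddp_scal 2), oddp_sq, HD]]. intros s. cbn. lra.
Qed.
Lemma Pk_bound k : exists K, 0 <= K /\ forall s, Rabs (Pk k s) <= K * (1 + s ^ 2) ^ k.
 induction k as [|k [K []]].
 - exists 1. split; [lra|]. intros s. simpl. rewrite Rabs_R1. lra.
 - set (c := (INR k + / 2) ^ 2). assert (Hc : 0 <= c) by apply pow2_ge_0. exists (K * (1 + c)). split; [pos|]. intros s. cbn [Pk]. fold c. rewrite Rabs_mult.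
  replace (K * (1 + c) * (1 + s ^ 2) ^ S k) with (K * (1 + s ^ 2) ^ k * ((1 + c) * (1 + s ^ 2))) by (simpl; lra). mul_le; auto using Rabs_pos. apply Rabs_le. nra.
Qed.
Lemma prod_peel (h : nat -> R) n : fold_right Rmult 1 (map h (seq 0 (S (S n)))) =
 h O * fold_right Rmult 1 (map (fun i => h (S i)) (seq 0 n)) * h (S n).
 rewrite <- cons_seq, seq_S, map_cons, map_app, <- seq_shift, map_map. cbn. rewrite fold_right_app. cbn.
 assert (E : forall l x, fold_right Rmult x l = fold_right Rmult 1 l * x) by (induction l; intros; simpl; [ring|rewrite IHl; ring]). rewrite E. ring.
Qed.
Lemma Rsum_peel (h : nat -> R) n : Rsum h (seq 0 (S (S n))) = h O + Rsum (fun i => h (S i)) (seq 0 n) + h (S n).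
 rewrite <- cons_seq, seq_S, <- seq_shift, Rsum_cons, Rsum_app, Rsum_map. simpl; lra. Qed.
(** The 2k factors are symmetric about s = m - 1/2, and opposite factors multiply to s^2 - (i +
    1/2)^2. *)
Lemma gbinom_Pk (m : Z) k : gbinom (m + zn k - 1) (2 * k) = Pk k (IZR m - / 2) / INR (fact (2 * k)).
 unfold gbinom. f_equal. induction k as [|k IH]; [auto|]. replace (2 * S k)%nat with (S (S (2 * k))) by lia. rewrite prod_peel. cbn [Pk]. rewrite <- IH. replace (map (fun i => IZR (m + zn (S k) - 1) - INR (S i)) (seq 0 (2 * k)))
  with (map (fun i => IZR (m + zn k - 1) - INR i) (seq 0 (2 * k))).
 - rewrite Nat2Z.inj_succ, minus_IZR, plus_IZR, succ_IZR, <- INR_IZR_INZ, S_INR, mult_INR. simpl; lra.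
 - apply map_ext. intros i. rewrite Nat2Z.inj_succ, S_INR, !minus_IZR, !plus_IZR, succ_IZR. ring.
Qed.
Lemma sum_sym (f : Z -> R) n : Rsum (fun i : nat => f (zn i - zn n)%Z) (seq 0 (2 * n + 1)) =
 f 0%Z + Rsum (fun j => f (zn j + 1)%Z) (seq 0 n) + Rsum (fun j => f (- (zn j + 1))%Z) (seq 0 n).
 induction n as [|n IH]; [simpl; lra|]. replace (2 * S n + 1)%nat with (S (S (2 * n + 1))) by lia. rewrite Rsum_peel, seq_S, !Rsum_app. replace (fun i => f (zn (S i) - zn (S n))%Z) with (fun i => f (zn i - zn n)%Z) by (fext; intros; f_equal; lia).
 rewrite IH. cbn [Rsum fold_right]. replace (zn (S (2 * n + 1)) - zn (S n))%Z with (zn (0 + n) + 1)%Z by lia. replace (zn 0 - zn (S n))%Z with (- (zn (0 + n) + 1))%Z by lia. ring.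
Qed.
Lemma abel_sum (b G : nat -> R) M : Rsum (fun j => b (S j) * (G j - G (S j))) (seq 0 M) =
 Rsum (fun j => (b (S j) - b j) * G j) (seq 0 M) + b O * G O - b M * G M.
 induction M as [|M IH]; [simpl; lra|]. rewrite seq_S, !Rsum_app. simpl; lra. Qed.
Lemma Nrank_ge m n : nrank_ge m n = (Nrank m n + nrank_ge (m + 1) n)%nat.
 unfold nrank_ge, Nrank. induction partitions as [|l L IH]; [auto|]. cbn. destruct (Z.leb_spec m (rank l)), (Z.leb_spec (m + 1) (rank l)), (Z.eqb_spec (rank l) m); cbn; lia.
Qed.
Lemma Nrank_le m n : nrank_le m n = (Nrank m n + nrank_le (m - 1) n)%nat.
 unfold nrank_le, Nrank. induction partitions as [|l L IH]; [auto|]. cbn. destruct (Z.leb_spec (rank l) m), (Z.leb_spec (rank l) (m - 1)), (Z.eqb_spec (rank l) m); cbn; lia.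
Qed.
Definition bet (k : nat) (m : Z) : R := Pk k (IZR m - / 2) / INR (fact (2 * k)).
Definition gam1 (k j : nat) : R := bet k (zn j + 1) - bet k (zn j).
Definition gam2 (k j : nat) : R := bet k (- (zn j + 1)) - bet k (- zn j).
Definition rk (k j n : nat) : R :=
 gam1 k j * INR (nrank_ge (zn (S j)) n) + gam2 k j * INR (nrank_le (- zn (S j)) n).
Lemma bet_0 k : (1 <= k)%nat -> bet k 0 = 0.
 intros Hk. unfold bet. replace (Pk k (IZR 0 - / 2)) with 0; [lra|]. induction Hk; cbn; [lra|]. nra. Qed.
(** Summation by parts replaces the counts of rank exactly m by counts of rank >= m and rank <= -m,
    whose generating functions are known. The boundary terms vanish because the weight is 0 at m = 0
    and a partition of n has |rank| <= n. *)
Lemma eta2k_rk k n : (1 <= k)%nat -> eta2k k n = Rsum (fun j => rk k j n) (seq 0 n).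
 unfold eta2k. transitivity (Rsum (fun i : nat => (fun m => bet k m * INR (Nrank m n)) (zn i - zn n)%Z) (seq 0 (2 * n + 1))).
 { unfold Rsum. generalize (seq 0 (2 * n + 1)). induction l as [|i l IH]; [auto|]. cbn [map fold_right]. rewrite IH. f_equal. unfold bet. rewrite <- gbinom_Pk.
  do 2 f_equal. replace ((2 * zn k - 1) / 2)%Z with (zn k - 1)%Z by (Z.to_euclidean_division_equations; lia). lia. } rewrite (sum_sym (fun m => bet k m * INR (Nrank m n))), bet_0, Rmult_0_l, Rplus_0_l by auto. unfold rk. rewrite Rsum_plus. f_equal.
 - transitivity (Rsum (fun j => bet k (zn (S j)) * (INR (nrank_ge (zn (S j)) n) - INR (nrank_ge (zn (S (S j))) n))) (seq 0 n)).
  { f_equal. fext. intros j. replace (zn (S (S j))) with (zn (S j) + 1)%Z by lia. rewrite Nrank_ge, plus_INR. replace (zn j + 1)%Z with (zn (S j)) by lia. ring. }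
  rewrite (abel_sum (fun j => bet k (zn j)) (fun j => INR (nrank_ge (zn (S j)) n))), bet_0, (nrank_ge_small (S n) n), Rmult_0_l, Rmult_0_r, Rminus_0_r, Rplus_0_r by lia. f_equal. fext. intros j. unfold gam1. do 3 f_equal. lia.
 - transitivity (Rsum (fun j => bet k (- zn (S j)) * (INR (nrank_le (- zn (S j)) n) - INR (nrank_le (- zn (S (S j))) n))) (seq 0 n)).
  { f_equal. fext. intros j. replace (- zn (S (S j)))%Z with (- zn (S j) - 1)%Z by lia. rewrite Nrank_le, plus_INR. replace (- (zn j + 1))%Z with (- zn (S j))%Z by lia. ring. }
  rewrite (abel_sum (fun j => bet k (- zn j)) (fun j => INR (nrank_le (- zn (S j)) n))), bet_0, (nrank_le_small (S n) n), Rmult_0_l, Rmult_0_r, Rminus_0_r, Rplus_0_r by lia. f_equal. fext. intros j. unfold gam2. do 3 f_equal. lia.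
Qed.
Lemma eta2k_HasSum k n : (1 <= k)%nat -> Sums (fun j => RtoC (rk k j n)) (RtoC (eta2k k n)).
 intros Hk. rewrite eta2k_rk, <- Csum_RtoC by auto. apply Sums_fin; [apply seq_NoDup|]. intros j Hj. unfold rk.
 rewrite nrank_ge_small, nrank_le_small; [cring|lia|destruct (Nat.lt_ge_cases j n); [exfalso; apply Hj, in_seq; lia|lia]|lia|destruct (Nat.lt_ge_cases j n); [exfalso; apply Hj, in_seq; lia|lia]].
Qed.
Lemma bet_bound k : exists K, 0 <= K /\ forall (j : nat) m, Rabs (IZR m - / 2) <= 3 / 2 * (INR j + 1) ->
 Rabs (bet k m) <= K * (INR j + 1) ^ (2 * k).
 destruct (Pk_bound k) as [K [HK HP]]. exists (K * 4 ^ k / INR (fact (2 * k))). split.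
 { apply Rmult_le_pos; [pos|pos]. } intros j m Hm. unfold bet, Rdiv. rewrite Rabs_mult, (Rabs_pos_eq (/ _)) by pos.
 replace (K * 4 ^ k * / INR (fact (2 * k)) * (INR j + 1) ^ (2 * k)) with (K * (4 ^ k * (INR j + 1) ^ (2 * k)) * / INR (fact (2 * k))) by ring.
 mul_r; [pos|]. eapply Rle_trans; [auto|]. mul_l; auto. rewrite pow_mult, <- Rpow_mult_distr. apply pow_incr. have pos_INR j. set (s := IZR m - / 2) in *. rewrite <- pow2_abs. have Rabs_pos s. nra.
Qed.
Lemma gam_bound k : exists K, 0 <= K /\ forall j, Rabs (gam1 k j) <= K * (INR j + 1) ^ (2 * k) /\ Rabs (gam2 k j) <= K * (INR j + 1) ^ (2 * k).
 destruct (bet_bound k) as [K ]. exists (2 * K). split; [lra|]. intros j. have pos_INR j. assert (A : forall m, Rabs (IZR m - / 2) <= 3 / 2 * (INR j + 1) -> Rabs (bet k m) <= K * (INR j + 1) ^ (2 * k)) by (intros; now apply H).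
 split; (le_via Rabs_triang); rewrite Rabs_Ropp; match goal with |- Rabs (bet k ?m1) + Rabs (bet k ?m2) <= _ => have A m1; have A m2 as H2 end; rewrite ?opp_IZR, ?plus_IZR, <- INR_IZR_INZ in *;
  assert (H1' := H1 ltac:(apply Rabs_le; lra)); assert (H2' := H2 ltac:(apply Rabs_le; lra)); lra.
Qed.
(** The exponent is 24 times [pexp (fst p) (S (snd p))]. *)
Definition St (j : nat) (z : C) (p : nat * nat) : C :=
 (sg (zn (S (fst p))) * RtoC ((INR (snd p) + / 2) ^ (2 * j + 1)) * ee (RtoC (36 * INR (S (fst p)) ^ 2 + 24 * INR (S (fst p)) * (INR (snd p) + / 2)) * z))%C.
Definition Sj (j : nat) (z : C) : C := tsum (St j z).
Lemma qs_Sj j : qs (fun p : nat * nat => (sg (zn (S (fst p))) * RtoC ((INR (snd p) + / 2) ^ (2 * j + 1)))%C)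
 (fun p => 36 * INR (S (fst p)) ^ 2 + 24 * INR (S (fst p)) * (INR (snd p) + / 2)).
 split.
 { intros. pos. } destruct (bnd_pow_exp 0) as [K1 [HK1 H1]]. destruct (bnd_pow_exp (2 * j + 1)) as [K2 [HK2 H2]]. exists (K1 * K2 + 8).
 assert (HKK : 0 <= K1 * K2) by now apply Rmult_le_pos. split; [lra|]. intros y Hy. have Rinv_0_lt_compat _ Hy. have PI2_3_2. assert (Ht : 0 < 2 * PI * 24 * y) by pos. set (t := 2 * PI * 24 * y). specialize (H1 t Ht). specialize (H2 t Ht).
 eapply bnd_weaken; [|eapply bnd_le; [|apply bnd_prod with (3 := H1) (4 := H2)]].
 - assert (Hit : / t <= / y) by (inv_le; unfold t; nra). replace (K1 * exp (4 * / t) * (K2 * exp (4 * / t))) with (K1 * K2 * exp (4 * / t + 4 * / t)) by (rewrite exp_plus; ring). mul_le; auto; [lra|]. apply exp_le. nra.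
 - intros [n m]. cbn [fst snd]. rewrite Cmod_mult, Cmod_sg, Cmod_R, Rmult_1_l. have pos_INR n. have pos_INR m. rewrite Rabs_pos_eq, S_INR, Rmult_1_l by pos.
  replace (exp (- t * (INR n + 1)) * ((INR m + 1) ^ (2 * j + 1) * exp (- t * (INR m + 1)))) with ((INR m + 1) ^ (2 * j + 1) * (exp (- t * (INR m + 1)) * exp (- t * (INR n + 1)))) by ring.
  mul_le; try (left; apply exp_pos); try (apply pow_le; lra); [apply pow_incr; lra|]. rewrite <- exp_plus. apply exp_le. unfold t. replace (- (2 * PI * 24 * y) * (INR m + 1) + - (2 * PI * 24 * y) * (INR n + 1)) with
   (- (2 * PI * y) * (24 * (INR m + 1) + 24 * (INR n + 1))) by ring. apply Rmult_le_compat_neg_l; [lra|nra].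
 - intros n. pos.
 - intros n. pos.
Qed.
Lemma Sj_spec j z : inH z -> Sums (St j z) (Sj j z).
 exact (qF_spec _ _ z (qs_Sj j)). Qed.
(** A term is nonzero only for j < n, so half of the decay of q^n can be spent on the variable j and
    the other half on the partition numbers. *)
Lemma bnd_rk k q t : 0 < t -> Cmod q = exp (- t) ->
 exists K, bnd (fun p : nat * nat => Cmod (RtoC (rk k (snd p) (fst p)) * q ^ (fst p))%C) K.
 intros Ht Hq. destruct (gam_bound k) as [K [HK Hg]]. assert (Ht2 : 0 < t / 2) by lra. destruct (bnd_pow_exp (2 * k)) as [K2 [_ H2]]. specialize (H2 _ Ht2). have bnd_npart (exp (- (t / 2))) (exp_neg_lt1 _ Ht2) as H1. eexists.
 eapply bnd_le; [|apply (bnd_scal (2 * K)); [lra|apply bnd_prod with (3 := H1) (4 := H2)]].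
 - intros [n j]. cbn [fst snd]. rewrite Cmod_mult, Cmod_pow, Cmod_R, Hq. destruct (Nat.lt_ge_cases j n) as [L|].
  + assert (HR : Rabs (rk k j n) <= 2 * K * (INR j + 1) ^ (2 * k) * INR (npart n)).
   { destruct (Hg j) as []. le_via Rabs_triang. rewrite !Rabs_mult, !(Rabs_pos_eq (INR _)) by apply pos_INR. have le_INR _ _ (nrank_ge_npart (zn (S j)) n). have le_INR _ _ (nrank_le_npart (- zn (S j)) n).
    replace (2 * K * (INR j + 1) ^ (2 * k) * INR (npart n)) with (K * (INR j + 1) ^ (2 * k) * INR (npart n) + K * (INR j + 1) ^ (2 * k) * INR (npart n)) by ring. apply Rplus_le_compat; mul_le; auto using Rabs_pos. }
   assert (HE : exp (- t) ^ n <= exp (- (t / 2)) ^ n * exp (- (t / 2) * (INR j + 1))) by (rewrite <- !exp_INR, <- exp_plus; apply exp_le; apply lt_INR in L; assert (INR j + 1 <= INR n) by (rewrite <- S_INR; apply le_INR, INR_lt, L); nra).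
   replace (2 * K * (INR (npart n) * exp (- (t / 2)) ^ n * ((INR j + 1) ^ (2 * k) * exp (- (t / 2) * (INR j + 1))))) with (2 * K * (INR j + 1) ^ (2 * k) * INR (npart n) * (exp (- (t / 2)) ^ n * exp (- (t / 2) * (INR j + 1)))) by ring.
   mul_le; auto using Rabs_pos. pos.
  + unfold rk. rewrite nrank_ge_small, nrank_le_small, !Rmult_0_r, Rplus_0_r, Rabs_R0, Rmult_0_l by lia. pos.
 - intros n. pos.
 - intros n. pos.
Qed.
Lemma Sums_swap {I J} (f : I * J -> C) s : Sums f s -> Sums (fun p => f (snd p, fst p)) s.
 apply (Sums_reindex (fun p : J * I => (snd p, fst p)) (fun p => (snd p, fst p))); intros []; reflexivity. Qed.
Lemma Sums_lincomb {I A} (l : list A) (c : A -> C) (f : A -> I -> C) (s : A -> C) : (forall a, Sums (f a) (s a)) ->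
 Sums (fun i => Csum (fun a => c a * f a i)%C l) (Csum (fun a => c a * s a)%C l).
 intros H. induction l as [|a l IH]; [auto|]. eapply Sums_ext; [|apply Sums_plus; [apply Sums_scal, H|eauto]]. auto. Qed.
(** Summing over n at fixed j, the ranks >= j + 1 and <= - (j + 1) have the same generating
    function, so only [gam1 + gam2] enters. Since [Pk k] is even, this is a multiple of Pk (s + 1) -
    Pk (s - 1) at s = j + 1/2, an odd polynomial; this is why only odd powers occur in [Sj]. *)
Theorem rank_moment_series k : (1 <= k)%nat -> exists l : list (R * nat), forall f : C -> C,
 (forall z : C, inH z -> @is_series C_AbsRing C_NormedModule (fun n : nat => Cmult (RtoC (eta2k k n)) (Cpow (qq z) (24 * n))) (Cmult (qq z) (f z))) -> forall z, inH z -> f z = (- / eta z * Csum (fun p => RtoC (fst p) * Sj (snd p) z) l)%C.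
 intros Hk. destruct (oddp_Pk k) as [[l0 Hl0] _]. set (l := map (fun p : R * nat => (fst p / INR (fact (2 * k)), snd p)) l0). assert (Hl : forall j, gam1 k j + gam2 k j = Rsum (fun p => fst p * (INR j + / 2) ^ (2 * snd p + 1)) l).
 { intros j. unfold l. rewrite Rsum_map. cbn [fst snd]. rewrite (functional_extensionality (fun j0 : R * nat => fst j0 / INR (fact (2 * k)) * (INR j + / 2) ^ (2 * snd j0 + 1))
    (fun j0 => / INR (fact (2 * k)) * (fst j0 * (INR j + / 2) ^ (2 * snd j0 + 1)))), Rsum_scal, <- Hl0 by intuition lra. unfold gam1, gam2, bet. assert (Ev : forall k s, Pk k (- s) = Pk k s) by (intros k' s; induction k'; cbn; [auto|nra]).
  rewrite !opp_IZR, plus_IZR, <- INR_IZR_INZ. replace (INR j + 1 - / 2) with (INR j + / 2) by field. replace (- (INR j + 1) - / 2) with (- (INR j + / 2 + 1)) by field. replace (- INR j - / 2) with (- (INR j + / 2)) by field.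
  replace (INR j - / 2) with (INR j + / 2 - 1) by field. rewrite !Ev. lra. } exists l. intros f Hf z Hz. have Cmod_ee24 z Hz as Hq. have eta_partitions z Hz as HP. set (q := ee (24 * z)) in *. set (P := gen npart q) in *.
 assert (Ht : 0 < 48 * PI * Im z) by pos. assert (Hqt : Cmod q = exp (- (48 * PI * Im z))) by (unfold q; rewrite Cmod_ee_c; f_equal; ring).
 (* Absolute summability over the pairs (n, j) justifies both orders of summation. *)
 destruct (bnd_rk k q _ Ht Hqt) as [K HK]. destruct (Sums_ex _ _ HK) as [S HS]. assert (H1 : (qq z * f z)%C = S).
 { eapply is_series_unique_C ; [auto|]. apply Sums_is_series, (Sums_fubini _ _ _ HS). intros n.
  eapply Sums_ext; [|eapply Sums_eq; [apply (Sums_scal (q ^ n)), (eta2k_HasSum k n Hk)|]]; [intros j; cring|unfold q; rewrite !ee_pow; replace (INR (24 * n) * z)%C with (INR n * (24 * z))%C; [ring|]; rewrite mult_INR; cring]. }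
 set (g := fun p : nat * nat => (P * (RtoC (gam1 k (fst p) + gam2 k (fst p)) * (RtoC ((-1) ^ snd p) * q ^ pexp (snd p) (Datatypes.S (fst p)))))%C). assert (Hg : Sums g (P * (- / ee z * (ee z * Csum (fun p => RtoC (fst p) * Sj (snd p) z)%C l)))).
 { apply Sums_scal. have Sums_lincomb l (fun p => fst p) (fun p => St (snd p) z) (fun p => Sj (snd p) z) (fun p => Sj_spec (snd p) z Hz) as HL. apply Sums_swap, (Sums_scal (-1)) in HL.
  eapply Sums_eq; [|instantiate (1 := (-1 * Csum (fun p => RtoC (fst p) * Sj (snd p) z) l)%C); field; apply ee_neq_0]. eapply Sums_ext; [|eauto]. intros [j i]. cbn. rewrite Hl, <- Csum_RtoC. unfold q. rewrite ee_pow.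
  assert (Ep : (INR (pexp i (Datatypes.S j)) * (24 * z) = RtoC (36 * INR (Datatypes.S i) ^ 2 + 24 * INR (Datatypes.S i) * (INR j + / 2)) * z)%C).
  { have pexp_closed i (Datatypes.S j) as Hc. apply (f_equal INR) in Hc. repeat rewrite ?mult_INR, ?plus_INR in Hc. rewrite !S_INR in *. simpl INR in Hc. rewrite Cmult_assoc. f_equal. rewrite <- RtoC_mult. f_equal. nra. }
  rewrite Ep, (Cmult_comm (Csum _ _)), <- Csum_scal, <- Csum_scal. f_equal. fext. intros p. unfold St. rewrite <- m1pow_sg. cring. } assert (H2 : S = (P * (- / ee z * (ee z * Csum (fun p => RtoC (fst p) * Sj (snd p) z) l)))%C).
 { set (row := fun j => (gam1 k j * genA (Datatypes.S j) q + gam2 k j * genC (Datatypes.S j) q)%C). apply (Sums_unique row).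
  - apply Sums_swap in HS. apply (Sums_fubini _ _ _ HS). intros j. eapply Sums_ext; [|apply Sums_plus; apply Sums_scal; [apply gen_spec|apply gen_spec]; auto using nrank_ge_npart, nrank_le_npart]. intros n. unfold rk. cring.
  - apply (Sums_fubini _ _ _ Hg). intros j. unfold row, g. cbn. rewrite genA_formula, genC_formula by (auto; lia). fold P. eapply Sums_eq; [apply Sums_scal, Sums_scal, genE_spec, Hq|]. cring. }
 rewrite H2, qq_ee in H1. assert (HPe : P = (ee z / eta z)%C) by (rewrite <- HP; field; auto). rewrite HPe in H1. transitivity (/ ee z * (ee z * f z))%C; [field; auto|]. rewrite H1. field; auto.
Qed.

(** * Lipschitz' summation formula *)

Lemma Cmod_sq (v : C) : Cmod v ^ 2 = Re v ^ 2 + Im v ^ 2.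
 unfold Cmod. rewrite pow2_sqrt; [auto|]. pos. Qed.
Lemma Re_addZ (v : C) (m : Z) : Re (v + IZR m)%C = Re v + IZR m.
 auto. Qed.
Lemma Im_addZ (v : C) (m : Z) : Im (v + IZR m)%C = Im v.
 rewrite Im_plus. simpl; lra. Qed.
Lemma inv_shift_bound (v : C) (m : Z) (a d : R) : 0 < d -> d <= Im v -> Rabs (Re v - a) <= 1 ->
 / Cmod (v + IZR m)%C ^ 2 <= (2 + 3 / d ^ 2) * / (1 + (IZR m + a) ^ 2).
 intros Hd Hv Ha. rewrite Cmod_sq, Im_addZ. apply Rabs_le_between in Ha. assert (Hd2 : 0 < d ^ 2) by pos. assert (d ^ 2 <= Im v ^ 2) by nra. have pow2_ge_0 (Re v + IZR m). have pow2_ge_0 (IZR m + a).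
 assert (Hx0 : 1 + (IZR m + a) ^ 2 <= (2 + 3 / d ^ 2) * ((Re v + IZR m) ^ 2 + Im v ^ 2)).
 { apply Rle_trans with (3 + 2 * (Re v + IZR m) ^ 2).
  - replace (IZR m + a) with (Re v + IZR m + (a - Re v)) by ring. set (x := Re v + IZR m). set (y := a - Re v). assert (-1 <= y <= 1) by (unfold y; lra). have pow2_ge_0 (x - y). nra.
  - assert (H3 : 3 <= 3 / d ^ 2 * Im v ^ 2) by (replace 3 with (3 / d ^ 2 * d ^ 2) at 1 by (field; lra); mul_l; auto; pos). nra. }
 assert (Hx : 0 < (Re v + IZR m) ^ 2 + Im v ^ 2) by lra. apply Rmult_le_reg_r with ((Re v + IZR m) ^ 2 + Im v ^ 2); auto. rewrite Rinv_l by lra. apply Rmult_le_reg_r with (1 + (IZR m + a) ^ 2); [lra|]. rewrite Rmult_1_l.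
 replace ((2 + 3 / d ^ 2) * / (1 + (IZR m + a) ^ 2) * ((Re v + IZR m) ^ 2 + Im v ^ 2) * (1 + (IZR m + a) ^ 2)) with ((2 + 3 / d ^ 2) * ((Re v + IZR m) ^ 2 + Im v ^ 2)) by (field; lra). auto.
Qed.
Lemma addZ_neq_0 (u : C) (m : Z) : inH u -> (u + IZR m)%C <> 0.
 intros Hu E. apply (f_equal Im) in E. rewrite Im_addZ in E. unfold inH in Hu. simpl in E. lra. Qed.
Lemma Cmod_Cinv_pow (w : C) p : w <> 0 -> Cmod (/ (w ^ p))%C = / Cmod w ^ p.
 intros Hw. rewrite Cmod_inv, Cmod_pow; auto0. auto. Qed.
Lemma inv_pow_bound (v : C) (m : Z) (a d : R) p : 0 < d -> d <= Im v -> Rabs (Re v - a) <= 1 ->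
 Cmod (/ ((v + IZR m) ^ (2 + p)))%C <= (/ d) ^ p * ((2 + 3 / d ^ 2) * / (1 + (IZR m + a) ^ 2)).
 intros Hd Hv Ha. assert (Hu : inH v) by (unfold inH; lra). rewrite Cmod_Cinv_pow, pow_add, Rinv_mult, Rmult_comm, <- pow_inv by now apply addZ_neq_0.
 mul_le; [apply pow_le; left; apply Rinv_0_lt_compat, Cmod_gt_0, addZ_neq_0, Hu|left; apply Rinv_0_lt_compat, pow_lt, Cmod_gt_0, addZ_neq_0, Hu| |now apply inv_shift_bound].
 apply pow_incr. split; [left; apply Rinv_0_lt_compat, Cmod_gt_0, addZ_neq_0, Hu|]. inv_le; auto. rewrite <- (Im_addZ v m) in Hv. have im_le_Cmod (v + IZR m). have Rle_abs (Im (v + IZR m)). lra.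
Qed.
Lemma bnd_inv_pow u p : inH u -> exists K, bnd (fun m : Z => Cmod (/ ((u + IZR m) ^ (2 + p)))%C) K.
 eexists. eapply bnd_le; [intros m; apply (inv_pow_bound u m (Re u) (Im u)); auto|]; [replace (Re u - Re u) with 0 by ring; rewrite Rabs_R0; lra|apply bnd_scal; [pos|]; apply bnd_scal; [|apply bnd_inv_sq]; pos].
Qed.
Definition PZ (u : C) : C := tsum (fun m : Z => / ((u + IZR m) ^ 2))%C.
Lemma PZ_spec u : inH u -> Sums (fun m : Z => / ((u + IZR m) ^ 2))%C (PZ u).
 intros Hu. destruct (bnd_inv_pow u 0 Hu) as [K HK]. eapply tsum_HasSum, HK. Qed.
Lemma PZ_shift u (n : Z) : inH u -> PZ (u + IZR n)%C = PZ u.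
 intros Hu. apply tsum_eq. apply (Sums_reindex_back (fun m => m - n)%Z (fun m => m + n)%Z); try (intros; lia). eapply Sums_ext; [|apply PZ_spec, Hu]. intros m. rewrite minus_IZR, RtoC_minus. do 2 f_equal. ring.
Qed.
Lemma inH_scal (r : R) (u : C) : 0 < r -> inH u -> inH (r * u)%C.
 unfold inH. intros. replace (Im (r * u)) with (r * Im u) by (unfold Im; simpl; ring). pos. Qed.
Lemma inH_addZ u (n : Z) : inH u -> inH (u + IZR n)%C.
 unfold inH. now rewrite Im_addZ. Qed.
Lemma RtoC_inv2 : RtoC (/ 2) = (/ 2)%C.
 apply RtoC_inv. lra. Qed.
Lemma RtoC_inv4 : RtoC (/ 4) = (/ 4)%C.
 apply RtoC_inv. lra. Qed.
Lemma C_inv_0 : (/ 0)%C = 0.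
 unfold Cinv, RtoC. cbn. f_equal; unfold Rdiv; ring. Qed.
Lemma inH_half u : inH u -> inH (u / 2)%C.
 replace (u / 2)%C with (RtoC (/ 2) * u)%C; [apply inH_scal; lra|]. rewrite RtoC_inv2. field. Qed.
Definition evod (x : Z + Z) : Z := match x with inl m => (2 * m)%Z | inr m => (2 * m + 1)%Z end.
Definition evod_inv (m : Z) : Z + Z := if Z.even m then inl (m / 2)%Z else inr (m / 2)%Z.
Lemma Sums_evod (f : Z -> C) s t : Sums (fun m => f (2 * m)%Z) s -> Sums (fun m => f (2 * m + 1)%Z) t -> Sums f (s + t)%C.
 intros Hs Ht. apply (Sums_reindex_back evod evod_inv).
 - intros [m|m]; unfold evod, evod_inv.
  + replace (Z.even (2 * m)) with true by now rewrite Z.even_mul. f_equal. Z.to_euclidean_division_equations; lia.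
  + replace (Z.even (2 * m + 1)) with false by now rewrite Z.even_add, Z.even_mul. f_equal. Z.to_euclidean_division_equations; lia.
 - intros m. unfold evod, evod_inv. destruct (Z.even m) eqn:E.
  + apply Z.even_spec in E. destruct E as [k ->]. rewrite (Z.mul_comm 2 k), Z.div_mul; lia.
  + rewrite <- Z.negb_odd in E. apply Bool.negb_false_iff, Z.odd_spec in E. destruct E as []. Z.to_euclidean_division_equations; lia.
 - apply Sums_sum; assumption.
Qed.
Lemma PZ_dup u : inH u -> PZ u = ((PZ (u / 2) + PZ ((u + IZR 1) / 2)) / 4)%C.
 intros Hu. apply tsum_eq. replace ((PZ (u / 2) + PZ ((u + IZR 1) / 2)) / 4)%C with (/ 4 * PZ (u / 2) + / 4 * PZ ((u + IZR 1) / 2))%C by field. apply Sums_evod.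
 - eapply Sums_ext; [|apply Sums_scal, PZ_spec, inH_half, Hu]. intros m. have addZ_neq_0 u (2 * m) Hu. rewrite mult_IZR, RtoC_mult in *. field; auto.
 - eapply Sums_ext; [|apply Sums_scal, PZ_spec, inH_half, inH_addZ, Hu]. intros m. have addZ_neq_0 u (2 * m + 1) Hu. rewrite plus_IZR, mult_IZR, RtoC_plus, RtoC_mult in *. field; auto.
Qed.
Lemma PZ_near u : inH u -> Rabs (Re u) <= / 2 -> Cmod (PZ u - / (u ^ 2))%C <= 48.
 intros Hu Hr. set (f := fun m : Z => if Z.eq_dec m 0 then RtoC 0 else (/ (u + IZR m) ^ 2)%C). assert (HS : Sums f (PZ u - / u ^ 2)).
 { eapply Sums_ext; [|apply Sums_minus; [apply PZ_spec, Hu|]]. 2:{ eapply Sums_eq; [apply (Sums_single 0%Z (fun m : Z => if Z.eq_dec m 0 then (/ u ^ 2)%C else 0))|]; [intros i Hi; destruct (Z.eq_dec i 0); tauto|auto]. }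
  intros m. unfold f. destruct (Z.eq_dec m 0) as [->|]; [|ring]. replace (u + IZR 0)%C with u by ring. ring. }
 eapply Sums_bound; [eauto|]. replace 48 with (8 * 6) by ring. eapply bnd_le; [|apply bnd_scal; [lra|apply bnd_inv_sq_Z]]. intros m. unfold f. have pow2_ge_0 (IZR m). destruct (Z.eq_dec m 0) as [|]; [rewrite Cmod_0; apply Rmult_le_pos; [lra|pos]|].
 rewrite Cmod_Cinv_pow, Cmod_sq, Re_addZ, Im_addZ by now apply addZ_neq_0. apply Rabs_le_between in Hr. assert (H1 : 1 <= IZR m \/ IZR m <= -1) by (destruct (Z.lt_total m 0) as [|[|]]; [right|lia|left]; apply IZR_le; lia).
 assert (H2 : (1 + IZR m ^ 2) / 8 <= (Re u + IZR m) ^ 2 + Im u ^ 2) by (destruct H1; nra). replace (8 * / (1 + IZR m ^ 2)) with (/ ((1 + IZR m ^ 2) / 8)) by (field; lra). inv_le; lra.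
Qed.
(* [sn u = sin (pi u) / pi] and [cn u = cos (pi u)]. *)
Definition sn (u : C) : C := ((ee (/ 2 * u) - ee (- / 2 * u)) / (2 * PI * Ci))%C.
Definition cn (u : C) : C := ((ee (/ 2 * u) + ee (- / 2 * u)) / 2)%C.
Lemma PI_C : RtoC PI <> 0.
 intros E. apply RtoC_inj in E. have PI_RGT_0. lra. Qed.
#[local] Hint Resolve PI_C : core.
Lemma Ci_neq_0 : Ci <> 0.
 intros E. injection E. lra. Qed.
#[local] Hint Resolve Ci_neq_0 : core.
Lemma Ci_sq : (Ci * Ci)%C = (-1).
 cring. Qed.
Lemma wder_ext F G z A B : (forall z, F z = G z) -> wder F z A B -> wder G z A B.
 intros E. replace G with F; auto. now fext. Qed.
Lemma wder_sn u : wder sn u (cn u) 0.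
 eapply wder_eq; [eapply wder_ext; [|apply (wder_scal (/ (2 * PI * Ci))), (wder_minus _ _ _ _ _ _ _ (wder_ee_lin (/ 2) u) (wder_ee_lin (- / 2) u))]| |]; [intros z; cring|unfold cn; field; auto|ring].
Qed.
Lemma wder_cn u : wder cn u (- (PI * PI) * sn u)%C 0.
 eapply wder_eq; [eapply wder_ext; [|apply (wder_scal (/ 2)), (wder_plus _ _ _ _ _ _ _ (wder_ee_lin (/ 2) u) (wder_ee_lin (- / 2) u))]| |].
 - intros z. cring.
 - unfold sn. replace (- (PI * PI) * ((ee (/ 2 * u) - ee (- / 2 * u)) / (2 * PI * Ci)))%C with (PI * (Ci * Ci) * (ee (/ 2 * u) - ee (- / 2 * u)) / (2 * Ci))%C; [field; auto|rewrite Ci_sq; field; auto].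
 - field.
Qed.
Lemma mvt_hol (F F' : C -> C) K (u : C) : (forall z, wder F z (F' z) 0) -> (forall z, Cmod z <= Cmod u -> Cmod (F' z) <= K) ->
 Cmod (F u - F 0)%C <= K * Cmod u.
 intros HF HK. replace u with (0 + u)%C at 1 by ring. apply wder_mvt. intros t Ht. exists (F' (0 + t * u)%C), 0. split; [auto|]. rewrite Cmod_0, Rplus_0_r. apply HK. rewrite Cplus_0_l, Cmod_mult, Cmod_R, Rabs_pos_eq by lra. have Cmod_ge_0 u. nra.
Qed.
Lemma sn_0 : sn 0 = 0.
 unfold sn. rewrite !Cmult_0_r. cring. Qed.
Lemma cn_0 : cn 0 = 1.
 unfold cn. rewrite !Cmult_0_r, ee_0. field. Qed.
Lemma cn_bound u : Cmod u <= 1 -> Cmod (cn u) <= exp PI.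
 intros Hu. unfold cn, Cdiv. rewrite Cmod_mult, Cmod_inv, Cmod_R, Rabs_pos_eq by (try lra; intros E; injection E; lra).
 assert (H : forall c : R, Rabs c = / 2 -> Cmod (ee (c * u)) <= exp PI) by (intros c Hc; rewrite Cmod_ee_c; apply exp_le; have PI_RGT_0; have im_le_Cmod u; assert (Rabs (c * Im u) <= / 2) by (rewrite Rabs_mult; nra); apply Rabs_le_between in H1; nra).
 have Cmod_triangle (ee (/ 2 * u)) (ee (- / 2 * u)). have H (/ 2). rewrite RtoC_inv2 in H1. have H (- / 2).
 rewrite RtoC_opp, RtoC_inv2 in H2. specialize (H1 ltac:(rewrite Rabs_pos_eq; lra)). specialize (H2 ltac:(rewrite Rabs_Ropp, Rabs_pos_eq; lra)). lra.
Qed.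
Lemma sn_bounds u : Cmod u <= 1 -> Cmod (sn u) <= exp PI * Cmod u /\ Cmod (sn u - u)%C <= PI ^ 2 * exp PI * Cmod u ^ 3.
 have exp_pos PI. assert (H1 : forall z, Cmod z <= 1 -> Cmod (sn z) <= exp PI * Cmod z).
 { intros z Hz. replace (sn z) with (sn z - sn 0)%C by (rewrite sn_0; ring). apply (mvt_hol sn cn); [apply wder_sn|]. intros; apply cn_bound; lra. } assert (H2 : forall z, Cmod z <= 1 -> Cmod (cn z - 1) <= PI ^ 2 * exp PI * Cmod z ^ 2).
 { intros z Hz. rewrite <- cn_0. replace (PI ^ 2 * exp PI * Cmod z ^ 2) with (PI ^ 2 * (exp PI * Cmod z) * Cmod z) by ring.
  apply (mvt_hol cn (fun z => - (PI * PI) * sn z)%C); [apply wder_cn|]. intros w Hw. rewrite Cmod_mult, Cmod_opp, Cmod_mult, Cmod_R, Rabs_pos_eq by pos. replace (PI * PI) with (PI ^ 2) by ring. mul_l; auto. eapply Rle_trans; [apply H1; lra|]. nra. }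
 split; [auto|]. replace (sn u - u)%C with (sn u - u - (sn 0 - 0))%C by (rewrite sn_0; ring). replace (PI ^ 2 * exp PI * Cmod u ^ 3) with (PI ^ 2 * exp PI * Cmod u ^ 2 * Cmod u) by ring. apply (mvt_hol (fun u => sn u - u)%C (fun u => cn u - 1)%C).
 - intros z. eapply wder_eq; [apply wder_minus; [apply wder_sn|auto]|auto|ring].
 - intros z Hz. eapply Rle_trans; [apply H2; lra|]. mul_l; [pos|]. apply pow_incr. auto.
Qed.
Lemma sin_ge_third a : 0 <= a <= PI / 2 -> a / 3 <= sin a.
 intros [H0 H1]. destruct (Rle_lt_dec a (PI / 3)) as [|H].
 - destruct (Req_dec a 0) as [->|]; [rewrite sin_0; lra|]. destruct (MVT_cor2 sin cos 0 a ltac:(lra)) as [c [E Hc]]; [intros; apply derivable_pt_lim_sin|].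
  rewrite sin_0 in E. assert (1 / 2 <= cos c) by (rewrite <- cos_PI3; apply cos_decr_1; lra). nra.
 - assert (sin (PI / 3) <= sin a) by (apply sin_incr_1; lra). rewrite sin_PI3 in H2. have PI_4. assert (8 / 5 <= sqrt 3); [|lra]. rewrite <- (sqrt_pow2 (8 / 5)) by lra. apply sqrt_le_1; lra.
Qed.
(** With PI u = a + i b one has |sin (a + i b)|^2 = sin^2 a + sinh^2 b, and |sin a| >= |a| / 3 for
    |a| <= PI / 2. *)
Lemma sn_lower u : inH u -> Rabs (Re u) <= / 2 -> Cmod u / 3 <= Cmod (sn u).
 intros Hu Hr. unfold inH in Hu. have PI_RGT_0. set (a := PI * Re u). set (b := PI * Im u). assert (Hb : 0 < b) by (apply Rmult_lt_0_compat; lra). assert (E : (2 * PI * Ci * sn u)%C = (cos a * (exp (- b) - exp b), sin a * (exp (- b) + exp b))).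
 { unfold sn. transitivity (ee (RtoC (/ 2) * u) - ee (RtoC (- / 2) * u))%C.
  { rewrite RtoC_opp, RtoC_inv2. field; auto. } rewrite !ee_polar. unfold polar. rewrite !ee_R. replace (-2 * PI * / 2 * Im u) with (- b) by (unfold b; field).
  replace (-2 * PI * - / 2 * Im u) with b by (unfold b; field). replace (2 * PI * (/ 2 * Re u)) with a by (unfold a; field). replace (2 * PI * (- / 2 * Re u)) with (- a) by (unfold a; field). rewrite cos_neg, sin_neg. cring. }
 assert (HM : Cmod (2 * PI * Ci * sn u) = 2 * PI * Cmod (sn u)) by (rewrite !Cmod_mult, Cmod_Ci, !Cmod_R, !Rabs_pos_eq by lra; ring). assert (HL : (2 / 3 * (PI * Cmod u)) ^ 2 <= (2 * PI * Cmod (sn u)) ^ 2).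
 { rewrite <- HM, E, Cmod_sq. cbn [Re Im fst snd]. rewrite !Rpow_mult_distr, Cmod_sq. replace (PI ^ 2 * (Re u ^ 2 + Im u ^ 2)) with (a ^ 2 + b ^ 2) by (unfold a, b; ring). assert (Ha : a ^ 2 <= 9 * sin a ^ 2).
  { apply Rabs_le_between in Hr. assert (- PI / 2 <= a <= PI / 2) by (unfold a; nra). destruct (Rle_lt_dec 0 a); [have sin_ge_third a ltac:(lra); nra|have sin_ge_third (- a) ltac:(lra) as Hs; rewrite sin_neg in Hs; nra]. }
  assert (Hee : exp b * exp (- b) = 1) by (rewrite <- exp_plus; replace (b + - b) with 0 by ring; apply exp_0). have exp_ge_1x b. assert (exp (- b) < 1) by nra. have sin2_cos2 a as Hsc. unfold Rsqr in Hsc. nra. }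
 have Cmod_ge_0 (sn u). assert (2 / 3 * PI * Cmod u <= 2 * PI * Cmod (sn u)) by (apply Rnot_lt_le; assert (0 <= 2 * PI * Cmod (sn u)); nra). nra.
Qed.
(** For |u| <= 1 the error of order |u|^3 in sn u = u + ... cancels the double pole. For |u| > 1 the
    two terms are at most 9 and 1, which gives the summand 10. *)
Lemma sn_near u : inH u -> Rabs (Re u) <= / 2 -> Cmod (/ (sn u ^ 2) - / (u ^ 2))%C <= 10 + 9 * (PI ^ 2 * exp PI * (exp PI + 1)).
 intros Hu Hr. have sn_lower u Hu Hr as HL. assert (Hu0 : u <> 0) by (intros E; rewrite E in Hu; unfold inH in Hu; simpl in Hu; lra).
 assert (Hum : 0 < Cmod u) by apply Cmod_gt_0, Hu0. assert (Hs0 : sn u <> 0) by (intros E; rewrite E, Cmod_0 in HL; lra). assert (HK : 0 <= PI ^ 2 * exp PI * (exp PI + 1)) by pos. assert (Hs2 : / Cmod (sn u) ^ 2 <= 9 * / Cmod u ^ 2).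
 { replace (9 * / Cmod u ^ 2) with (/ (Cmod u / 3) ^ 2) by (field; lra). inv_le; [pos|nra]. } destruct (Rle_lt_dec (Cmod u) 1) as [H1|].
 - destruct (sn_bounds u H1) as []. replace (/ sn u ^ 2 - / u ^ 2)%C with (- (sn u - u) * (sn u + u) * / u ^ 2 * / sn u ^ 2)%C by (field; auto). rewrite !Cmod_mult, Cmod_opp, !Cmod_Cinv_pow by auto.
  assert (Hp : Cmod (sn u + u) <= (exp PI + 1) * Cmod u) by (eapply Rle_trans; [apply Cmod_triangle|lra]). apply Rle_trans with (PI ^ 2 * exp PI * Cmod u ^ 3 * ((exp PI + 1) * Cmod u) * / Cmod u ^ 2 * (9 * / Cmod u ^ 2)).
  + repeat mul_le; repeat apply Rmult_le_pos; auto using Cmod_ge_0; left; apply Rinv_0_lt_compat, pow_lt; auto. lra.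
  + replace (PI ^ 2 * exp PI * Cmod u ^ 3 * ((exp PI + 1) * Cmod u) * / Cmod u ^ 2 * (9 * / Cmod u ^ 2)) with (9 * PI ^ 2 * exp PI * (exp PI + 1)) by (field; lra). lra.
 - le_via Cmod_triangle. rewrite Cmod_opp, !Cmod_Cinv_pow by auto. assert (/ Cmod u ^ 2 <= 1) by (rewrite <- Rinv_1; inv_le; nra). lra.
Qed.
Lemma one_minus_neq_0 (q : C) : Cmod q < 1 -> (1 - q)%C <> 0.
 intros Hq E. assert (E2 : q = 1) by (replace q with (1 - (1 - q))%C by ring; rewrite E; ring). rewrite E2, Cmod_1 in Hq. lra. Qed.
Lemma Sums_geomC (q : C) : Cmod q < 1 -> Sums (fun k : nat => (q ^ k)%C) (/ (1 - q))%C.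
 intros Hq. have one_minus_neq_0. assert (HG : exists G, Sums (fun k => q ^ k)%C G).
 { eapply Sums_ex, bnd_le; [|apply (bnd_geom (Cmod q)); auto using Cmod_ge_0]. intros k. rewrite Cmod_pow. lra. }
 destruct HG as [G HG]. assert (EG : G = (1 + q * G)%C) by (apply (Sums_unique _ _ _ HG), Sums_nat_S; eapply Sums_ext; [|apply Sums_scal, HG]; auto).
 eapply Sums_eq; [eauto|]. transitivity ((G - q * G) / (1 - q))%C; [field; auto|]. rewrite EG at 1. cring.
Qed.
Lemma Sums_arith (q : C) : Cmod q < 1 -> q <> 0 -> Sums (fun k : nat => (RtoC (INR k) * q ^ k)%C) (q / (1 - q) ^ 2)%C.
 intros Hq Hq0. have one_minus_neq_0 q Hq. have Sums_geomC q Hq as HG. set (G := (/ (1 - q))%C). assert (HT : exists T, Sums (fun k => INR k * q ^ k)%C T).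
 { set (t := - ln (Cmod q)). assert (Ht : 0 < t) by (unfold t; assert (L : ln (Cmod q) < ln 1) by (apply ln_increasing; auto; now apply Cmod_gt_0); rewrite ln_1 in L; lra). destruct (bnd_pow_exp 1) as [K []].
  eapply Sums_ex, (bnd_le _ (fun k => exp t * ((INR k + 1) ^ 1 * exp (- t * (INR k + 1))))); [|apply bnd_scal; [auto|eauto]]. intros k. rewrite Cmod_mult, Cmod_pow, Cmod_R, Rabs_pos_eq by apply pos_INR.
  replace (Cmod q) with (exp (- t)) by (unfold t; rewrite Ropp_involutive, exp_ln; auto; now apply Cmod_gt_0). rewrite <- exp_INR.
  replace (exp t * ((INR k + 1) ^ 1 * exp (- t * (INR k + 1)))) with ((INR k + 1) * (exp t * exp (- t * (INR k + 1)))) by ring. rewrite <- exp_plus. replace (t + - t * (INR k + 1)) with (- t * INR k) by ring. mul_r; [auto|lra]. }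
 destruct HT as [T HT]. assert (ET : T = (q * T + q * G)%C).
 { apply (Sums_unique _ _ _ HT). eapply Sums_eq; [apply Sums_nat_S; eapply Sums_ext; [|apply Sums_plus; [apply (Sums_scal q), HT|apply (Sums_scal q), HG]]|]; [intros k; rewrite S_INR; cring|cring]. }
 eapply Sums_eq; [eauto|]. transitivity ((T - q * T) / (1 - q))%C; [field; auto|]. rewrite ET at 1. unfold G. field; auto.
Qed.
Lemma ee_lt_1 u : inH u -> Cmod (ee u) < 1.
 intros Hu. rewrite Cmod_ee, <- exp_0. apply exp_increasing. have Rmult_lt_0_compat _ _ PI_RGT_0 Hu. lra. Qed.
Lemma sn_neq_0 u : inH u -> sn u <> 0.
 intros Hu E. assert (E2 : ee u = 1).
 { unfold sn in E. assert (E3 : (ee (/ 2 * u) - ee (- / 2 * u))%C = 0).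
  { replace (ee (/ 2 * u) - ee (- / 2 * u))%C with ((ee (/ 2 * u) - ee (- / 2 * u)) / (2 * PI * Ci) * 2 * PI * Ci)%C; [rewrite E; ring|field; auto]. }
  replace u with (/ 2 * u + / 2 * u)%C by field. rewrite ee_plus. replace (ee (/ 2 * u)) with (ee (/ 2 * u) - ee (- / 2 * u) + ee (- / 2 * u))%C at 1 by ring. rewrite E3, Cplus_0_l, <- ee_plus, <- ee_0. f_equal. ring. }
 have ee_lt_1 u Hu. rewrite E2, Cmod_1 in H. lra.
Qed.
Lemma sn_ee u : inH u -> (/ (sn u ^ 2))%C = (- (4 * PI * PI) * (ee u / (1 - ee u) ^ 2))%C.
 intros Hu. have sn_neq_0. assert (E1 : ee u = (ee (/ 2 * u) * ee (/ 2 * u))%C) by (rewrite <- ee_plus; f_equal; field). assert (E2 : ee (- / 2 * u) = (/ ee (/ 2 * u))%C) by (rewrite <- ee_opp; f_equal; ring).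
 assert (E3 : (2 * PI * Ci * sn u = ee (/ 2 * u) - / ee (/ 2 * u))%C) by (unfold sn; rewrite E2; field; auto). assert (E4 : (1 - ee u = - ee (/ 2 * u) * (2 * PI * Ci * sn u))%C) by (rewrite E3, E1; field; auto). rewrite E4, E1.
 replace ((- ee (/ 2 * u) * (2 * PI * Ci * sn u)) ^ 2)%C with (4 * PI * PI * (Ci * Ci) * ee (/ 2 * u) * ee (/ 2 * u) * sn u * sn u)%C by ring. rewrite Ci_sq. field; auto.
Qed.
(** This is (PI / sin (PI u))^2 written in the variable e^(2 PI i u). *)
Definition gL (u : C) : C := (- (4 * PI * PI) * (ee u / (1 - ee u) ^ 2))%C.
Lemma gL_dup u : inH u -> gL u = ((gL (u / 2) + gL ((u + IZR 1) / 2)) / 4)%C.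
 intros Hu. assert (E : forall v, inH v -> forall x, ee v = (x * x)%C -> (1 - x)%C <> 0 /\ (1 + x)%C <> 0).
 { intros v Hv x Ex. have ee_lt_1 v Hv. split; intros E.
  - assert (x = 1) by (replace x with (1 - (1 - x))%C by ring; rewrite E; ring). rewrite Ex, H0, Cmult_1_l, Cmod_1 in H. lra.
  - assert (x = -1) by (replace x with (1 + x - 1)%C by ring; rewrite E; ring). rewrite Ex, H0, Cmod_mult, Cmod_R, Rabs_left in H; lra. }
 assert (E1 : ee u = (ee (u / 2) * ee (u / 2))%C) by (rewrite <- ee_plus; f_equal; field). destruct (E u Hu _ E1) as [].
 assert (E2 : ee ((u + IZR 1) / 2) = (- ee (u / 2))%C) by (replace ((u + IZR 1) / 2)%C with (u / 2 + IZR 1 / 2)%C by field; rewrite ee_plus, ee_half; cring).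
 unfold gL. rewrite E2, E1. set (x := ee (u / 2)). replace (1 - x * x)%C with ((1 - x) * (1 + x))%C by ring. replace (1 - - x)%C with (1 + x)%C by ring. field; auto.
Qed.
Lemma gL_shift u (n : Z) : gL (u + IZR n)%C = gL u.
 unfold gL. now rewrite ee_shift. Qed.
(* Herglotz' argument: the difference is bounded, and the duplication formula halves the bound. *)
Lemma PZ_gL u : inH u -> PZ u = gL u.
 set (M := 48 + 10 + 9 * PI ^ 2 * exp PI * (exp PI + 1)). assert (HM : forall u, inH u -> Cmod (PZ u - gL u) <= M).
 { intros v Hv. destruct (archimed (- Re v + / 2)) as []. set (n := (up (- Re v + / 2) - 1)%Z). rewrite <- (PZ_shift v n), <- (gL_shift v n) by auto. assert (Hn : inH (v + IZR n)) by now apply inH_addZ.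
  assert (Hr : Rabs (Re (v + IZR n)) <= / 2) by (rewrite Re_addZ; unfold n; rewrite minus_IZR; apply Rabs_le; lra). set (w := (v + IZR n)%C).
  replace (gL w) with (/ sn w ^ 2)%C by now apply sn_ee. replace (PZ w - / sn w ^ 2)%C with (PZ w - / w ^ 2 - (/ sn w ^ 2 - / w ^ 2))%C by ring. le_via Cmod_triangle. rewrite Cmod_opp. unfold M. have PZ_near w Hn Hr. have sn_near w Hn Hr. lra. }
 assert (HN : forall N u, inH u -> Cmod (PZ u - gL u) <= M * (/ 2) ^ N).
 { induction N as [|N IH]; intros v Hv; [rewrite Rmult_1_r; auto|]. rewrite PZ_dup, gL_dup by auto. set (a := (v / 2)%C). set (b := ((v + IZR 1) / 2)%C).
  replace ((PZ a + PZ b) / 4 - (gL a + gL b) / 4)%C with (RtoC (/ 4) * (PZ a - gL a + (PZ b - gL b)))%C by (rewrite RtoC_inv4; field). rewrite Cmod_mult, Cmod_R, Rabs_pos_eq by lra. have IH a (inH_half _ Hv). have IH b (inH_half _ (inH_addZ _ 1 Hv)).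
  have Cmod_triangle (PZ a - gL a) (PZ b - gL b). simpl. lra. } intros Hu. apply Ceq_minus, Cmod_eq_0, Rle_antisym; [|auto]. apply Rnot_lt_le. intros L. assert (HM0 : 0 < M + 1) by (specialize (HM u Hu); lra).
 destruct (pow_lt_1_zero (/ 2)) with (y := Cmod (PZ u - gL u) / (M + 1)) as [N HNN].
 - rewrite Rabs_pos_eq; lra.
 - pos.
 - specialize (HNN N (le_n _)). specialize (HN N u Hu). assert (0 < (/ 2) ^ N) by pos. rewrite Rabs_pos_eq in HNN by lra. apply (Rmult_lt_compat_r (M + 1)) in HNN; auto. unfold Rdiv in HNN. rewrite Rmult_assoc, Rinv_l in HNN by lra. nra.
Qed.
Definition lipT (p : nat) (u : C) (k : nat) : C := (RtoC ((INR k + / 2) ^ p) * ee (RtoC (INR k + / 2) * u))%C.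
Definition lipS (p : nat) : C -> C := qF (fun k : nat => RtoC ((INR k + / 2) ^ p)) (fun k => INR k + / 2).
Lemma qs_lip p : qs (fun k : nat => RtoC ((INR k + / 2) ^ p)) (fun k => INR k + / 2).
 split; [intros; pos|]. destruct (bnd_pow_exp p) as [K [HK H]]. exists (K + 4). split; [lra|]. intros y Hy. have PI2_3_2. have Rinv_0_lt_compat _ Hy. eapply bnd_weaken; [|eapply bnd_le; [|apply (H (PI * y)); pos]].
 - mul_le; auto; [lra|]. apply exp_le. assert (/ (PI * y) <= / y) by (inv_le; nra). nra.
 - intros k. have pos_INR k. rewrite Cmod_R, Rabs_pos_eq by pos. mul_le; [pos|auto|apply pow_incr; lra|apply exp_le; assert (0 <= PI * y * INR k) by pos; lra].
Qed.
Lemma lipS_spec p u : inH u -> Sums (lipT p u) (lipS p u).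
 exact (qF_spec _ _ u (qs_lip p)). Qed.
Lemma wder_lipS p u : inH u -> wder (lipS p) u (2 * PI * Ci * lipS (S p) u)%C 0.
 intros Hu. eapply wder_eq; [apply qF_wder; [apply qs_lip|auto]| |reflexivity]. apply tsum_eq. eapply Sums_ext; [|apply Sums_scal, (lipS_spec (S p) u Hu)]. intros k. unfold lipT. cbn . rewrite RtoC_mult. ring.
Qed.
Lemma wder_inv_pow p (a u : C) : (u + a)%C <> 0 -> wder (fun u => / ((u + a) ^ p))%C u (- (INR p) * / ((u + a) ^ S p))%C 0.
 intros H. induction p as [|p IH].
 - eapply wder_eq; [eapply wder_ext; [|apply (wder_const 1)]| |]; [intros; simpl; field|cring|auto].
 - eapply wder_eq; [eapply wder_ext; [|apply (wder_mult _ _ _ _ _ _ _ IH (wder_comp_hol Cinv (fun u => u + a)%C u _ _ _ (wder_Cinv _ H) (wder_plus _ _ _ _ _ _ _ (wder_id u) (wder_const a u))))]| |].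
  + intros z. cbn. destruct (Ceq_dec (z + a) 0) as [E|]; [rewrite E, Cmult_0_l, C_inv_0; ring|field; auto].
  + rewrite S_INR, RtoC_plus. cbn. field; auto.
  + ring.
Qed.
Definition lipZ (p : nat) (u : C) : C := tsum (fun m : Z => (sg m * / ((u + IZR m) ^ p))%C).
Lemma lipZ_spec p u : inH u -> Sums (fun m : Z => (sg m * / ((u + IZR m) ^ (2 + p)))%C) (lipZ (2 + p) u).
 intros Hu. destruct (bnd_inv_pow u p Hu) as []. eapply tsum_HasSum, bnd_le; [|eauto]. intros m. rewrite Cmod_mult, Cmod_sg. lra. Qed.
Lemma wder_lipZ p u : inH u -> wder (lipZ (2 + p)) u (- INR (2 + p) * lipZ (2 + S p) u)%C 0.
 intros Hu. set (d := Im u / 2). assert (Hd : 0 < d) by (unfold inH in Hu; unfold d; lra). set (rho := Rmin d 1).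
 assert (Hrho : 0 < rho) by (apply Rmin_pos; lra). assert (Hb : forall h, Cmod h < rho -> d <= Im (u + h) /\ Rabs (Re (u + h) - Re u) <= 1).
 { intros h Hh. rewrite Im_plus, Re_plus. have im_le_Cmod h. assert (Hr1 : rho <= d) by apply Rmin_l. assert (Hr2 : rho <= 1) by apply Rmin_r.
  assert (H2 : Rabs (Im h) <= d) by lra. apply Rabs_le_between in H2. split; [unfold d in *; lra|]. replace (Re u + Re h - Re u) with (Re h) by ring. have Rmax_Cmod h. have Rmax_l (Rabs (fst h)) (Rabs (snd h)). unfold Re. lra. }
 set (M := fun m : Z => INR (2 + p) * ((/ d) ^ S p * ((2 + 3 / d ^ 2) * / (1 + (IZR m + Re u) ^ 2)))).
 assert (HM : bnd M (INR (2 + p) * ((/ d) ^ S p * ((2 + 3 / d ^ 2) * 18)))) by (assert (0 < 3 / d ^ 2) by pos; apply bnd_scal; [auto|]; apply bnd_scal; [pos|]; apply bnd_scal; [lra|apply bnd_inv_sq]).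
 apply (wder_sum (fun m u => sg m * / (u + IZR m) ^ (2 + p))%C (fun m u => - INR (2 + p) * (sg m * / (u + IZR m) ^ (2 + S p)))%C (fun _ _ => 0) M _ rho) with (1 := Hrho) (2 := HM).
 - intros m h Hh. destruct (Hb h Hh) as []. eapply wder_eq; [apply wder_scal, wder_inv_pow| |]; [apply addZ_neq_0; unfold inH; lra|cring|ring].
 - intros m h Hh. destruct (Hb h Hh) as []. rewrite Cmod_0, Rplus_0_r, !Cmod_mult, Cmod_opp, Cmod_sg, Cmod_R, Rabs_pos_eq, Rmult_1_l by apply pos_INR. mul_l; [auto|]. now apply inv_pow_bound.
 - intros h Hh. destruct (Hb h Hh) as []. apply lipZ_spec. unfold inH. lra.
 - apply Sums_scal, lipZ_spec, Hu.
 - auto.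
Qed.
(** An alternating sum is twice its even part minus the full sum, here PZ (u / 2) / 2 - PZ u. *)
Lemma lipZ_2 u : inH u -> lipZ 2 u = (- (4 * PI * PI) * lipS 1 u)%C.
 intros Hu. have inH_half u Hu as Hh. assert (E1 : lipZ 2 u = (PZ (u / 2) / 2 - PZ u)%C).
 { transitivity (/ 4 * PZ (u / 2) + - / 4 * PZ ((u + IZR 1) / 2))%C; [|rewrite (PZ_dup u Hu); field]. apply tsum_eq, Sums_evod.
  + eapply Sums_ext; [|apply Sums_scal, PZ_spec, Hh]. intros m. have addZ_neq_0 u (2 * m) Hu. rewrite (sg_par (2 * m) 0 m), sg_0 by lia. rewrite mult_IZR, RtoC_mult in *. field; auto.
  + eapply Sums_ext; [|apply Sums_scal, PZ_spec, inH_half, inH_addZ, Hu]. intros m. have addZ_neq_0 u (2 * m + 1) Hu. rewrite (sg_par (2 * m + 1) 1 m), sg_1 by lia. rewrite plus_IZR, mult_IZR, RtoC_plus, RtoC_mult in *. field; auto. }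
 rewrite E1, !PZ_gL by auto. assert (Eq : ee u = (ee (u / 2) * ee (u / 2))%C) by (rewrite <- ee_plus; f_equal; field). have ee_lt_1 u Hu as Hq. have one_minus_neq_0. have one_minus_neq_0 _ (ee_lt_1 _ Hh).
 assert (E2 : lipS 1 u = (ee (u / 2) * (ee u / (1 - ee u) ^ 2) + ee (u / 2) / 2 * / (1 - ee u))%C).
 { apply tsum_eq. eapply Sums_ext; [|apply Sums_plus; apply Sums_scal; [apply Sums_arith; [auto|auto]|apply Sums_geomC, Hq]]. intros k. unfold lipT. rewrite ee_pow.
  replace (RtoC (INR k + / 2) * u)%C with (u / 2 + INR k * u)%C; [rewrite ee_plus, pow_1, RtoC_plus, RtoC_inv2; field|rewrite RtoC_plus, RtoC_inv2; field]. } rewrite E2. unfold gL. rewrite Eq in *. field; auto.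
Qed.
Definition clip (p : nat) : C := ((- (2 * PI * Ci)) ^ (2 + p) / INR (fact (1 + p)))%C.
Lemma fact_C p : RtoC (INR (fact p)) <> 0.
 intros E. apply RtoC_inj in E. have INR_fact_lt_0 p. lra. Qed.
#[local] Hint Resolve fact_C : core.
Lemma clip_neq_0 p : clip p <> 0.
 apply Cmult_neq_0; [apply Cpow_nz; intros E; apply Ci_neq_0; transitivity (- - (2 * PI * Ci) / (2 * PI))%C; [field; auto|]; rewrite E; cring|intros E; have fact_C (1 + p); apply C1_nz; rewrite <- (Cinv_r _ H), E; ring].
Qed.
(** Induction by differentiation: on the left the order of the poles rises, on the right a factor k
    + 1/2 comes down, and uniqueness of derivatives identifies the results. The half-integers come
    from the signs (-1)^m on the left. *)
Theorem lipschitz_formula p u : inH u -> lipZ (2 + p) u = (clip p * lipS (1 + p) u)%C.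
 revert u. induction p as [|p IH]; intros u Hu.
 - rewrite lipZ_2 by auto. unfold clip. cbn [Nat.add fact Nat.mul]. replace ((- (2 * PI * Ci)) ^ 2)%C with (4 * PI * PI * (Ci * Ci))%C by ring. rewrite Ci_sq. simpl INR. field.
 - have wder_lipZ p u Hu as H1. assert (H2 : wder (lipZ (2 + p)) u (clip p * (2 * PI * Ci * lipS (2 + p) u)) 0).
  { eapply wder_extH; [auto|intros z Hz; symmetry; apply IH, Hz|]. eapply wder_eq; [apply wder_scal, wder_lipS, Hu|auto|ring]. } destruct (wder_unique _ _ _ _ _ _ H1 H2) as [E _].
  assert (Hn : RtoC (INR (2 + p)) <> 0) by (intros E0; apply RtoC_inj in E0; rewrite plus_INR in E0; simpl in E0; have pos_INR p; lra).
  transitivity (- / INR (2 + p) * (- INR (2 + p) * lipZ (2 + S p) u))%C; [field; auto|]. rewrite E. unfold clip. change (1 + S p)%nat with (2 + p)%nat.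
  replace (2 + S p)%nat with (S (2 + p)) by lia. change (fact (2 + p)) with ((2 + p) * fact (1 + p))%nat. rewrite mult_INR, RtoC_mult. change ((- (2 * PI * Ci)) ^ S (2 + p))%C with (- (2 * PI * Ci) * (- (2 * PI * Ci)) ^ (2 + p))%C. field; auto.
Qed.

(** * Lattice sums and the splitting by Taylor's formula *)

Definition latc (z : C) : R := Rmin (/ 2) ((24 * Im z) ^ 2).
Lemma latc_pos z : inH z -> 0 < latc z.
 intros Hz. apply Rmin_pos; [lra|]. pos. Qed.
Lemma IZR_ge1 (n : Z) : n <> 0%Z -> 1 <= IZR n ^ 2.
 intros H. assert (1 <= IZR n \/ IZR n <= -1) by (destruct (Z.lt_total n 0) as [|[|]]; [right|lia|left]; apply IZR_le; lia). nra. Qed.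
Lemma lw_lower z p : inH z -> p <> (0, 0)%Z -> latc z * (1 + (IZR (snd p) + 24 * Re z * IZR (fst p)) ^ 2) <= Cmod (lw z p) ^ 2.
 intros Hz Hp. rewrite Cmod_sq, lw_Re, lw_Im. destruct p as [n m]. cbn. assert (H1 : latc z <= / 2) by apply Rmin_l.
 assert (H2 : latc z <= (24 * Im z) ^ 2) by apply Rmin_r. replace (24 * IZR n * Re z + IZR m) with (IZR m + 24 * Re z * IZR n) by ring. set (s := IZR m + 24 * Re z * IZR n).
 destruct (Z.eq_dec n 0) as [->|Hn]; [assert (Hm : m <> 0%Z) by (intros ->; now apply Hp); have IZR_ge1 m Hm; assert (E : s = IZR m) by (unfold s; ring); nra|have IZR_ge1 n Hn; nra].
Qed.
Lemma lw_neq_0 z p : inH z -> p <> (0, 0)%Z -> lw z p <> 0.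
 intros Hz Hp E. have lw_lower z p Hz Hp. rewrite E, Cmod_0 in H. have latc_pos z Hz. have pow2_ge_0 (IZR (snd p) + 24 * Re z * IZR (fst p)). nra.
Qed.
Lemma lw_00 z : lw z (0, 0)%Z = 0.
 cring. Qed.
Lemma Rinv_pow_0 j : / 0 ^ (S j) = 0.
 rewrite pow_i by lia. apply Rinv_0. Qed.
(** The inverse of 0 being 0, the origin drops out of each lattice sum of w^(-2j), j >= 1, without
    an exclusion clause. *)
Lemma C_inv_pow_0 j : (/ (0 ^ S j))%C = 0.
 simpl Cpow. rewrite Cmult_0_l. apply C_inv_0. Qed.
Lemma lat_term_le z j p : inH z ->
 / Cmod (lw z p) ^ (2 * S j) <= (/ latc z) ^ S j * / (1 + (IZR (snd p) + 24 * Re z * IZR (fst p)) ^ 2).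
 intros Hz. have latc_pos z Hz. set (s := IZR (snd p) + 24 * Re z * IZR (fst p)). have pow2_ge_0 s. destruct (eq_dec_cl _ p (0, 0)%Z) as [->|Hp].
 - rewrite lw_00, Cmod_0. replace (2 * S j)%nat with (S (S (2 * j))) by lia. rewrite Rinv_pow_0. pos.
 - have lw_lower z p Hz Hp as HL. fold s in HL. rewrite pow_mult. assert (HA : 0 < latc z * (1 + s ^ 2)) by pos. apply Rle_trans with (/ (latc z ^ S j * (1 + s ^ 2))); [|rewrite Rinv_mult, pow_inv; lra]. inv_le; [pos|].
  apply Rle_trans with ((latc z * (1 + s ^ 2)) ^ S j); [rewrite Rpow_mult_distr; mul_l; [pos|]; simpl; assert (1 <= (1 + s * (s * 1)) ^ j) by (apply pow_R1_Rle; lra); nra|apply pow_incr; lra].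
Qed.
(** The sum of |w|^(-2) over the lattice diverges; the Gaussian factor in Im w makes the sum over
    the rows converge, so the lowest exponent is included. *)
Lemma bnd_lat z j k : inH z -> 0 < k -> exists K, bnd (fun p => exp (- k * Im (lw z p) ^ 2) * / Cmod (lw z p) ^ (2 * S j)) K.
 intros Hz Hk. have latc_pos z Hz. assert (Hy : 0 < k * (24 * Im z) ^ 2) by pos. eexists. eapply bnd_le; [|apply (bnd_scal ((/ latc z) ^ S j)); [pos|]].
 - intros p. eapply Rle_trans; [mul_l; [auto|apply lat_term_le, Hz]|]. rewrite <- Rmult_assoc, (Rmult_comm (exp _)), Rmult_assoc. apply Rle_refl.
 - apply (bnd_fubini _ (fun n => exp (- (k * (24 * Im z) ^ 2) * (IZR n + 0) ^ 2) * 18) ((1 + / (k * (24 * Im z) ^ 2)) * 18 * 18)).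
  + intros p. pos.
  + intros n. apply (bnd_le _ (fun m => exp (- (k * (24 * Im z) ^ 2) * (IZR n + 0) ^ 2) * / (1 + (IZR m + 24 * Re z * IZR n) ^ 2))); [|apply bnd_scal; [auto|]; apply bnd_inv_sq].
   intros m. rewrite lw_Im. cbn [fst snd]. replace (- k * (24 * IZR n * Im z) ^ 2) with (- (k * (24 * Im z) ^ 2) * (IZR n + 0) ^ 2) by ring. auto.
  + eapply bnd_le; [|eapply bnd_weaken; [|apply (bnd_scal 18); [lra|apply (bnd_gauss _ 0 Hy)]]]; [intuition lra|lra].
Qed.
Lemma Cmod_thT_le r z p : inH z -> 0 <= r <= 1 ->
 Cmod (thT r z p) = exp (- (Xy z * (1 - r)) * Cmod (lw z p) ^ 2 - 2 * r * Xy z * Im (lw z p) ^ 2).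
 intros Hz Hr. rewrite Cmod_thT by auto. f_equal. rewrite Cmod_sq, lw_Re, lw_Im. ring. Qed.
Definition BT (j : nat) (z : C) (p : Z * Z) : C := (thT 1 z p * / (lw z p ^ (2 * j)))%C.
Definition LT (j : nat) (z : C) (p : Z * Z) : C := (thT 0 z p * / (lw z p ^ (2 * j)))%C.
Definition Bj (j : nat) (z : C) : C := tsum (BT j z).
Definition Lj (j : nat) (z : C) : C := tsum (LT j z).
Lemma Cmod_inv_lw z p j : Cmod (/ (lw z p ^ (2 * S j)))%C = / Cmod (lw z p) ^ (2 * S j).
 destruct (Ceq_dec (lw z p) 0) as [->|]; [|now apply Cmod_Cinv_pow]. rewrite Cmod_0. replace (2 * S j)%nat with (S (S (2 * j))) by lia. now rewrite Rinv_pow_0, C_inv_pow_0, Cmod_0.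
Qed.
Lemma Bj_spec j z : inH z -> Sums (BT (S j) z) (Bj (S j) z).
 intros Hz. have Xy_pos z Hz. destruct (bnd_lat z j (2 * Xy z) Hz ltac:(lra)) as []. eapply tsum_HasSum, bnd_le; [|eauto]. intros p. unfold BT. rewrite Cmod_mult, Cmod_thT_le, Cmod_inv_lw by pos. right. f_equal. f_equal. ring.
Qed.
Lemma Lj_spec j z : inH z -> Sums (LT (S j) z) (Lj (S j) z).
 intros Hz. have Xy_pos z Hz as HX. destruct (bnd_lat z j (Xy z) Hz ltac:(lra)) as [K HK]. eapply tsum_HasSum, bnd_le; [|eauto]. intros p. unfold LT. rewrite Cmod_mult, Cmod_thT_le, Cmod_inv_lw by pos. mul_r; [|apply exp_le; rewrite Cmod_sq; nra].
 destruct (Ceq_dec (lw z p) 0) as [->|H]; [rewrite Cmod_0; replace (2 * S j)%nat with (S (S (2 * j))) by lia; rewrite Rinv_pow_0; lra|]. left. apply Rinv_0_lt_compat, pow_lt, Cmod_gt_0, H.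
Qed.
(** At r = 1 the exponent is X w (w - conj w) = 3 PI i n w, from which Im z has disappeared. *)
Lemma thT1_eq z n m : inH z -> thT 1 z (n, m) = (sg n * sg m * ee (RtoC (36 * IZR n ^ 2) * z))%C.
 intros Hz. assert (Hy : Im z <> 0) by (unfold inH in *; lra). rewrite thT_polar by auto. unfold sg. rewrite ee_polar, !polar_mult. apply polar_eqZ with (k := (2 * n * m)%Z); [unfold Xy; field; lra|rewrite !plus_IZR, !mult_IZR; lra].
Qed.
Definition Bc (j : nat) : C := tsum (fun m : Z => (sg m * / (IZR m ^ (2 * j)))%C).
Lemma Bc_spec j : Sums (fun m : Z => (sg m * / (IZR m ^ (2 * S j)))%C) (Bc (S j)).
 eapply tsum_HasSum. eapply bnd_le; [|apply (bnd_scal 2); [lra|apply bnd_inv_sq_Z]]. intros m. rewrite Cmod_mult, Cmod_sg, Rmult_1_l. destruct (Z.eq_dec m 0) as [->|Hm].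
 - replace (2 * S j)%nat with (S (S (2 * j))) by lia. rewrite C_inv_pow_0, Cmod_0. lra.
 - have IZR_ge1 m Hm. rewrite Cmod_Cinv_pow by (intros E; apply RtoC_inj in E; apply Hm, eq_IZR, E). rewrite Cmod_R, pow_mult, pow2_abs. replace (2 * / (1 + IZR m ^ 2)) with (/ ((1 + IZR m ^ 2) / 2)) by (field; lra). inv_le; [lra|]. cbn.
  assert (1 <= (IZR m * (IZR m * 1)) ^ j) by (apply pow_R1_Rle; lra). nra.
Qed.
(** The row n = 0 is the constant [Bc]. A row n <> 0 is an alternating sum of (24 |n| z +
    m)^(-2j-2), evaluated by the Lipschitz formula, and the rows n and -n agree, whence the factor
    2. *)
Theorem Bj_value j z : inH z -> Bj (S j) z = (Bc (S j) + 2 * clip (2 * j) * Sj j z)%C.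
 intros Hz. set (g := fun n : Z => if Z.eq_dec n 0 then Bc (S j) else (sg n * ee (RtoC (36 * IZR n ^ 2) * z) * lipZ (2 + 2 * j) (RtoC (24 * Rabs (IZR n)) * z))%C).
 assert (Hu : forall n : Z, n <> 0%Z -> inH (RtoC (24 * Rabs (IZR n)) * z)) by (intros n Hn; apply inH_scal; auto; apply Rmult_lt_0_compat; [lra|]; apply Rabs_pos_lt; intros E; apply Hn, eq_IZR, E). assert (Hg : Sums g (Bj (S j) z)).
 { apply (Sums_fubini _ _ _ (Bj_spec j z Hz)). intros n. unfold g. destruct (Z.eq_dec n 0) as [->|Hn].
  - sum_ext Bc_spec. intros m. unfold BT. rewrite thT1_eq by auto. f_equal; [replace (36 * IZR 0 ^ 2) with 0 by lra; rewrite Cmult_0_l, ee_0, sg_0; ring|do 2 f_equal; cring].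
  - destruct (Z.lt_total n 0) as [L|[|]]; [|lia|].
   + apply (Sums_reindex_back (fun m => (- m)%Z) (fun m => (- m)%Z)); try (intros; lia). eapply Sums_ext; [|apply Sums_scal, lipZ_spec, Hu, Hn]. intros m. unfold BT. rewrite thT1_eq by auto. rewrite (sg_par (- m) m (- m)) by lia.
    assert (El : lw z (n, (- m)%Z) = (- (RtoC (24 * Rabs (IZR n)) * z + IZR m))%C) by (unfold lw; cbn; rewrite Rabs_left by apply IZR_lt, L; rewrite opp_IZR; cring). rewrite El. replace (2 + 2 * j)%nat with (2 * S j)%nat by lia. rewrite !Cpow_mult_r.
    replace ((- (RtoC (24 * Rabs (IZR n)) * z + IZR m)) ^ 2)%C with ((RtoC (24 * Rabs (IZR n)) * z + IZR m) ^ 2)%C by ring. ring.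
   + eapply Sums_ext; [|apply Sums_scal, lipZ_spec, Hu, Hn]. intros m. unfold BT. rewrite thT1_eq by auto. replace (2 * S j)%nat with (2 + 2 * j)%nat by lia. unfold lw. cbn. rewrite Rabs_pos_eq by (apply IZR_le; lia). ring. }
 assert (Hrow : forall i : nat, Sums (fun k => St j z (i, k)) (sg (zn (S i)) * ee (RtoC (36 * INR (S i) ^ 2) * z) * lipS (1 + 2 * j) (RtoC (24 * INR (S i)) * z))).
 { intros i. eapply Sums_ext; [|apply Sums_scal, lipS_spec, inH_scal; auto; rewrite S_INR; have pos_INR i; lra]. intros k. unfold lipT, St. cbn [fst snd]. replace (2 * j + 1)%nat with (1 + 2 * j)%nat by lia.
  replace (RtoC (36 * INR (S i) ^ 2 + 24 * INR (S i) * (INR k + / 2)) * z)%C with (RtoC (36 * INR (S i) ^ 2) * z + RtoC (INR k + / 2) * (RtoC (24 * INR (S i)) * z))%C by cring. rewrite ee_plus. ring. }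
 have Sums_fubini _ _ _ (Sj_spec j z Hz) Hrow as HS. assert (Hp : Sums (fun n : nat => g (zn (S n))) (clip (2 * j) * Sj j z)).
 { eapply Sums_ext; [|apply Sums_scal, HS]. intros n. unfold g. destruct (Z.eq_dec (zn (S n)) 0); [lia|].
  rewrite <- INR_IZR_INZ, Rabs_pos_eq by apply pos_INR. rewrite lipschitz_formula; [ring|]. apply inH_scal; auto. rewrite S_INR; have pos_INR n; lra. }
 apply (Sums_unique g); auto. replace (Bc (S j) + 2 * clip (2 * j) * Sj j z)%C with (Bc (S j) + clip (2 * j) * Sj j z + clip (2 * j) * Sj j z)%C by ring.
 apply Sums_Z; [apply Sums_nat_S; auto|]. eapply Sums_ext; [|eauto]. intros n. unfold g. destruct (Z.eq_dec (zn (S n)) 0); [lia|]. destruct (Z.eq_dec (- zn n - 1) 0); [lia|]. replace (- zn n - 1)%Z with (- zn (S n))%Z by lia.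
 rewrite opp_IZR, Rabs_Ropp, (sg_par (- zn (S n)) (zn (S n)) (- zn (S n))) by lia. do 4 f_equal. cring.
Qed.
Definition expS (j : nat) (s : C) : C := Csum (fun i => (s ^ i / INR (fact i))%C) (seq 0 j).
Lemma expS_S j s : expS (S j) s = (expS j s + s ^ j / INR (fact j))%C.
 unfold expS. rewrite seq_S, Csum_app. cring. Qed.
(* [om j s r = (1-r)^j e^(r s) Tay_j ((1-r) s)] with [Tay_j] the normalised Taylor remainder of [exp]. *)
Definition om (j : nat) (s : C) (r : R) : C :=
 if Ceq_dec s 0 then (RtoC ((1 - r) ^ j) / INR (fact j))%C else ((cexp s - cexp (r * s) * expS j ((1 - r) * s)) / s ^ j)%C.
Definition Wj (j : nat) (z : C) : C := tsum (fun p => (thT 0 z p * om j (Xy z * (lw z p * lw z p)) 0)%C).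
Lemma thT_cexp r z p : thT r z p = (thT 0 z p * cexp (r * (Xy z * (lw z p * lw z p))))%C.
 unfold thT. rewrite <- Cmult_assoc, <- cexp_plus. do 2 f_equal. ring. Qed.
Lemma expS_bound j (s : C) a : 0 <= a -> Cmod s <= a -> Cmod (expS j s) <= INR j * 2 ^ j * exp (a / 2).
 intros Ha Hs. induction j as [|]; [unfold expS; simpl; rewrite Cmod_0; lra|]. rewrite expS_S. le_via Cmod_triangle. assert (H : Cmod (s ^ j / INR (fact j)) <= 2 ^ j * exp (a / 2)).
 { unfold Cdiv. rewrite Cmod_mult, Cmod_pow, Cmod_inv, Cmod_R by apply fact_C. have INR_fact_lt_0 j. rewrite Rabs_pos_eq by lra.
  have pow_le_fact_exp j (a / 2) ltac:(lra). apply Rmult_le_reg_r with (INR (fact j)); auto. rewrite Rmult_assoc, Rinv_l, Rmult_1_r by lra. apply Rle_trans with (a ^ j); [apply pow_incr; auto using Cmod_ge_0|].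
  replace (a ^ j) with (2 ^ j * (a / 2) ^ j) by (rewrite <- Rpow_mult_distr; f_equal; field). rewrite Rmult_assoc. mul_l; [pos|lra]. } rewrite S_INR. have exp_pos (a / 2). assert (1 <= 2 ^ j) by (apply pow_R1_Rle; lra). have pos_INR j.
 replace (2 ^ S j) with (2 * 2 ^ j) by reflexivity. assert (INR j * 2 ^ j * exp (a / 2) <= INR j * 2 * 2 ^ j * exp (a / 2)) by (mul_r; nra). nra.
Qed.
(** The bound is independent of r in [0, 1], as the deformation in r requires. Since Re s = X (|w|^2
    - 2 (Im w)^2), the Gaussian of [thT 0] absorbs the exponentials in the remainder and leaves the
    decay exp (- X (Im w)^2 / 2). *)
Lemma om_bound j z p r : inH z -> 0 <= r <= 1 ->
 Cmod (thT 0 z p * om (S j) (Xy z * (lw z p * lw z p)) r)%C <= (if eq_dec_cl _ p (0, 0)%Z then 1 else 0) + ((1 + INR (S j) * 2 ^ (S j)) * / (Xy z) ^ (S j)) * (exp (- (Xy z / 2) * Im (lw z p) ^ 2) * / Cmod (lw z p) ^ (2 * S j)).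
 intros Hz Hr. have Xy_pos z Hz. destruct eq_dec_cl as [->|].
 - rewrite lw_00, Cmod_0. replace (2 * S j)%nat with (S (S (2 * j))) by lia. rewrite Rinv_pow_0. unfold om. destruct Ceq_dec as [|N]; [|exfalso; apply N; ring]. rewrite Cmod_mult, Cmod_thT_le, lw_00, Cmod_0 by pos.
  replace (- (Xy z * (1 - 0)) * 0 ^ 2 - 2 * 0 * Xy z * Im 0 ^ 2) with 0 by field. rewrite exp_0. unfold Cdiv. rewrite Cmod_mult, Cmod_inv, !Cmod_R by apply fact_C. rewrite !Rabs_pos_eq by pos.
  assert (H1 : (1 - r) ^ S j <= 1) by (assert (HH := pow_incr (1 - r) 1 (S j) ltac:(lra)); rewrite pow1 in HH; exact HH). assert (H2 : / INR (fact (S j)) <= 1) by (rewrite <- Rinv_1; inv_le; [lra|]; apply (le_INR 1), lt_O_fact).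
  have pow_le (1 - r) (S j) ltac:(lra). nra.
 - rewrite Rplus_0_l. assert (Hw : lw z p <> 0) by now apply lw_neq_0. set (w := lw z p). set (X := Xy z) in *. set (s := (X * (w * w))%C). assert (Hs : s <> 0) by (unfold s; apply Cmult_neq_0; [|now apply Cmult_neq_0]; cnz).
  assert (HRs : Re s = X * (Cmod w ^ 2 - 2 * Im w ^ 2)) by (unfold s; rewrite Cmod_sq; simpl; ring).
  assert (HMs : Cmod s = X * Cmod w ^ 2) by (unfold s; rewrite !Cmod_mult, Cmod_R, Rabs_pos_eq by lra; ring). unfold om. destruct Ceq_dec as [|]; [tauto|].
  rewrite Cmod_mult, Cmod_thT_le by pos. fold w X. unfold Cdiv. rewrite Cmod_mult, Cmod_Cinv_pow, HMs, Rpow_mult_distr, <- pow_mult, Rinv_mult by auto. replace (- (X * (1 - 0)) * Cmod w ^ 2 - 2 * 0 * X * Im w ^ 2) with (- X * Cmod w ^ 2) by ring.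
  assert (HN : exp (- X * Cmod w ^ 2) * Cmod (cexp s - cexp (r * s) * expS (S j) ((1 - r) * s)) <= (1 + INR (S j) * 2 ^ S j) * exp (- (X / 2) * Im w ^ 2)).
  { assert (Hiw : Im w ^ 2 <= Cmod w ^ 2) by (rewrite Cmod_sq; have pow2_ge_0 (Re w); lra). assert (Ht : Cmod (cexp s - cexp (r * s) * expS (S j) ((1 - r) * s)) <= exp (Re s) + exp (r * Re s) * (INR (S j) * 2 ^ S j * exp ((1 - r) * Cmod s / 2))).
   { le_via Cmod_triangle. rewrite Cmod_opp, Cmod_mult, !Cmod_cexp. replace (Re (r * s)) with (r * Re s) by (simpl; ring).
    apply Rplus_le_compat_l, Rmult_le_compat_l; [auto|]. apply expS_bound; [pos|]. rewrite <- RtoC_minus, Cmod_mult, Cmod_R, Rabs_pos_eq by lra. lra. }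
   apply Rle_trans with (exp (- X * Cmod w ^ 2) * (exp (Re s) + exp (r * Re s) * (INR (S j) * 2 ^ S j * exp ((1 - r) * Cmod s / 2)))).
   { mul_l; auto0. auto. } replace (exp (- X * Cmod w ^ 2) * (exp (Re s) + exp (r * Re s) * (INR (S j) * 2 ^ S j * exp ((1 - r) * Cmod s / 2)))) with
    (exp (- X * Cmod w ^ 2) * exp (Re s) + INR (S j) * 2 ^ S j * (exp (- X * Cmod w ^ 2) * exp (r * Re s) * exp ((1 - r) * Cmod s / 2))) by ring. rewrite <- !exp_plus, HRs, HMs, Rmult_plus_distr_r, Rmult_1_l.
   apply Rplus_le_compat; [|mul_l; [pos|]]; apply exp_le; assert (HQ : 0 <= X * Im w ^ 2) by pos; assert (HP : X * Im w ^ 2 <= X * Cmod w ^ 2) by nra; have Rmult_le_pos (1 - r) (X * Cmod w ^ 2 - X * Im w ^ 2) ltac:(lra) ltac:(lra);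
    have Rmult_le_pos r (X * Im w ^ 2) ltac:(lra) HQ; lra. } rewrite <- Rmult_assoc. replace ((1 + INR (S j) * 2 ^ S j) * / X ^ S j * (exp (- (X / 2) * Im w ^ 2) * / Cmod w ^ (2 * S j))) with
   ((1 + INR (S j) * 2 ^ S j) * exp (- (X / 2) * Im w ^ 2) * (/ X ^ S j * / Cmod w ^ (2 * S j))) by ring. mul_r; auto. left. apply Rmult_lt_0_compat; apply Rinv_0_lt_compat, pow_lt; [lra|]. now apply Cmod_gt_0.
Qed.
Lemma bnd_delta {I} (i0 : I) : bnd (fun p => if eq_dec_cl _ p i0 then 1 else 0) 1.
 intros l Hl. induction l as [|]; [simpl; lra|]. inversion Hl. rewrite Rsum_cons. destruct eq_dec_cl as [->|]; [|intuition lra].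
 assert (E : Rsum (fun p => if eq_dec_cl I p i0 then 1 else 0) l = 0); [|lra]. clear - H1. induction l as [|y l IH]; [auto|]. rewrite Rsum_cons, IH by (intros H; apply H1; now right). destruct eq_dec_cl; [exfalso; apply H1; now left|lra].
Qed.
Definition omM (j : nat) (z : C) (p : Z * Z) : R := (if eq_dec_cl _ p (0, 0)%Z then 1 else 0) +
 ((1 + INR (S j) * 2 ^ (S j)) * / (Xy z) ^ (S j)) * (exp (- (Xy z / 2) * Im (lw z p) ^ 2) * / Cmod (lw z p) ^ (2 * S j)).
Lemma bnd_omM j z : inH z -> exists K, bnd (omM j z) K.
 intros Hz. have Xy_pos z Hz. destruct (bnd_lat z j (Xy z / 2) Hz ltac:(lra)) as []. eexists. apply bnd_plus; [apply bnd_delta|]. apply bnd_scal; [|eauto]. pos.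
Qed.
Lemma Wj_spec j z : inH z -> Sums (fun p => (thT 0 z p * om (S j) (Xy z * (lw z p * lw z p)) 0)%C) (Wj (S j) z).
 intros Hz. destruct (bnd_omM j z Hz) as []. eapply tsum_HasSum, bnd_le; [|eauto]. intros p. apply om_bound; auto. lra. Qed.
(** For w <> 0 the summand is thT 0 * exp s / w^(2j+2) with s = X w^2, and exp s is split into its
    Taylor polynomial and remainder. The origin is absent from B and L but contributes 1 / (j+1)! to
    W, which the subtracted power of X corrects; this correction is the origin of the entry - 1 /
    eta in [E0]. *)
Theorem Bj_split j z : inH z ->
 Bj (S j) z = (Csum (fun i => Xy z ^ i / INR (fact i) * Lj (S j - i) z) (seq 0 (S j)) - Xy z ^ S j / INR (fact (S j)) + Xy z ^ S j * Wj (S j) z)%C.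
 intros Hz. have Xy_pos z Hz as HX. assert (HL : Sums (fun p => Csum (fun i => Xy z ^ i / INR (fact i) * LT (S j - i) z p)%C (seq 0 (S j))) (Csum (fun i => Xy z ^ i / INR (fact i) * Lj (S j - i) z)%C (seq 0 (S j)))).
 { assert (H : forall l, (forall i, In i l -> (i < S j)%nat) -> Sums (fun p => Csum (fun i => Xy z ^ i / INR (fact i) * LT (S j - i) z p)%C l) (Csum (fun i => Xy z ^ i / INR (fact i) * Lj (S j - i) z)%C l)).
  { induction l as [|i l IH]; intros Hl; [auto|]. eapply Sums_ext; [|apply Sums_plus; [apply (Sums_scal (Xy z ^ i / INR (fact i)) (LT (S j - i) z) (Lj (S j - i) z))|apply IH; intros; apply Hl; now right]]; [auto|].
   specialize (Hl i (or_introl eq_refl)). replace (S j - i)%nat with (S (j - i)) by lia. apply Lj_spec, Hz. } apply H. intros i Hi. apply in_seq in Hi. lia. } apply (Sums_unique (BT (S j) z)); [now apply Bj_spec|].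
 eapply Sums_ext; [|apply Sums_plus; [apply Sums_minus; [eauto|]|apply Sums_scal, (Wj_spec j z Hz)]].
 2:{ eapply Sums_eq; [apply (Sums_single (0, 0)%Z (fun p => if eq_dec_cl _ p (0, 0)%Z then (Xy z ^ S j / INR (fact (S j)))%C else 0))|]; [intros p Hp; destruct eq_dec_cl; tauto|destruct eq_dec_cl; tauto]. }
 intros p. cbv beta. destruct eq_dec_cl as [->|].
 - assert (E1 : forall i, (i < S j)%nat -> LT (S j - i) z (0, 0)%Z = 0) by (intros i Hi; unfold LT; rewrite lw_00; replace (2 * (S j - i))%nat with (S (S (2 * (j - i)))) by lia; rewrite C_inv_pow_0; ring).
  rewrite (Csum_ext_in _ (fun _ => 0)) by (intros i Hi; apply in_seq in Hi; rewrite E1 by lia; ring). unfold BT. rewrite lw_00.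
  replace (2 * S j)%nat with (S (S (2 * j))) by lia. rewrite C_inv_pow_0. unfold om. destruct Ceq_dec as [|N]; [|exfalso; apply N; ring]. unfold thT, leps. cbn [fst snd]. rewrite lw_00. replace (0 + 0 + 0 * 0)%Z with 0%Z by ring. rewrite sg_0.
  replace (Xy z * (0 * (0 * 0) - 0 * Cconj 0))%C with (RtoC 0) by ring. rewrite cexp_0. replace ((1 - 0) ^ S j) with 1 by (rewrite Rminus_0_r, pow1; ring).
  assert (E0 : forall l : list nat, Csum (fun _ => 0) l = 0) by (induction l as [|? l IH]; [auto|rewrite Csum_cons, IH; ring]). rewrite E0. cring.
 - assert (Hw : lw z p <> 0) by now apply lw_neq_0. unfold BT, LT. rewrite (thT_cexp 1). set (w := lw z p). set (X := RtoC (Xy z)). assert (HX0 : X <> 0) by cnz. set (s := (X * (w * w))%C). assert (Hs : s <> 0) by (unfold s; auto using Cmult_neq_0).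
  assert (Es : forall k, (s ^ k = X ^ k * w ^ (2 * k))%C) by (intros k; unfold s; rewrite Cpow_mult_l, Cpow_mult_r; do 2 f_equal; ring). unfold om. destruct Ceq_dec as [|]; [tauto|].
  replace (Csum (fun i => X ^ i / INR (fact i) * (thT 0 z p * / w ^ (2 * (S j - i))))%C (seq 0 (S j))) with (thT 0 z p * / w ^ (2 * S j) * expS (S j) s)%C.
  + replace (1 * s)%C with s by ring. replace (0 * s)%C with (RtoC 0) by ring. replace ((1 - 0) * s)%C with s by ring. rewrite cexp_0, Es. field; auto.
  + unfold expS. rewrite <- Csum_scal. apply Csum_ext_in. intros i Hi. apply in_seq in Hi. replace (2 * S j)%nat with (2 * i + 2 * (S j - i))%nat by lia. rewrite Cpow_add_r, Es. field; auto.
Qed.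

(** * Incomplete gamma integrals *)

Definition hh (j : nat) (y : R) : R := / (y ^ S j * sqrt y).
Lemma hh_pos j y : 0 < y -> 0 < hh j y.
 intros Hy. apply Rinv_0_lt_compat, Rmult_lt_0_compat; [pos|pos]. Qed.
#[local] Hint Resolve hh_pos : core.
Lemma hh_anti j y y' : 0 < y -> y <= y' -> hh j y' <= hh j y.
 intros Hy Hy'. inv_le; [pos|]. mul_le; [pos|auto|apply pow_incr; lra|apply sqrt_le_1; lra]. Qed.
Lemma is_derive_hh j y : 0 < y -> is_derive (hh j) y (- (INR j + 3 / 2) * hh (S j) y).
 intros Hy. have sqrt_lt_R0 y Hy. have pow_lt y j Hy as Hp. unfold hh. eapply is_derive_val; [apply is_derive_inv; [apply (is_derive_mult (fun y => y ^ S j) sqrt)|]|].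
 - apply is_derive_pow, is_derive_id.
 - apply is_derive_sqrt; [apply is_derive_id|auto].
 - intros; apply Rmult_comm.
 - cbn. assert (0 < y * y ^ j * sqrt y) by pos. lra.
 - rewrite S_INR. cbn. have sqrt_sqrt y ltac:(lra) as Ey. set (t := sqrt y) in *. revert Hp. rewrite <- Ey. generalize (t ^ j). intros P HP. field. lra.
Qed.
Lemma is_derive_lin_exp b y : is_derive (fun y => exp (b * y)) y (b * exp (b * y)).
 auto_derive; [auto|ring]. Qed.
(* After the substitution [u = / v ^ 2] the incomplete gamma integral of [u ^ (-3/2) exp (- b u)] over [[y, oo)] is proper. *)
Definition gv (b v : R) : R := if Req_EM_T v 0 then 0 else exp (- (b / v ^ 2)).
Lemma gv_bounds b v : 0 < b -> 0 <= gv b v <= 1.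
 unfold gv. destruct Req_EM_T; [lra|]. split; [auto|]. apply Rle_trans with (exp 0); [|rewrite exp_0; lra]. apply exp_le. assert (0 < b / v ^ 2) by (apply Rdiv_lt_0_compat; assert (0 < v ^ 2) by nra; auto). lra.
Qed.
Lemma gv_cont b v : 0 < b -> continuous (gv b) v.
 intros Hb. destruct (Req_EM_T v 0) as [->|].
 - apply continuity_pt_filterlim. intros eps He. exists (Rmin 1 (eps * b)). split; [apply Rmin_pos; nra|]. intros x [_ Hx]. simpl in Hx |- *.
  unfold Rdist in *. rewrite Rminus_0_r in Hx. unfold gv. destruct (Req_EM_T 0 0) as [|]; [|tauto]. destruct Req_EM_T; [rewrite Rminus_0_r, Rabs_R0; auto|].
  rewrite Rminus_0_r, Rabs_pos_eq by auto. assert (H1 : Rabs x < 1) by (eapply Rlt_le_trans; [eauto|apply Rmin_l]).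
  assert (H2 : Rabs x < eps * b) by (eapply Rlt_le_trans; [exact Hx|apply Rmin_r]). assert (Hx2 : 0 < x ^ 2) by nra. assert (Hq : 0 < b / x ^ 2) by pos.
  rewrite exp_Ropp. have exp_ge_1x (b / x ^ 2). apply Rle_lt_trans with (/ (b / x ^ 2)); [inv_le; lra|]. replace (/ (b / x ^ 2)) with (Rabs x * Rabs x * / b) by (rewrite <- Rabs_mult, Rabs_pos_eq by nra; field; lra). have Rabs_pos x.
  apply Rle_lt_trans with (Rabs x * / b); [mul_r; [pos|nra]|apply Rmult_lt_reg_r with b; auto; rewrite Rmult_assoc, Rinv_l; lra].
 - assert (Hl : locally v (fun x => exp (- (b / x ^ 2)) = gv b x)).
  { assert (Hp : 0 < Rabs v) by now apply Rabs_pos_lt. exists (mkposreal _ Hp). intros x Hx. unfold gv. destruct Req_EM_T as [->|]; auto. change (Rabs (0 - v) < Rabs v) in Hx. rewrite Rminus_0_l, Rabs_Ropp in Hx. lra. }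
  apply (continuous_ext_loc _ _ _ Hl), (ex_derive_continuous (V := R_NormedModule)). auto_derive. auto.
Qed.
Lemma gv_ex b x y : 0 < b -> ex_RInt (gv b) x y.
 intros Hb. apply (ex_RInt_continuous (V := R_CompleteNormedModule)). intros; now apply gv_cont. Qed.
(** This is exp (b y) times the integral of u^(-j-3/2) exp (- b u) over [y, oo), and the recursion
    is integration by parts. The factor exp (b y) leaves a quantity bounded by powers of y. *)
Fixpoint II (j : nat) (b y : R) : R := match j with
 | O => 2 * exp (b * y) * RInt (gv b) 0 (/ sqrt y)
 | S j' => (hh j' y - b * II j' b y) / (INR j' + 3 / 2) end.
Lemma is_derive_II j b y : 0 < b -> 0 < y -> is_derive (II j b) y (b * II j b y - hh j y).
 intros Hb Hy. induction j as [|j IH].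
 - have sqrt_lt_R0 y Hy as Hs. assert (D2 : is_derive (fun y => RInt (gv b) 0 (/ sqrt y)) y (- / 2 * / (y * sqrt y) * gv b (/ sqrt y))).
  { eapply is_derive_val; [apply is_derive_comp|].
   - apply (is_derive_RInt (gv b) (RInt (gv b) 0) 0); [apply filter_forall; intros x; apply (RInt_correct (V := R_CompleteNormedModule)), gv_ex, Hb|apply gv_cont, Hb].
   - apply is_derive_inv; [apply is_derive_sqrt; [apply is_derive_id|auto]|lra].
   - cbn -[sqrt pow gv]. have sqrt_sqrt y ltac:(lra) as Ey. set (t := sqrt y) in *. rewrite <- Ey. field; lra. } eapply is_derive_val; [apply (is_derive_mult (fun y => 2 * exp (b * y)) (fun y => RInt (gv b) 0 (/ sqrt y)));
   [apply is_derive_scal, is_derive_lin_exp|eauto|intros; apply Rmult_comm]|]. cbn -[sqrt pow gv RInt].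
  assert (Eg : gv b (/ sqrt y) = / exp (b * y)) by (unfold gv; destruct Req_EM_T as [|]; [exfalso; have Rinv_0_lt_compat _ Hs; lra|]; rewrite <- exp_Ropp; do 2 f_equal; rewrite pow_inv, pow2_sqrt by lra; field; lra).
  rewrite Eg. unfold hh. have exp_pos (b * y). field. lra.
 - have pos_INR j. cbn. eapply is_derive_val; [eapply is_derive_ext; [intros; apply Rmult_comm|apply is_derive_scal, (is_derive_minus (hh j) (fun y => b * II j b y)); [apply is_derive_hh, Hy|apply is_derive_scal, IH]]|]. cbn -[hh II INR]. field. lra.
Qed.
(** By the equation exp (- b y) K(y) is nonincreasing, and it tends to 0 because K is bounded. *)
Lemma ode_nonneg (K k : R -> R) b C y : 0 < b -> 0 < y -> (forall x, y <= x -> is_derive K x (b * K x - k x)) ->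
 (forall x, y <= x -> 0 <= k x) -> (forall x, y <= x -> Rabs (K x) <= C) -> 0 <= K y.
 intros Hb Hy HD Hk HC. assert (Hdec : forall Y, y < Y -> exp (- b * Y) * K Y <= exp (- b * y) * K y).
 { intros Y HY.
  assert (HE : forall x, y <= x -> is_derive (fun x => exp (- b * x) * K x) x (- (exp (- b * x) * k x))) by (intros x Hx; eapply is_derive_val; [apply (is_derive_mult (fun x => exp (- b * x)) K); [apply is_derive_lin_exp|auto|intros; apply Rmult_comm]|]; cbn; ring).
  destruct (MVT_gen (fun x => exp (- b * x) * K x) y Y (fun x => - (exp (- b * x) * k x))) as [c [Hc E]].
  - intros x Hx. apply HE. rewrite Rmin_left in Hx; lra.
  - intros x Hx. apply continuity_pt_filterlim, (ex_derive_continuous (fun x => exp (- b * x) * K x)). eexists. apply HE. rewrite Rmin_left in Hx; lra.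
  - rewrite Rmin_left in Hc by lra. specialize (Hk c ltac:(lra)). have Rmult_le_pos (exp (- b * c) * k c) (Y - y) ltac:(pos) ltac:(lra). lra. }
 apply Rnot_lt_le. intros L. assert (HC0 : 0 <= C) by (eapply Rle_trans; [apply Rabs_pos|auto]). set (e := exp (- b * y) * - K y).
 assert (He : 0 < e) by (apply Rmult_lt_0_compat; [auto|lra]). set (Y := y + (C + 1) / (e * b)). assert (HY0 : 0 < (C + 1) / (e * b)) by pos.
 assert (HY : y < Y) by (unfold Y; lra). specialize (Hdec Y HY). have HC Y ltac:(lra) as HCY. apply Rabs_le_between in HCY.
 assert (H1 : e <= exp (- b * Y) * C) by (unfold e; have exp_pos (- b * Y); have Rmult_le_compat_l (exp (- b * Y)) (- K Y) C ltac:(lra) ltac:(lra); lra). assert (H2 : exp (- b * Y) * (1 + b * Y) <= 1).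
 { replace (- b * Y) with (- (b * Y)) by ring. rewrite exp_Ropp. have exp_ge_1x (b * Y). have exp_pos (b * Y). apply Rmult_le_reg_l with (exp (b * Y)); auto. rewrite <- Rmult_assoc, Rinv_r by lra. lra. }
 assert (H3 : e * (1 + b * Y) <= C) by (have exp_pos (- b * Y); nra). assert (H4 : e * b * (C + 1) / (e * b) = C + 1) by (field; lra). have Rmult_lt_0_compat e (b * y) He ltac:(pos). unfold Y in H3. lra.
Qed.
(** The positivity principle is applied to [II] and to hh / b - II, which satisfies an equation of
    the same type; induction on j supplies the boundedness that it requires. *)
Lemma II_bounds j b y : 0 < b -> 0 < y -> 0 <= II j b y <= hh j y / b.
 intros Hb. revert y. assert (Hgen : forall j y0, 0 < y0 -> (exists C, forall x, y0 <= x -> Rabs (II j b x) <= C) -> 0 <= II j b y0 <= hh j y0 / b).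
 { clear j. intros j y0 Hy0 [C HC]. split.
  - apply (ode_nonneg (II j b) (hh j) b C); auto; [intros x Hx; apply is_derive_II; lra|left; apply hh_pos; lra].
  - assert (0 <= hh j y0 / b - II j b y0); [|lra]. apply (ode_nonneg (fun y => hh j y / b - II j b y) (fun y => (INR j + 3 / 2) * hh (S j) y / b) b (hh j y0 / b + C)); auto.
   + intros x Hx. eapply is_derive_val; [apply (is_derive_minus (fun y => hh j y / b) (II j b)); [eapply is_derive_ext; [intros; apply Rmult_comm|apply is_derive_scal, is_derive_hh; lra]|apply is_derive_II; lra]|]. cbn -[hh II INR]. field. lra.
   + intros x Hx. have hh_pos (S j) x ltac:(lra). pos.
   + intros x Hx. le_via Rabs_triang. rewrite Rabs_Ropp. apply Rplus_le_compat; auto. have hh_pos j x ltac:(lra). rewrite Rabs_pos_eq by pos. mul_r; [pos|]. now apply hh_anti. } induction j as [|j IH]; intros y Hy; apply Hgen; auto.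
 - exists (2 * / sqrt y). intros x Hx. assert (Hx0 : 0 < x) by lra. have sqrt_lt_R0 x Hx0 as Hs. assert (HR : 0 <= RInt (gv b) 0 (/ sqrt x) <= / sqrt x * exp (- (b * x))).
  { have Rinv_0_lt_compat _ Hs. split.
   - apply RInt_ge_0; [lra|now apply gv_ex|intros; now apply gv_bounds].
   - apply Rle_trans with (RInt (fun _ => exp (- (b * x))) 0 (/ sqrt x)); [|rewrite RInt_const; cbn; lra]. apply RInt_le; [lra|now apply gv_ex|apply ex_RInt_const|]. intros v Hv. unfold gv. destruct Req_EM_T; [lra|]. apply exp_le.
    assert (x <= / v ^ 2); [|nra]. rewrite <- (Rinv_inv x). inv_le; [pos|]. replace (/ x) with ((/ sqrt x) ^ 2) by (rewrite pow_inv, pow2_sqrt; lra). nra. } have exp_pos (b * x). rewrite Rabs_pos_eq by (apply Rmult_le_pos; lra).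
  apply Rle_trans with (2 * exp (b * x) * (/ sqrt x * exp (- (b * x)))); [mul_l; lra|]. rewrite exp_Ropp. replace (2 * exp (b * x) * (/ sqrt x * / exp (b * x))) with (2 * / sqrt x) by (field; lra). mul_l; [lra|]. inv_le; [pos|apply sqrt_le_1; lra].
 - exists (hh j y / (INR j + 3 / 2)). intros x Hx. specialize (IH x ltac:(lra)). cbn. have hh_anti j y x Hy Hx. unfold Rdiv. rewrite Rabs_mult, (Rabs_pos_eq (/ _)) by pos. mul_r; [pos|]. assert (b * II j b x <= hh j x).
  { destruct IH as [_ IH]. apply (Rmult_le_compat_l b) in IH; [|lra]. replace (b * (hh j x / b)) with (hh j x) in IH by (field; lra). lra. } assert (0 <= b * II j b x) by pos. rewrite Rabs_pos_eq; lra.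
Qed.

(** * Differentiation with respect to the deformation parameter *)

Lemma rder_of_wder (F : C -> C) (t : R) A B : wder F (RtoC t) A B -> rder (fun t => F (RtoC t)) t (A + B)%C.
 intros H eps He. destruct (H eps He) as [d [Hd HF]]. exists d. split; auto. intros s Hs. specialize (HF s). rewrite Cmod_R in HF. rewrite Cconj_RtoC in HF. rewrite RtoC_plus. replace ((A + B) * s)%C with (A * s + B * s)%C by ring. auto.
Qed.
Lemma rder_ext f g t l : (forall t, f t = g t) -> rder f t l -> rder g t l.
 intros E. replace g with f; auto. now fext. Qed.
Lemma rder_eq f t l l' : rder f t l -> l = l' -> rder f t l'.
 now intros H <-. Qed.
Lemma wder_rder_Re F (t : R) A B : wder (fun z => F (Re z)) (RtoC t) A B -> rder F t (A + B)%C.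
 intros H. apply rder_of_wder in H. auto. Qed.
Lemma rder_wder_Re F (t : R) l : rder F t l -> wder (fun z => F (Re z)) (RtoC t) (l * (1 / 2))%C (l * (1 / 2))%C.
 intros H. apply wder_Re_fun. auto. Qed.
Lemma rder_scal c f t l : rder f t l -> rder (fun t => c * f t)%C t (c * l)%C.
 intros H. apply rder_wder_Re, (wder_scal c), (wder_rder_Re (fun t => c * f t)%C) in H. eapply rder_eq; [eauto|field]. Qed.
Lemma rder_sum {I : Type} (f f' : I -> R -> C) (M : I -> R) (K rho : R) (F : R -> C) (t : R) (l : C) :
 0 < rho -> bnd M K -> (forall i s, Rabs (s - t) < rho -> rder (f i) s (f' i s)) -> (forall i s, Rabs (s - t) < rho -> Cmod (f' i s) <= M i) -> (forall s, Rabs (s - t) < rho -> Sums (fun i => f i s) (F s)) -> Sums (fun i => f' i t) l -> rder F t l.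
 intros Hr HM Hf HB HS Hl. eapply rder_eq; [apply wder_rder_Re|].
 - assert (Hc : forall h, Cmod h < rho -> Rabs (Re (t + h) - t) < rho).
  { intros h Hh. rewrite Re_plus. simpl Re. replace (t + Re h - t) with (Re h) by ring. have Rmax_Cmod h. have Rmax_l (Rabs (fst h)) (Rabs (snd h)). unfold Re. lra. }
  assert (Hw : forall s x l, rder s (Re x) l -> wder (fun z => s (Re z)) x (l * (1 / 2)) (l * (1 / 2))) by (intros; now apply wder_Re_fun).
  apply (wder_sum (fun i z => f i (Re z)) (fun i z => f' i (Re z) * (1 / 2))%C (fun i z => f' i (Re z) * (1 / 2))%C M K rho) with (1 := Hr) (2 := HM).
  + auto.
  + intros i h Hh. rewrite Cmod_mult. specialize (HB i _ (Hc h Hh)). replace (1 / 2)%C with (RtoC (/ 2)) by (rewrite RtoC_inv2; field). rewrite Cmod_R, Rabs_pos_eq; lra.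
  + auto.
  + eapply Sums_ext; [|apply (Sums_scal (1 / 2)), Hl]. intros i. cring.
  + eapply Sums_ext; [|apply (Sums_scal (1 / 2)), Hl]. intros i. cring.
 - field.
Qed.
Lemma rder_const_eq f a b : a <= b -> (forall t, a <= t <= b -> rder f t 0) -> f a = f b.
 intros Hab H. symmetry. have wder_const_seg (fun z => f (Re z)) a (RtoC (b - a)) as Hc. rewrite <- RtoC_plus in Hc.
 replace (a + (b - a)) with b in Hc by ring. apply Hc. intros t Ht. rewrite <- RtoC_mult, <- RtoC_plus. eapply wder_eq; [apply rder_wder_Re, H; nra| |]; ring.
Qed.
Lemma rder_cont f t l : rder f t l -> forall eps, 0 < eps -> exists d, 0 < d /\ forall s, Rabs (s - t) < d -> Cmod (f s - f t)%C < eps.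
 intros H eps He. destruct (H 1 Rlt_0_1) as [d [Hd HF]]. have Cmod_ge_0 l. exists (Rmin d (eps / (Cmod l + 2))).
 split; [apply Rmin_pos; auto; apply Rdiv_lt_0_compat; lra|]. intros s Hs. specialize (HF (s - t) ltac:(eapply Rlt_le_trans; [eauto|apply Rmin_l])).
 replace (t + (s - t)) with s in HF by ring. replace (f s - f t)%C with (f s - f t - l * RtoC (s - t) + l * RtoC (s - t))%C by ring. lt_via Cmod_triangle. rewrite Cmod_mult, Cmod_R.
 assert (Hs2 : Rabs (s - t) < eps / (Cmod l + 2)) by (eapply Rlt_le_trans; [eauto|apply Rmin_r]). apply (Rmult_lt_compat_r (Cmod l + 2)) in Hs2; [|lra]. unfold Rdiv in Hs2. rewrite Rmult_assoc, Rinv_l in Hs2 by lra. nra.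
Qed.
Lemma wder_pow F z A B n : wder F z A B -> wder (fun z => F z ^ S n)%C z (INR (S n) * F z ^ n * A)%C (INR (S n) * F z ^ n * B)%C.
 intros H. induction n as [|n IH].
 - eapply wder_eq; [eapply wder_ext; [|exact H]| |]; [intros; ring|cring|cring].
 - eapply wder_eq; [eapply wder_ext; [|apply (wder_mult _ _ _ _ _ _ _ H IH)]| |].
  + auto.
  + cring.
  + cring.
Qed.
Lemma wder_expS j v : wder (expS (S j)) v (expS j v) 0.
 induction j as [|j IH].
 - eapply wder_eq; [eapply wder_ext; [|apply (wder_const 1)]| |]; [|auto|auto]. intros z. unfold expS. simpl. field.
 - eapply wder_eq; [eapply wder_ext; [|apply wder_plus; [exact IH|apply (wder_scal (/ INR (fact (S j)))), (wder_pow _ _ _ _ j (wder_id v))]]| |].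
  + intros z. rewrite expS_S. cring.
  + rewrite expS_S. change (fact (S j)) with (S j * fact j)%nat. rewrite mult_INR, RtoC_mult. assert (H : RtoC (INR (S j)) <> 0) by (intros E; apply RtoC_inj in E; now apply (not_0_INR (S j))). field; auto.
  + ring.
Qed.
(** In the derivative of Taylor's remainder all terms but one telescope. Multiplied by [thT 0] the
    surviving exponential is [thT r], so that the sum over the lattice is given by
    [Theta_identity]. *)
Lemma rder_om j s r : rder (om (S j) s) r (- (RtoC ((1 - r) ^ j) / INR (fact j)) * cexp (r * s))%C.
 assert (Hu : wder (fun u : C => (1 - u)%C) r (-1) 0) by (eapply wder_eq; [apply wder_minus; [auto|auto]| |]; ring).
 assert (HS : RtoC (INR (S j)) <> 0) by (intros E; apply RtoC_inj in E; now apply (not_0_INR (S j))). unfold om. destruct Ceq_dec as [->|].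
 - eapply rder_eq; [eapply rder_ext; [|apply (rder_of_wder (fun u => / INR (fact (S j)) * (1 - u) ^ S j)%C)]|].
  + intros t. cbv beta. rewrite <- RtoC_minus, <- RtoC_pow. cring.
  + apply wder_scal, wder_pow, Hu.
  + rewrite !Cmult_0_r, cexp_0, RtoC_pow, RtoC_minus. change (fact (S j)) with (S j * fact j)%nat. rewrite mult_INR, RtoC_mult. field; auto.
 - eapply rder_eq; [eapply rder_ext; [|apply (rder_of_wder (fun u => / s ^ S j * (cexp s - cexp (s * u) * expS (S j) (s * (1 - u))))%C)]|].
  + intros t. cbv beta. rewrite (Cmult_comm s t), (Cmult_comm s (1 - t)). cring.
  + apply wder_scal, wder_minus; [auto|]. apply wder_mult.
   * apply wder_comp_hol; [apply wder_cexp|apply wder_scal, wder_id].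
   * apply wder_comp_hol; [apply wder_expS|apply wder_scal, Hu].
  + cbv beta. rewrite expS_S, (Cmult_comm s r), Cpow_mult_l, RtoC_pow, RtoC_minus. cbn. field; auto.
Qed.

(** * The nonholomorphic integral of the shadow *)

Definition bq (i : Z) : R := IZR (6 * i + 1) ^ 2.
Lemma bq_ge1 i : 1 <= bq i.
 apply IZR_ge1. lia. Qed.
Definition bet4 (i : Z) : R := 4 * PI * bq i.
Lemma bet4_ge1 i : 1 <= bet4 i.
 unfold bet4. have bq_ge1 i. have PI2_3_2. nra. Qed.
(** With b = (6i + 1)^2 this is (-1)^i q^(-b) times the integral of u^(-j-3/2) exp (- 4 PI b u) over
    u >= Im z, a term of the nonholomorphic Eichler integral of [eta]. The form with conj q keeps
    each factor bounded in i. *)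
Definition Tt (j : nat) (z : C) (i : Z) : C := (sg i * Cconj (ee (RtoC (bq i) * z)) * RtoC (II j (bet4 i) (Im z)))%C.
Definition Tc (j : nat) : R := (PI / 16) ^ S j * (8 / INR (fact j)).
Definition Tj (j : nat) (z : C) : C := (RtoC (Tc j) * tsum (Tt j z))%C.
Lemma II_le j i y : 0 < y -> 0 <= II j (bet4 i) y <= hh j y.
 intros Hy. have bet4_ge1 i. destruct (II_bounds j (bet4 i) y ltac:(lra) Hy) as []. split; auto. eapply Rle_trans; [exact H1|]. have hh_pos j y Hy. apply Rmult_le_reg_r with (bet4 i); [lra|]. unfold Rdiv. rewrite Rmult_assoc, Rinv_l by lra. nra.
Qed.
Lemma bnd_bq y : 0 < y -> bnd (fun i : Z => exp (- 2 * PI * bq i * y)) ((1 + / (2 * PI * y)) * 18).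
 intros Hy. apply (bnd_theta_aff 6 1 y Hy). lia. Qed.
#[local] Hint Resolve bnd_bq : core.
Lemma Tt_le j z i y : 0 < y -> y <= Im z -> Cmod (Tt j z i) <= hh j y * exp (- 2 * PI * bq i * y).
 intros Hy Hz. unfold Tt. rewrite !Cmod_mult, Cmod_sg, Cmod_conj, Cmod_ee_c, Cmod_R. destruct (II_le j i (Im z) ltac:(lra)) as [].
 rewrite Rabs_pos_eq, Rmult_1_l, Rmult_comm by auto. have hh_anti j y (Im z) Hy Hz. mul_le; auto0; [auto|lra|]. apply exp_le. have bq_ge1 i. have PI_RGT_0. apply Rmult_le_compat_neg_l; auto. nra.
Qed.
Lemma Tt_spec j z : inH z -> Sums (Tt j z) (tsum (Tt j z)).
 intros Hz. eapply tsum_HasSum, bnd_le; [intros i; apply Tt_le; [exact Hz|lra]|]. apply bnd_scal; [auto|]. auto. Qed.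
(** The integral of [II j b y] with lower limit moved to y / (1 - r): it runs from [II j b y] at r =
    0 to 0 as r -> 1. *)
Definition vd (j : nat) (y b r : R) : R := exp (- b * (y / (1 - r) - y)) * II j b (y / (1 - r)).
Definition vk (j : nat) (y r : R) : R := hh j (y / (1 - r)) * (y / (1 - r) ^ 2).
Lemma is_derive_vd j y b r : 0 < b -> 0 < y -> r < 1 -> is_derive (vd j y b) r (- exp (- b * (y / (1 - r) - y)) * vk j y r).
 intros Hb Hy Hr. assert (HY : 0 < y / (1 - r)) by pos. assert (D0 : is_derive (fun r => y / (1 - r)) r (y / (1 - r) ^ 2)) by (auto_derive; [lra|field; lra]).
 assert (D1 : is_derive (fun Y => exp (- b * (Y - y)) * II j b Y) (y / (1 - r)) (- exp (- b * (y / (1 - r) - y)) * hh j (y / (1 - r)))).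
 { eapply is_derive_val; [apply (is_derive_mult (fun Y => exp (- b * (Y - y))) (II j b)); [|apply is_derive_II; auto|intros; apply Rmult_comm]|].
  - instantiate (1 := - b * exp (- b * (y / (1 - r) - y))). auto_derive; [auto|unfold Rminus; ring].
  - unfold plus, mult. simpl; lra. } eapply is_derive_val; [apply (is_derive_comp (fun Y => exp (- b * (Y - y)) * II j b Y) (fun r => y / (1 - r))); [eauto|eauto]|]. cbn -[II hh pow]. unfold vk. ring.
Qed.
Lemma vk_eq j y r : 0 < y -> r < 1 -> (PI / (16 * y)) ^ S j * (1 - r) ^ j * sqrt (y / (1 - r)) = (PI / 16) ^ S j * vk j y r.
 intros Hy Hr. unfold vk, hh. set (Y := y / (1 - r)). assert (HY : 0 < Y) by (apply Rdiv_lt_0_compat; lra).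
 assert (Ey : y = Y * (1 - r)) by (unfold Y; field; lra). replace (PI / (16 * y)) with (PI / 16 * / y) by (field; lra). rewrite Rpow_mult_distr. replace (y / (1 - r) ^ 2) with (Y / (1 - r)) by (unfold Y; field; lra).
 replace ((/ y) ^ S j) with (/ Y ^ S j * / (1 - r) ^ S j) by (rewrite Ey, pow_inv, Rpow_mult_distr, Rinv_mult; reflexivity). have sqrt_lt_R0 Y HY.
 have sqrt_sqrt Y ltac:(lra) as Ess. replace (Y / (1 - r)) with (sqrt Y * sqrt Y / (1 - r)) by nra. assert (H1 : 0 < (1 - r) ^ j) by pos. assert (H2 : 0 < Y ^ S j) by now apply pow_lt. change ((1 - r) ^ S j) with ((1 - r) * (1 - r) ^ j). field; lra.
Qed.
(** The lattice terms and the terms of T are joined in one family over [Z * Z + Z] that depends on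
    r. The derivative of its sum vanishes for 0 < r < 1, so the sum is constant there. It tends to 0
    as r -> 1 and to the difference of the two sides as r -> 0. *)
Theorem eta_Tj j z : inH z -> (eta z * Tj j z)%C = (Xy z ^ S j * Wj (S j) z)%C.
 intros Hz. assert (Hy : 0 < Im z) by exact Hz. have Xy_pos z Hz as HX. set (y := Im z) in *. set (sp := fun p => (Xy z * (lw z p * lw z p))%C).
 set (XJ := (Xy z ^ S j)%C). set (c := (Tc j * eta z)%C). set (ci := fun i : Z => (sg i * Cconj (ee (bq i * z)))%C). set (F := fun r x => match x with
   | inl p => (XJ * (thT 0 z p * om (S j) (sp p) r))%C | inr i => (- c * ci i * vd j y (bet4 i) r)%C end). set (F' := fun x r => match x with
   | inl p => (XJ * (thT 0 z p * (- (RtoC ((1 - r) ^ j) / INR (fact j)) * cexp (r * sp p))))%C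
   | inr i => (- c * ci i * RtoC (- exp (- bet4 i * (y / (1 - r) - y)) * vk j y r))%C end).
 assert (Hder : forall x r, r < 1 -> rder (fun r => F r x) r (F' x r)) by (intros [|i] r Hr; [apply rder_scal, rder_scal, rder_om|apply rder_scal, rder_real, is_derive_vd; auto; have bet4_ge1 i; lra]).
 assert (Hci : forall i, Cmod (ci i) = exp (- 2 * PI * bq i * y)) by (intros i; unfold ci; rewrite Cmod_mult, Cmod_sg, Cmod_conj, Cmod_ee_c; unfold y; ring).
 assert (HY : forall r, 0 <= r < 1 -> y <= y / (1 - r)) by (intros r Hr; apply Rmult_le_reg_r with (1 - r); [lra|]; unfold Rdiv; rewrite Rmult_assoc, Rinv_l by lra; nra).
 assert (Hexp : forall i r, 0 <= r < 1 -> 0 < exp (- bet4 i * (y / (1 - r) - y)) <= 1) by (intros i r Hr; split; [auto|]; apply Rle_trans with (exp 0); [apply exp_le|rewrite exp_0; lra]; have bet4_ge1 i; specialize (HY r Hr); nra).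
 assert (Hvd : forall i r, 0 <= r < 1 -> 0 <= vd j y (bet4 i) r <= hh j (y / (1 - r))) by (intros i r Hr; specialize (Hexp i r Hr); specialize (HY r Hr); destruct (II_le j i (y / (1 - r)) ltac:(lra)) as []; unfold vd; nra).
 set (M := fun x : Z * Z + Z => match x with inl p => Cmod XJ * omM j z p | inr i => Cmod c * hh j y * exp (- 2 * PI * bq i * y) end).
 assert (HM : exists K, bnd M K) by (destruct (bnd_omM j z Hz) as [K HK]; eexists; apply bnd_sum; [apply bnd_scal; [auto|eauto]|apply bnd_scal; [|auto]; apply Rmult_le_pos; [auto|auto]]). assert (HFM : forall r x, 0 <= r < 1 -> Cmod (F r x) <= M x).
 { intros r [|i] Hr; unfold F.
  - rewrite Cmod_mult. mul_l; [auto|]. apply om_bound; auto. lra.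
  - rewrite !Cmod_mult, Cmod_opp, Hci, Cmod_R. destruct (Hvd i r Hr) as []. rewrite Rabs_pos_eq by auto. have hh_anti j y (y / (1 - r)) Hy (HY r Hr).
   have Cmod_ge_0 c. have exp_pos (- 2 * PI * bq i * y). rewrite Rmult_assoc, (Rmult_comm (exp _)), <- Rmult_assoc. mul_r; [lra|]. nra. }
 destruct HM as [K HM]. assert (HS : forall r, 0 <= r < 1 -> Sums (F r) (tsum (F r))) by (intros r Hr; eapply tsum_HasSum, bnd_le; [|eauto]; auto). assert (HF'0 : forall r, 0 <= r < 1 -> Sums (fun x => F' x r) 0).
 (* The derivatives of the lattice terms add up to a multiple of [eta z * conj (eta (zr r z))];
    those of the other terms are the expansion of the same product with the opposite sign. *)
 { intros r Hr. have zr_inH r z Hz Hr as Hzr. eapply Sums_eq; [apply Sums_sum; unfold F'|].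
  - eapply Sums_ext; [|apply (Sums_scal (- XJ * (RtoC ((1 - r) ^ j) / INR (fact j)))), (Theta_identity r z Hz Hr)]. intros p. cbv beta. rewrite thT_cexp. unfold sp. ring.
  - eapply Sums_ext; [|apply (Sums_scal (c * vk j y r)), Sums_conj, (eta_spec _ Hzr)]. intros i. unfold etat, ci. rewrite Cmult_conj, sg_conj.
   assert (E : Cconj (ee (RtoC (IZR (6 * i + 1) ^ 2) * zr r z)) = (Cconj (ee (bq i * z)) * exp (- bet4 i * (y / (1 - r) - y)))%C).
   { rewrite !ee_polar, !polar_conj. replace (RtoC (exp (- bet4 i * (y / (1 - r) - y)))) with (polar (- bet4 i * (y / (1 - r) - y)) 0); [|unfold polar; rewrite ee_0; ring].
    rewrite polar_mult. unfold zr. cbn [Re Im fst snd]. fold y. fold (bq i). apply polar_eq; [unfold bet4; field; lra|lra]. } rewrite E, RtoC_mult, RtoC_opp. ring.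
  - unfold c. fold y. replace (- XJ * (RtoC ((1 - r) ^ j) / INR (fact j)) * (RtoC (8 * sqrt (y / (1 - r))) * (eta z * Cconj (eta (zr r z)))))%C
    with (- RtoC (Xy z ^ S j * (1 - r) ^ j * sqrt (y / (1 - r))) * (8 / INR (fact j)) * eta z * Cconj (eta (zr r z)))%C; [|unfold XJ; rewrite !RtoC_mult, <- RtoC_pow; cring].
   unfold Xy. rewrite vk_eq by lra. unfold Tc. rewrite !RtoC_mult, RtoC_div by apply INR_fact_neq_0. ring. } assert (Hconst : forall r, 0 < r < 1 -> rder (fun r => tsum (F r)) r 0).
 (* The majorant for the derivatives is local in r, because the Gaussian decay of [thT r] in the
    direction of Re w degenerates as r -> 1. *)
 { intros r Hr. set (kap := (1 - r) / 2). set (rho := Rmin r kap). assert (Hk : 0 < kap < 1) by (unfold kap; lra). assert (Hrho : 0 < rho) by (apply Rmin_pos; lra). assert (Hin : forall s, Rabs (s - r) < rho -> 0 <= s /\ kap <= 1 - s).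
  { intros s Hs. assert (rho <= r) by apply Rmin_l. assert (rho <= kap) by apply Rmin_r. apply Rabs_lt_between in Hs. unfold kap in *. lra. }
  set (M' := fun x : Z * Z + Z => match x with inl p => Cmod XJ * (/ INR (fact j) * exp (- (Xy z * kap) * (IZR (snd p) + 24 * Re z * IZR (fst p)) ^ 2 - Xy z * kap * (24 * y) ^ 2 * IZR (fst p) ^ 2))
    | inr i => Cmod c * (hh j y * y / kap ^ 2) * exp (- 2 * PI * bq i * y) end).
  assert (HM' : exists K', bnd M' K') by (eexists; apply bnd_sum; [apply bnd_scal; [auto|]; apply bnd_scal; [pos|]; apply (bnd2_gauss _ _ (fun n => 24 * Re z * IZR n)); [pos|]; pos|apply bnd_scal; [|auto]; have hh_pos j y Hy; pos]).
  destruct HM' as [K' HM']. apply (rder_sum (fun x r => F r x) F' M' K' rho) with (1 := Hrho) (2 := HM').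
  - intros x s Hs. apply Hder. specialize (Hin s Hs). lra.
  - intros [|i] s Hs; specialize (Hin s Hs); unfold F'.
   + rewrite Cmod_mult. mul_l; [auto|]. replace (thT 0 z p * (- (RtoC ((1 - s) ^ j) / INR (fact j)) * cexp (s * sp p)))%C with (- (RtoC ((1 - s) ^ j) * / INR (fact j)) * thT s z p)%C by (rewrite thT_cexp; unfold sp, Cdiv; ring).
    rewrite Cmod_mult, Cmod_opp, Cmod_mult, Cmod_inv, !Cmod_R by apply fact_C. rewrite !Rabs_pos_eq by pos. rewrite Cmod_thT by auto. have Rinv_0_lt_compat _ (INR_fact_lt_0 j). mul_le; [pos|auto| |].
    * assert (HH := pow_incr (1 - s) 1 j ltac:(lra)). rewrite pow1 in HH. nra.
    * apply exp_le. fold y. set (a := (IZR (snd p) + 24 * Re z * IZR (fst p)) ^ 2). assert (Ha : 0 <= a) by apply pow2_ge_0. assert (Hn : 0 <= (24 * y) ^ 2 * IZR (fst p) ^ 2) by pos. set (n2 := (24 * y) ^ 2 * IZR (fst p) ^ 2) in *.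
     replace (- (Xy z * (1 - s)) * a - Xy z * (1 + s) * (24 * y) ^ 2 * IZR (fst p) ^ 2) with (- Xy z * ((1 - s) * a + (1 + s) * n2)) by (unfold n2; ring).
     replace (- (Xy z * kap) * a - Xy z * kap * (24 * y) ^ 2 * IZR (fst p) ^ 2) with (- Xy z * (kap * a + kap * n2)) by (unfold n2; ring). apply Rmult_le_compat_neg_l; [lra|]. nra.
   + rewrite !Cmod_mult, Cmod_opp, Hci, Cmod_R, Rabs_mult, Rabs_Ropp. assert (Hs1 : 0 <= s < 1) by lra. specialize (Hexp i s Hs1). rewrite Rabs_pos_eq by lra. assert (Hvk : 0 <= vk j y s <= hh j y * (y / kap ^ 2)).
    { have HY s Hs1. have hh_anti j y (y / (1 - s)) Hy H. have hh_pos j (y / (1 - s)) ltac:(lra). assert (0 < y / (1 - s) ^ 2) by pos. split; [apply Rmult_le_pos; lra|]. mul_le; try lra. mul_l; [lra|]. inv_le; [pos|nra]. }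
    rewrite Rabs_pos_eq by lra. have Cmod_ge_0 c. have exp_pos (- 2 * PI * bq i * y). rewrite Rmult_assoc, (Rmult_comm (exp (-2 * PI * bq i * y))), <- Rmult_assoc. mul_r; [lra|]. mul_l; [lra|]. nra.
  - intros s Hs. specialize (Hin s Hs). apply HS. lra.
  - apply HF'0. lra. } set (d := tsum (F (1 / 2))). assert (Hd : forall r, 0 < r < 1 -> Sums (F r) d).
 { intros r Hr. replace d with (tsum (F r)); [apply HS; lra|].
  destruct (Rle_lt_dec r (1 / 2)) as [|]; [apply (rder_const_eq (fun r => tsum (F r))); auto; intros t Ht; apply Hconst; lra|symmetry; apply (rder_const_eq (fun r => tsum (F r))); [lra|]; intros t Ht; apply Hconst; lra]. }
 (* Passage to an endpoint by dominated convergence: the majorant M of the terms themselves holds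
    for all r in [0, 1). *)
 assert (Hlim : forall r0 f s, 0 <= r0 <= 1 -> (forall x, Cmod (f x) <= M x) -> (forall x eps, 0 < eps -> exists dd, 0 < dd /\ forall r, 0 < r < 1 -> Rabs (r - r0) < dd -> Cmod (F r x - f x) < eps) -> Sums f s -> d = s).
 { intros r0 f s Hr0 HfM Hf Hs. apply Ceq_minus, Cmod_eq_0, Rle_antisym; [|auto]. apply Rnot_lt_le. intros L.
  destruct (tannery (fun r => 0 < r < 1) (fun r => Rabs (r - r0)) F f M K (fun _ => d) s HM) with (eps := Cmod (d - s)) as [dd [Hdd H]]; auto; [intros r x Hr; apply HFM; lra|].
  set (e := Rmin (dd / 2) (/ 4)). assert (He : 0 < e) by (apply Rmin_pos; lra). assert (He1 : e <= dd / 2) by apply Rmin_l. assert (He2 : e <= / 4) by apply Rmin_r. destruct (Rle_lt_dec r0 (1 / 2)) as [|].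
  + specialize (H (r0 + e) ltac:(lra)). rewrite Rabs_pos_eq in H by lra. lra.
  + specialize (H (r0 - e) ltac:(lra)). replace (r0 - e - r0) with (- e) in H by ring. rewrite Rabs_Ropp, Rabs_pos_eq in H by lra. lra. } assert (Hd0 : d = 0).
 { apply (Hlim 1 (fun _ => 0)); [lra| | |auto].
  - intros x. rewrite Cmod_0. eapply Rle_trans; [apply Cmod_ge_0|apply (HFM (1 / 2) x); lra].
  - intros [|i] eps He; unfold F.
   + assert (E : om (S j) (sp p) 1 = 0).
    { unfold om. destruct Ceq_dec; [cring|]. replace (expS (S j) ((1 - 1) * sp p)) with (RtoC 1); [replace (1 * sp p)%C with (sp p); unfold Cdiv; ring|]. clear. induction j as [|j IH]; [unfold expS; simpl; field|]. rewrite expS_S, <- IH. cring. }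
    destruct (rder_cont _ _ _ (rder_scal XJ _ _ _ (rder_scal (thT 0 z p) _ _ _ (rder_om j (sp p) 1))) eps He) as [dd [Hdd H]]. exists dd. rewrite E, !Cmult_0_r in H. auto.
   + have Cmod_ge_0 c. exists (Rmin y (eps * y / (Cmod c + 1))). split; [apply Rmin_pos; auto; apply Rdiv_lt_0_compat; [nra|lra]|]. intros r Hr Hr2. assert (A1 : Rabs (r - 1) < y) by (eapply Rlt_le_trans; [eauto|apply Rmin_l]).
    assert (A2 : Rabs (r - 1) < eps * y / (Cmod c + 1)) by (eapply Rlt_le_trans; [exact Hr2|apply Rmin_r]). rewrite Rabs_left in A1, A2 by lra.
    replace (- c * ci i * vd j y (bet4 i) r - 0)%C with (- c * ci i * vd j y (bet4 i) r)%C by ring. rewrite !Cmod_mult, Cmod_opp, Hci, Cmod_R. destruct (Hvd i r ltac:(lra)) as []. rewrite Rabs_pos_eq by auto.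
    assert (HY1 : 1 <= y / (1 - r)) by (apply Rmult_le_reg_r with (1 - r); [lra|]; unfold Rdiv; rewrite Rmult_assoc, Rinv_l; lra). assert (B3 : hh j (y / (1 - r)) <= (1 - r) / y).
    { replace ((1 - r) / y) with (/ (y / (1 - r))) by (field; lra). inv_le; [lra|]. set (Y := y / (1 - r)) in *. assert (1 <= sqrt Y) by (rewrite <- sqrt_1; apply sqrt_le_1; lra). assert (1 <= Y ^ j) by now apply pow_R1_Rle. cbn.
     assert (Y * 1 <= Y * Y ^ j) by nra. nra. } assert (B4 : exp (- 2 * PI * bq i * y) <= 1) by (apply Rle_trans with (exp 0); [apply exp_le|rewrite exp_0; lra]; have bq_ge1 i; have Rmult_le_pos (PI * bq i) y ltac:(pos) ltac:(lra); lra).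
    apply Rle_lt_trans with (Cmod c * 1 * ((1 - r) / y)); [mul_le; auto; [pos|nra|lra]|]. apply (Rmult_lt_compat_r (Cmod c + 1)) in A2; [|lra]. unfold Rdiv in A2. rewrite Rmult_assoc, Rinv_l in A2 by lra. apply Rmult_lt_reg_r with y; auto.
    unfold Rdiv. replace (Cmod c * 1 * ((1 - r) * / y) * y) with (Cmod c * (1 - r)) by (field; lra). nra. } assert (HsF : Sums (F 0) (XJ * Wj (S j) z + - c * tsum (Tt j z))).
 { apply Sums_sum; unfold F; [apply Sums_scal, (Wj_spec j z Hz)|]. eapply Sums_ext; [|apply Sums_scal, (Tt_spec j z Hz)]. intros i. unfold Tt, ci, vd.
  rewrite Rminus_0_r. replace (y / 1) with y by field. replace (- bet4 i * (y - y)) with 0 by ring. rewrite exp_0, Rmult_1_l. fold y. ring. }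
 assert (Hd1 : d = (XJ * Wj (S j) z + - c * tsum (Tt j z))%C) by (apply (Hlim 0 (F 0)); [lra| | |auto]; [intros x; apply HFM; lra|intros x eps He; destruct (rder_cont _ _ _ (Hder x 0 ltac:(lra)) eps He) as [dd []]; eauto]).
 rewrite Hd0 in Hd1. replace (XJ * Wj (S j) z)%C with (XJ * Wj (S j) z + - c * tsum (Tt j z) + c * tsum (Tt j z))%C by ring. rewrite <- Hd1. cring.
Qed.

(** * Holomorphic functions of moderate growth with all derivatives *)

Definition gr (F : C -> C) : Prop := exists K, 0 <= K /\ forall z, inH z -> Cmod (F z) <= K * exp (K * (Im z + / Im z)).
Lemma ht_pos z : inH z -> 0 < Im z + / Im z.
 intros Hz. pos. Qed.
Lemma gr_ext F G : (forall z, inH z -> F z = G z) -> gr F -> gr G.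
 intros E [K []]. exists K. split; auto. intros z Hz. rewrite <- E; auto. Qed.
Lemma gr_exp_le K K' t : 0 <= K <= K' -> 0 <= t -> exp (K * t) <= exp (K' * t).
 intros. apply exp_le, Rmult_le_compat_r; lra. Qed.
Lemma gr_plus F G : gr F -> gr G -> gr (fun z => F z + G z)%C.
 intros [K [HK H]] [L [HL H']]. exists (K + L). split; [lra|]. intros z Hz. le_via Cmod_triangle. have ht_pos z Hz. have gr_exp_le K (K + L) (Im z + / Im z) ltac:(lra) ltac:(lra). have gr_exp_le L (K + L) (Im z + / Im z) ltac:(lra) ltac:(lra).
 specialize (H z Hz). specialize (H' z Hz). nra.
Qed.
Lemma gr_mult F G : gr F -> gr G -> gr (fun z => F z * G z)%C.
 intros [K []] [L []]. exists (K * L + K + L). assert (0 <= K * L) by pos. split; [lra|]. intros z Hz. rewrite Cmod_mult. have ht_pos z Hz.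
 set (t := Im z + / Im z) in *. apply Rle_trans with (K * exp (K * t) * (L * exp (L * t))); [mul_le; auto using Cmod_ge_0|].
 replace (K * exp (K * t) * (L * exp (L * t))) with (K * L * exp ((K + L) * t)) by (rewrite Rmult_plus_distr_r, exp_plus; ring). have gr_exp_le (K + L) (K * L + K + L) t ltac:(lra) ltac:(lra). have exp_pos ((K + L) * t). nra.
Qed.
Lemma gr_const c : gr (fun _ => c).
 exists (Cmod c). have Cmod_ge_0 c. split; auto. intros z Hz. have ht_pos z Hz. assert (1 <= exp (Cmod c * (Im z + / Im z))) by (rewrite <- exp_0; apply exp_le, Rmult_le_pos; lra). nra.
Qed.
(** Growth is imposed on every derivative because modular entries are later built from derivatives
    and have to satisfy the cusp condition. The class is closed under sums, products and
    differentiation. *)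
Fixpoint hg (n : nat) (F : C -> C) : Prop := gr F /\ match n with O => True | S m => (forall z, inH z -> wder F z (dX F z) 0) /\ hg m (dX F) end.
Definition hgood F := forall n, hg n F.
Lemma wder_hol_dX F z A : wder F z A 0 -> dX F z = A.
 intros H. destruct (wder_dX _ _ _ _ H) as [E _]. rewrite E. ring. Qed.
Lemma hg_ext n F G : (forall z, inH z -> F z = G z) -> hg n F -> hg n G.
 revert F G. induction n as [|n IH]; intros F G E; [intros []; split; auto; eapply gr_ext; eauto|]. intros [H []].
 assert (HD : forall z, inH z -> dX F z = dX G z) by (intros z Hz; symmetry; apply wder_hol_dX; eapply wder_extH; eauto). split; [eapply gr_ext; eauto|]. split; [|eauto]. intros z Hz. rewrite <- HD by auto. eapply wder_extH; eauto.
Qed.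
Lemma hg_intro n F F' : gr F -> (forall z, inH z -> wder F z (F' z) 0) -> hg n F' -> hg (S n) F.
 intros H H1 H2. assert (HD : forall z, inH z -> F' z = dX F z) by (intros z Hz; symmetry; apply wder_hol_dX; auto). split; auto. split; [intros z Hz; rewrite <- HD; auto|eapply hg_ext; eauto].
Qed.
Lemma hg_S n F : hg (S n) F -> hg n F.
 revert F. induction n as [|]; intros F; [now simpl|]. intros [H []]. split; auto. Qed.
Lemma hg_plus n F G : hg n F -> hg n G -> hg n (fun z => F z + G z)%C.
 revert F G. induction n as [|n IH]; intros F G; [intros [] []; split; auto; now apply gr_plus|]. intros [H []] [H' []].
 apply (hg_intro n _ (fun z => dX F z + dX G z)%C); [now apply gr_plus| |auto]. intros z Hz. eapply wder_eq; [apply wder_plus; eauto|auto|ring].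
Qed.
Lemma hg_mult n F G : hg n F -> hg n G -> hg n (fun z => F z * G z)%C.
 revert F G. induction n as [|n IH]; intros F G; [intros [] []; split; auto; now apply gr_mult|]. intros HF HG. have hg_S _ _ HF. have hg_S _ _ HG. destruct HF as [A []]. destruct HG as [B []].
 apply (hg_intro n _ (fun z => dX F z * G z + F z * dX G z)%C); [now apply gr_mult| |apply hg_plus; now apply IH]. intros z Hz. eapply wder_eq; [apply wder_mult; eauto|auto|ring].
Qed.
Lemma hg_const n c : hg n (fun _ => c).
 revert c. induction n as [|n IH]; intros c; [split; auto; apply gr_const|]. apply (hg_intro n _ (fun _ => 0)); [apply gr_const| |auto]. auto. Qed.
Lemma hgood_plus F G : hgood F -> hgood G -> hgood (fun z => F z + G z)%C.
 intros H H' n. now apply hg_plus. Qed.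
Lemma hgood_mult F G : hgood F -> hgood G -> hgood (fun z => F z * G z)%C.
 intros H H' n. now apply hg_mult. Qed.
Lemma hgood_const c : hgood (fun _ => c).
 intros n. apply hg_const. Qed.
#[local] Hint Resolve hgood_const : core.
Lemma hgood_scal c F : hgood F -> hgood (fun z => c * F z)%C.
 apply hgood_mult. auto. Qed.
Lemma hgood_ext F G : (forall z, inH z -> F z = G z) -> hgood F -> hgood G.
 intros E H n. eapply hg_ext; eauto. Qed.
Lemma hgood_dX F : hgood F -> hgood (dX F).
 intros H n. exact (proj2 (proj2 (H (S n)))). Qed.
Lemma hgood_wder F z : hgood F -> inH z -> wder F z (dX F z) 0.
 intros H. exact (proj1 (proj2 (H 1%nat)) z). Qed.
Lemma hgood_gr F : hgood F -> gr F.
 intros H. exact (proj1 (H O)). Qed.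
Lemma qF_gr {I} (c : I -> C) lam : qs c lam -> gr (qF c lam).
 intros Hq. have Hq as [Hl [K [HK H]]]. exists K. split; auto. intros z Hz. have Hz as Hz'. unfold inH in Hz'. eapply Rle_trans; [eapply Sums_bound; [now apply qF_spec|eapply bnd_le; [intros i; apply (qs_term c lam z i (Im z)); auto|auto]]|].
 mul_l; auto. apply exp_le. nra.
Qed.
Lemma qF_hgood {I} (c : I -> C) lam : qs c lam -> hgood (qF c lam).
 intros Hq n. revert c Hq. induction n as [|n IH]; intros c Hq; [split; auto; now apply qF_gr|]. eapply hg_intro; [now apply qF_gr| |apply IH, (qs_deriv _ _ Hq)]. intros z Hz. now apply qF_wder.
Qed.
Lemma qs_eta : qs (fun i : Z => sg i) bq.
 split; [intros i; have bq_ge1 i; lra|]. exists 18. split; [lra|]. intros y Hy. have PI2_3_2. have Rinv_0_lt_compat _ Hy.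
 eapply bnd_weaken; [|eapply bnd_le; [|apply (bnd_bq y Hy)]]; [assert (/ (2 * PI * y) <= / y) by (inv_le; nra); have exp_ge_1x (18 * / y); lra|intros i; rewrite Cmod_sg, Rmult_1_l; right; f_equal; ring].
Qed.
Lemma hgood_eta : hgood eta.
 apply qF_hgood, qs_eta. Qed.
#[local] Hint Resolve hgood_eta : core.
Lemma hgood_Sj j : hgood (Sj j).
 eapply (hgood_ext (qF _ _)); [|apply qF_hgood, (qs_Sj j)]. auto. Qed.
Lemma eta_inv_gen z : inH z -> (/ eta z)%C = (/ ee z * gen npart (ee (24 * z)))%C.
 intros Hz. have eta_partitions z Hz as HP. assert (Hg : gen npart (ee (24 * z)) <> 0) by (intros E; rewrite E, Cmult_0_r in HP; now apply (ee_neq_0 z)). rewrite <- HP. field. auto.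
Qed.
(** 1 / eta is q^(-1) times the partition series in q^24, whose coefficients are nonnegative, so at
    a given height its modulus is largest on the imaginary axis. *)
Lemma eta_inv_imag z : inH z -> Cmod (/ eta z)%C <= Cmod (/ eta (RtoC (Im z) * Ci))%C.
 intros Hz. set (w := (Im z * Ci)%C). assert (Hw : inH w) by (unfold inH; simpl; unfold inH in Hz; lra). assert (HI : Im w = Im z) by (simpl; ring). rewrite !eta_inv_gen, !Cmod_mult, !Cmod_inv, !Cmod_ee, HI by auto using ee_neq_0. mul_l; [pos|].
 assert (Ew : ee (24 * w) = exp (-2 * PI * (24 * Im z))) by (rewrite <- ee_imag; f_equal; unfold w; rewrite RtoC_mult; ring). eapply Sums_dom; [apply gen_spec; [auto|now apply Cmod_ee24]| |].
 - eapply Sums_ext; [|apply gen_spec; [auto|now apply Cmod_ee24]]. intros n. rewrite Ew, <- RtoC_pow, <- RtoC_mult. easy.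
 - intros n. cbv beta. rewrite Cmod_gen_term, Cmod_ee_c. right. do 3 f_equal. ring.
Qed.
Lemma eta_inv_high z y0 : 0 < y0 -> y0 <= Im z -> Cmod (/ eta z)%C <= exp (/ (1 - exp (- (48 * PI * y0))) ^ 2) * exp (2 * PI * Im z).
 intros Hy0 Hy. assert (Hz : inH z) by (unfold inH; lra). rewrite (eta_inv_gen z Hz), Cmult_comm, Cmod_mult, Cmod_inv, Cmod_ee, <- exp_Ropp by apply ee_neq_0.
 replace (- (-2 * PI * Im z)) with (2 * PI * Im z) by ring. mul_r; [auto|]. eapply Rle_trans; [apply gen_bound; [auto|now apply Cmod_ee24]|].
 apply exp_le. have Rmult_lt_0_compat _ _ PI_RGT_0 Hy0. have exp_neg_lt1 (48 * PI * y0) ltac:(lra). inv_le; [pos|]. apply pow_incr. split; [lra|]. apply Rplus_le_compat_l, Ropp_le_contravar. rewrite Cmod_ee_c. apply exp_le. nra.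
Qed.
(* The inversion [z -> -1/(576 z)] permutes the lattice points up to a common factor. *)
Lemma eta_inversion y : 0 < y -> Cmod (eta (RtoC y * Ci)) ^ 2 = / (24 * y) * Cmod (eta (RtoC (/ (576 * y)) * Ci)) ^ 2.
 intros Hy. set (y' := / (576 * y)). assert (Hy' : 0 < y') by (apply Rinv_0_lt_compat; lra). assert (HI : forall t, Im (RtoC t * Ci) = t) by (intros; simpl; ring). assert (HR : forall t, Re (RtoC t * Ci) = 0) by (intros; simpl; ring).
 assert (Hz : inH (y * Ci)) by (unfold inH; now rewrite HI). assert (Hz' : inH (y' * Ci)) by (unfold inH; now rewrite HI). have Theta0_spec _ Hz.
 have Theta0_spec _ Hz' as H'. rewrite HI in *. assert (H2 : Sums (thT 0 (y' * Ci)) (RtoC (8 * sqrt y) * (eta (y * Ci) * Cconj (eta (y * Ci))))).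
 { apply (Sums_reindex_back (fun p : Z * Z => (snd p, - fst p)%Z) (fun p : Z * Z => (- snd p, fst p)%Z)).
  - intros. cring.
  - intros. cring.
  - eapply Sums_ext; [|exact H]. intros [n m]. rewrite !thT0_eq. unfold leps. cbn [fst snd].
   f_equal; [apply (sg_par _ _ (n + n * m)); ring|do 3 f_equal; rewrite !Cmod_sq, !lw_Re, !lw_Im, !HR; cbn; unfold Xy; rewrite !HI; unfold y'; rewrite opp_IZR; field; lra]. }
 have Sums_unique _ _ _ H' H2 as E. rewrite <- !Cmod2_conj', <- !RtoC_mult in E. apply RtoC_inj in E. assert (Es : sqrt y' = / (24 * y) * sqrt y).
 { rewrite <- (sqrt_pow2 (/ (24 * y))) by pos. rewrite <- sqrt_mult by auto. f_equal. unfold y'. field. lra. } have sqrt_lt_R0 y Hy. nra.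
Qed.
(** For Im z >= 1/24 the partition series suffices. Lower points are compared with the imaginary
    axis, where y -> 1 / (576 y), with fixed point 1/24, leads back to the first case. *)
Lemma gr_p0 : gr (fun z => / eta z)%C.
 set (B := exp (/ (1 - exp (- (48 * PI * / 24))) ^ 2)). assert (HB : 0 < B) by apply exp_pos. have PI_RGT_0. exists (B + 2 * PI). split; [lra|].
 intros z Hz. have Hz as Hy. unfold inH in Hy. set (y := Im z) in *. have Rinv_0_lt_compat _ Hy. destruct (Rle_lt_dec (/ 24) y) as [L|].
 - eapply Rle_trans; [apply (eta_inv_high z (/ 24)); [lra|auto]|]. fold B y. mul_le; [lra|auto|lra|]. apply exp_le. nra.
 - eapply Rle_trans; [apply eta_inv_imag, Hz|]. set (w' := (RtoC (/ (576 * y)) * Ci)%C). assert (HIw : Im w' = / (576 * y)) by (simpl; ring).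
  assert (Hy' : / 24 <= Im w') by (rewrite HIw; inv_le; lra). have eta_inv_high w' (/ 24) ltac:(lra) Hy' as HH. fold B in HH.
  assert (Hw' : inH w') by (unfold inH; lra). assert (Hw : inH (y * Ci)) by (unfold inH; simpl; lra). assert (Hm : Cmod (/ eta (y * Ci)) <= Cmod (/ eta w')).
  { rewrite !Cmod_inv by now apply eta_neq_0. inv_le; [apply Cmod_gt_0, eta_neq_0, Hw'|]. have eta_inversion y Hy as E. fold w' in E. have Cmod_ge_0 (eta (y * Ci)). assert (1 <= / (24 * y)) by (rewrite <- Rinv_1; inv_le; lra). nra. }
  eapply Rle_trans; [exact Hm|]. eapply Rle_trans; [exact HH|]. mul_le; [lra|auto|lra|]. apply exp_le. rewrite HIw, Rinv_mult. nra.
Qed.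
Lemma wder_p0 z : inH z -> wder (fun z => / eta z)%C z (- (dX eta z * (/ eta z * / eta z)))%C 0.
 intros Hz. have eta_neq_0 z Hz as H0. eapply wder_eq; [apply wder_comp_hol; [apply wder_Cinv, H0|apply hgood_wder; [auto|auto]]| |]; [field; auto|ring].
Qed.
Lemma hgood_p0 : hgood (fun z => / eta z)%C.
 intros n. induction n as [|]; [split; auto; apply gr_p0|]. eapply hg_intro; [apply gr_p0|intros z Hz; apply wder_p0, Hz|]. eapply (hg_ext n (fun z => -1 * (dX eta z * (/ eta z * / eta z)))%C); [intros; ring|]. apply hg_mult; [apply hg_const|].
 apply hg_mult; [apply (hgood_dX _ hgood_eta)|]. now apply hg_mult.
Qed.
#[local] Hint Resolve hgood_p0 : core.

(** * Sequences that transform like the derivatives of a modular form *)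

Lemma Gam_det a b c d : Gam a b c d -> (a * d - b * c = 1)%Z.
 intros []. auto. Qed.
Lemma Lj_mob j a b c d z : Gam a b c d -> inH z -> Lj (S j) (mob a b c d z) = (jfac c d z ^ (2 * S j) * Lj (S j) z)%C.
 intros HG Hz. destruct (Gam_c _ _ _ _ HG) as [Hc [Hd' Hd]]. have jfac_neq_0 a b c d z Hd Hz as HJ. apply tsum_eq. eapply Sums_ext; [|apply Sums_scal, (Sums_latmap a b c d (LT (S j) z) _ HG), (Lj_spec j z Hz)]. intros p. unfold LT.
 rewrite !thT0_eq, leps_latmap, (Xw_mob a b c d z p HG Hz) by auto. assert (El : lw (mob a b c d z) p = (lw z (latmap a b (c / 24) d p) / jfac c d z)%C) by (have lw_mob a b (c / 24) d z p Hd' Hz; rewrite <- Hc in H; auto).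
 rewrite El. set (w := lw z _). set (J := jfac c d z).
 destruct (Ceq_dec w 0) as [->|]; [replace (0 / J)%C with (RtoC 0) by cring; replace (2 * S j)%nat with (S (S (2 * j))) by lia; rewrite C_inv_pow_0; ring|unfold Cdiv; rewrite Cpow_mult_l, Cpow_inv by auto; field; auto].
Qed.
(** The action of exp (x D) on sequences, where D is the shift a_J -> a_(J-1); hence the additivity
    in x proved in [cv_cv]. *)
Definition cv (x : C) (a : nat -> C) (J : nat) : C := Csum (fun i => x ^ i / INR (fact i) * a (J - i)%nat)%C (seq 0 (S J)).
Lemma Csum_seq_S (f : nat -> C) n : Csum f (seq 0 (S n)) = (f O + Csum (fun i => f (S i)) (seq 0 n))%C.
 rewrite <- cons_seq, <- seq_shift, Csum_cons, Csum_map. auto. Qed.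
Lemma Csum_seq_last (f : nat -> C) n : Csum f (seq 0 (S n)) = (Csum f (seq 0 n) + f n)%C.
 rewrite seq_S, Csum_app. cring. Qed.
Lemma cv_S x a J : cv x a (S J) = (a (S J) + Csum (fun i => x ^ S i / INR (fact (S i)) * a (J - i)%nat) (seq 0 (S J)))%C.
 unfold cv. rewrite Csum_seq_S. simpl. field. Qed.
Lemma cv_O x a : cv x a O = a O.
 unfold cv. simpl. field. Qed.
Lemma fact_S_C i : RtoC (INR (fact (S i))) = (INR (S i) * INR (fact i))%C.
 change (fact (S i)) with (S i * fact i)%nat. now rewrite mult_INR, RtoC_mult. Qed.
Lemma INR_S_C i : RtoC (INR (S i)) <> 0.
 intros E. apply RtoC_inj in E. now apply (not_0_INR (S i)). Qed.
Lemma wder_Csum {I} (f A B : I -> C -> C) z l : (forall i, In i l -> wder (f i) z (A i z) (B i z)) ->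
 wder (fun z => Csum (fun i => f i z) l) z (Csum (fun i => A i z) l) (Csum (fun i => B i z) l).
 induction l as [|i l IH]; intros H; [now simpl|]. apply wder_plus; [apply H; now left|apply IH; intros; apply H; now right]. Qed.
Lemma Csum_zero {I} (l : list I) : Csum (fun _ => RtoC 0) l = 0.
 induction l as [|? l IH]; [auto|rewrite Csum_cons, IH; ring]. Qed.
Lemma wder_cv a J x : wder (fun x => cv x a (S J)) x (cv x a J) 0.
 eapply wder_eq; [eapply wder_ext; [intros w; symmetry; apply cv_S|]|..].
 - apply wder_plus; [auto|]. apply (wder_Csum (fun i x => x ^ S i / INR (fact (S i)) * a (J - i)%nat)%C (fun i x => x ^ i / INR (fact i) * a (J - i)%nat)%C (fun _ _ => 0)). intros i _.
  eapply wder_eq; [eapply wder_ext; [|apply (wder_scal (/ INR (fact (S i)) * a (J - i)%nat)), (wder_pow _ _ _ _ i (wder_id x))]| |]; [intros w; cring|rewrite fact_S_C; field; split; auto using INR_S_C|ring].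
 - cring.
 - rewrite Csum_zero. ring.
Qed.
(** Differentiation in t lowers J, so by induction the difference of the two sides has derivative 0,
    and it vanishes at t = 0. *)
Lemma cv_cv t x a J : cv t (cv x a) J = cv (t + x)%C a J.
 revert t. induction J as [|J IH]; intros t; [now rewrite cv_O|]. apply Ceq_minus. rewrite <- (Cplus_0_l t). transitivity (cv 0 (cv x a) (S J) - cv (0 + x) a (S J))%C.
 - apply (wder_const_seg (fun t => cv t (cv x a) (S J) - cv (t + x) a (S J))%C). intros s _.
  eapply wder_eq; [apply wder_minus; [apply wder_cv|apply (wder_comp_hol (fun x => cv x a (S J)) (fun t => t + x)%C); [apply wder_cv|apply wder_plus; [auto|auto]]]| |]; [rewrite IH; ring|ring].
 - rewrite cv_S, Cplus_0_l, (Csum_ext_in _ (fun _ => 0)), Csum_zero; [ring|]. intros i _. cring.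
Qed.
Definition nu a b c d (z : C) : C := (eta z / eta (mob a b c d z))%C.
Lemma wder_jfac c d z : wder (jfac c d) z (RtoC (IZR c)) 0.
 eapply wder_eq; [apply wder_plus; [apply wder_scal, wder_id|auto]|ring|ring]. Qed.
Lemma wder_mob a b c d z : (a * d - b * c = 1)%Z -> inH z -> wder (mob a b c d) z (/ (jfac c d z * jfac c d z))%C 0.
 intros Hd Hz. have jfac_neq_0 a b c d z Hd Hz as HJ. eapply wder_eq; [apply wder_mult| |].
 - apply wder_plus; [apply wder_scal, wder_id|auto].
 - apply wder_comp_hol; [apply wder_Cinv, HJ|apply wder_jfac].
 - apply (f_equal IZR) in Hd. rewrite minus_IZR, !mult_IZR in Hd. apply (f_equal RtoC) in Hd. rewrite RtoC_minus, !RtoC_mult in Hd.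
  transitivity ((IZR a * IZR d - IZR b * IZR c) / (jfac c d z * jfac c d z))%C; [|rewrite Hd; field; auto]. unfold jfac. field. auto.
 - ring.
Qed.
Lemma wder_eta_mob a b c d z : Gam a b c d -> inH z ->
 wder (fun z => eta (mob a b c d z)) z (dX eta (mob a b c d z) * / (jfac c d z * jfac c d z))%C 0.
 intros HG Hz. have Gam_det _ _ _ _ HG. eapply wder_eq; [apply wder_comp_hol; [apply hgood_wder; [auto|now apply mob_inH]|now apply wder_mob]|auto|ring].
Qed.
Lemma wder_nu_ex a b c d z : Gam a b c d -> inH z -> exists A, wder (nu a b c d) z A 0.
 intros HG Hz. have eta_neq_0 _ (mob_inH a b c d z (Gam_det _ _ _ _ HG) Hz) as He. eexists. eapply wder_eq; [apply wder_mult; [apply hgood_wder; [auto|auto]|apply wder_comp_hol; [apply wder_Cinv, He|now apply wder_eta_mob]]|auto|ring].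
Qed.
(* [1 / nu ^ 2] and the automorphy factor have the same modulus, so their holomorphic quotient is constant. *)
Lemma wder_nu_sq a b c d z : Gam a b c d -> inH z -> wder (fun z => nu a b c d z * nu a b c d z * jfac c d z)%C z 0 0.
 intros HG Hz. have Gam_det _ _ _ _ HG as Hd.
 assert (Hex : forall z, inH z -> exists A, wder (fun z => nu a b c d z * nu a b c d z * jfac c d z)%C z A 0) by (intros w Hw; destruct (wder_nu_ex a b c d w HG Hw) as [A HA]; eexists; eapply wder_eq; [apply wder_mult; [apply wder_mult; exact HA|apply wder_jfac]|auto|ring]).
 destruct (Hex z Hz) as [A HA]. set (g := fun z => (nu a b c d z * nu a b c d z * jfac c d z)%C). assert (Hmod : forall z, inH z -> (g z * Cconj (g z))%C = 1).
 { intros w Hw. have eta_neq_0 w Hw. have eta_neq_0 _ (mob_inH a b c d w Hd Hw). have jfac_neq_0 a b c d w Hd Hw as HJ. have eta_mob_mod a b c d w HG Hw as HE. set (e := eta w) in *. set (e' := eta (mob a b c d w)) in *. set (J := jfac c d w) in *.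
  assert (Hc : forall x : C, x <> 0 -> Cconj x <> 0) by (intros x Hx E; apply Hx; rewrite <- (Cconj_conj x), E; unfold Cconj, RtoC; simpl; f_equal; ring). assert (HJm : RtoC (Cmod J) <> 0) by (intros E; apply RtoC_inj in E; apply HJ, Cmod_eq_0, E).
  assert (E1 : (g w * Cconj (g w) = e * Cconj e * e * Cconj e * (J * Cconj J) / (e' * Cconj e' * (e' * Cconj e')))%C) by (unfold g, nu; fold e e' J; unfold Cdiv; rewrite !Cmult_conj, Cinv_conj by auto; field; auto).
  rewrite E1, HE. replace (J * Cconj J)%C with (Cmod J * Cmod J)%C by (rewrite <- Cmod2_conj', <- RtoC_mult; f_equal; ring). field. auto. } assert (HA0 : A = 0).
 { assert (H1 : wder (fun z => g z * Cconj (g z))%C z (A * Cconj (g z)) (g z * Cconj A)) by (eapply wder_eq; [apply wder_mult; [eauto|apply wder_comp; [apply wder_Cconj|eauto]]| |]; [cring|ring]).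
  assert (H2 : wder (fun z => g z * Cconj (g z))%C z 0 0) by (eapply wder_extH; [auto|intros w Hw; symmetry; apply Hmod, Hw|auto]).
  destruct (wder_unique _ _ _ _ _ _ H1 H2) as [E _]. specialize (Hmod z Hz). transitivity (A * Cconj (g z) * g z)%C; [|rewrite E; ring]. transitivity (A * (g z * Cconj (g z)))%C; [rewrite Hmod; ring|ring]. } rewrite HA0 in HA. auto.
Qed.
(** Obtained by differentiating nu^2 J = const. Under differentiation [nu] thus behaves like
    J^(-1/2), and no branch of the square root has to be chosen. *)
Lemma wder_nu a b c d z : Gam a b c d -> inH z -> wder (nu a b c d) z (- (IZR c / (2 * jfac c d z)) * nu a b c d z)%C 0.
 intros HG Hz. have Gam_det _ _ _ _ HG as Hd. have jfac_neq_0 a b c d z Hd Hz. have eta_neq_0 z Hz as He. have eta_neq_0 _ (mob_inH a b c d z Hd Hz). destruct (wder_nu_ex a b c d z HG Hz) as [A HA]. eapply wder_eq; [eauto| |auto].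
 assert (H1 : wder (fun z => nu a b c d z * nu a b c d z * jfac c d z)%C z ((A * nu a b c d z + nu a b c d z * A) * jfac c d z + nu a b c d z * nu a b c d z * IZR c) 0) by (eapply wder_eq; [apply wder_mult; [apply wder_mult; exact HA|apply wder_jfac]|auto|ring]).
 destruct (wder_unique _ _ _ _ _ _ H1 (wder_nu_sq a b c d z HG Hz)) as [E _]. assert (Hn0 : nu a b c d z <> 0).
 { unfold nu. intros E0. apply He. transitivity (eta z / eta (mob a b c d z) * eta (mob a b c d z))%C; [field; auto|rewrite E0; ring]. } set (n := nu a b c d z) in *. set (J := jfac c d z) in *.
 transitivity (((A * n + n * A) * J + n * n * IZR c) / (2 * n * J) - IZR c / (2 * J) * n)%C; [field; auto|rewrite E; field; auto].
Qed.
(** Read off from X (g z) / J^2 = X(z) + kap c / J, where J = c z + d is the denominator of g;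
    [alph] is the inverse of [kap]. *)
Definition kap : C := (- (PI * Ci / 8))%C.
Definition alph : C := (8 * Ci / PI)%C.
Lemma kap_alph : (kap * alph)%C = 1.
 unfold kap, alph. transitivity (- Ci * Ci)%C; [field; auto|]. cring. Qed.
Definition tJ c d (z : C) : C := (kap * IZR c / jfac c d z)%C.
(** Entry J behaves as a form of weight 2J - 1/2, with [nu] in the role of J^(-1/2), up to lower
    entries. This is the law of the suitably normalized derivatives of a form of weight 2s - 1/2,
    placed from index s on. *)
Definition QL (E : nat -> C -> C) : Prop := forall a b c d z J, Gam a b c d -> inH z ->
 E J (mob a b c d z) = (nu a b c d z * jfac c d z ^ (2 * J) * cv (tJ c d z) (fun i => E i z) J)%C.
Lemma cv_plus x a b J : cv x (fun i => a i + b i)%C J = (cv x a J + cv x b J)%C.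
 unfold cv. rewrite <- Csum_plus. apply Csum_ext_in. intros; ring. Qed.
Lemma cv_scal x k a J : cv x (fun i => k * a i)%C J = (k * cv x a J)%C.
 unfold cv. rewrite <- Csum_scal. apply Csum_ext_in. intros; ring. Qed.
Lemma cv_ext x a b J : (forall i, (i <= J)%nat -> a i = b i) -> cv x a J = cv x b J.
 intros H. apply Csum_ext_in. intros i Hi. rewrite H; [auto|lia]. Qed.
Lemma QL_minus E F : QL E -> QL F -> QL (fun J z => E J z - F J z)%C.
 intros HE HF a b c d z J HG Hz. rewrite HE, HF by auto. rewrite (cv_ext _ (fun i => E i z - F i z)%C (fun i => E i z + -1 * F i z)%C) by (intros; ring). rewrite cv_plus, cv_scal. ring.
Qed.
Definition E0 (J : nat) (z : C) : C := match J with O => (- / eta z)%C | S j => (Bj (S j) z / eta z - Tj j z)%C end.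
Definition ell (J : nat) (z : C) : C := match J with O => (- / eta z)%C | S j => (Lj (S j) z / eta z)%C end.
(** [Bj_split] divided by [eta]: the sequence is the image under exp (X D) of the entries [ell],
    which do not mix under the group. *)
Lemma E0_cv J z : inH z -> E0 J z = cv (Xy z) (fun i => ell i z) J.
 intros Hz. destruct J as [|j]; [now rewrite cv_O|]. unfold cv. rewrite Csum_seq_last, Nat.sub_diag. cbn [E0 ell]. rewrite (Csum_ext_in _ (fun i => / eta z * (Xy z ^ i / INR (fact i) * Lj (S j - i) z))%C).
 - rewrite Csum_scal. replace (Tj j z) with (Xy z ^ S j * Wj (S j) z / eta z)%C by (rewrite <- eta_Tj by auto; field; auto). rewrite (Bj_split j z Hz). cring.
 - intros i Hi. apply in_seq in Hi. replace (S j - i)%nat with (S (j - i)) by lia. cring.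
Qed.
(** The identity kap c / J + X(z) = X(g z) / J^2 and the additivity of [cv] turn the law of the
    unmixed entries [ell] into the law of [E0]. *)
Lemma QL_E0 : QL E0.
 intros a b c d z J HG Hz. have Gam_det _ _ _ _ HG as Hd. have jfac_neq_0 a b c d z Hd Hz. have mob_inH. rewrite E0_cv by auto. set (j := jfac c d z). assert (Hell : forall i, ell i (mob a b c d z) = (nu a b c d z * j ^ (2 * i) * ell i z)%C).
 { intros [|]; cbn [ell]; unfold nu; [simpl; field; auto|]. rewrite Lj_mob by auto. fold j. field. auto. } rewrite (cv_ext _ (fun i => E0 i z) (cv (Xy z) (fun i => ell i z))) by (intros; now apply E0_cv). rewrite cv_cv.
 assert (Et : (tJ c d z + Xy z = Xy (mob a b c d z) / (j * j))%C).
 { rewrite Xy_mob, RtoC_mult, Cmod2_conj' by auto. unfold tJ. fold j. assert (Ec : Cconj j = (j - 2 * Ci * IZR c * Im z)%C) by (unfold Cconj, Cminus, Cplus, Im; simpl; f_equal; ring). rewrite Ec. unfold Xy, kap.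
  assert (Hy : RtoC (Im z) <> 0) by (intros E; apply RtoC_inj in E; unfold inH in Hz; lra). rewrite RtoC_div, RtoC_mult by (unfold inH in *; lra). field. auto. }
 rewrite Et. unfold cv. rewrite <- Csum_scal. apply Csum_ext_in. intros i Hi. apply in_seq in Hi. rewrite Hell. replace (2 * J)%nat with (2 * i + 2 * (J - i))%nat by lia. rewrite Cpow_add_r. unfold Cdiv.
 rewrite Cpow_mult_l, Cpow_inv, (Cpow_mult_r j 2 i) by now apply Cmult_neq_0. replace (j ^ 2)%C with (j * j)%C by ring. field. split; [auto|apply Cpow_nz; now apply Cmult_neq_0].
Qed.
(** The constants that make H_i' = lam H_(i+1) compatible with [QL]: for weight w = 2s - 1/2 the
    i-th step carries (i + 1) (w + i), and [alph] compensates [kap]. They are nonzero because w is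
    not an integer. *)
Definition lam (s i : nat) : C := (alph * (INR i + 1) * (2 * INR s - / 2 + INR i))%C.
Lemma lam_neq_0 s i : lam s i <> 0.
 assert (HA : (8 * Ci / PI)%C <> 0) by (intros E; apply Ci_neq_0; transitivity (8 * Ci / PI * (PI / 8))%C; [field; auto|rewrite E; ring]).
 assert (HB : (INR i + 1)%C <> 0) by (rewrite <- RtoC_plus, <- S_INR; apply INR_S_C). assert (HC : (2 * INR s - / 2 + INR i)%C <> 0).
 { rewrite <- RtoC_inv2, <- RtoC_mult, <- RtoC_minus, <- RtoC_plus. intros E. apply RtoC_inj in E. rewrite !INR_IZR_INZ in E. assert (E2 : IZR (4 * zn s + 2 * zn i) = IZR 1) by (rewrite plus_IZR, !mult_IZR; lra). apply eq_IZR in E2. lia. }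
 apply Cmult_neq_0; [apply Cmult_neq_0|]; assumption.
Qed.
#[local] Hint Resolve lam_neq_0 : core.
Definition md (s : nat) (F : C -> C) : Prop := forall a b c d z, Gam a b c d -> inH z ->
 F (mob a b c d z) = (nu a b c d z * jfac c d z ^ (2 * s) * F z)%C.
(** Each H (S i - r) receives one contribution from the term r - 1 and one from the term r, and
    together they make up [lam s i]. *)
Lemma chain_comb s i t (H : nat -> C) :
 Csum (fun r => t ^ r / INR (fact r) * ((2 * INR (s + i) - / 2 - INR r) * (alph * t) * H (i - r)%nat + lam s (i - r) * H (S (i - r))))%C (seq 0 (S i)) = (lam s i * cv t H (S i))%C.
 unfold cv. rewrite <- Csum_scal. transitivity (Csum (fun r => t ^ r / INR (fact r) * (INR r * (2 * INR (s + i) + / 2 - INR r) * alph * H (S i - r)%nat)) (seq 0 (S (S i))) +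
  Csum (fun r => t ^ r / INR (fact r) * ((lam s i - INR r * (2 * INR (s + i) + / 2 - INR r) * alph) * H (S i - r)%nat)) (seq 0 (S (S i))))%C; [|rewrite <- Csum_plus; apply Csum_ext_in; intros; ring].
 rewrite (Csum_seq_S _ (S i)), (Csum_seq_last _ (S i)). replace (lam s i - INR (S i) * (2 * INR (s + i) + / 2 - INR (S i)) * alph)%C with (RtoC 0) by (unfold lam; rewrite S_INR, plus_INR, !RtoC_plus; field).
 replace (t ^ 0 / INR (fact 0) * (INR 0 * (2 * INR (s + i) + / 2 - INR 0) * alph * H (S i - 0)%nat))%C with (RtoC 0) by (simpl; ring).
 rewrite Cmult_0_l, Cmult_0_r, Cplus_0_l, Cplus_0_r, <- Csum_plus. apply Csum_ext_in. intros r Hr. apply in_seq in Hr. rewrite Nat.sub_succ.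
 replace (S i - r)%nat with (S (i - r)) by lia. rewrite fact_S_C. cbn [Cpow]. unfold lam. rewrite minus_INR, S_INR, plus_INR, !RtoC_plus, RtoC_minus by lia.
 assert (Hr1 : (INR r + 1)%C <> 0) by (rewrite <- RtoC_plus, <- S_INR; apply INR_S_C). field; auto.
Qed.
(** The law of [H i] is differentiated in two ways and the coefficients of dz are compared. Those of
    d(conj z) do not enter, so H may be nonholomorphic; this is how the integrals T are included. *)
Lemma chain_law s (H B : nat -> C -> C) : (forall i z, inH z -> wder (H i) z (lam s i * H (S i) z)%C (B i z)) -> md s (H O) ->
 forall i a b c d z, Gam a b c d -> inH z -> H i (mob a b c d z) = (nu a b c d z * jfac c d z ^ (2 * (s + i)) * cv (tJ c d z) (fun r => H r z) i)%C.
 intros HD HM i. induction i as [|i IH]; intros a b c d z HG Hz; [rewrite cv_O, Nat.add_0_r; now apply HM|]. have (Gam_det _ _ _ _ HG) as Hd.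
 have (jfac_neq_0 a b c d z Hd Hz) as HJ. have (mob_inH a b c d z Hd Hz) as Hm. have (lam_neq_0 s i) as Hl. set (J := jfac c d z) in *. set (t := tJ c d z). set (n := nu a b c d z). set (m := (s + i)%nat).
 assert (H1 : wder (fun z => H i (mob a b c d z)) z (lam s i * H (S i) (mob a b c d z) * / (J * J))%C (B i (mob a b c d z) * Cconj (/ (J * J)))%C).
 { eapply wder_eq; [apply (wder_comp (H i) (mob a b c d)); [apply HD, Hm|now apply wder_mob]| |]; [fold J; replace (Cconj 0) with (RtoC 0) by (unfold Cconj, RtoC; simpl; f_equal; ring); ring|fold J; ring]. }
 assert (Ht : wder (tJ c d) z (- (t * (IZR c / J)))%C 0) by (unfold tJ, Cdiv; eapply wder_eq; [apply (wder_scal (kap * IZR c)%C), (wder_comp_hol Cinv (jfac c d)); [apply wder_Cinv, HJ|apply wder_jfac]| |]; [unfold t, tJ; fold J; field; auto|ring]).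
 assert (Htr : forall r, wder (fun z => tJ c d z ^ r / INR (fact r))%C z (- INR r * (IZR c / J) * (t ^ r / INR (fact r)))%C 0).
 { intros [|r].
  - eapply wder_eq; [eapply wder_ext; [|apply (wder_const (1 / INR (fact 0)))]| |]; [reflexivity|simpl INR; ring|reflexivity].
  - eapply wder_eq; [eapply wder_ext; [|apply (wder_scal (/ INR (fact (S r)))%C), (wder_pow _ _ _ _ r Ht)]| |]; [intros w; unfold Cdiv; ring|fold t; cbn [Cpow]; unfold Cdiv; ring|ring]. }
 assert (H2 : exists Bz, wder (fun z => H i (mob a b c d z)) z (n * J ^ (2 * m) * Csum (fun r => t ^ r / INR (fact r) * ((2 * INR (s + i) - / 2 - INR r) * (alph * t) * H (i - r)%nat z + lam s (i - r) * H (S (i - r)) z))%C (seq 0 (S i)))%C Bz).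
 { eexists. eapply wder_extH; [exact Hz|intros w Hw; symmetry; apply IH; auto|]. eapply wder_eq; [apply wder_mult; [apply wder_mult; [now apply wder_nu|]|]| |reflexivity].
  - eapply wder_eq; [apply (wder_comp_hol (fun w => w ^ (2 * m))%C (jfac c d)); [|apply wder_jfac]| |reflexivity]; [|reflexivity]. instantiate (1 := (INR (2 * m) * J ^ (2 * m) * / J)%C).
   destruct (2 * m)%nat as [|q] eqn:Eq; [eapply wder_eq; [apply (wder_const 1)|simpl; ring|reflexivity]|eapply wder_eq; [apply (wder_pow _ _ _ _ q (wder_id J))|cbn [Cpow]; field; auto|ring]].
  - unfold cv. apply (wder_Csum (fun r z => tJ c d z ^ r / INR (fact r) * H (i - r)%nat z)%C
     (fun r z => - INR r * (IZR c / jfac c d z) * (tJ c d z ^ r / INR (fact r)) * H (i - r)%nat z + tJ c d z ^ r / INR (fact r) * (lam s (i - r) * H (S (i - r)) z))%C (fun r z => tJ c d z ^ r / INR (fact r) * B (i - r)%nat z)%C). intros r _.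
   eapply wder_eq; [apply (wder_mult (fun z => tJ c d z ^ r / INR (fact r))%C (H (i - r)%nat)); [apply Htr|apply HD, Hz]|reflexivity|cbv beta; ring].
  - fold J t n m. unfold cv. assert (Ec : (IZR c / J = alph * t)%C).
   { unfold t, tJ. fold J. transitivity (kap * alph * (IZR c / J))%C; [rewrite kap_alph; ring|field; auto]. } rewrite <- Ec.
   set (D := Csum (fun r => - INR r * (IZR c / J) * (t ^ r / INR (fact r)) * H (i - r)%nat z + t ^ r / INR (fact r) * (lam s (i - r) * H (S (i - r)) z))%C (seq 0 (S i))).
   set (W := Csum (fun r => t ^ r / INR (fact r) * H (i - r)%nat z)%C (seq 0 (S i))). replace (Csum (fun r => t ^ r / INR (fact r) * ((2 * INR m - / 2 - INR r) * (IZR c / J) * H (i - r)%nat z + lam s (i - r) * H (S (i - r)) z))%C (seq 0 (S i)))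
     with ((2 * INR m - / 2) * (IZR c / J) * W + D)%C.
   + rewrite mult_INR, RtoC_mult. change (INR 2) with (1 + 1). replace (1 + 1) with 2 by ring. change (Csum (fun i0 : nat => tJ c d z ^ i0 / INR (fact i0) * H (i - i0)%nat z)%C (seq 0 (S i))) with W. change (nu a b c d z) with n.
    change (jfac c d z) with J. field. auto.
   + unfold W, D. rewrite <- Csum_scal, <- Csum_plus. apply Csum_ext_in. intros; ring. } destruct H2 as [Bz H2]. destruct (wder_unique _ _ _ _ _ _ H1 H2) as [E _]. have (chain_comb s i t (fun i => H i z)) as EC. cbv beta in EC.
 rewrite EC in E. clear EC. apply (f_equal (fun w => w * (J * J) / lam s i)%C) in E. transitivity (lam s i * H (S i) (mob a b c d z) * / (J * J) * (J * J) / lam s i)%C; [field; auto|]. rewrite E.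
 replace (2 * (s + S i))%nat with (S (S (2 * m))) by (unfold m; lia). cbn [Cpow]. field. auto.
Qed.
Definition shf (s : nat) (H : nat -> C -> C) (J : nat) (z : C) : C := if Nat.ltb J s then RtoC 0 else H (J - s)%nat z.
Lemma QL_chain s (H B : nat -> C -> C) : (forall i z, inH z -> wder (H i) z (lam s i * H (S i) z)%C (B i z)) -> md s (H O) -> QL (shf s H).
 intros HD HM a b c d z J HG Hz. unfold shf. destruct (Nat.ltb_spec J s) as [|].
 - unfold cv. rewrite (Csum_ext_in _ (fun _ => 0)), Csum_zero; [ring|]. intros i Hi. destruct (Nat.ltb_spec (J - i) s); [ring|lia].
 - rewrite (chain_law s H B HD HM) by auto. replace (s + (J - s))%nat with J by lia. f_equal. unfold cv. replace (seq 0 (S J)) with (seq 0 (S (J - s)) ++ seq (S (J - s)) s) by (rewrite <- seq_app; f_equal; lia).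
  rewrite Csum_app, (Csum_ext_in _ (fun _ => 0) (seq (S (J - s)) s)), Csum_zero, Cplus_0_r.
  + apply Csum_ext_in. intros i Hi. apply in_seq in Hi. destruct (Nat.ltb_spec (J - i) s); [lia|]. do 2 f_equal. lia.
  + intros i Hi. apply in_seq in Hi. destruct (Nat.ltb_spec (J - i) s); [ring|lia].
Qed.
Lemma QL_first s E : QL E -> (forall J z, (J < s)%nat -> inH z -> E J z = 0) -> md s (E s).
 intros HE H0 a b c d z HG Hz. rewrite HE by auto. f_equal. destruct s as [|]; [apply cv_O|]. rewrite cv_S, (Csum_ext_in _ (fun _ => 0)), Csum_zero; [ring|]. intros i Hi. rewrite H0 by (auto; lia). ring.
Qed.

(** * Quadratic Gauss sums and the Jacobi symbol *)

Lemma NoDup_map_on {A B} (g : A -> B) L : NoDup L -> (forall x y, In x L -> In y L -> g x = g y -> x = y) -> NoDup (map g L).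
 induction 1 as [|x L Hn HL IH]; intros Hg; [constructor|]. constructor; [intros H; apply in_map_iff in H; destruct H as [y []]; apply Hn; rewrite (Hg x y); auto; [now left|now right]|apply IH; intros; apply Hg; auto; now right].
Qed.
(** Any complete residue system may replace 0, ..., n - 1; all substitutions in the Gauss sums below
    are instances. *)
Lemma Csum_mod {A} (L : list A) (psi : A -> Z) (n : Z) (f : Z -> C) : (0 < n)%Z -> NoDup L -> zn (length L) = n ->
 (forall x y, In x L -> In y L -> (n | psi x - psi y)%Z -> x = y) -> (forall k j, f (k + j * n)%Z = f k) -> Csum (fun x => f (psi x)) L = Csum (fun r => f (zn r)) (seq 0 (Z.to_nat n)).
 intros Hn HL Hlen Hinj Hf. transitivity (Csum (fun r => f (zn r)) (map (fun x => Z.to_nat (psi x mod n)) L)).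
 - rewrite Csum_map. apply Csum_ext_in. intros x _. have Z.mod_pos_bound (psi x) n Hn. rewrite Z2Nat.id, <- (Hf (psi x mod n) (psi x / n)%Z) by lia. f_equal. have Z.div_mod (psi x) n ltac:(lia). lia.
 - apply Csum_perm, NoDup_Permutation_bis.
  + apply NoDup_map_on; auto. intros x y Hx Hy E. apply Hinj; auto. have Z.mod_pos_bound (psi x) n Hn. have Z.mod_pos_bound (psi y) n Hn. exists (psi x / n - psi y / n)%Z. have Z.div_mod (psi x) n ltac:(lia). have Z.div_mod (psi y) n ltac:(lia). lia.
  + rewrite length_map, length_seq. lia.
  + intros r Hr. apply in_map_iff in Hr. destruct Hr as []. apply in_seq. have Z.mod_pos_bound (psi x) n Hn. lia.
Qed.
Definition En (n x : Z) : C := ee (RtoC (IZR x / IZR n)).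
Lemma IZR_pos n : (0 < n)%Z -> 0 < IZR n.
 apply IZR_lt. Qed.
Lemma En_plus n x y : En n (x + y) = (En n x * En n y)%C.
 unfold En. rewrite <- ee_plus, <- RtoC_plus, plus_IZR. do 2 f_equal. lra. Qed.
Lemma En_mul n k : (0 < n)%Z -> En n (k * n) = 1.
 intros Hn. have IZR_pos n Hn. unfold En. rewrite mult_IZR. replace (IZR k * IZR n / IZR n) with (IZR k) by (field; lra). apply ee_Z. Qed.
Lemma En_mod n x y k : (0 < n)%Z -> (x = y + k * n)%Z -> En n x = En n y.
 intros Hn ->. rewrite En_plus, En_mul by auto. ring. Qed.
Lemma En_1 n x : (0 < n)%Z -> En n x = 1 -> (n | x)%Z.
 intros Hn H. have IZR_pos n Hn as Hn'. unfold En in H. rewrite ee_R in H. have PI_RGT_0. injection H as H1 H2.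
 destruct (sin_eq_0_0 _ H2) as [k Hk]. assert (E : 2 * IZR x = IZR k * IZR n) by (assert (E1 : 2 * IZR x / IZR n = IZR k) by nra; rewrite <- E1; field; lra). destruct (Z.Even_or_Odd k) as [[q ->]|[q ->]].
 - exists q. apply eq_IZR. rewrite mult_IZR. rewrite mult_IZR in E. lra.
 - rewrite Hk in H1. replace (IZR (2 * q + 1) * PI) with (PI + 2 * PI * IZR q) in H1 by (rewrite plus_IZR, mult_IZR; ring). replace (cos (PI + 2 * PI * IZR q)) with (Re (ee (RtoC (/ 2 + IZR q)))) in H1 by (rewrite ee_R; cbn; f_equal; field).
  rewrite RtoC_plus, ee_shift, ee_R in H1. cbn in H1. replace (2 * PI * / 2) with PI in H1 by field. rewrite cos_PI in H1. lra.
Qed.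
Definition Gs (a n : Z) : C := Csum (fun r : nat => En n (a * (zn r * zn r))) (seq 0 (Z.to_nat n)).
Lemma En_sq_per a n k j : (0 < n)%Z -> En n (a * ((k + j * n) * (k + j * n))) = En n (a * (k * k)).
 intros Hn. apply (En_mod n _ _ (a * (2 * k * j + j * j * n))); auto. ring. Qed.
Lemma Csum_En_zero n u : (0 < n)%Z -> ~ (n | u)%Z -> Csum (fun t : nat => En n (u * zn t)) (seq 0 (Z.to_nat n)) = 0.
 intros Hn Hu. set (S := Csum _ _). assert (E : (En n u * S)%C = S).
 { unfold S. rewrite <- Csum_scal, <- (Csum_mod (seq 0 (Z.to_nat n)) (fun t => zn t + 1)%Z n (fun k => En n (u * k))).
  - apply Csum_ext_in. intros t _. rewrite <- En_plus. f_equal. ring.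
  - auto.
  - apply seq_NoDup.
  - rewrite length_seq. lia.
  - intros x y Hx Hy [q Hq]. apply in_seq in Hx, Hy. assert (q = 0)%Z by nia. nia.
  - intros k j. apply (En_mod n _ _ (u * j)); auto. ring. } assert (H1 : (En n u - 1)%C <> 0) by (intros E1; apply Hu, (En_1 n u Hn); transitivity (En n u - 1 + 1)%C; [ring|rewrite E1; ring]).
 transitivity ((En n u * S - S) / (En n u - 1))%C; [field; auto|rewrite E; field; auto].
Qed.
Lemma Csum_const {I} (c : C) (l : list I) : Csum (fun _ => c) l = (INR (length l) * c)%C.
 induction l as [|x l IH]; [cring|]. rewrite Csum_cons, IH. cbn [length]. rewrite S_INR, RtoC_plus. ring. Qed.
Lemma Gs_scale_sq a n x : (0 < n)%Z -> rel_prime n x -> Gs (a * (x * x)) n = Gs a n.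
 intros Hn Hx. unfold Gs. rewrite <- (Csum_mod (seq 0 (Z.to_nat n)) (fun r => x * zn r)%Z n (fun k => En n (a * (k * k)))).
 - apply Csum_ext_in. intros r _. f_equal. ring.
 - auto.
 - apply seq_NoDup.
 - rewrite length_seq. lia.
 - intros r s Hr Hs Hd. apply in_seq in Hr, Hs. replace (x * zn r - x * zn s)%Z with (x * (zn r - zn s))%Z in Hd by ring. apply Gauss in Hd; auto. destruct Hd as [q Hq]. assert (q = 0)%Z by nia. nia.
 - intros k j. now apply En_sq_per.
Qed.
Lemma Gs_mod a b n k : (0 < n)%Z -> (a = b + k * n)%Z -> Gs a n = Gs b n.
 intros Hn ->. apply Csum_ext_in. intros r _. apply (En_mod n _ _ (k * zn r * zn r)); auto. ring. Qed.
(** An index set of 2m + 1 elements: 0 and two copies of 1, ..., m. It is used with the residues r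
    and -r, and for a nonresidue c with r^2 and c r^2. *)
Definition half (m : nat) : list (bool * nat) := map (fun r => (true, r)) (seq 1 m) ++ map (fun r => (false, r)) (seq 1 m) ++ [(true, 0%nat)].
Lemma half_in m x : In x (half m) -> (snd x <= m)%nat /\ (fst x = false -> (1 <= snd x)%nat).
 unfold half. rewrite !in_app_iff, !in_map_iff. intros [[r [<- H]]|[[r [<- H]]|[<-|[]]]]; try apply in_seq in H; cbn; lia. Qed.
Lemma half_NoDup m : NoDup (half m).
 apply NoDup_app; [apply NoDup_map_on; [apply seq_NoDup|congruence]|apply NoDup_app|].
 - apply NoDup_map_on; [apply seq_NoDup|congruence].
 - constructor; [auto|constructor].
 - intros x H1 [<-|[]]. apply in_map_iff in H1. destruct H1 as []. easy.
 - intros x H1 H2. apply in_map_iff in H1. destruct H1 as [r [<- Hr]]. apply in_seq in Hr. rewrite in_app_iff, in_map_iff in H2. destruct H2 as [[]|[E|[]]]; [easy|]. injection E. lia.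
Qed.
Lemma half_length m : length (half m) = (2 * m + 1)%nat.
 unfold half. rewrite !length_app, !length_map, length_seq. simpl. lia. Qed.
Lemma Csum_half m (f : bool * nat -> C) : Csum f (half m) = (Csum (fun r => f (true, r)) (seq 1 m) + Csum (fun r => f (false, r)) (seq 1 m) + f (true, 0%nat))%C.
 unfold half. rewrite !Csum_app, !Csum_map. cring. Qed.
Lemma Gs_half a p m : (p = 2 * zn m + 1)%Z -> Gs a p = (1 + 2 * Csum (fun r => En p (a * (zn r * zn r))) (seq 1 m))%C.
 intros Hp. assert (Hp0 : (0 < p)%Z) by lia. unfold Gs. rewrite <- (Csum_mod (half m) (fun x => if fst x then zn (snd x) else - zn (snd x))%Z p (fun k => En p (a * (k * k)))); auto.
 - rewrite Csum_half. cbn [fst snd]. rewrite (Csum_ext_in (fun r => En p (a * (- zn r * - zn r))) (fun r => En p (a * (zn r * zn r)))) by (intros; f_equal; ring). replace (a * (zn 0 * zn 0))%Z with (0 * p)%Z by lia. rewrite En_mul by auto. ring.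
 - apply half_NoDup.
 - rewrite half_length. lia.
 - intros [] [b' s] Hx Hy [q Hq]. apply half_in in Hx, Hy. cbn [fst snd] in *. assert (q = 0)%Z by (destruct b, b'; nia). destruct b, b'; f_equal; lia.
 - intros k j. now apply En_sq_per.
Qed.
Lemma small_div p r : (0 <= r < p)%Z -> (p | r)%Z -> r = 0%Z.
 intros Hr [q Hq]. assert (q = 0)%Z by nia. lia. Qed.
(** For a residue c = x^2 the variable r is replaced by x r. For a nonresidue, 0 together with the
    r^2 and the c r^2 for 1 <= r <= m exhausts the residues; the two half sums then add up to -1,
    and the Gauss sums are opposite. *)
Lemma legendre_gauss p c a : prime p -> Z.odd p = true -> ~ (p | c)%Z -> ~ (p | a)%Z ->
 (legendre c p = 1 \/ legendre c p = -1)%Z /\ Gs (c * a) p = (IZR (legendre c p) * Gs a p)%C.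
 intros Hp Ho Hc Ha. assert (Hp0 : (0 < p)%Z) by (destruct Hp; lia). apply Z.odd_spec in Ho. destruct Ho as [h Hh]. set (m := Z.to_nat h).
 assert (Hm : (p = 2 * zn m + 1)%Z) by lia. unfold legendre. destruct (Z.eqb_spec (c mod p) 0) as [|]; [exfalso; apply Hc, Z.mod_divide; lia|]. destruct existsb eqn:Ex.
 - split; [auto|]. apply existsb_exists in Ex. destruct Ex as [x [_ Ex]]. apply Z.eqb_eq, Z.mod_divide in Ex; [|lia]. destruct Ex as [q Hq].
  assert (Hx : rel_prime p (zn x)) by (apply prime_rel_prime; auto; intros [u Hu]; apply Hc; exists (u * zn x - q)%Z; lia). rewrite (Gs_mod (c * a) (a * (zn x * zn x)) p (- q * a)) by lia. rewrite Gs_scale_sq by auto. ring.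
 - split; [auto|]. assert (Hsum : (Csum (fun r => En p (a * (zn r * zn r))) (seq 1 m) + Csum (fun r => En p (c * a * (zn r * zn r))) (seq 1 m) + 1)%C = 0).
  { rewrite <- (Csum_En_zero p a Hp0 Ha). rewrite <- (Csum_mod (half m) (fun x => if fst x then (zn (snd x) * zn (snd x))%Z else (c * (zn (snd x) * zn (snd x)))%Z) p (fun k => En p (a * k))); auto.
   - rewrite Csum_half. cbn [fst snd]. rewrite (Csum_ext_in (fun r => En p (a * (c * (zn r * zn r)))) (fun r => En p (c * a * (zn r * zn r)))) by (intros; f_equal; ring).
    replace (a * (zn 0 * zn 0))%Z with (0 * p)%Z by lia. rewrite En_mul by auto. ring.
   - apply half_NoDup.
   - rewrite half_length. lia.
   - assert (Hsq : forall r s : nat, (r <= m)%nat -> (s <= m)%nat -> (p | zn r * zn r - zn s * zn s) -> r = s).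
    { intros r s Hr Hs Hd. replace (zn r * zn r - zn s * zn s)%Z with ((zn r - zn s) * (zn r + zn s))%Z in Hd by ring. apply prime_mult in Hd; auto. destruct Hd as [[q Hq]|[q Hq]]; assert (q = 0)%Z; nia. }
    assert (Hcr : forall r s : nat, (s <= m)%nat -> (1 <= s)%nat -> ~ (p | zn r * zn r - c * (zn s * zn s))).
    (* If r^2 = c s^2 modulo p, then x = r / s is a square root of c, against the failed search for
       one. *)
    { intros r s Hs1 Hs2 [q Hq]. assert (Hrs : rel_prime p (zn s)) by (apply prime_rel_prime; auto; intros Hd; apply small_div in Hd; lia). destruct (rel_prime_bezout _ _ Hrs) as [].
     assert (HE : existsb (fun x : nat => (zn x * zn x - c) mod p =? 0) (seq 0 (Z.to_nat p)) = true); [|eauto]. set (x := zn r * v mod p). have Z.mod_pos_bound (zn r * v) p Hp0. apply existsb_exists. exists (Z.to_nat x).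
     split; [apply in_seq; lia|]. rewrite Z2Nat.id by lia. apply Z.eqb_eq, Z.mod_divide; [lia|]. have Z.div_mod (zn r * v) p ltac:(lia). set (k := (zn r * v / p)%Z). assert (Hx : x = (zn r * v - p * k)%Z) by lia.
     exists (q * v * v + c * (u * u * p - 2 * u) - 2 * zn r * v * k + p * k * k)%Z. assert (Hv : (v * zn s = 1 - u * p)%Z) by lia. assert (Hr2 : (zn r * zn r = q * p + c * zn s * zn s)%Z) by lia. rewrite Hx.
     transitivity (zn r * zn r * v * v - c - 2 * zn r * v * k * p + p * k * k * p)%Z; [ring|]. rewrite Hr2. transitivity (q * p * v * v + c * (v * zn s) * (v * zn s) - c - 2 * zn r * v * k * p + p * k * k * p)%Z; [ring|]. rewrite Hv. ring. }
    intros [b r] [b' s] Hx Hy Hd. apply half_in in Hx, Hy. cbn in *. destruct Hx as [Hx1 Hx2], Hy as [Hy1 Hy2]. destruct b, b'.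
    + auto.
    + exfalso. now apply (Hcr r s Hy1 (Hy2 eq_refl)).
    + exfalso. apply (Hcr s r Hx1 (Hx2 eq_refl)). destruct Hd as [q Hq]. exists (- q)%Z. lia.
    + f_equal. apply Hsq; auto. replace (c * (zn r * zn r) - c * (zn s * zn s))%Z with (c * (zn r * zn r - zn s * zn s))%Z in Hd by ring. apply prime_mult in Hd; auto. tauto.
   - intros k j. apply (En_mod p _ _ (a * j)); auto. ring. } rewrite !(Gs_half _ p m Hm). set (A := Csum (fun r => En p (a * (zn r * zn r))) (seq 1 m)) in *.
  set (B := Csum (fun r => En p (c * a * (zn r * zn r))) (seq 1 m)) in *. replace B with (A + B + 1 - A - 1)%C by ring. rewrite Hsum. ring.
Qed.
Lemma Csum_list_prod {A B} (f : A * B -> C) l m : Csum f (list_prod l m) = Csum (fun a => Csum (fun b => f (a, b)) m) l.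
 induction l as [|a l IH]; [auto|]. cbn [list_prod]. rewrite Csum_app, Csum_map, IH. auto. Qed.
Lemma NoDup_list_prod {A B} (l : list A) (m : list B) : NoDup l -> NoDup m -> NoDup (list_prod l m).
 intros Hl Hm. induction Hl as [|a l Hn Hl IH]; [constructor|]. apply NoDup_app; auto; [apply NoDup_map_on; auto; congruence|intros [x y] H1 H2; apply in_map_iff in H1; destruct H1 as [b [E _]]; injection E as <- <-; apply in_prod_iff in H2; tauto].
Qed.
Lemma Gs_crt x p m : (0 < p)%Z -> (0 < m)%Z -> rel_prime p m -> Gs x (p * m) = (Gs (x * m) p * Gs (x * p) m)%C.
 intros Hp Hm Hpm. assert (Hn : (0 < p * m)%Z) by lia. unfold Gs. rewrite <- (Csum_mod (list_prod (seq 0 (Z.to_nat p)) (seq 0 (Z.to_nat m))) (fun u => zn (fst u) * m + zn (snd u) * p)%Z (p * m) (fun k => En (p * m) (x * (k * k)))); auto.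
 - rewrite Csum_list_prod, Cmult_comm, <- Csum_scal. apply Csum_ext_in. intros r _. rewrite Cmult_comm, <- Csum_scal. apply Csum_ext_in. intros s _. cbn.
  have IZR_pos p Hp. have IZR_pos m Hm. unfold En. rewrite <- ee_plus, <- (ee_shift (_ + _) (2 * x * zn r * zn s)). f_equal. rewrite <- !RtoC_plus. f_equal. repeat rewrite ?mult_IZR, ?plus_IZR. field. lra.
 - apply NoDup_list_prod; apply seq_NoDup.
 - rewrite length_prod, !length_seq. lia.
 - intros [r s] [r' s'] H1 H2 Hd. apply in_prod_iff in H1, H2. rewrite !in_seq in H1, H2. cbn in *. destruct Hd as [q Hq]. assert (Hd1 : (p | m * (zn r - zn r'))) by (exists (q * m - (zn s - zn s'))%Z; lia).
  assert (Hd2 : (m | p * (zn s - zn s'))) by (exists (q * p - (zn r - zn r'))%Z; lia). apply Gauss in Hd1; auto.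
  apply Gauss in Hd2; [|now apply rel_prime_sym]. destruct Hd1 as [u Hu], Hd2 as [v Hv]. assert (u = 0)%Z by nia. assert (v = 0)%Z by nia. f_equal; nia.
 - intros k j. now apply En_sq_per.
Qed.
(** With k = p s + u + p m t, the sum over t is a complete character sum modulo p and kills every u
    <> 0. *)
Lemma Gs_psq x p m : prime p -> Z.odd p = true -> (0 < m)%Z -> ~ (p | x)%Z -> Gs x (p * (p * m)) = (IZR p * Gs x m)%C.
 intros Hp Ho Hm Hx. assert (Hp0 : (1 < p)%Z) by (destruct Hp; lia). assert (Hn : (0 < p * (p * m))%Z) by nia. unfold Gs. have IZR_pos p ltac:(lia) as Hp'. have IZR_pos m Hm as Hm'.
 rewrite <- (Csum_mod (list_prod (list_prod (seq 0 (Z.to_nat m)) (seq 0 (Z.to_nat p))) (seq 0 (Z.to_nat p))) (fun u => p * zn (fst (fst u)) + zn (snd (fst u)) + p * m * zn (snd u))%Z (p * (p * m)) (fun k => En (p * (p * m)) (x * (k * k)))); auto.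
 - rewrite !Csum_list_prod, <- Csum_scal. apply Csum_ext_in. intros s _. cbn.
  assert (Hin : forall u : nat, (u < Z.to_nat p)%nat -> Csum (fun t => En (p * (p * m)) (x * ((p * zn s + zn u + p * m * zn t) * (p * zn s + zn u + p * m * zn t)))) (seq 0 (Z.to_nat p))
    = (if Nat.eqb u 0 then IZR p * En m (x * (zn s * zn s)) else 0)%C).
  { intros u Hu. transitivity (En (p * p * m) (x * (p * zn s + zn u) * (p * zn s + zn u)) * Csum (fun t => En p (2 * x * zn u * zn t)) (seq 0 (Z.to_nat p)))%C.
   - rewrite <- Csum_scal. apply Csum_ext_in. intros t _. unfold En. rewrite <- ee_plus, <- (ee_shift (_ + _) (2 * x * zn s * zn t + x * m * zn t * zn t)). f_equal. rewrite <- !RtoC_plus. f_equal. repeat rewrite ?mult_IZR, ?plus_IZR. field. lra.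
   - destruct (Nat.eqb_spec u 0) as [->|].
    + rewrite (Csum_ext_in _ (fun _ => 1)), Csum_const, length_seq.
     * rewrite INR_IZR_INZ, Z2Nat.id, Cmult_1_r, Cmult_comm by lia. f_equal. unfold En. do 2 f_equal. repeat rewrite ?mult_IZR, ?plus_IZR. field; lra.
     * intros t _. replace (2 * x * zn 0 * zn t)%Z with (0 * p)%Z by lia. apply En_mul. lia.
    + rewrite Csum_En_zero; [ring|lia|]. intros Hd. apply prime_mult in Hd; auto.
     destruct Hd as [Hd|Hd]; [apply prime_mult in Hd; auto; destruct Hd as [Hd|]; [|tauto]; apply Z.odd_spec in Ho; destruct Ho as []; apply Z.divide_pos_le in Hd; [|lia]; lia|apply small_div in Hd; lia]. }
  rewrite (Csum_ext_in _ (fun u => if Nat.eqb u 0 then IZR p * En m (x * (zn s * zn s)) else 0)%C) by (intros u Hu; apply in_seq in Hu; apply Hin; lia). replace (Z.to_nat p) with (S (Z.to_nat p - 1)) by lia. rewrite Csum_seq_S. simpl (Nat.eqb 0 0).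
  rewrite (Csum_ext_in _ (fun _ => 0)), Csum_zero by reflexivity. ring.
 - repeat apply NoDup_list_prod; apply seq_NoDup.
 - rewrite !length_prod, !length_seq. nia.
 - intros [[s u] t] [[s' u'] t'] H1 H2 Hd. rewrite !in_prod_iff, !in_seq in H1, H2. cbn in *. destruct Hd as [q Hq].
  assert (u = u') by (assert (Hd : (p | zn u - zn u')) by (exists (q * p * m - (zn s - zn s') - m * (zn t - zn t'))%Z; lia); destruct Hd as [k Hk]; assert (k = 0)%Z by nia; lia).
  subst u'. assert (Hq2 : (zn s - zn s' + m * (zn t - zn t') = q * p * m)%Z) by nia. assert (Hs : s = s').
  { assert (Hd : (m | zn s - zn s')) by (exists (q * p - (zn t - zn t'))%Z; lia). destruct Hd as [k Hk]. assert (k = 0)%Z by nia. lia. } subst s'. assert (Hq3 : (zn t - zn t' = q * p)%Z) by nia. assert (q = 0)%Z by nia. f_equal. lia.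
 - intros k j. now apply En_sq_per.
Qed.
Definition is_spf (p n : Z) : Prop := (1 < p)%Z /\ (p | n)%Z /\ forall q, (1 < q < p)%Z -> ~ (q | n)%Z.
Lemma spf_aux_spec fuel d n : (1 < d)%Z -> (forall q, (1 < q < d)%Z -> ~ (q | n)%Z) -> (1 < n)%Z -> (n < d + zn fuel)%Z \/ (d <= n < d + zn fuel)%Z -> (d <= n)%Z -> is_spf (spf_aux fuel d n) n.
 revert d. induction fuel as [|f IH]; intros d Hd Hq Hn Hf Hdn; cbn; [lia|]. destruct (Z.eqb_spec (n mod d) 0) as [|E]; [split; [auto|]; split; auto; apply Z.mod_divide; lia|].
 assert (Hnd : ~ (d | n)) by (intros Hd'; apply E, Z.mod_divide; auto; lia). assert (d <> n) by (intros ->; apply Hnd; reflexivity). apply IH; try lia. intros q Hqq. destruct (Z.eq_dec q d) as [->|]; auto. apply Hq. lia.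
Qed.
Lemma spf_spec n : (1 < n)%Z -> is_spf (spf n) n.
 intros Hn. apply spf_aux_spec; lia. Qed.
Lemma is_spf_unique p q n : is_spf p n -> is_spf q n -> p = q.
 intros [A1 [A2 A3]] [B1 [B2 B3]]. destruct (Z.lt_total p q) as [|[|]]; auto; exfalso; [apply (B3 p)|apply (A3 q)]; auto. Qed.
Lemma is_spf_prime p n : is_spf p n -> prime p.
 intros [A1 [A2 A3]]. apply prime_alt. split; auto. intros q Hq Hd. apply (A3 q Hq). now apply Z.divide_trans with p. Qed.
Lemma jacobi_aux_fuel f g a n : (Z.to_nat n <= f)%nat -> (Z.to_nat n <= g)%nat -> jacobi_aux f a n = jacobi_aux g a n.
 revert g n. induction f as [|f IH]; intros g n Hf Hg.
 - destruct g; auto. cbn. destruct (Z.leb_spec n 1); auto. lia.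
 - cbn. destruct (Z.leb_spec n 1).
  + destruct g; auto. cbn. destruct (Z.leb_spec n 1); auto. lia.
  + destruct g; [lia|]. cbn. destruct (Z.leb_spec n 1); [lia|]. f_equal. destruct (spf_spec n ltac:(lia)) as []. assert (n / spf n < n)%Z by (apply Z.div_lt; lia). apply IH; lia.
Qed.
Lemma jacobi_step a n : (1 < n)%Z -> jacobi a n = (legendre a (spf n) * jacobi a (n / spf n))%Z.
 intros Hn. unfold jacobi. replace (Z.to_nat n) with (S (Z.to_nat n - 1)) by lia. cbn. destruct (Z.leb_spec n 1); [lia|]. f_equal. destruct (spf_spec n ltac:(lia)) as []. assert (n / spf n < n)%Z by (apply Z.div_lt; lia). apply jacobi_aux_fuel; lia.
Qed.
(** Follows the recursion of [jacobi] along the smallest prime factor p. If p^2 divides n, the two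
    Legendre symbols cancel and a factor p^2 is split off the modulus; otherwise the Gauss sum
    factors by the Chinese remainder theorem. *)
Theorem jacobi_gauss n c a : (0 < n)%Z -> Z.odd n = true -> rel_prime n c -> rel_prime n a ->
 (jacobi c n = 1 \/ jacobi c n = -1)%Z /\ Gs (c * a) n = (IZR (jacobi c n) * Gs a n)%C.
 cut (forall N n, (0 < n)%Z -> (n <= zn N)%Z -> forall c a, Z.odd n = true -> rel_prime n c -> rel_prime n a -> (jacobi c n = 1 \/ jacobi c n = -1)%Z /\ Gs (c * a) n = (IZR (jacobi c n) * Gs a n)%C).
 { intros HH Hn. apply (HH (Z.to_nat n)); auto. lia. } clear n c a. induction N as [|N IH]; intros n Hn HnN c a Ho Hc Ha; [lia|]. destruct (Z.eq_dec n 1) as [->|].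
 - split; [auto|]. rewrite Cmult_1_l. apply (Gs_mod _ _ 1 (c * a - a)); lia.
 - rewrite jacobi_step by lia. have spf_spec n ltac:(lia) as Hs. set (p := spf n) in *. have is_spf_prime _ _ Hs as Hp.
  destruct Hs as [A1 [[m Hm] A3]]. assert (Hnm : (n / p = m)%Z) by (rewrite Hm; apply Z.div_mul; lia). rewrite Hnm. assert (Hm0 : (0 < m < n)%Z) by nia.
  assert (Hodd : Z.odd p = true /\ Z.odd m = true) by (rewrite Hm, Z.odd_mul in Ho; apply andb_prop in Ho; tauto). destruct Hodd as [Hop Hom].
  assert (Hdiv : forall x, rel_prime n x -> rel_prime p x /\ rel_prime m x) by (split; [apply (rel_prime_div n x p); [auto|exists m; lia]|apply (rel_prime_div n x m); [auto|exists p; lia]]).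
  destruct (Hdiv c Hc) as [Hc1 Hc2]. destruct (Hdiv a Ha) as [Ha1 Ha2]. assert (Hnd : forall x, rel_prime p x -> ~ (p | x)).
  { intros x Hx Hd. destruct Hx as [_ _ Hx]. specialize (Hx p (Z.divide_refl p) Hd). apply Z.divide_1_r_nonneg in Hx; lia. } destruct (Zdivide_dec p m) as [Hpm|].
  + destruct Hpm as [m' Hm']. assert (Hm'0 : (0 < m' < n)%Z) by nia.
   assert (Hspm : spf m = p) by (apply (is_spf_unique _ _ m); [apply spf_spec; nia|]; split; auto; split; [exists m'; lia|]; intros q Hq Hd; apply (A3 q Hq); rewrite Hm; now apply Z.divide_mul_l).
   rewrite jacobi_step, Hspm by nia. replace (m / p)%Z with m' by (rewrite Hm', Z.div_mul; lia). destruct (legendre_gauss p c a Hp Hop (Hnd c Hc1) (Hnd a Ha1)) as [HL _].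
   assert (Hrp : forall x, rel_prime m x -> rel_prime m' x) by (intros x Hx; apply (rel_prime_div m x m'); [auto|exists p; lia]). assert (Hom' : Z.odd m' = true) by (rewrite Hm', Z.odd_mul in Hom; apply andb_prop in Hom; tauto).
   destruct (IH m' ltac:(lia) ltac:(lia) c a Hom' (Hrp c Hc2) (Hrp a Ha2)) as [HJ HG]. replace (legendre c p * (legendre c p * jacobi c m'))%Z with (jacobi c m') by lia. split; auto. rewrite Hm, Hm'.
   replace (m' * p * p)%Z with (p * (p * m'))%Z by ring. rewrite !Gs_psq; auto; try lia; [rewrite HG; ring|intros Hd; apply prime_mult in Hd; auto; destruct Hd as [|]; [now apply (Hnd c Hc1)|now apply (Hnd a Ha1)]].
  + assert (Hrel : rel_prime p m) by now apply prime_rel_prime. assert (Hcop : forall x y z, rel_prime x y -> rel_prime x z -> rel_prime x (y * z)) by (intros; now apply rel_prime_mult).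
   destruct (legendre_gauss p c (a * m) Hp Hop (Hnd c Hc1) (Hnd _ (Hcop _ _ _ Ha1 Hrel))) as [HL HG1]. destruct (IH m ltac:(lia) ltac:(lia) c (a * p)%Z Hom Hc2 (Hcop _ _ _ Ha2 (rel_prime_sym _ _ Hrel))) as [HJ HG2]. split; [lia|].
   replace n with (p * m)%Z by lia. rewrite !Gs_crt by (auto; lia). replace (c * a * m)%Z with (c * (a * m))%Z by ring. replace (c * a * p)%Z with (c * (a * p))%Z by ring. rewrite HG1, HG2, mult_IZR, RtoC_mult. ring.
Qed.

(** * Theta near rational points *)

Definition lim0 (f : R -> C) (l : C) : Prop := filterlim f (at_right 0) (@locally (AbsRing_UniformSpace C_AbsRing) l).
Lemma lim0_unique f l l' : lim0 f l -> lim0 f l' -> l = l'.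
 apply (filterlim_locally_unique (V := AbsRing_NormedModule C_AbsRing) (F := at_right 0)). Qed.
Lemma lim0_bound f l (B : R -> R) C : 0 <= C -> (forall s, 0 < s < 1 -> Cmod (f s - l)%C <= C * B s) ->
 (forall eps, 0 < eps -> exists d, 0 < d /\ forall s, 0 < s < d -> B s < eps) -> lim0 f l.
 intros HC H HB. apply (filterlim_locally (U := AbsRing_UniformSpace C_AbsRing) (F := at_right 0)). intros [eps He]. destruct (HB (eps / (C + 1))) as [d [Hd HBd]]; [pos|]. exists (mkposreal (Rmin d 1) (Rmin_pos _ _ Hd Rlt_0_1)). intros s Hs0 Hs1. change (Rabs (s - 0) < Rmin d 1) in Hs0. rewrite Rminus_0_r, Rabs_pos_eq in Hs0 by lra. change (Cmod (f s - l) < eps).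
 have Rmin_l d 1. have Rmin_r d 1. specialize (H s ltac:(lra)). specialize (HBd s ltac:(lra)). apply (Rmult_lt_compat_r (C + 1)) in HBd; [|lra]. unfold Rdiv in HBd. rewrite Rmult_assoc, Rinv_l in HBd by lra. nra.
Qed.
Lemma lim0_mult f g l m : lim0 f l -> lim0 g m -> lim0 (fun s => f s * g s)%C (l * m)%C.
 intros Hf Hg. exact (filterlim_comp_2 _ _ _ Hf Hg (filterlim_mult (K := C_AbsRing) l m)). Qed.
Lemma lim0_const c : lim0 (fun _ => c) c.
 apply (filterlim_const (U := AbsRing_UniformSpace C_AbsRing)). Qed.
Lemma lim0_ext f g l : (forall s, 0 < s -> f s = g s) -> lim0 f l -> lim0 g l.
 intros E. apply (filterlim_ext_loc (G := @locally (AbsRing_UniformSpace C_AbsRing) l)). exists (mkposreal 1 Rlt_0_1). auto. Qed.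
Lemma dual_near t x : 0 < t -> Cmod (dualF t 0 x - 1)%C <= 12 * t.
 intros Ht. have PI2_3_2. assert (HS : Sums (fun k : Z => if Z.eq_dec k 0 then 0 else (exp (- (PI / t) * (IZR k - 0) ^ 2) * ee (RtoC (x * IZR k)))%C) (dualF t 0 x - 1)).
 { eapply Sums_ext; [|apply Sums_minus; [apply (dualF_spec t 0 x Ht)|eapply Sums_eq; [apply (Sums_single 0%Z (fun k : Z => if Z.eq_dec k 0 then 1 else 0))|auto]]]; [|intros k Hk; destruct (Z.eq_dec k 0); tauto].
  intros k. cbv beta. destruct (Z.eq_dec k 0) as [->|]; [|ring]. rewrite Rmult_0_r, ee_0. replace (- (PI / t) * (0 - 0) ^ 2) with 0 by ring. rewrite exp_0. ring. }
 eapply Rle_trans; [eapply Sums_bound; [eauto|]|auto]. replace (12 * t) with (2 * t * 6) by ring. eapply bnd_le; [|apply bnd_scal; [lra|apply bnd_inv_sq_Z]].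
 intros k. destruct (Z.eq_dec k 0) as [->|Hk]; [rewrite Cmod_0; lra|]. rewrite Cmod_mult, Cmod_R, Cmod_ee_R, Rmult_1_r, Rabs_pos_eq, Rminus_0_r by auto.
 have IZR_ge1 k Hk. replace (- (PI / t) * IZR k ^ 2) with (- (PI / t * IZR k ^ 2)) by ring. rewrite exp_Ropp. have exp_ge_1x (PI / t * IZR k ^ 2).
 replace (2 * t * / (1 + IZR k ^ 2)) with (/ ((1 + IZR k ^ 2) / (2 * t))) by (field; lra). assert (Hi : (1 + IZR k ^ 2) / (2 * t) <= PI / t * IZR k ^ 2).
 { replace (PI / t * IZR k ^ 2) with (2 * PI * IZR k ^ 2 / (2 * t)) by (field; lra). mul_r; [pos|]. nra. } inv_le; [|lra]. pos.
Qed.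
Lemma Sums_residues (n : nat) (f : Z -> C) (S : nat -> C) : (0 < n)%nat ->
 (forall r, (r < n)%nat -> Sums (fun m : Z => f (zn n * m + zn r)%Z) (S r)) -> Sums f (Csum S (seq 0 n)).
 intros Hn H. set (fr := fun r a => if Z.eq_dec (a mod zn n) (zn r) then f a else 0). assert (Hr : forall r, (r < n)%nat -> Sums (fr r) (S r)).
 { intros r Hr. apply (Sums_inj (fun m => zn n * m + zn r)%Z).
  - nia.
  - intros i Hi. unfold fr. destruct (Z.eq_dec (i mod zn n) (zn r)) as [E|]; auto. exfalso. apply (Hi (i / zn n)%Z). rewrite <- E. symmetry. apply Z.div_mod. lia.
  - eapply Sums_ext; [|auto]. intros m. unfold fr. destruct Z.eq_dec as [|E]; auto. exfalso. apply E. rewrite Z.add_comm, Z.mul_comm, Z.mod_add by lia. apply Z.mod_small. lia. }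
 assert (HL : forall l, (forall r, In r l -> (r < n)%nat) -> Sums (fun a => Csum (fun r => fr r a) l) (Csum S l)) by (induction l as [|r l IH]; intros Hl; [auto|]; apply Sums_plus; [apply Hr, Hl; now left|apply IH; intros; apply Hl; now right]).
 eapply Sums_ext; [|apply HL; intros r Hr'; apply in_seq in Hr'; lia]. intros a. set (r0 := Z.to_nat (a mod zn n)). have Z.mod_pos_bound a (zn n) ltac:(lia). replace (seq 0 n) with (seq 0 r0 ++ r0 :: seq (Datatypes.S r0) (n - r0 - 1)).
 - rewrite Csum_app, Csum_cons, !(Csum_ext_in (fun r => fr r a) (fun _ => 0)), !Csum_zero.
  + unfold fr. destruct (Z.eq_dec (a mod zn n) (zn r0)) as [|]; [ring|lia].
  + intros r Hr'. apply in_seq in Hr'. unfold fr. destruct (Z.eq_dec (a mod zn n) (zn r)); auto. lia.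
  + intros r Hr'. apply in_seq in Hr'. unfold fr. destruct (Z.eq_dec (a mod zn n) (zn r)); auto. lia.
 - change (r0 :: seq (Datatypes.S r0) (n - r0 - 1)) with (seq r0 (Datatypes.S (n - r0 - 1))). rewrite <- seq_app. f_equal. lia.
Qed.
Definition Gr (b d : Z) : C := Csum (fun r : nat => ee (RtoC (IZR b * INR r ^ 2 / IZR d))) (seq 0 (Z.abs_nat d)).
Definition rpt (b d : Z) (s : R) : C := (RtoC (IZR b / IZR d) + RtoC s * Ci)%C.
Lemma rpt_Im b d s : Im (rpt b d s) = s.
 simpl; lra. Qed.
(** In each class modulo d the rational phase is constant, and Poisson summation leaves dual series
    that tend to 1 as s -> 0. *)
Lemma theta_rat b d s : d <> 0%Z -> 0 < s ->
 (RtoC (IZR (Z.abs d) * sqrt (2 * s)) * theta (rpt b d s))%C = Csum (fun r : nat => ee (RtoC (IZR b * INR r ^ 2 / IZR d)) * dualF (2 * s * IZR (Z.abs d) ^ 2) 0 (INR r / IZR (Z.abs d)))%C (seq 0 (Z.abs_nat d)).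
 intros Hd Hs. set (n := IZR (Z.abs d)). assert (Hn : 0 < n) by (unfold n; apply IZR_lt; lia). set (t := 2 * s * n ^ 2).
 assert (Hd0 : IZR d <> 0) by (intros E; apply Hd, eq_IZR, E). assert (Ht : 0 < t) by (unfold t; apply Rmult_lt_0_compat; [lra|pos]). assert (Hz : inH (rpt b d s)) by (unfold inH; rewrite rpt_Im; exact Hs).
 assert (HS : Sums (fun a : Z => ee (RtoC (IZR a ^ 2) * rpt b d s)) (Csum (fun r : nat => ee (RtoC (IZR b * INR r ^ 2 / IZR d)) * gaussF t 0 (INR r / n))%C (seq 0 (Z.abs_nat d)))).
 { apply Sums_residues; [lia|]. intros r Hr. eapply Sums_ext; [|apply Sums_scal, (gaussF_spec t 0 (INR r / n) Ht)]. intros m. unfold gauss. rewrite Rmult_0_r, ee_0, Cmult_1_r. set (a := (zn (Z.abs_nat d) * m + zn r)%Z).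
  assert (Ea : IZR a = n * IZR m + INR r) by (unfold a; rewrite plus_IZR, mult_IZR, Zabs2Nat.id_abs, <- INR_IZR_INZ; reflexivity). replace (RtoC (IZR a ^ 2) * rpt b d s)%C with (RtoC (IZR a ^ 2 * IZR b / IZR d) + Ci * RtoC (IZR a ^ 2 * s))%C.
  - rewrite ee_plus, ee_imag. f_equal; [|do 2 f_equal; rewrite Ea; unfold t; field; lra]. destruct (Z.abs_eq_or_opp d) as [Ed|Ed].
   * rewrite <- (ee_shift (RtoC (IZR b * INR r ^ 2 / IZR d)) (b * (d * m * m + 2 * m * zn r))), <- RtoC_plus. do 2 f_equal. rewrite Ea. unfold n. rewrite Ed. repeat rewrite ?mult_IZR, ?plus_IZR. rewrite <- INR_IZR_INZ. field; lra.
   * rewrite <- (ee_shift (RtoC (IZR b * INR r ^ 2 / IZR d)) (b * (d * m * m - 2 * m * zn r))), <- RtoC_plus. do 2 f_equal. rewrite Ea. unfold n. rewrite Ed, opp_IZR. repeat rewrite ?mult_IZR, ?minus_IZR. rewrite <- INR_IZR_INZ. field; lra.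
  - replace (IZR a ^ 2 * IZR b / IZR d) with (IZR a ^ 2 * (IZR b / IZR d)) by lra. cring. } rewrite (Sums_unique _ _ _ (theta_spec _ Hz) HS), <- Csum_scal. apply Csum_ext_in. intros r _. rewrite poisson_gauss by auto.
 replace (sqrt t) with (n * sqrt (2 * s)).
 - assert (Hq : RtoC (n * sqrt (2 * s)) <> 0) by (intros E; apply RtoC_inj in E; have sqrt_lt_R0 (2 * s) ltac:(lra); nra). rewrite RtoC_inv by (intros E; apply Hq; now rewrite E). field. auto.
 - unfold t. rewrite (sqrt_mult (2 * s) (n ^ 2)) by pos. rewrite sqrt_pow2 by lra. ring.
Qed.
Lemma theta_rat_lim b d : d <> 0%Z -> lim0 (fun s => RtoC (IZR (Z.abs d) * sqrt (2 * s)) * theta (rpt b d s))%C (Gr b d).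
 intros Hd. set (n := IZR (Z.abs d)). assert (Hn : 0 < n) by (unfold n; apply IZR_lt; lia). apply (lim0_bound _ _ (fun s => s) (INR (Z.abs_nat d) * (12 * (2 * n ^ 2)))).
 - pos.
 - intros s Hs. unfold n. rewrite theta_rat by pos. fold n. unfold Gr. replace (Csum _ _ - Csum _ _)%C with (Csum (fun r : nat => ee (RtoC (IZR b * INR r ^ 2 / IZR d)) * (dualF (2 * s * n ^ 2) 0 (INR r / n) - 1))%C (seq 0 (Z.abs_nat d))).
  + le_via Cmod_Csum.
   assert (HR : forall l : list nat, Rsum (fun r => Cmod (ee (RtoC (IZR b * INR r ^ 2 / IZR d)) * (dualF (2 * s * n ^ 2) 0 (INR r / n) - 1))) l <= INR (length l) * (12 * (2 * n ^ 2)) * s) by (induction l as [|r l IH]; [simpl; lra|]; rewrite Rsum_cons; cbn [length]; rewrite S_INR, Cmod_mult, Cmod_ee_R; have dual_near (2 * s * n ^ 2) (INR r / n) ltac:(pos); lra).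
   specialize (HR (seq 0 (Z.abs_nat d))). rewrite length_seq in HR. auto.
  + unfold Cminus. replace (- Csum _ _)%C with (-1 * Csum (fun r : nat => ee (RtoC (IZR b * INR r ^ 2 / IZR d))) (seq 0 (Z.abs_nat d)))%C by ring. rewrite <- Csum_scal, <- Csum_plus. apply Csum_ext_in. intros; ring.
 - intros eps He. exists eps. easy.
Qed.
(** The preimage of b / d + i s under (a b; c d), as determined by c and d alone. *)
Definition crv (c d : Z) (s : R) : C := (RtoC (s * IZR d ^ 2) * Ci / (1 - RtoC (IZR c * IZR d * s) * Ci))%C.
Definition cD (c d : Z) (s : R) : R := 1 + (IZR c * IZR d * s) ^ 2.
Lemma cD_ge1 c d s : 1 <= cD c d s.
 unfold cD. nra. Qed.
Lemma crv_den x : (1 - RtoC x * Ci)%C <> 0.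
 intros E. apply (f_equal Re) in E. simpl in E. lra. Qed.
Lemma crv_eq c d s : crv c d s = (- (IZR c * IZR d * s) * (s * IZR d ^ 2) / cD c d s, s * IZR d ^ 2 / cD c d s).
 have cD_ge1 c d s. have crv_den. set (w := (- (IZR c * IZR d * s) * (s * IZR d ^ 2) / cD c d s, s * IZR d ^ 2 / cD c d s)).
 transitivity (w * (1 - RtoC (IZR c * IZR d * s) * Ci) / (1 - RtoC (IZR c * IZR d * s) * Ci))%C; [|field; auto]. unfold crv. f_equal. unfold w, Cmult, Cminus, Cplus, Copp, RtoC, Ci. cbn. unfold cD in *. f_equal; field; lra.
Qed.
Lemma crv_mob a b c d s : (a * d - b * c = 1)%Z -> d <> 0%Z -> 0 < s -> mob a b c d (crv c d s) = rpt b d s /\ jfac c d (crv c d s) = (IZR d / (1 - RtoC (IZR c * IZR d * s) * Ci))%C /\ inH (crv c d s).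
 intros Hdet Hd Hs. have cD_ge1 c d s. have crv_den (IZR c * IZR d * s). assert (Hd0 : IZR d <> 0) by (intros E; apply Hd, eq_IZR, E).
 assert (HdC : RtoC (IZR d) <> 0) by cnz. apply (f_equal IZR) in Hdet. rewrite minus_IZR, !mult_IZR in Hdet. apply (f_equal RtoC) in Hdet.
 rewrite RtoC_minus in Hdet. assert (HJ : jfac c d (crv c d s) = (IZR d / (1 - RtoC (IZR c * IZR d * s) * Ci))%C).
 { unfold jfac, crv. rewrite !RtoC_mult in *. rewrite <- RtoC_pow || rewrite RtoC_pow. field; auto. } split; [|split; auto].
 - unfold mob, crv, rpt. rewrite RtoC_div by auto. rewrite !RtoC_mult in *. rewrite RtoC_pow. transitivity ((IZR b + (IZR a * IZR d - IZR b * IZR c) * s * IZR d * Ci) / IZR d)%C; [field; auto|]. rewrite Hdet. field. auto.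
 - rewrite crv_eq. apply Rdiv_lt_0_compat; [|lra]. apply Rmult_lt_0_compat; auto. nra.
Qed.
Lemma ee_real_lip (x : R) : Cmod (ee (RtoC x) - 1)%C <= 2 * PI * Rabs x.
 have wder_mvt (fun w => ee (1 * w)) 0 x (2 * PI). cbv beta in H. replace (1 * (0 + x))%C with (RtoC x) in H by ring.
 replace (1 * 0)%C with (RtoC 0) in H by ring. rewrite ee_0, Cmod_R in H. apply H. intros t _. exists (2 * PI * Ci * 1 * ee (1 * (0 + t * x)))%C, 0.
 split; [apply wder_ee_lin|]. replace (1 * (0 + t * x))%C with (RtoC (t * x)) by cring. rewrite !Cmod_mult, Cmod_Ci, Cmod_ee_R, !Cmod_R, !Rabs_pos_eq by pos. lra.
Qed.
Lemma theta_shift_bound u v : 0 < v -> Cmod (theta (u, v) - theta (0, v)%R)%C <= 36 * (Rabs u / v) * (1 + / (PI * v)).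
 intros Hv. assert (Huv : 0 <= Rabs u / v) by (apply Rmult_le_pos; [auto|pos]). eapply Sums_bound; [apply Sums_minus; apply theta_spec; assumption|].
 eapply bnd_weaken; [|eapply bnd_le; [|apply (bnd_scal (2 * (Rabs u / v))); [lra|apply (bnd_theta (v / 2)); lra]]]; [replace (2 * PI * (v / 2)) with (PI * v) by field; lra|]. intros a.
 assert (E : forall x, (RtoC (IZR a ^ 2) * (x, v) = RtoC (IZR a ^ 2 * x) + Ci * RtoC (IZR a ^ 2 * v))%C) by (intros; unfold Cmult, Cplus; simpl; f_equal; ring). rewrite !E, !ee_plus, ee_imag, Rmult_0_r, ee_0.
 replace (ee (RtoC (IZR a ^ 2 * u)) * exp (-2 * PI * (IZR a ^ 2 * v)) - 1 * exp (-2 * PI * (IZR a ^ 2 * v)))%C with ((ee (RtoC (IZR a ^ 2 * u)) - 1) * exp (-2 * PI * (IZR a ^ 2 * v)))%C by ring.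
 rewrite Cmod_mult, Cmod_R, Rabs_pos_eq by auto. have ee_real_lip (IZR a ^ 2 * u) as A1. rewrite Rabs_mult, Rabs_pos_eq in A1 by auto.
 set (x := PI * IZR a ^ 2 * v). replace (-2 * PI * (IZR a ^ 2 * v)) with (- x + - x) by (unfold x; ring). rewrite exp_plus. replace (-2 * PI * IZR a ^ 2 * (v / 2)) with (- x) by (unfold x; field). have exp_ge_1x x. have exp_pos (- x).
 assert (Ee : exp x * exp (- x) = 1) by (rewrite <- exp_plus; replace (x + - x) with 0 by ring; apply exp_0). assert (A2 : x * exp (- x) <= 1) by nra. apply Rle_trans with (2 * PI * (IZR a ^ 2 * Rabs u) * (exp (- x) * exp (- x))).
 { nra. } replace (2 * PI * (IZR a ^ 2 * Rabs u) * (exp (- x) * exp (- x))) with (2 * (Rabs u / v) * exp (- x) * (x * exp (- x))) by (unfold x; field; lra). rewrite <- (Rmult_1_r (2 * (Rabs u / v) * exp (- x))) at 2. mul_l; auto. pos.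
Qed.
Lemma theta_imag_bound v : 0 < v -> Cmod (RtoC (sqrt (2 * v)) * theta (0, v)%R - 1)%C <= 24 * v.
 intros Hv. have theta_rat 0 1 v ltac:(lia) Hv. simpl seq in H. rewrite Csum_cons in H. change (IZR (Z.abs 1)) with 1 in H. rewrite Rmult_1_l in H.
 replace (rpt 0 1 v) with ((0, v) : C) in H by (unfold rpt, Cplus; cbn; f_equal; field). rewrite H. replace (IZR 0 * INR 0 ^ 2 / IZR 1) with 0 by lra. rewrite ee_0.
 replace (1 * dualF (2 * v * 1 ^ 2) 0 (INR 0 / 1) + Csum (fun r : nat => ee (RtoC (IZR 0 * INR r ^ 2 / IZR 1)) * dualF (2 * v * 1 ^ 2) 0 (INR r / 1)) [] - 1)%C with (dualF (2 * v * 1 ^ 2) 0 (INR 0 / 1) - 1)%C by (simpl; ring).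
 eapply Rle_trans; [apply dual_near; lra|lra].
Qed.
Lemma sqrt_lim0 eps : 0 < eps -> exists d, 0 < d /\ forall s, 0 < s < d -> sqrt s < eps.
 exists (eps ^ 2). split; [pos|]. intros s Hs. rewrite <- sqrt_pow2 by lra. apply sqrt_lt_1; lra. Qed.
(** On the curve |Re| / Im = |c d| s, so projecting to the imaginary axis changes [theta] by a
    bounded amount, which the factor sqrt (2 Im) sends to 0. *)
Lemma theta_crv_lim c d : d <> 0%Z -> lim0 (fun s => RtoC (sqrt (2 * (s * IZR d ^ 2 / cD c d s))) * theta (crv c d s))%C 1.
 intros Hd. assert (Hd2 : 1 <= IZR d ^ 2) by now apply IZR_ge1. set (k := Rabs (IZR c * IZR d)). assert (Hk : 0 <= k) by apply Rabs_pos. have PI2_3_2.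
 apply (lim0_bound _ _ sqrt (sqrt (2 * IZR d ^ 2) * (36 * k * (2 + k ^ 2)) + 24 * IZR d ^ 2)); [|intros s Hs|exact sqrt_lim0].
 { pos. } have cD_ge1 c d s. set (D := cD c d s) in *. assert (HD : D <= 1 + k ^ 2) by (unfold D, cD, k; rewrite pow2_abs; assert (s ^ 2 <= 1) by nra; nra). rewrite crv_eq. fold D. set (v := s * IZR d ^ 2 / D).
 replace (- (IZR c * IZR d * s) * (s * IZR d ^ 2) / D) with (- (IZR c * IZR d * s) * v) by (unfold v; lra). set (u := - (IZR c * IZR d * s) * v).
 assert (Hv : 0 < v) by (unfold v; apply Rdiv_lt_0_compat; [pos|]; lra). assert (Hvs : v <= s * IZR d ^ 2).
 { unfold v. rewrite <- (Rmult_1_r (s * IZR d ^ 2)) at 2. mul_l; [pos|]. rewrite <- Rinv_1. inv_le; lra. }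
 assert (Hu : Rabs u / v = k * s) by (unfold u; rewrite Rabs_mult, Rabs_Ropp, (Rabs_pos_eq v), Rabs_mult, (Rabs_pos_eq s) by lra; fold k; field; lra).
 replace (sqrt (2 * v) * theta (u, v) - 1)%C with (sqrt (2 * v) * (theta (u, v) - theta (0, v)) + (sqrt (2 * v) * theta (0, v) - 1))%C by ring. le_via Cmod_triangle. have theta_imag_bound v Hv. have theta_shift_bound u v Hv as B1. rewrite Hu in B1.
 assert (Hss : s <= sqrt s) by (rewrite <- sqrt_sqrt at 1 by lra; have sqrt_pos s; assert (sqrt s <= 1) by (rewrite <- sqrt_1; apply sqrt_le_1; lra); nra).
 rewrite Rmult_plus_distr_r. apply Rplus_le_compat; [|nra]. rewrite Cmod_mult, Cmod_R, Rabs_pos_eq by apply sqrt_pos. assert (Hsv : sqrt (2 * v) <= sqrt (2 * IZR d ^ 2) * sqrt s) by (rewrite <- sqrt_mult by lra; apply sqrt_le_1; lra).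
 assert (B3 : Cmod (theta (u, v) - theta (0, v)) <= 36 * k * (2 + k ^ 2)).
 { eapply Rle_trans; [exact B1|]. replace (36 * (k * s) * (1 + / (PI * v))) with (36 * k * (s + s * / (PI * v))) by ring. mul_l; [lra|]. assert (s * / (PI * v) <= D).
  { unfold v. replace (s * / (PI * (s * IZR d ^ 2 / D))) with (D * / (PI * IZR d ^ 2)) by (field; lra || nra). rewrite <- (Rmult_1_r D) at 2. mul_l; [lra|]. rewrite <- Rinv_1. inv_le; nra. } lra. }
 replace (sqrt (2 * IZR d ^ 2) * (36 * k * (2 + k ^ 2)) * sqrt s) with (sqrt (2 * IZR d ^ 2) * sqrt s * (36 * k * (2 + k ^ 2))) by ring. mul_le; auto using Cmod_ge_0.
Qed.
Lemma csqrt_sq w : (csqrt w * csqrt w)%C = w.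
 have Cmod_sq w. assert (HR : - Cmod w <= Re w <= Cmod w) by (apply Rabs_le_between; have Rmax_Cmod w; have Rmax_l (Rabs (fst w)) (Rabs (snd w)); unfold Re; lra).
 set (A := (Cmod w + Re w) / 2). set (B := (Cmod w - Re w) / 2). assert (HA : 0 <= A) by (unfold A; lra). assert (HB : 0 <= B) by (unfold B; lra).
 assert (HAB : sqrt A * sqrt B = Rabs (Im w) / 2) by (rewrite <- sqrt_mult by auto; replace (A * B) with ((Rabs (Im w) / 2) ^ 2); [apply sqrt_pow2; have Rabs_pos (Im w); lra|]; unfold A, B, Rdiv; rewrite Rpow_mult_distr, pow2_abs; lra).
 have sqrt_sqrt A HA. have sqrt_sqrt B HB. assert (HRe : sqrt A * sqrt A - sqrt B * sqrt B = Re w) by (unfold A, B in *; lra). unfold csqrt. fold A B. destruct w as [x y]. unfold Cmult. cbn in *.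
 destruct Rlt_dec; [f_equal; [lra|]; rewrite Rabs_left in HAB by lra; lra|f_equal; [lra|]; rewrite Rabs_pos_eq in HAB by lra; lra].
Qed.
Lemma csqrt_Re w : 0 <= Re (csqrt w).
 now simpl. Qed.
Lemma csqrt_Im_neg w : Im w < 0 -> Im (csqrt w) <= 0.
 cbn. destruct Rlt_dec; [|tauto]. have sqrt_pos ((Cmod w - Re w) / 2). lra. Qed.
Lemma csqrt_Im_pos w : 0 <= Im w -> 0 <= Im (csqrt w).
 intros H. cbn. destruct Rlt_dec; [lra|]. pos. Qed.
Lemma re_le_Cmod (w : C) : Rabs (Re w) <= Cmod w.
 have Rmax_Cmod w. have Rmax_l (Rabs (fst w)) (Rabs (snd w)). unfold Re. lra. Qed.
Lemma csqrt_same_sign w w' : (0 < Im w /\ 0 < Im w') \/ (Im w < 0 /\ Im w' < 0) -> Cmod (csqrt w) <= Cmod (csqrt w' + csqrt w)%C.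
 intros H. have csqrt_Re w. have csqrt_Re w'. assert (HI : 0 <= Im (csqrt w) * Im (csqrt w')).
 { destruct H as [|[I1 I2]]; [have csqrt_Im_pos w ltac:(lra); have csqrt_Im_pos w' ltac:(lra)|have csqrt_Im_neg w I1; have csqrt_Im_neg w' I2]; nra. }
 apply Rnot_lt_le. intros L. have Cmod_ge_0 (csqrt w' + csqrt w). assert (L2 : Cmod (csqrt w' + csqrt w) ^ 2 < Cmod (csqrt w) ^ 2) by nra. rewrite !Cmod_sq, Re_plus, Im_plus in L2. nra.
Qed.
Lemma wder_csqrt w : Im w <> 0 -> wder csqrt w (/ (2 * csqrt w))%C 0.
 intros Hw eps He. set (q := csqrt w). have csqrt_sq w as Hq. fold q in Hq. assert (Hq0 : q <> 0) by (intros E; apply Hw; rewrite <- Hq, E; simpl; ring).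
 assert (Hqm : 0 < Cmod q) by now apply Cmod_gt_0. exists (Rmin (Rabs (Im w)) (2 * eps * Cmod q ^ 3)). assert (Hq3 : 0 < Cmod q ^ 3) by now apply pow_lt.
 split; [apply Rmin_pos; [now apply Rabs_pos_lt|nra]|]. intros h Hh. assert (H1 : Cmod h < Rabs (Im w)) by (eapply Rlt_le_trans; [eauto|apply Rmin_l]).
 assert (H2 : Cmod h < 2 * eps * Cmod q ^ 3) by (eapply Rlt_le_trans; [exact Hh|apply Rmin_r]). have im_le_Cmod h. assert (Hsgn : 0 < Im w /\ 0 < Im (w + h) \/ Im w < 0 /\ Im (w + h) < 0).
 { rewrite Im_plus. assert (H3 : Rabs (Im h) < Rabs (Im w)) by lra. apply Rabs_lt_between in H3. destruct (Rle_lt_dec 0 (Im w)); [rewrite Rabs_pos_eq in H3 by lra; lra|rewrite Rabs_left in H3 by lra; lra]. }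
 have csqrt_same_sign w (w + h) Hsgn as HS. fold q in HS. have csqrt_sq (w + h) as Hq'. set (q' := csqrt (w + h)) in *. assert (HS0 : (q' + q)%C <> 0) by (intros E; rewrite E, Cmod_0 in HS; lra).
 assert (E2 : h = ((q' - q) * (q' + q))%C) by (transitivity (q' * q' - q * q)%C; [rewrite Hq', Hq; ring|ring]).
 replace (q' - q - (/ (2 * q) * h + 0 * Cconj h))%C with (- (h * (h / (q' + q))) / (2 * q * (q' + q)))%C by (rewrite E2; field; auto). unfold Cdiv.
 rewrite Cmod_mult, Cmod_opp, !Cmod_mult, !Cmod_inv, !Cmod_mult, Cmod_R, Rabs_pos_eq by (auto; try lra; repeat apply Cmult_neq_0; auto; intros E; apply RtoC_inj in E; lra).
 set (S := Cmod (q' + q)) in *. assert (HiS : / S <= / Cmod q) by (inv_le; auto). apply Rle_trans with (Cmod h * (Cmod h * / Cmod q) * / (2 * Cmod q * Cmod q)).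
 - mul_le; [pos|pos|nra|]. inv_le; nra.
 - replace (Cmod h * (Cmod h * / Cmod q) * / (2 * Cmod q * Cmod q)) with (Cmod h * (Cmod h / (2 * Cmod q ^ 3))) by (field; lra). rewrite Rmult_comm.
  mul_r; auto. left. apply Rmult_lt_reg_r with (2 * Cmod q ^ 3); [lra|]. unfold Rdiv. rewrite Rmult_assoc, Rinv_l by lra. lra.
Qed.
(** The limit of the principal root of c z + d as it tends to d along [crv]. For d < 0 the sign of
    its imaginary part, which is that of c, decides between i and -i. *)
Definition Lc (c d : Z) : C := if Z.ltb 0 d then RtoC (sqrt (IZR d)) else (RtoC ((if Z.ltb c 0 then -1 else 1) * sqrt (- IZR d)) * Ci)%C.
Lemma csqrt_crv_lim a b c d : (a * d - b * c = 1)%Z -> d <> 0%Z -> c <> 0%Z -> lim0 (fun s => csqrt (jfac c d (crv c d s))) (Lc c d).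
 intros Hdet Hd Hc. apply (lim0_bound _ _ (fun s => s) (Rabs (IZR d) * Rabs (IZR c * IZR d))).
 - pos.
 - intros s Hs. destruct (crv_mob a b c d s Hdet Hd ltac:(lra)) as [_ [HJ _]]. have cD_ge1 c d s as HD. set (e := IZR c * IZR d * s) in *.
  set (J := jfac c d (crv c d s)) in *. have crv_den as Hn. assert (EJ : J = (IZR d / cD c d s, IZR d * e / cD c d s)).
  { unfold J, jfac. unfold cD in *. unfold Cplus, Cmult, RtoC. cbn. f_equal; unfold e; field; lra. } assert (HJd : Cmod (J - IZR d) <= Rabs (IZR d) * Rabs (IZR c * IZR d) * s).
  { rewrite HJ. replace (IZR d / (1 - e * Ci) - IZR d)%C with (IZR d * e * Ci * / (1 - e * Ci))%C by (field; auto).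
   rewrite !Cmod_mult, Cmod_inv, Cmod_Ci, !Cmod_R by auto. unfold e at 1. rewrite Rabs_mult, (Rabs_pos_eq s) by lra. assert (1 <= Cmod (1 - e * Ci)).
   { have re_le_Cmod (1 - e * Ci). replace (Re (1 - e * Ci)) with 1 in H by (simpl; lra). rewrite Rabs_R1 in H. auto. } assert (Hle1 : / Cmod (1 - e * Ci) <= 1) by (apply Rle_trans with (/ 1); [inv_le; lra|lra]).
   assert (Hge0 : 0 <= Rabs (IZR d) * Rabs (IZR c * IZR d) * s) by pos. nra. } assert (HL2 : (Lc c d * Lc c d)%C = IZR d).
  { unfold Lc. destruct (Z.ltb_spec 0 d); [rewrite <- RtoC_mult, sqrt_sqrt; auto; apply IZR_le; lia|]. assert (IZR d <= 0) by (apply IZR_le; lia). set (g := if c <? 0 then -1 else 1). assert (Hg : g * g = 1) by (unfold g; destruct (c <? 0); ring).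
   transitivity (RtoC (g * g * (sqrt (- IZR d) * sqrt (- IZR d))) * (Ci * Ci))%C; [cring|]. rewrite Hg, sqrt_sqrt by lra. cring. } assert (Hsum : 1 <= Cmod (csqrt J + Lc c d)).
  { unfold Lc. destruct (Z.ltb_spec 0 d) as [|].
   - assert (1 <= IZR d) by (apply IZR_le; lia). assert (1 <= sqrt (IZR d)) by (rewrite <- sqrt_1; apply sqrt_le_1; lra). have re_le_Cmod (csqrt J + sqrt (IZR d)) as HH. rewrite Re_plus in HH. have csqrt_Re J.
    change (Re (sqrt (IZR d))) with (sqrt (IZR d)) in HH. have Rle_abs (Re (csqrt J) + sqrt (IZR d)). lra.
   - assert (1 <= - IZR d) by (rewrite <- opp_IZR; apply IZR_le; lia). assert (1 <= sqrt (- IZR d)) by (rewrite <- sqrt_1; apply sqrt_le_1; lra).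
    set (g := if c <? 0 then -1 else 1). have im_le_Cmod (csqrt J + RtoC (g * sqrt (- IZR d)) * Ci) as HH. rewrite Im_plus in HH. replace (Im (RtoC (g * sqrt (- IZR d)) * Ci)) with (g * sqrt (- IZR d)) in HH by (simpl; lra).
    assert (HIm : Im J = IZR c * IZR d ^ 2 * s / cD c d s) by (rewrite EJ; cbn; unfold e; lra). assert (Hpos : 0 < IZR d ^ 2 * s / cD c d s) by (apply Rdiv_lt_0_compat; [apply Rmult_lt_0_compat; [nra|lra]|lra]). unfold g in *.
    destruct (Z.ltb_spec c 0) as [|].
    + assert (IZR c < 0) by (apply IZR_lt; lia). have csqrt_Im_neg J ltac:(nra). rewrite Rabs_left in HH by lra. lra.
    + assert (0 <= IZR c) by (apply IZR_le; lia). have csqrt_Im_pos J ltac:(nra). rewrite Rabs_pos_eq in HH by lra. lra. } have csqrt_sq J as HqJ.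
  assert (Hprod : Cmod (csqrt J - Lc c d) * Cmod (csqrt J + Lc c d) = Cmod (J - IZR d)) by (rewrite <- Cmod_mult; f_equal; rewrite <- HL2; rewrite <- HqJ at 3; ring). have Cmod_ge_0 (csqrt J - Lc c d). nra.
 - intros eps He. exists eps. easy.
Qed.
(** Both sides of the law are followed along [crv] as s -> 0: the image approaches b / d and yields
    a Gauss sum, the curve itself approaches 0 and yields the limit of the square root. *)
Lemma theta_law_const a b c d (sig : C) : (a * d - b * c = 1)%Z -> d <> 0%Z -> c <> 0%Z ->
 (forall z, inH z -> (theta (mob a b c d z) * sig = csqrt (jfac c d z) * theta z)%C) -> (sig * Gr b d = Lc c d)%C.
 intros Hdet Hd Hc H. assert (Hd2 : 1 <= IZR d ^ 2) by now apply IZR_ge1. apply (lim0_unique (fun s => sig * (RtoC (IZR (Z.abs d) * sqrt (2 * s)) * theta (rpt b d s)))%C); [apply lim0_mult; [apply lim0_const|now apply theta_rat_lim]|].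
 replace (Lc c d) with (Lc c d * 1 * 1)%C by ring. apply (lim0_ext (fun s => csqrt (jfac c d (crv c d s)) * (sqrt (2 * (s * IZR d ^ 2 / cD c d s)) * theta (crv c d s)) * sqrt (cD c d s))%C).
 + intros s Hs. destruct (crv_mob a b c d s Hdet Hd Hs) as [E1 [_ Hz]]. specialize (H _ Hz). rewrite E1 in H. have cD_ge1 c d s. assert (Es : sqrt (2 * (s * IZR d ^ 2 / cD c d s)) * sqrt (cD c d s) = IZR (Z.abs d) * sqrt (2 * s)).
  { rewrite <- sqrt_mult.
   - replace (2 * (s * IZR d ^ 2 / cD c d s) * cD c d s) with (IZR (Z.abs d) ^ 2 * (2 * s)); [rewrite sqrt_mult, sqrt_pow2 by (try apply pow2_ge_0; try (apply IZR_le; lia); lra); auto|rewrite abs_IZR, pow2_abs; field; lra].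
   - pos.
   - lra. } rewrite <- Es, RtoC_mult. transitivity (sqrt (2 * (s * IZR d ^ 2 / cD c d s)) * sqrt (cD c d s) * (csqrt (jfac c d (crv c d s)) * theta (crv c d s)))%C; [ring|]. rewrite <- H. ring.
 + apply lim0_mult; [apply lim0_mult; [now apply (csqrt_crv_lim a b)|now apply theta_crv_lim]|]. apply (lim0_bound _ _ (fun s => s) (Rabs (IZR c * IZR d) ^ 2)); [auto| |intros eps He; exists eps; split; intros; lra]. intros s Hs.
  rewrite <- RtoC_minus, Cmod_R. have cD_ge1 c d s. assert (1 <= sqrt (cD c d s)) by (rewrite <- sqrt_1; apply sqrt_le_1; lra).
  rewrite Rabs_pos_eq by lra. assert (sqrt (cD c d s) <= cD c d s) by (rewrite <- (sqrt_sqrt (cD c d s)) at 2; nra). unfold cD in *. rewrite pow2_abs. nra.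
Qed.

(** * The multiplier of eta is the Kronecker symbol *)

Lemma theta_nu a b c d z : Gam a b c d -> inH z -> (theta (mob a b c d z) * nu a b c d z)%C = theta z.
 intros HG Hz. have Gam_det _ _ _ _ HG as Hd. have eta_neq_0 z Hz. have eta_neq_0 _ (mob_inH a b c d z Hd Hz). have jfac_neq_0 a b c d z Hd Hz as HJ. have eta_mob_mod a b c d z HG Hz as E1. have theta_eta_mob a b c d z HG Hz as E2. unfold nu.
 set (t' := theta (mob a b c d z)) in *. set (e' := eta (mob a b c d z)) in *. set (e := eta z) in *.
 assert (Hc : forall x : C, x <> 0 -> Cconj x <> 0) by (intros x Hx E; apply Hx; rewrite <- (Cconj_conj x), E; unfold Cconj, RtoC; simpl; f_equal; ring).
 assert (HJm : RtoC (Cmod (jfac c d z)) <> 0) by (intros E; apply RtoC_inj in E; apply HJ, Cmod_eq_0, E). set (k := Cmod (jfac c d z)) in *.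
 transitivity (t' * Cconj e' * (k * (e * Cconj e)) / (k * e' * Cconj e' * Cconj e))%C; [field; auto|]. rewrite E2, <- E1. field; auto.
Qed.
Lemma theta_shift z (k : Z) : inH z -> theta (z + IZR k)%C = theta z.
 intros Hz. apply tsum_ext. intros a. replace (RtoC (IZR a ^ 2) * (z + IZR k))%C with (RtoC (IZR a ^ 2) * z + IZR (a * a * k))%C; [apply ee_shift|rewrite !mult_IZR, !RtoC_mult, RtoC_pow; ring].
Qed.
Lemma jfac_Im c d z : Im (jfac c d z) = IZR c * Im z.
 unfold Im. simpl; lra. Qed.
Definition sgm a b c d (z : C) : C := (nu a b c d z * csqrt (jfac c d z))%C.
(** For c <> 0 the automorphy factor never meets the real axis, so [csqrt] is holomorphic there, and
    the logarithmic derivatives of [nu] and [csqrt] cancel. *)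
Lemma sgm_const a b c d z w : Gam a b c d -> c <> 0%Z -> inH z -> inH w -> sgm a b c d w = sgm a b c d z.
 intros HG Hc Hz Hw. replace w with (z + (w - z))%C by ring. apply wder_const_seg. intros t Ht. assert (Hu : inH (z + t * (w - z))).
 { unfold inH in *. rewrite Im_plus. replace (Im (t * (w - z))) with (t * (Im w - Im z)) by (unfold Im; simpl; ring). nra. }
 set (u := (z + t * (w - z))%C) in *. have Gam_det _ _ _ _ HG as Hd. have jfac_neq_0 a b c d u Hd Hu as HJ. assert (HI : Im (jfac c d u) <> 0).
 { rewrite jfac_Im. unfold inH in Hu. assert (IZR c <> 0) by (intros E; apply Hc, eq_IZR, E). nra. } have csqrt_sq (jfac c d u) as Hq. set (J := jfac c d u) in *. set (q := csqrt J) in *.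
 assert (Hq0 : q <> 0) by (intros E; apply HJ; rewrite <- Hq, E; ring). eapply wder_eq; [apply wder_mult; [now apply wder_nu|apply wder_comp_hol; [apply wder_csqrt, HI|apply wder_jfac]]| |ring]. cbv beta.
 change (csqrt (jfac c d u)) with q. change (jfac c d u) with J. rewrite <- Hq. field. auto.
Qed.
Lemma sgm_Gr a b c d z : Gam a b c d -> c <> 0%Z -> inH z -> (sgm a b c d z * Gr b d = Lc c d)%C.
 intros HG Hc Hz. apply (theta_law_const a b c d); [now apply Gam_det|destruct HG as [_ [a' [b' [c' []]]]]; lia|auto|intros w Hw; rewrite <- (sgm_const a b c d z w HG Hc Hz Hw); unfold sgm; rewrite <- (theta_nu a b c d w HG Hw); ring].
Qed.
Lemma Gam_A : Gam 1 0 576 1.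
 split; [auto|]. exists 0%Z, 0%Z, 1%Z, 0%Z. auto. Qed.
Lemma sgm_A z : inH z -> sgm 1 0 576 1 z = 1.
 intros Hz. have sgm_Gr 1 0 576 1 z Gam_A ltac:(lia) Hz. unfold Gr, Lc in H. simpl in H. replace (0 * (0 * (0 * 1)) / 1) with 0 in H by field. rewrite ee_0, sqrt_1 in H. rewrite <- H. ring.
Qed.
(* [(1, k; 576, 1 + 576 k)] is [(1, 0; 576, 1)] times a translation, so its multiplier is explicit and evaluates the Gauss sum. *)
Lemma Gr_ref k : (1 + 576 * k <> 0)%Z -> Gr k (1 + 576 * k) = Lc 576 (1 + 576 * k).
 intros Hk. rewrite <- (theta_law_const 1 k 576 (1 + 576 * k) 1); [ring|ring|auto|lia|]. intros z Hz. have inH_addZ z k Hz as Hzk.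
 assert (EJ : jfac 576 1 (z + IZR k) = jfac 576 (1 + 576 * k) z) by (unfold jfac; rewrite plus_IZR, mult_IZR, RtoC_plus, RtoC_mult; ring).
 assert (Em : mob 1 k 576 (1 + 576 * k) z = mob 1 0 576 1 (z + IZR k)) by (unfold mob; change (IZR 576 * z + IZR (1 + 576 * k))%C with (jfac 576 (1 + 576 * k) z); change (IZR 576 * (z + IZR k) + IZR 1)%C with (jfac 576 1 (z + IZR k)); rewrite EJ; ring).
 rewrite Em, <- EJ, <- (theta_shift z k Hz), <- (theta_nu _ _ _ _ _ Gam_A Hzk). transitivity (theta (mob 1 0 576 1 (z + IZR k)) * sgm 1 0 576 1 (z + IZR k))%C; [rewrite sgm_A by auto; ring|]. cring.
Qed.
Lemma Gr_Gs b d : d <> 0%Z -> Gr b d = Gs (b * Z.sgn d) (Z.abs d).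
 intros Hd. unfold Gs. replace (Z.to_nat (Z.abs d)) with (Z.abs_nat d) by lia. apply Csum_ext_in. intros r _. unfold En. do 2 f_equal. assert (Hd0 : IZR d <> 0) by (intros E; apply Hd, eq_IZR, E). rewrite INR_IZR_INZ.
 destruct (Z.lt_total d 0) as [|[|]]; [|lia|]; [rewrite Z.sgn_neg, Z.abs_neq, opp_IZR, !mult_IZR by lia; field; lra|rewrite Z.sgn_pos, Z.abs_eq, !mult_IZR by lia; lra].
Qed.
(** Let n = |d| and e = sgn d. Since b c = -1 modulo d, [Gr b d] is [jacobi c n] times Gs (-e) n.
    Since d = 1 + 576 d' with 576 = 24^2, the same Gs (-e) n equals [Gr d' d], which [Gr_ref]
    evaluates as [Lc 576 d]. The sign of a Gauss sum is thus never computed directly. *)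
Lemma kron_pm a b c d : Gam a b c d -> (kron c d = 1 \/ kron c d = -1)%Z /\ forall z, inH z -> sgm a b c d z = RtoC (IZR (kron c d)).
 intros HG. have Gam_det _ _ _ _ HG as Hdet. have HG as HG0. destruct HG0 as [_ [a' [b' [c' [d' [Ea [Eb [Ec Ed]]]]]]]]. have HG as HG0. destruct (Z.eq_dec c 0) as [Hc|Hc].
 (* For c = 0 the congruences force a = d = 1, so the matrix is an integral translation, which fixes
    [eta]. *)
 - assert (Hd1 : d = 1%Z) by (assert (Hdd : (d | 1)) by (exists a; lia); apply Z.divide_1_r in Hdd; lia). assert (Ha1 : a = 1%Z) by lia. rewrite Hc, Hd1.
  split; [auto|]. intros z Hz. change (kron 0 1) with 1%Z. assert (EJ : jfac 0 1 z = 1) by cring. unfold sgm. rewrite EJ.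
  assert (Eq : csqrt 1 = 1) by (unfold csqrt; rewrite Cmod_1; cbn; unfold RtoC; f_equal; [rewrite <- sqrt_1 at 3; f_equal; lra|replace ((1 - 1) / 2) with 0 by field; rewrite sqrt_0; ring]).
  rewrite Eq, Ha1. unfold nu. replace (mob 1 b 0 1 z) with (z + IZR b)%C; [|unfold mob; field]. replace (eta (z + IZR b)) with (eta z); [field; auto|]. apply tsum_ext. intros i. unfold etat.
  replace (RtoC (IZR (6 * i + 1) ^ 2) * (z + IZR b))%C with (RtoC (IZR (6 * i + 1) ^ 2) * z + IZR ((6 * i + 1) * (6 * i + 1) * b))%C; [now rewrite ee_shift|]. rewrite mult_IZR, mult_IZR, !RtoC_mult, RtoC_pow. ring.
 - assert (Hd0 : d <> 0%Z) by lia. set (n := Z.abs d). assert (Hn : (0 < n)%Z) by lia. assert (Ho : Z.odd n = true).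
  { apply Z.odd_spec. destruct (Z.abs_eq_or_opp d) as [|]; [exists (288 * d')%Z|exists (- 288 * d' - 1)%Z]; lia. } set (e := Z.sgn d) in *.
  assert (Hbez : forall x u v, (u * d + v * x = 1)%Z -> rel_prime n x) by (intros x u v Huv; apply bezout_rel_prime; apply (Bezout_intro _ _ _ (u * e) v); lia). assert (Hrc : rel_prime n c) by (apply (Hbez c a (- b)%Z); lia).
  assert (Hre : rel_prime n (- e)) by (apply bezout_rel_prime; apply (Bezout_intro _ _ _ 0 (- e)); lia). assert (Hr24 : rel_prime n 24) by (apply (Hbez 24%Z 1%Z (- 24 * d')%Z); lia). destruct (jacobi_gauss n c (- e) Hn Ho Hrc Hre) as [HJ HGs].
  assert (E1 : Gr b d = (IZR (jacobi c n) * Gs (- e) n)%C) by (rewrite Gr_Gs by auto; fold n e; rewrite <- HGs, <- (Gs_scale_sq (b * e) n c Hn Hrc); apply (Gs_mod _ _ n (a * c)); auto; nia).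
  assert (E2 : Gr d' d = Gs (- e) n) by (rewrite Gr_Gs by auto; fold n e; rewrite <- (Gs_scale_sq (d' * e) n 24 Hn Hr24); apply (Gs_mod _ _ n 1); auto; lia). have Gr_ref d' ltac:(lia) as E3. rewrite <- Ed, E2 in E3. rewrite E3 in E1.
  assert (HJ2 : (IZR (jacobi c n) * IZR (jacobi c n))%C = 1) by (rewrite <- RtoC_mult; destruct HJ as [-> | ->]; f_equal; ring). unfold kron. destruct (Z.ltb_spec 0 d) as [L|].
  + replace n with d in * by lia. split; auto. intros z Hz. have sgm_Gr a b c d z HG0 Hc Hz as HS. rewrite E1 in HS. unfold Lc in HS. destruct (Z.ltb_spec 0 d); [|lia].
   assert (Hsq : RtoC (sqrt (IZR d)) <> 0) by (intros E; apply RtoC_inj in E; have sqrt_lt_R0 (IZR d) (IZR_lt 0 d L); lra).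
   set (k := IZR (jacobi c d)) in *. set (q := sqrt (IZR d)) in *. transitivity (sgm a b c d z * (k * q) * k / q)%C; [|rewrite HS; field; auto]. transitivity (sgm a b c d z * (k * k))%C; [rewrite HJ2; ring|field; auto].
  + replace (- d)%Z with n by lia. assert (Hsq : 0 < sqrt (- IZR d)) by (apply sqrt_lt_R0; rewrite <- opp_IZR; apply IZR_lt; lia).
   split; [destruct HJ as [-> | ->]; destruct c%Z; auto|]. intros z Hz. have sgm_Gr a b c d z HG0 Hc Hz as HS. rewrite E1 in HS. unfold Lc in HS.
   destruct (Z.ltb_spec 0 d); [lia|]. change (576 <? 0) with false in HS. rewrite RtoC_mult, mult_IZR, RtoC_mult in *. set (k := IZR (jacobi c n)) in *. assert (Hq : RtoC (sqrt (- IZR d)) <> 0) by cnz. set (q := sqrt (- IZR d)) in *.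
   replace (RtoC (IZR (if c <? 0 then -1 else 1%Z))) with (RtoC (if c <? 0 then -1 else 1)) by (destruct c%Z; reflexivity). transitivity (sgm a b c d z * (k * (1 * q * Ci)) * k / (q * Ci))%C; [|rewrite HS; field; auto].
   transitivity (sgm a b c d z * (k * k))%C; [rewrite HJ2; ring|field; auto].
Qed.

(** * The conditions on the group, the multiplier and the cusps *)

Lemma Gam_cong : cong_subgroup_G04 576 Gam.
 split; [lia|]. split; [|split; [|split; [|split]]].
 - intros a b c d [H [a' [b' [c' [d' [-> [-> [-> ->]]]]]]]]. split; [auto|]. apply Z.mod_divide; [lia|]. exists (144 * c')%Z. ring.
 - split; [auto|]. exists 0%Z, 0%Z, 0%Z, 0%Z. auto.
 - intros a b c d a1 b1 c1 d1 [H [a' [b' [c' [d' ]]]]] [H1 [a1' [b1' [c1' [d1' [-> [-> [-> ->]]]]]]]].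
  split; [nia|exists (a' + a1' + 576 * a' * a1' + 576 * b' * c1')%Z, (b1' + 576 * a' * b1' + b' + 576 * b' * d1')%Z, (c' + 576 * c' * a1' + c1' + 576 * d' * c1')%Z, (d' + d1' + 576 * d' * d1' + 576 * c' * b1')%Z; lia].
 - intros a b c d [H [a' [b' [c' [d' ]]]]]. split; [lia|]. exists d', (- b')%Z, (- c')%Z, a'. lia.
 - intros a b c d H Ha Hb Hc Hd. apply Z.mod_divide in Ha, Hb, Hc, Hd; try lia. destruct Ha as [a' Ha], Hb as [b' Hb], Hc as [c' Hc], Hd as [d' Hd]. split; [auto|]. exists a', b', c', d'. lia.
Qed.
Lemma char_1 : dirichlet_char 1 (fun _ => 1).
 split; [lia|]. split; [auto|]. split; [intros; ring|]. split; [cnz|]. intros H. exfalso. apply H, Z.gcd_1_r. Qed.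
Lemma Cpowz_4s1 (w : C) (s : nat) : w <> 0 -> Cpowz w (4 * zn s - 1) = ((w * w) ^ (2 * s) / w)%C.
 intros Hw. replace ((w * w) ^ (2 * s))%C with (w ^ (4 * s))%C by (replace (4 * s)%nat with (2 * (2 * s))%nat by lia; rewrite Cpow_mult_r; f_equal; ring).
 destruct s as [|]; [simpl; field; auto|replace (4 * zn (S s) - 1)%Z with (Zpos (Pos.of_nat (4 * s + 3))) by lia; cbn [Cpowz]; rewrite Nat2Pos.id by lia; replace (4 * S s)%nat with (S (4 * s + 3)) by lia; cbn; field; auto].
Qed.
(** Weight 2s - 1/2 is m / 2 with m = 4s - 1. On the group d = 1 modulo 4, so [epsd d] is 1, and an
    odd power of the Kronecker symbol is the symbol itself. *)
Lemma transforms_md s g : md s g -> transforms (4 * zn s - 1) Gam (fun _ => RtoC 1) g.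
 intros Hg a b c d z HG Hz. have Gam_det _ _ _ _ HG as Hdet. have jfac_neq_0 a b c d z Hdet Hz as HJ. destruct (kron_pm a b c d HG) as [Hk Hs].
 specialize (Hs z Hz). unfold sgm in Hs. rewrite Hg by auto. have csqrt_sq (jfac c d z) as Hq. unfold Chalfpow. set (J := jfac c d z) in *. set (q := csqrt J) in *. assert (Hq0 : q <> 0) by (intros E; apply HJ; rewrite <- Hq, E; ring).
 assert (Hk2 : (IZR (kron c d) * IZR (kron c d))%C = 1) by (rewrite <- RtoC_mult; destruct Hk as [-> | ->]; f_equal; ring).
 assert (Hk0 : RtoC (IZR (kron c d)) <> 0) by (intros E; rewrite E in Hk2; apply C1_nz; rewrite <- Hk2; ring). rewrite !Cpowz_4s1, Hk2, Hq by auto. assert (He : Cpowz (epsd d) (- (4 * zn s - 1)) = 1).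
 { unfold epsd. replace (d mod 4) with 1%Z.
  - destruct (- (4 * zn s - 1))%Z; cbn; rewrite ?Cpow_1_l; auto. field.
  - destruct HG as [_ [a' [b' [c' [d' [_ [_ [_ ->]]]]]]]]. replace (1 + 576 * d')%Z with (1 + 144 * d' * 4)%Z by ring. rewrite Z.mod_add by lia. auto. }
 rewrite He, Cpow_1_l. set (k := IZR (kron c d)) in *. transitivity (nu a b c d z * q * J ^ (2 * s) / q * g z)%C; [field; auto|]. rewrite Hs. transitivity (k * k / k * (J ^ (2 * s) / q) * g z)%C; [field; auto|]. rewrite Hk2. ring.
Qed.
Lemma nu_mod a b c d z : Gam a b c d -> inH z -> Cmod (nu a b c d z) ^ 2 * Cmod (jfac c d z) = 1.
 intros HG Hz. destruct (kron_pm a b c d HG) as [Hk Hs]. specialize (Hs z Hz). unfold sgm in Hs. have csqrt_sq (jfac c d z) as Hq.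
 rewrite <- Hq, Cmod_mult. transitivity (Cmod (nu a b c d z * csqrt (jfac c d z)) ^ 2); [rewrite Cmod_mult; ring|]. rewrite Hs, Cmod_R, pow2_abs. destruct Hk as [-> | ->]; ring.
Qed.
Lemma Rpower_half_int x s : 0 < x -> Rpower x (- IZR (4 * zn s - 1) / 2) * x ^ (2 * s) = Rpower x (/ 2).
 intros Hx. rewrite <- Rpower_pow, <- Rpower_plus by auto. f_equal. rewrite minus_IZR, mult_IZR, <- INR_IZR_INZ, mult_INR. simpl; lra. Qed.
(** The group is normal in SL2(Z): it contains the conjugate (da db; dc dd) of the translation by
    576 j, so the quantity that is to be bounded at the cusp is invariant under this translation. *)
Lemma md_cusp s g a b c d z j : md s g -> SL2Z a b c d -> inH z ->
 Cmod (g (mob a b c d z)) * Rpower (Cmod (jfac c d z)) (- IZR (4 * zn s - 1) / 2) = Cmod (g (mob a b c d (z + IZR (576 * j))%C)) * Rpower (Cmod (jfac c d (z + IZR (576 * j))%C)) (- IZR (4 * zn s - 1) / 2).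
 intros Hg Hdet Hz. set (h := (576 * j)%Z). set (z' := (z + IZR h)%C). set (da := (1 - a * c * h)%Z). set (db := (a * a * h)%Z). set (dc := (- c * c * h)%Z). set (dd := (1 + a * c * h)%Z). assert (HG : Gam da db dc dd).
 { unfold da, db, dc, dd. split; [ring|]. exists (- a * c * j)%Z, (a * a * j)%Z, (- c * c * j)%Z, (a * c * j)%Z. lia. } have jfac_neq_0 a b c d z Hdet Hz. have mob_inH a b c d z Hdet Hz as Hm. have jfac_neq_0 da db dc dd _ (Gam_det _ _ _ _ HG) Hm.
 assert (EdetC : (IZR a * IZR d - IZR b * IZR c)%C = 1) by (rewrite <- !RtoC_mult, <- RtoC_minus, <- !mult_IZR, <- minus_IZR, Hdet; reflexivity). assert (EJ : (jfac dc dd (mob a b c d z) * jfac c d z)%C = jfac c d z').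
 { unfold jfac, mob. change (IZR c * z + IZR d)%C with (jfac c d z). transitivity (IZR dc * (IZR a * z + IZR b) + IZR dd * jfac c d z)%C; [field; auto|].
  unfold jfac, z', dc, dd. rewrite ?plus_IZR, ?mult_IZR, ?opp_IZR, ?RtoC_plus, ?RtoC_mult, ?RtoC_opp. transitivity (IZR c * z + IZR d + IZR c * IZR h * (IZR a * IZR d - IZR b * IZR c))%C; [ring|rewrite EdetC; ring]. }
 assert (EM : mob da db dc dd (mob a b c d z) = mob a b c d z').
 { unfold mob at 1. change (IZR dc * mob a b c d z + IZR dd)%C with (jfac dc dd (mob a b c d z)). assert (EN : ((IZR da * mob a b c d z + IZR db) * jfac c d z = IZR a * z' + IZR b)%C).
  { unfold mob. change (IZR c * z + IZR d)%C with (jfac c d z). transitivity (IZR da * (IZR a * z + IZR b) + IZR db * jfac c d z)%C; [field; auto|]. unfold jfac, z', da, db. rewrite ?minus_IZR, ?mult_IZR, ?RtoC_minus, ?RtoC_mult.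
   transitivity (IZR a * z + IZR b + IZR a * IZR h * (IZR a * IZR d - IZR b * IZR c))%C; [ring|rewrite EdetC; ring]. } change (mob a b c d z') with ((IZR a * z' + IZR b) * / jfac c d z')%C. rewrite <- EN, <- EJ. field. auto. }
 rewrite <- EM, (Hg da db dc dd _ HG Hm), !Cmod_mult, Cmod_pow, <- EJ, Cmod_mult. have nu_mod _ _ _ _ _ HG Hm.
 set (n := Cmod (nu da db dc dd (mob a b c d z))) in *. set (x := Cmod (jfac dc dd (mob a b c d z))) in *. assert (Hx : 0 < x) by now apply Cmod_gt_0.
 assert (Hy : 0 < Cmod (jfac c d z)) by now apply Cmod_gt_0. rewrite <- Rpower_mult_distr by auto. assert (Hn : n * Rpower x (/ 2) = 1).
 { assert (0 <= n) by apply Cmod_ge_0. assert (Hr : Rpower x (/ 2) * Rpower x (/ 2) = x) by (rewrite <- Rpower_plus; replace (/ 2 + / 2) with 1 by field; now apply Rpower_1).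
  assert (0 < Rpower x (/ 2)) by apply exp_pos. assert (0 <= n * Rpower x (/ 2)) by pos. nra. } have Rpower_half_int x s Hx as Hh. set (P := Rpower x (- IZR (4 * zn s - 1) / 2)) in *. set (Q := Rpower (Cmod (jfac c d z)) _).
 transitivity (Cmod (g (mob a b c d z)) * Q * (n * (P * x ^ (2 * s)))); [rewrite Hh, Hn; ring|ring].
Qed.
(** [gr] bounds g in terms of the height of the image point, and 1 / Im (g z) = |J|^2 / Im z depends
    on Re z. Periodicity at the cusp restricts Re z to [0, 576], where |J| <= A Im z. *)
Lemma growth_md s g : md s g -> gr g -> linexp_growth (4 * zn s - 1) g.
 (* The number 577 is 576 + 1: on the strip |w| <= 576 + Im w <= 577 Im w once Im w >= 1. *)
 intros Hg [K [HK Hgr]] a b c d Hdet. set (m := IZR (4 * zn s - 1)). set (A := Rabs (IZR c) * 577 + Rabs (IZR d)).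
 assert (HA : 0 <= A) by (unfold A; have Rabs_pos (IZR c); have Rabs_pos (IZR d); lra). set (L := K * (1 + A ^ 2) + Rabs m / 2 * A + 1). have Rabs_pos m as Hm0. assert (HL : 0 <= K * (1 + A ^ 2) /\ 0 <= Rabs m / 2 * A) by nra.
 assert (HKL : K <= L) by (unfold L; assert (K * 1 <= K * (1 + A ^ 2)) by nra; lra). exists L, 1. split; [unfold L; lra|]. intros z Hz1.
 assert (Hz : inH z) by (unfold inH; lra). set (j := (- (up (Re z / 576) - 1))%Z). have md_cusp s g a b c d z j Hg Hdet Hz as Ecusp. fold m in Ecusp.
 rewrite Ecusp. set (w := (z + IZR (576 * j))%C). assert (HIw : Im w = Im z) by apply Im_addZ. assert (HRw : 0 <= Re w <= 576).
 { unfold w. rewrite Re_addZ, mult_IZR. unfold j. rewrite opp_IZR, minus_IZR. destruct (archimed (Re z / 576)) as []. lra. }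
 assert (Hw : inH w) by (unfold inH; lra). unfold SL2Z in Hdet. set (y := Im z) in *. have mob_Im a b c d w Hdet Hw as HI. rewrite HIw in HI. set (J := jfac c d w) in *. assert (HJ1 : 1 <= Cmod J).
 { destruct (Z.eq_dec c 0) as [->|].
  - assert (Hd : IZR d ^ 2 = 1) by (assert (Hdd : (d | 1)) by (exists a; lia); apply Z.divide_1_r in Hdd; destruct Hdd as [-> | ->]; simpl; ring).
   assert (HJ2 : Cmod J ^ 2 = 1) by (rewrite Cmod_sq; unfold J; rewrite jfac_Im; replace (Re (jfac 0 d w)) with (IZR d) by (simpl; ring); lra). have Cmod_ge_0 J. nra.
  - have im_le_Cmod J. unfold J in H at 1. rewrite jfac_Im, HIw, Rabs_mult in H. rewrite (Rabs_pos_eq y) in H by lra. assert (1 <= Rabs (IZR c)) by (rewrite <- abs_IZR; apply IZR_le; lia). nra. } assert (HJ2 : Cmod J <= A * y).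
 { le_via Cmod_triangle. rewrite Cmod_mult, !Cmod_R. assert (Cmod w <= 577 * y) by (assert (Ew : w = (Re w + Ci * Im w)%C) by cring; rewrite Ew; le_via Cmod_triangle; rewrite Cmod_mult, Cmod_Ci, !Cmod_R, !Rabs_pos_eq by lra; lra).
  unfold A. have Rabs_pos (IZR c). have Rabs_pos (IZR d). nra. } assert (HJsq : Cmod J ^ 2 <= (A * y) ^ 2) by nra. have mob_inH a b c d w Hdet Hw as HmH. specialize (Hgr _ HmH). set (v := Im (mob a b c d w)) in *.
 assert (Hv1 : v <= y) by (rewrite HI; rewrite <- (Rmult_1_r y) at 2; mul_l; [lra|]; apply Rle_trans with (/ 1); [inv_le; nra|lra]).
 assert (Hv2 : / v <= A ^ 2 * y) by (rewrite HI; replace (/ (y / Cmod J ^ 2)) with (Cmod J ^ 2 * / y) by (field; lra); apply Rmult_le_reg_r with y; [lra|]; rewrite Rmult_assoc, Rinv_l by lra; lra).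
 assert (HP : Rpower (Cmod J) (- m / 2) <= exp (Rabs m / 2 * A * y)).
 { apply exp_le. assert (Hln : 0 <= ln (Cmod J)) by (rewrite <- ln_1; destruct HJ1 as [|H1]; [left; apply ln_increasing; lra|rewrite <- H1; lra]).
  assert (Hln2 : ln (Cmod J) <= Cmod J) by (have exp_ge_1x (ln (Cmod J)) as He; rewrite exp_ln in He; lra). apply Rle_trans with (Rabs m / 2 * ln (Cmod J)); [mul_r; auto; have Rle_abs (- m); rewrite Rabs_Ropp in H; lra|nra]. }
 assert (HG2 : Cmod (g (mob a b c d w)) <= L * exp (K * (1 + A ^ 2) * y)) by (eapply Rle_trans; [exact Hgr|]; mul_le; auto0; [auto|]; apply exp_le; nra).
 apply Rle_trans with (L * exp (K * (1 + A ^ 2) * y) * exp (Rabs m / 2 * A * y)); [mul_le; auto0; [auto|left; apply exp_pos]|]. rewrite Rmult_assoc, <- exp_plus. mul_l; [lra|]. apply exp_le. unfold L. nra.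
Qed.
Lemma modular_form_md s g : md s g -> hgood g -> modular_form g.
 exists (4 * zn s - 1)%Z, 576%Z, 1%Z, Gam, (fun _ => 1). split; [apply Gam_cong|]. split; [apply char_1|]. split; [|split; [now apply transforms_md|apply growth_md; auto; now apply hgood_gr]]. eexists. apply is_derive_wder, hgood_wder; eauto.
Qed.

(** * Smoothness and harmonicity of the nonholomorphic part *)

Fixpoint csm (n : nat) (F : C -> C) : Prop := match n with O => True | S m =>
 exists A B, (forall z, inH z -> wder F z (A z) (B z)) /\ csm m A /\ csm m B end.
Lemma csm_ext n F G : (forall z, inH z -> F z = G z) -> csm n F -> csm n G.
 destruct n as [|]; auto. intros E [A [B []]]. exists A, B. split; auto. intros z Hz. eapply wder_extH; eauto. Qed.
Lemma csm_S n F : csm (S n) F -> csm n F.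
 revert F. induction n as [|]; [easy|]. intros F [A [B [H []]]]. exists A, B. auto. Qed.
Lemma csm_const n c : csm n (fun _ => c).
 revert c. induction n as [|]; [easy|]. exists (fun _ => 0), (fun _ => 0). auto. Qed.
#[local] Hint Resolve csm_const : core.
Lemma csm_plus n F G : csm n F -> csm n G -> csm n (fun z => F z + G z)%C.
 revert F G. induction n as [|]; intros F G; [auto|]. intros [A [B [H []]]] [A' [B' [H' []]]]. exists (fun z => A z + A' z)%C, (fun z => B z + B' z)%C. split; auto. intros z Hz. apply wder_plus; auto.
Qed.
Lemma csm_mult n F G : csm n F -> csm n G -> csm n (fun z => F z * G z)%C.
 revert F G. induction n as [|n IH]; intros F G HF HG; [auto|]. have csm_S _ _ HF as HF0. have csm_S _ _ HG as HG0. destruct HF as [A [B [H []]]].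
 destruct HG as [A' [B' [H' []]]]. exists (fun z => A z * G z + F z * A' z)%C, (fun z => B z * G z + F z * B' z)%C. split; [|split; apply csm_plus; auto]. intros z Hz. eapply wder_eq; [apply wder_mult; eauto| |]; ring.
Qed.
Lemma csm_hgood n F : hgood F -> csm n F.
 revert F. induction n as [|n IH]; intros F HF; [easy|]. exists (dX F), (fun _ => 0). split; [|split; [apply IH; now apply hgood_dX|auto]]. intros z Hz. now apply hgood_wder.
Qed.
Lemma wder_conj_hol F z A : wder F z A 0 -> wder (fun z => Cconj (F z)) z 0 (Cconj A).
 intros H. eapply wder_eq; [apply wder_comp; [apply wder_Cconj|eauto]| |]; [cring|]; ring. Qed.
Lemma csm_conj n F : hgood F -> csm n (fun z => Cconj (F z)).
 revert F. induction n as [|n IH]; [easy|]. exists (fun _ => 0), (fun z => Cconj (dX F z)). split; [|split; [auto|apply IH; now apply hgood_dX]]. intros z Hz. apply wder_conj_hol. now apply hgood_wder.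
Qed.
Lemma wder_hh j z : inH z -> wder (fun z => RtoC (hh j (Im z))) z
 (RtoC (- (INR j + 3 / 2)) * RtoC (hh (S j) (Im z)) * (- Ci / 2))%C (RtoC (- (INR j + 3 / 2)) * RtoC (hh (S j) (Im z)) * (Ci / 2))%C.
 intros Hz. rewrite <- RtoC_mult. apply (wder_Im_fun (fun t => hh j t)), rder_real, is_derive_hh, Hz. Qed.
Lemma csm_hh n j : csm n (fun z => RtoC (hh j (Im z))).
 revert j. induction n as [|]; intros j; [easy|]. exists (fun z => RtoC (- (INR j + 3 / 2)) * hh (S j) (Im z) * (- Ci / 2))%C, (fun z => RtoC (- (INR j + 3 / 2)) * hh (S j) (Im z) * (Ci / 2))%C.
 split; [intros z Hz; now apply wder_hh|]. split; repeat apply csm_mult; auto using csm_const.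
Qed.
Lemma csm_wder n F : csm (S n) F -> csm n (dX F) /\ csm n (dY F).
 intros [A [B [H []]]]. split.
 - apply (csm_ext n (fun z => A z + B z)%C); [|now apply csm_plus]. intros z Hz. symmetry. apply (wder_dX F z _ _ (H z Hz)).
 - apply (csm_ext n (fun z => Ci * (A z + -1 * B z))%C); [intros z Hz; destruct (wder_dY F z _ _ (H z Hz)) as [-> _]; ring|apply csm_mult; [auto|]; apply csm_plus; auto; apply csm_mult; auto using csm_const].
Qed.
Lemma csm_smooth F : (forall n, csm n F) -> smooth_H F.
 intros HF w. assert (Hw : forall n, csm n (iterD w F)) by (induction w as [|[|] w IH]; auto; intros n; now apply csm_wder). intros z Hz.
 destruct (Hw 1%nat) as [A [B []]]. specialize (H z Hz). split; [eapply wder_continuous; eauto|]. destruct (wder_dX _ _ _ _ H) as [_ []]. destruct (wder_dY _ _ _ _ H) as []. auto.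
Qed.
(* The antiholomorphic derivative of [Tj j] is a multiple of [y^(-j-3/2) * conj eta]: the shadow is a unary theta function. *)
Definition Tb (j : nat) (z : C) : C := (- (Ci / 2) * RtoC (Tc j) * RtoC (hh j (Im z)) * Cconj (eta z))%C.
Lemma wder_Tt j i z : inH z -> wder (fun z => Tt j z i) z (Ci / 2 * RtoC (INR j + 3 / 2) * Tt (S j) z i)%C
 (- (Ci / 2) * RtoC (hh j (Im z)) * (sg i * Cconj (ee (RtoC (bq i) * z))))%C.
 intros Hz. have bet4_ge1 i. have pos_INR j. unfold Tt. eapply wder_eq; [apply wder_mult| |].
 - apply wder_scal, wder_conj_hol, wder_ee_lin.
 - apply (wder_Im_fun (fun t => II j (bet4 i) t)), rder_real, is_derive_II; [lra|auto].
 - cbn. rewrite RtoC_div, !RtoC_minus, RtoC_plus by lra. assert (INR j + RtoC (3 / 2) <> 0)%C by (rewrite <- RtoC_plus; intros E; apply RtoC_inj in E; lra). field. auto.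
 - rewrite !Cmult_conj, !Cconj_RtoC. assert (ECi : Cconj Ci = (- Ci)%C) by cring. rewrite ECi. unfold bet4. rewrite RtoC_minus, !RtoC_mult. field.
Qed.
Lemma lam_1_Tc j : (lam 1 j * RtoC (Tc (S j)))%C = (Ci / 2 * RtoC (INR j + 3 / 2) * RtoC (Tc j))%C.
 unfold lam, alph, Tc. change (fact (S j)) with (S j * fact j)%nat. rewrite mult_INR. have pos_INR j. replace ((PI / 16) ^ S (S j) * (8 / (INR (S j) * INR (fact j)))) with (PI / 16 / (INR j + 1) * ((PI / 16) ^ S j * (8 / INR (fact j))))
  by (rewrite S_INR; cbn; field; split; auto; lra). rewrite RtoC_mult, !RtoC_div, RtoC_plus, RtoC_plus, RtoC_div by lra. change (INR 1) with 1. assert (INR j + 1 <> 0)%C by (rewrite <- RtoC_plus; intros E; apply RtoC_inj in E; lra). field; auto.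
Qed.
(** In the direction dz the T_j form a chain with the constants [lam 1] of a form of weight 3/2; the
    constants [Tc] are made for this, as [lam_1_Tc] records. *)
Lemma wder_Tj j z : inH z -> wder (Tj j) z (lam 1 j * Tj (S j) z)%C (Tb j z).
 intros Hz. assert (Hy : 0 < Im z / 2) by pos. have pos_INR j. have hh_pos j _ Hy. have hh_pos (S j) _ Hy as Hh1. set (y := Im z / 2) in *.
 assert (D : wder (fun z => tsum (Tt j z)) z (Ci / 2 * RtoC (INR j + 3 / 2) * tsum (Tt (S j) z)) (- (Ci / 2) * hh j (Im z) * Cconj (eta z))).
 { assert (HC : Cmod (Ci / 2) = / 2) by (unfold Cdiv; rewrite Cmod_mult, Cmod_Ci, <- RtoC_inv2, Cmod_R, Rabs_pos_eq; lra). apply (wder_sum (fun i z => Tt j z i) (fun i z => Ci / 2 * RtoC (INR j + 3 / 2) * Tt (S j) z i)%C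
   (fun i z => - (Ci / 2) * hh j (Im z) * (sg i * Cconj (ee (bq i * z))))%C (fun i => (/ 2 * (INR j + 3 / 2) * hh (S j) y + / 2 * hh j y) * exp (- 2 * PI * bq i * y))
   ((/ 2 * (INR j + 3 / 2) * hh (S j) y + / 2 * hh j y) * ((1 + / (2 * PI * y)) * 18)) y) with (1 := Hy).
  - apply bnd_scal; [|auto]. pos.
  - intros i h Hh. apply wder_Tt. now apply half_ball.
  - intros i h Hh. destruct (half_ball z h Hz Hh) as []. have Tt_le (S j) (z + h) i y Hy H1 as HT. rewrite !Cmod_mult, Cmod_opp, Cmod_sg, Cmod_conj, Cmod_ee_c, !Cmod_R, !Rabs_pos_eq by (try lra; left; now apply hh_pos). have hh_anti j y _ Hy H1.
   have bq_ge1 i. have PI_RGT_0. assert (E : exp (-2 * PI * bq i * Im (z + h)) <= exp (-2 * PI * bq i * y)) by (apply exp_le; apply Rmult_le_compat_neg_l; auto; nra). have exp_pos (-2 * PI * bq i * Im (z + h)). nra.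
  - intros h Hh. apply Tt_spec. now apply half_ball.
  - apply Sums_scal. now apply Tt_spec.
  - apply Sums_scal. eapply Sums_ext; [|apply Sums_conj, (eta_spec z Hz)]. intros i. unfold etat. now rewrite Cmult_conj, sg_conj. } eapply wder_eq; [apply wder_scal; exact D| |]; [unfold Tj; rewrite (Cmult_assoc (lam 1 j)), lam_1_Tc; ring|cring].
Qed.
Lemma csm_Tb n j : csm n (Tb j).
 repeat apply csm_mult; auto using csm_hh, csm_conj. Qed.
Lemma csm_Tj n j : csm n (Tj j).
 revert j. induction n as [|]; intros j; [easy|]. exists (fun z => lam 1 j * Tj (S j) z)%C, (Tb j). split; [intros z Hz; now apply wder_Tj|]. split; [apply csm_mult; auto using csm_const|apply csm_Tb].
Qed.
Lemma Tc_pos j : 0 < Tc j.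
 unfold Tc. pos. Qed.
#[local] Hint Resolve Tc_pos : core.
Lemma Tj_bound j z : inH z -> Cmod (Tj j z) <= Tc j * (hh j (Im z) * ((1 + / (2 * PI * Im z)) * 18)).
 intros Hz. unfold Tj. have Tc_pos j. rewrite Cmod_mult, Cmod_R, Rabs_pos_eq by lra. mul_l; [lra|]. eapply Sums_bound; [now apply Tt_spec|]. eapply bnd_le; [intros i; apply Tt_le; [exact Hz|lra]|]. apply bnd_scal; [auto|auto].
Qed.
Lemma inv_2PI_le y : 0 < y -> / (2 * PI * y) <= / y.
 intros Hy. have PI2_3_2. inv_le; auto. nra. Qed.
Lemma hh0_le y : 0 < y -> hh 0 y <= / y * (1 + / y).
 intros Hy. unfold hh. rewrite pow_1, Rinv_mult. have Rinv_0_lt_compat y Hy. mul_l; [lra|]. have sqrt_lt_R0 y Hy. have sqrt_sqrt y ltac:(lra).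
 destruct (Rle_dec 1 y) as [|]; [assert (1 <= sqrt y) by nra; apply Rle_trans with (/ 1); [inv_le; lra|lra]|apply Rle_trans with (/ y); [inv_le; nra|lra]].
Qed.
Lemma gr_T0 : gr (Tj 0).
 have Tc_pos 0. exists (18 * Tc 0 + 3). split; [lra|]. intros z Hz. eapply Rle_trans; [now apply Tj_bound|]. unfold inH in Hz. set (y := Im z) in *.
 have hh0_le y Hz. have inv_2PI_le y Hz. assert (H3 : 0 < / (2 * PI * y)) by pos. have exp_ge_1x (/ y). set (e := exp (/ y)) in *. assert (H5 : hh 0 y * (1 + / (2 * PI * y)) <= e * e * e) by (assert (hh 0 y <= e * e) by nra; nra).
 assert (H6 : e * e * e <= exp ((18 * Tc 0 + 3) * (y + / y))) by (unfold e; rewrite <- !exp_plus; apply exp_le; nra). nra.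
Qed.
Lemma dX_extH F G z : inH z -> (forall z, inH z -> F z = G z) -> (exists A B, wder G z A B) -> dX F z = dX G z /\ dY F z = dY G z.
 intros Hz E [A [B H]]. assert (H' : wder F z A B) by (eapply wder_extH; [auto| |eauto]; symmetry; auto). rewrite (proj1 (wder_dX _ _ _ _ H)), (proj1 (wder_dX _ _ _ _ H')), (proj1 (wder_dY _ _ _ _ H)), (proj1 (wder_dY _ _ _ _ H')). auto.
Qed.
(** In Wirtinger terms g_xx + g_yy = 2 (A2 + B1), four times the mixed derivative, and g_x + i g_y =
    2 B. *)
Lemma laplacian_wder m g (A B : C -> C) z A1 A2 B1 B2 : inH z -> (forall z, inH z -> wder g z (A z) (B z)) -> wder A z A1 A2 -> wder B z B1 B2 ->
 laplacian m g z = (RtoC (- Im z ^ 2) * (2 * (A2 + B1)) + Ci * RtoC (IZR m / 2 * Im z) * (2 * B z))%C.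
 intros Hz H HA HB. unfold laplacian. assert (DX : wder (fun z => A z + B z)%C z (A1 + B1) (A2 + B2)) by now apply wder_plus.
 assert (DY : wder (fun z => Ci * (A z - B z))%C z (Ci * (A1 - B1)) (Ci * (A2 - B2))) by (apply wder_scal; now apply wder_minus).
 destruct (dX_extH (dX g) _ z Hz (fun w Hw => proj1 (wder_dX _ _ _ _ (H w Hw))) (ex_intro _ _ (ex_intro _ _ DX))) as [-> _]. destruct (dX_extH (dY g) _ z Hz (fun w Hw => proj1 (wder_dY _ _ _ _ (H w Hw))) (ex_intro _ _ (ex_intro _ _ DY))) as [_ ->].
 rewrite (proj1 (wder_dX _ _ _ _ DX)), (proj1 (wder_dY _ _ _ _ DY)), (proj1 (wder_dX _ _ _ _ (H z Hz))), (proj1 (wder_dY _ _ _ _ (H z Hz))). cring.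
Qed.
(** The derivative of T_0 in conj z is Im(z)^(-3/2) times an antiholomorphic function, which is the
    form that weight 3/2 requires. *)
Lemma laplacian_T0 G z : hgood G -> inH z -> laplacian 3 (fun z => G z - Tj 0 z)%C z = 0.
 intros HG Hz. erewrite laplacian_wder; auto0.
 - shelve.
 - intros w Hw. apply wder_minus; [now apply hgood_wder|now apply wder_Tj].
 - apply wder_minus; [apply hgood_wder; auto; now apply hgood_dX|]. apply wder_scal, wder_Tj, Hz.
 - apply wder_minus; [auto|]. apply wder_mult; [apply wder_scal, wder_hh, Hz|]. apply wder_conj_hol. apply hgood_wder; auto0. apply hgood_eta. Unshelve. unfold Tb.
  replace (lam 1 0 * (- (Ci / 2) * Tc 1 * hh 1 (Im z) * Cconj (eta z)))%C with (lam 1 0 * Tc 1 * - (Ci / 2) * hh 1 (Im z) * Cconj (eta z))%C by ring. rewrite lam_1_Tc, Rplus_0_l. assert (E : RtoC (hh 0 (Im z)) = (Im z * hh 1 (Im z))%C).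
  { rewrite <- RtoC_mult. f_equal. unfold hh. unfold inH in Hz. have sqrt_lt_R0 _ Hz. field; lra. } rewrite E, RtoC_opp, RtoC_mult, RtoC_pow, RtoC_opp. field.
Qed.

(** * Fourier coefficients of the nonholomorphic part *)

Lemma RInt_Cint (f : R -> C) a b : (forall x, Rmin a b <= x <= Rmax a b -> Ccont f x) -> @RInt C_R_CompleteNormedModule f a b = Cint f a b.
 intros H. destruct (Ccont_ex f a b H) as []. apply is_RInt_unique, is_RInt_fct_extend_pair; [apply (RInt_correct (V := R_CompleteNormedModule)); auto|apply (RInt_correct (V := R_CompleteNormedModule)); auto].
Qed.
Definition fT (n : Z) (y x : R) : C := (Tj 0 (x, y) * ee (RtoC (x * (- IZR n / 576))))%C.
Definition fTt (n : Z) (y : R) (i : Z) (x : R) : C :=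
 (RtoC (Tc 0) * (sg i * RtoC (exp (- 2 * PI * bq i * y)) * RtoC (II 0 (bet4 i) y)) * ee (RtoC (x * (- IZR (576 * (6 * i + 1) ^ 2 + n) / 576))))%C.
Lemma fTt_eq n y i x : (RtoC (Tc 0) * Tt 0 (x, y) i * ee (RtoC (x * (- IZR n / 576))))%C = fTt n y i x.
 unfold Tt, fTt. rewrite ee_polar, polar_conj. cbn [Re Im fst snd]. unfold polar.
 replace (x * (- IZR (576 * (6 * i + 1) ^ 2 + n) / 576)) with (- (bq i * x) + x * (- IZR n / 576)); [rewrite RtoC_plus, ee_plus; ring|rewrite plus_IZR, mult_IZR; unfold bq; rewrite pow_IZR; simpl; lra].
Qed.
Lemma fT_spec n y x : 0 < y -> Sums (fun i => fTt n y i x) (fT n y x).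
 intros Hy. assert (Hz : inH (x, y)) by exact Hy. set (c := (Tc 0 * ee (RtoC (x * (- IZR n / 576))))%C). eapply Sums_eq; [eapply Sums_ext; [|apply (Sums_scal c), (Tt_spec 0 _ Hz)]|cring]. intros i. rewrite <- fTt_eq. cring.
Qed.
Lemma fTt_bound n y i x : 0 < y -> Cmod (fTt n y i x) <= Tc 0 * hh 0 y * exp (- 2 * PI * bq i * y).
 intros Hy. rewrite <- fTt_eq, !Cmod_mult, Cmod_ee_R, Rmult_1_r, Cmod_R. have Tc_pos 0. rewrite Rabs_pos_eq, Rmult_assoc by lra. mul_l; [lra|]. apply Tt_le; [auto|auto].
Qed.
Lemma fT_bound n y x : 0 < y -> Cmod (fT n y x) <= Tc 0 * (hh 0 y * ((1 + / (2 * PI * y)) * 18)).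
 unfold fT. rewrite Cmod_mult, Cmod_ee_R, Rmult_1_r. apply (Tj_bound 0 (x, y)). Qed.
Lemma fT_cont n y x : 0 < y -> Ccont (fT n y) x.
 intros Hy. apply (Ccont_HasSum (fTt n y) (fT n y) (fun i => Tc 0 * hh 0 y * exp (- 2 * PI * bq i * y)) (Tc 0 * hh 0 y * ((1 + / (2 * PI * y)) * 18)) (x - 1) (x + 1)); try lra.
 - apply bnd_scal; [|auto]. have Tc_pos 0. have hh_pos 0 y Hy. pos.
 - intros i. have Tc_pos 0. have hh_pos 0 y Hy. pos.
 - intros i t _. now apply fTt_bound.
 - intros i t _. apply Ccont_scal, Ccont_ee_lin.
 - intros t _. now apply fT_spec.
Qed.
Lemma fcoef_T0 n y : 0 < y -> fcoef 576 (fun z => - Tj 0 z)%C n y = (- RtoC (/ 576) * Cint (fT n y) 0 576)%C.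
 intros Hy. unfold fcoef. transitivity (RtoC (/ 576) * Cint (fun x => -1 * fT n y x) 0 576)%C; [|rewrite Cint_scal by (intros; apply fT_cont, Hy); ring].
 f_equal. rewrite <- RInt_Cint by (intros; apply Ccont_scal, fT_cont, Hy). f_equal. fext. intros x. unfold fT, ee. transitivity (-1 * (Tj 0 (x, y) * cexp (RtoC (-2 * PI * IZR n * x / 576) * Ci)))%C; [ring|]. do 3 f_equal.
 replace (-2 * PI * IZR n * x / 576) with (2 * PI * x * (- IZR n / 576)) by field. cring.
Qed.
(** The frequencies of T_0 are - (6i + 1)^2, that is, - 576 (6i + 1)^2 when counted for the period
    576; all are negative. *)
Lemma Cint_fT n y : 0 < y -> (0 <= n)%Z -> Cint (fT n y) 0 576 = 0.
 intros Hy Hn. eapply Sums_unique; [|auto]. eapply Sums_ext; [|apply (Cint_HasSum (fTt n y) (fT n y) (fun i => Tc 0 * hh 0 y * exp (- 2 * PI * bq i * y)) (Tc 0 * hh 0 y * ((1 + / (2 * PI * y)) * 18)) 0 576)]; try lra.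
 - intros i. unfold fTt. rewrite Cint_scal by (intros; apply Ccont_ee_lin). assert (Hj : (576 * (6 * i + 1) ^ 2 + n <> 0)%Z) by nia. set (j := (576 * (6 * i + 1) ^ 2 + n)%Z) in *.
  rewrite Cint_ee_period; [ring| |]; [intros E; apply Hj, eq_IZR; lra|replace (576 * (- IZR j / 576)) with (IZR (- j)) by (rewrite opp_IZR; field); apply ee_Z].
 - apply bnd_scal; [|auto]. have Tc_pos 0. have hh_pos 0 y Hy. pos.
 - intros i. have Tc_pos 0. have hh_pos 0 y Hy. pos.
 - intros i t _. now apply fTt_bound.
 - intros i t _. apply Ccont_scal, Ccont_ee_lin.
 - intros t _. apply fT_cont, Hy.
 - intros t _. now apply fT_spec.
Qed.
Lemma fcoef_decay n : filterlim (fun y => fcoef 576 (fun z => - Tj 0 z)%C n y) (Rbar_locally p_infty) (locally (RtoC 0)).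
 apply filterlim_locally. intros eps. have cond_pos eps. have Tc_pos 0 as HT. set (K := Tc 0 * 144). assert (HKe : 0 < K / eps) by (apply Rdiv_lt_0_compat; unfold K; lra). exists (1 + K / eps). intros y Hy. assert (H0 : 0 < y) by lra.
 rewrite (fcoef_T0 n y H0). apply C_NormedModule_mixin_compat1. change (Cmod (- RtoC (/ 576) * Cint (fT n y) 0 576 - 0) < eps). replace (- RtoC (/ 576) * Cint (fT n y) 0 576 - 0)%C with (- (RtoC (/ 576) * Cint (fT n y) 0 576))%C by ring.
 rewrite Cmod_opp, Cmod_mult, Cmod_R, Rabs_pos_eq by lra. have Cint_bound (fT n y) 0 576 _ ltac:(lra) (fun x _ => fT_cont n y x H0) (fun x _ => fT_bound n y x H0). have hh0_le y H0.
 have inv_2PI_le y H0. assert (H5 : 0 < / (2 * PI * y)) by pos. assert (H6 : / y <= 1) by (rewrite <- Rinv_1; inv_le; lra). assert (H8 : hh 0 y * (1 + / (2 * PI * y)) <= / y * 4) by nra.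
 assert (H9 : K * / y < eps) by (apply Rmult_lt_reg_r with y; auto; rewrite Rmult_assoc, Rinv_l by lra; apply (Rmult_lt_reg_r (/ eps)); [pos|]; replace (eps * y * / eps) with y by (field; lra); lra).
 apply Rle_lt_trans with (K * / y); auto. unfold K. nra.
Qed.
Lemma eta_576 z : eta (z + 576)%C = eta z.
 apply tsum_ext. intros i. unfold etat. f_equal. rewrite Cmult_plus_distr_l. replace (RtoC (IZR (6 * i + 1) ^ 2) * 576)%C with (RtoC (IZR ((6 * i + 1) ^ 2 * 576))) by (rewrite mult_IZR, pow_IZR, RtoC_mult; reflexivity). apply ee_shift.
Qed.
Lemma Tj_576 j z : Tj j (z + 576)%C = Tj j z.
 unfold Tj. f_equal. apply tsum_ext. intros i. unfold Tt. rewrite Cmult_plus_distr_l. replace (bq i * 576)%C with (RtoC (IZR ((6 * i + 1) ^ 2 * 576))) by (unfold bq; rewrite mult_IZR, pow_IZR, RtoC_mult; reflexivity). rewrite ee_shift, Im_plus.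
 now rewrite Rplus_0_r.
Qed.
Lemma md_576 s g z : md s g -> inH z -> g (z + 576)%C = g z.
 intros Hm Hz. assert (HG : Gam 1 576 0 1) by (destruct Gam_cong as [_ ]; apply H; reflexivity). specialize (Hm _ _ _ _ z HG Hz).
 assert (Ej : jfac 0 1 z = 1) by cring. assert (Em : mob 1 576 0 1 z = (z + 576)%C) by (unfold mob; fold (jfac 0 1 z); rewrite Ej; field).
 assert (En : nu 1 576 0 1 z = 1) by (unfold nu; rewrite Em, eta_576; field; now apply eta_neq_0). rewrite Em, En, Ej, Cpow_1_l in Hm. rewrite Hm. ring.
Qed.
Theorem holomorphic_part_T0 G : hgood G -> md 1 (fun z => G z - Tj 0 z)%C -> holomorphic_part (fun z => G z - Tj 0 z)%C G.
 intros HG Hm. exists 3%Z, 576%Z, 1%Z, Gam, (fun _ => 1). split; [|split; [|split]].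
 - split; [auto|]. split; [apply Gam_cong|]. split; [apply char_1|]. split; [|split; [exact (transforms_md 1 _ Hm)|split]].
  + apply csm_smooth. intros n. apply (csm_ext n (fun z => G z + -1 * Tj 0 z)%C); [intros; ring|]. apply csm_plus; [now apply csm_hgood|]. apply csm_mult; [auto|apply csm_Tj].
  + intros z Hz. now apply laplacian_T0.
  + apply (growth_md 1 _ Hm). apply (gr_ext (fun z => G z + -1 * Tj 0 z)%C); [intros; ring|]. apply gr_plus; [now apply hgood_gr|]. apply gr_mult; [apply gr_const|apply gr_T0].
 - eexists. apply is_derive_wder, hgood_wder; eauto.
 - intros z Hz. have md_576 1 _ z Hm Hz. cbv beta in H. rewrite Tj_576 in H. transitivity (G (z + 576) - Tj 0 z + Tj 0 z)%C; [ring|]. rewrite H. ring.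
 (* T_0 has no mode of index 0, so the coefficient of the power of y is 0. *)
 - intros gm. assert (Egm : gm = (fun z => - Tj 0 z)%C) by (fext; intros z; unfold gm; ring). rewrite Egm. split; [intros n _; apply fcoef_decay|]. split; [exists 0|intros n Hn]; intros y Hy; rewrite fcoef_T0, Cint_fT by (auto; lia); ring.
Qed.

(** * Linear combinations and the final assembly *)

Definition spanH (P : (C -> C) -> Prop) (h : C -> C) : Prop :=
 exists l : list (C * (C -> C)), (forall a F, In (a, F) l -> P F) /\ forall z, inH z -> h z = lincomb l z.
Lemma spanH_ext P h h' : (forall z, inH z -> h z = h' z) -> spanH P h -> spanH P h'.
 intros E [l []]. exists l. split; auto. intros z Hz. rewrite <- E; auto. Qed.
Lemma spanH_plus P h h' : spanH P h -> spanH P h' -> spanH P (fun z => h z + h' z)%C.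
 intros [l [H1 H2]] [l' [H1' H2']]. exists (l ++ l'). split; [intros a F HI; apply in_app_or in HI; destruct HI; eauto|]. intros z Hz. rewrite H2, H2' by auto. clear. induction l as [|[] l IH]; simpl; [ring|]. rewrite <- IH. ring.
Qed.
Lemma spanH_scal P c h : spanH P h -> spanH P (fun z => c * h z)%C.
 intros [l [H1 H2]]. exists (map (fun p => (c * fst p, snd p)%C) l).
 split; [intros a F HI; apply in_map_iff in HI; destruct HI as [[] [E HI]]; injection E as _ <-; eauto|intros z Hz; rewrite H2 by auto; clear; induction l as [|[] l IH]; simpl; [ring|]; rewrite <- IH; ring].
Qed.
Lemma spanH_zero P : spanH P (fun _ => RtoC 0).
 exists []. easy. Qed.
Lemma spanH_gen P F : P F -> spanH P F.
 exists [(RtoC 1, F)]. split; [intros a G [E|[]]; injection E as _ <-; auto|]. intros z _. cring. Qed.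
Lemma quasimock_ext f f' : (forall z, inH z -> f z = f' z) -> quasimock f -> quasimock f'.
 intros E [h [Hh Hs]]. exists h. split; auto. revert Hs. apply spanH_ext. intros z Hz. rewrite E; auto. Qed.
Lemma quasimock_plus f f' : quasimock f -> quasimock f' -> quasimock (fun z => f z + f' z)%C.
 intros [h [Hh Hs]] [h' [Hh' Hs']]. exists (fun z => h z + h' z)%C. split; [now apply spanH_plus|]. have spanH_plus _ _ _ Hs Hs'. revert H. apply spanH_ext. intros z _. ring.
Qed.
Lemma quasimock_scal c f : quasimock f -> quasimock (fun z => c * f z)%C.
 intros [h [Hh Hs]]. exists (fun z => c * h z)%C. split; [now apply spanH_scal|]. have spanH_scal _ c _ Hs. revert H. apply spanH_ext. intros z _. ring.
Qed.
(** With h = - f the combination of holomorphic parts is empty. *)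
Lemma quasimock_quasimodular f : quasimodular f -> quasimock f.
 exists (fun z => -1 * f z)%C. split; [now apply spanH_scal|]. apply (spanH_ext _ (fun _ => 0)); [intros z _; ring|apply spanH_zero]. Qed.
Lemma quasimock_nderiv n g gp F : holomorphic_part g gp -> is_nderiv n gp F -> quasimock F.
 exists (fun _ => 0). split; [apply spanH_zero|]. apply (spanH_ext _ F); [intros z _; ring|]. apply spanH_gen. eauto. Qed.
Lemma quasimock_Csum {I} (f : I -> C -> C) l : (forall i, quasimock (f i)) -> quasimock (fun z => Csum (fun i => f i z) l).
 intros H. induction l as [|]; [apply quasimock_quasimodular, spanH_zero|]. now apply quasimock_plus. Qed.
Lemma hgood_iter G n : hgood G -> hgood (Nat.iter n dX G).
 intros H. induction n; auto. now apply hgood_dX. Qed.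
Lemma is_nderiv_iter G n : hgood G -> is_nderiv n G (Nat.iter n dX G).
 revert G. induction n as [|n IH]; intros G HG; [easy|]. exists (dX G). split; [intros z Hz; apply is_derive_wder; now apply hgood_wder|rewrite Nat.iter_succ_r; apply IH; now apply hgood_dX].
Qed.
(** Derivatives of G, rescaled so that they form a chain for [lam s]; up to constants they are the
    ordinary iterated derivatives, see [chn_iter]. *)
Fixpoint chn (s : nat) (G : C -> C) (i : nat) : C -> C := match i with O => G | S i => fun z => (/ lam s i * dX (chn s G i) z)%C end.
Lemma hgood_chn s G i : hgood G -> hgood (chn s G i).
 intros H. induction i; auto. apply hgood_scal. now apply hgood_dX. Qed.
Lemma wder_chn s G i z : hgood G -> inH z -> wder (chn s G i) z (lam s i * chn s G (S i) z)%C 0.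
 intros H Hz. eapply wder_eq; [apply hgood_wder; auto; now apply hgood_chn| |auto]. cbn. field; auto. Qed.
Lemma chn_iter s G i : hgood G -> exists c, forall z, inH z -> (c * Nat.iter i dX G z)%C = chn s G i z.
 intros H. induction i as [|i [c IH]]; [exists 1; intros; simpl; ring|]. exists (/ lam s i * c)%C. intros z Hz. cbn. rewrite <- Cmult_assoc. f_equal.
 symmetry. apply wder_hol_dX. eapply wder_extH; [auto|exact IH|]. eapply wder_eq; [apply wder_scal, hgood_wder; auto; now apply hgood_iter|auto|ring].
Qed.
Lemma QL_chn s G : hgood G -> md s G -> QL (shf s (chn s G)).
 intros H Hm. apply (QL_chain s _ (fun _ _ => 0)); auto. intros i z Hz. now apply wder_chn. Qed.
Lemma quasimodular_chn s G i : hgood G -> md s G -> quasimodular (chn s G i).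
 intros H Hm. destruct (chn_iter s G i H) as [c Hc]. apply (spanH_ext _ _ _ Hc), spanH_scal, spanH_gen. exists i, G. split; [now apply (modular_form_md s)|now apply is_nderiv_iter].
Qed.
(* The first nonzero entry of a quasi-Lie sequence is modular; subtracting the sequence of its derivatives makes that entry vanish. *)
Lemma quasimodular_QL n s E : QL E -> (forall J, hgood (E J)) -> (forall J z, (J < s)%nat -> inH z -> E J z = 0) -> quasimodular (E (s + n)%nat).
 revert s E. induction n as [|n IH]; intros s E HQ HG H0; have QL_first s E HQ H0 as Hm.
 - rewrite Nat.add_0_r. exact (quasimodular_chn s (E s) 0 (HG s) Hm).
 - set (E' := fun J z => (E J z - shf s (chn s (E s)) J z)%C). assert (H : quasimodular (E' (S s + n)%nat)).
  { apply IH.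
   - apply QL_minus; auto. now apply QL_chn.
   - intros J. unfold E', shf. apply (hgood_ext (fun z => E J z + -1 * if Nat.ltb J s then 0 else chn s (E s) (J - s) z)%C); [intros; ring|]. apply hgood_plus; auto. apply hgood_scal. destruct (Nat.ltb J s); [auto|now apply hgood_chn].
   - intros J z HJ Hz. unfold E', shf. destruct (Nat.ltb_spec J s) as [|]; [rewrite H0 by auto; ring|]. assert (J = s) as -> by lia. rewrite Nat.sub_diag. cring. }
  have quasimodular_chn s (E s) (S n) (HG s) Hm as Hc. have spanH_plus _ _ _ H Hc as HH. revert HH. apply spanH_ext. intros z Hz. replace (S s + n)%nat with (s + S n)%nat by lia. unfold E', shf. destruct (Nat.ltb_spec (s + S n) s) as [|]; [lia|].
  replace (s + S n - s)%nat with (S n) by lia. ring.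
Qed.
Lemma hgood_Bj_eta j : hgood (fun z => Bj (S j) z / eta z)%C.
 apply (hgood_ext (fun z => (Bc (S j) + 2 * clip (2 * j) * Sj j z) * / eta z)%C); [intros z Hz; now rewrite Bj_value|]. apply hgood_mult; [|auto]. apply hgood_plus; [auto|apply hgood_scal, hgood_Sj].
Qed.
Lemma eta_inv_md : md 0 (fun z => / eta z)%C.
 have QL_first 0 E0 QL_E0 ltac:(lia). intros a b c d z HG Hz. specialize (H a b c d z HG Hz). cbn [E0] in H. transitivity (- - / eta (mob a b c d z))%C; [ring|]. rewrite H. ring.
Qed.
Lemma quasimodular_eta_inv : quasimodular (fun z => / eta z)%C.
 exact (quasimodular_chn 0 _ 0 hgood_p0 eta_inv_md). Qed.
Theorem quasimock_Bj_eta j : quasimock (fun z => Bj (S j) z / eta z)%C.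
 set (p := fun z => (- / eta z)%C). assert (Hp : hgood p) by (apply (hgood_ext (fun z => -1 * / eta z)%C); [intros; unfold p; ring|apply hgood_scal, hgood_p0]).
 assert (Hpm : md 0 p) by exact (QL_first 0 E0 QL_E0 ltac:(lia)). set (G := fun z => (Bj 1 z / eta z - chn 0 p 1 z)%C).
 assert (HG : hgood G) by (apply (hgood_ext (fun z => Bj 1 z / eta z + -1 * chn 0 p 1 z)%C); [intros; unfold G; ring|]; apply hgood_plus; [apply hgood_Bj_eta|apply hgood_scal; now apply hgood_chn]).
 have QL_minus _ _ QL_E0 (QL_chn 0 p Hp Hpm) as HF. set (F1 := fun J z => (E0 J z - shf 0 (chn 0 p) J z)%C) in HF. assert (HF0 : forall z, F1 O z = 0) by (intros z; unfold F1; cbn; unfold p; ring).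
 assert (HFS : forall i z, F1 (S i) z = (Bj (S i) z / eta z - Tj i z - chn 0 p (S i) z)%C) by auto. assert (Hm : md 1 (fun z => G z - Tj 0 z)%C).
 { replace (fun z => G z - Tj 0 z)%C with (F1 1%nat); [|fext; intros z; rewrite HFS; unfold G; ring]. apply QL_first; auto. intros J z HJ _. assert (J = O) as -> by lia. auto. }
 (* As T obeys the recursion with the same constants as G, the chain of G - T_0 is
    [chn 1 G i - Tj i]; subtracting it removes T from all entries at once. *)
 assert (HH : QL (shf 1 (fun i z => chn 1 G i z - Tj i z)%C)) by (apply (QL_chain 1 _ (fun i z => 0 - Tb i z)%C); [|auto]; intros i z Hz; eapply wder_eq; [apply wder_minus; [apply wder_chn; auto|now apply wder_Tj]|ring|auto]).
 have QL_minus _ _ HF HH as HE. set (E := fun J z => (F1 J z - shf 1 (fun i z => chn 1 G i z - Tj i z) J z)%C) in HE.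
 assert (HES : forall i z, E (S i) z = (Bj (S i) z / eta z + -1 * (chn 0 p (S i) z + chn 1 G i z))%C) by (intros i z; unfold E; rewrite HFS; unfold shf; cbn [Nat.ltb Nat.leb]; replace (S i - 1)%nat with i by lia; ring).
 assert (Hq : quasimodular (E (0 + S j)%nat)).
 { apply quasimodular_QL; auto; [|lia]. intros [|i]; [apply (hgood_ext (fun _ => 0)); [|auto]; intros z _; cring|]. apply (hgood_ext (fun z => Bj (S i) z / eta z + -1 * (chn 0 p (S i) z + chn 1 G i z))%C); [auto|].
  apply hgood_plus; [apply hgood_Bj_eta|apply hgood_scal, hgood_plus; now apply hgood_chn]. } apply (quasimock_ext (fun z => E (S j) z + (chn 0 p (S j) z + chn 1 G j z))%C); [intros z _; rewrite HES; ring|].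
 apply quasimock_plus; [now apply quasimock_quasimodular|]. apply quasimock_plus; [apply quasimock_quasimodular; now apply quasimodular_chn|]. destruct (chn_iter 1 G j HG) as [c Hc]. apply (quasimock_ext _ _ Hc), quasimock_scal.
 apply (quasimock_nderiv j (fun z => G z - Tj 0 z)%C G); [now apply holomorphic_part_T0|now apply is_nderiv_iter].
Qed.
(** The constant row of B only contributes a multiple of 1 / eta, which is itself modular of weight
    -1/2. *)
Lemma quasimock_Sj_eta j : quasimock (fun z => Sj j z / eta z)%C.
 apply (quasimock_ext (fun z => / (2 * clip (2 * j)) * (Bj (S j) z / eta z + - Bc (S j) * / eta z))%C).
 - intros z Hz. rewrite Bj_value by auto. have clip_neq_0. field; auto.
 - apply quasimock_scal, quasimock_plus; [apply quasimock_Bj_eta|]. apply quasimock_scal, quasimock_quasimodular, quasimodular_eta_inv.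
Qed.
Theorem theorem1p1 :
  forall (k : nat), (1 <= k)%nat ->
  forall f : C -> C,
    (* f(z) = q^{-1} R_{k+1}(q^{24}),  q = e^{2 pi i z},  z in H *)
    (forall z : C, inH z ->
       @is_series C_AbsRing C_NormedModule
         (fun n : nat => Cmult ((eta2k k n)) (Cpow (qq z) (24 * n)))
         (Cmult (qq z) (f z))) ->
    quasimock f.
Proof.
  intros k Hk f Hf. destruct (rank_moment_series k Hk) as [l Hl].
  apply (quasimock_ext (fun z => Csum (fun p : R * nat => - fst p * (Sj (snd p) z / eta z)) l)%C).
  - intros z Hz. rewrite (Hl f Hf z Hz), <- Csum_scal. apply Csum_ext_in. intros p _. cring.
  - apply quasimock_Csum. intros p. apply quasimock_scal, quasimock_Sj_eta.
Qed.
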